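(* Let $\phi,f\in C_c^\infty(\mathbb R)$, $s_1,s_2\in(0,1)$ with $s_1+s_2=1$, $p,p'\in(1,\infty)$ and $q,q'\in[1,\infty]$ with $\frac1p+\frac1{p'}=\frac1q+\frac1{q'}=1$. Then $$\big\|[\mathcal H,\phi]((-\Delta)^{1/2}f)-[\mathcal H,f]((-\Delta)^{1/2}\phi)\big\|_{L^1(\mathbb R)}\lesssim\|(-\Delta)^{s_1/2}\phi\|_{L^{(p,q)}}\,\|(-\Delta)^{s_2/2}f\|_{L^{(p',q')}}$$ and $$\big\|\mathcal H\big([\mathcal H,\phi]((-\Delta)^{1/2}f)+[\mathcal H,f]((-\Delta)^{1/2}\phi)\big)\big\|_{L^1(\mathbb R)}\lesssim\|(-\Delta)^{s_1/2}\phi\|_{L^{(p,q)}}\,\|(-\Delta)^{s_2/2}f\|_{L^{(p',q')}}.$$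
   Context: $\mathcal H$ is the Hilbert transform, i.e. the Riesz transform on $\mathbb R$: $\widehat{\mathcal Hg}(\xi)=-i\frac{\xi}{|\xi|}\widehat g(\xi)$ with $\widehat g(\xi)=\int g(x)e^{-2\pi ix\xi}dx$. $[\mathcal H,\phi](g)=\mathcal H(\phi g)-\phi\mathcal Hg$. Fractional Laplacian: $\widehat{(-\Delta)^{\sigma/2}g}=(2\pi|\xi|)^\sigma\widehat g$. Lorentz norm $\|g\|_{L^{(p,q)}}=(\int_0^\infty(t^{1/p}g^*(t))^q\frac{dt}t)^{1/q}$ (sup if $q=\infty$), $g^*$ the decreasing rearrangement. $A\lesssim B$ means $A\le CB$, $C$ depending only on parameters. *)

(* Defs.v *)
From HB Require Import structures.
From mathcomp Require Import all_boot all_order all_algebra.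
From mathcomp Require Import all_classical all_reals all_analysis.
Set Implicit Arguments. Unset Strict Implicit. Unset Printing Implicit Defensive.
Import Order.TTheory GRing.Theory Num.Theory.
Import numFieldNormedType.Exports.
Local Open Scope classical_set_scope.
Local Open Scope ring_scope.

Section Defs.
Variable R : realType.
Local Notation mu := (@lebesgue_measure R).

Definition smooth_cpt (f : R -> R) : Prop :=
  (forall (n : nat) (x : R), derivable (derive1n n f) x 1) /\
  (exists M : R, forall x : R, M < `|x| -> f x = 0).

(* Real and imaginary parts (up to sign) of the Fourier transform
   \hat g(xi) = \int g(x) e^{-2 pi i x xi} dx = FC g xi - i FS g xi. *)
Definition FC (g : R -> R) (xi : R) : R :=
  Rintegral mu setT (fun y => g y * cos (2 * pi * y * xi)).
Definition FS (g : R -> R) (xi : R) : R :=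
  Rintegral mu setT (fun y => g y * sin (2 * pi * y * xi)).

(* (-Delta)^{sigma/2} g (x) = \int (2 pi |xi|)^sigma \hat g(xi) e^{2 pi i x xi} dxi,
   written out for real g (the integral is real). *)
Definition fraclap (sigma : R) (g : R -> R) (x : R) : R :=
  Rintegral mu setT (fun xi =>
    (2 * pi * `|xi|) `^ sigma *
      (FC g xi * cos (2 * pi * x * xi) + FS g xi * sin (2 * pi * x * xi))).

(* Hilbert transform (multiplier -i xi/|xi|), as the principal value
   H g (x) = lim_{eps -> 0+} (1/pi) \int_{|x-y|>eps} g(y)/(x-y) dy. *)
Definition hilbert (g : R -> R) (x : R) : R :=
  lim ((fun eps : R =>
          pi^-1 * Rintegral mu [set y | eps < `|x - y|] (fun y => g y / (x - y)))
       @ at_right 0).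

Definition commH (phi g : R -> R) : R -> R :=
  fun x => hilbert (fun y => phi y * g y) x - phi x * hilbert g x.

Local Open Scope ereal_scope.

Definition L1norm (g : R -> R) : \bar R := \int[mu]_x (`|g x|)%:E.

Definition distrib (g : R -> R) (lam : R) : \bar R := mu [set x | lam < `|g x|]%R.
Definition rearr (g : R -> R) (t : R) : \bar R :=
  ereal_inf [set lam%:E | lam in [set lam : R | (0 <= lam)%R /\ distrib g lam <= t%:E]].

Definition lorentz (p : R) (q : \bar R) (g : R -> R) : \bar R :=
  match q with
  | q'%:E => poweR (\int[mu]_(t in `]0%R, +oo[)
                      (poweR ((t `^ p^-1)%:E * rearr g t) q' * (t^-1)%:E)) q'^-1
  | +oo => ereal_sup [set (t `^ p^-1)%:E * rearr g t | t in `]0%R, +oo[]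
  | -oo => 0
  end.

Definition conj_exp (q q' : \bar R) : Prop :=
  match q, q' with
  | a%:E, b%:E => (1 <= a)%R /\ (1 <= b)%R /\ (a^-1 + b^-1 = 1)%R
  | +oo, b%:E => b = 1%R
  | a%:E, +oo => a = 1%R
  | _, _ => False
  end.

End Defs.

(* Main.v *)
(* Let P_t, Q_t be the Poisson and conjugate Poisson kernels and Phi, F the
   Poisson extensions of phi, f to the upper half-plane. If X_y = - Y_t, Green's
   identity against (P_t, Q_t) shows that X(., 0) - H(Y(., 0)) is bounded by
   int int P_t(x - y) |X_t - Y_y|. The choices
   (Phi F_y - F Phi_y, Phi F_t - F Phi_t) and ((Phi F)_t, - (Phi F)_y)
   then bound both left-hand sides in L^1 by int int |grad Phi| |grad F|.
   With g = (-Delta)^(s1/2) phi, grad Phi is Gamma(s1)^-1 times the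
   superposition of r^(s1-1) grad (P_(t+r) * g) over r > 0, and similarly for F,
   so a bilinear form BB in the two fractional Laplacians has to be bounded.
   If |g| <= 1_A and |h| <= 1_B with |A| <= a <= b, |B| <= b, then
   BB(g, h) <= C a (b / a)^kappa for any small kappa > 0: a Schur test reduces
   this to square functions weighted by powers of the maximal function of 1_A,
   and these follow from Green's identity for t and V^2 W^r + k W^c, where V, W
   are Poisson extensions.
   Cutting g and h at the dyadic values of their decreasing rearrangements gives
   a double series with off-diagonal geometric decay, summed by Young's
   inequality against the Lorentz norms. *)

Require Import Defs.
From HB Require Import structures.
From mathcomp Require Import all_boot all_order all_algebra.
From mathcomp Require Import all_classical all_reals all_analysis.
From mathcomp Require Import measurable_realfun ring lra zify.
Import Order.TTheory GRing.Theory Num.Theory.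
Import numFieldNormedType.Exports.
Set Implicit Arguments. Unset Strict Implicit. Unset Printing Implicit Defensive.
Local Open Scope classical_set_scope.
Local Open Scope ring_scope.

(** On indicators an unweighted Schur test gives only sqrt(a b): no off-diagonal decay for p = 2 and
    a loss for every other p. The weight trades this for a (b / a)^kappa, and as soon as kappa +
    delta <= min(1/p, 1/p') this beats a^(1/p) b^(1/p') by the factor (a / b)^delta. One estimate on
    indicators therefore serves all p and all q, the endpoints q = 1 and q = oo included, without
    interpolation or density. The function living on the larger set is not controlled by the weight
    built from the smaller one, so a small multiple of its own indicator is added to that weight.
    The Hilbert transform is never treated as a multiplier. It is rewritten as an absolutely
    convergent integral, and the rules H (-Delta)^(1/2) f = - f' and H H a = - a are cases of
    Green's identity in which the defect X_t - Y_y vanishes. Behind the superposition formula stands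
    the Gamma integral: (2 pi |xi|)^s times the integral of r^(s-1) e^(-2 pi r |xi|) over r > 0
    equals Gamma(s). *)

Local Notation integ f :=
  ((@lebesgue_measure _).-integrable [set: _] (EFin \o f)).

(** * Integration *)

Section base.
Context {R : realType}.
Local Notation mu := (@lebesgue_measure R).
Local Notation "\I f" := (Rintegral mu setT f) (at level 10).
Implicit Types (f g : R -> R).

(** Writing x^-1 as x (x^2)^(-1) reduces the claim to the measurability of [powR]; at 0 the
    convention 0^-1 = 0 makes both sides vanish. *)
Lemma measurable_invr : measurable_fun [set: R] (fun x : R => x^-1).
Proof.
have -> : (fun x : R => x^-1) = (fun x => x * (x ^+ 2) `^ (-1)).
  apply/funext => x; rewrite powR_inv1 ?sqr_ge0//.
  have [->|x0] := eqVneq x 0; first by rewrite invr0 mul0r.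
  by rewrite expr2 invfM mulrA divff// mul1r.
apply: measurable_funM => //.
by apply: (measurableT_comp (measurable_powR _)) => //.
Qed.

Lemma measurable_funV d (T : measurableType d) (f : T -> R) :
  measurable_fun setT f -> measurable_fun setT (fun x => (f x)^-1).
Proof. by move=> mf; exact: (measurableT_comp measurable_invr). Qed.

Lemma measurable_fun_powR d (T : measurableType d) (f : T -> R) p :
  measurable_fun setT f -> measurable_fun setT (fun x => f x `^ p).
Proof. by move=> mf; exact: (measurableT_comp (measurable_powR p)). Qed.

Lemma integ_measurable f : integ f -> measurable_fun setT f.
Proof. by move/integrableP => [/measurable_EFinP]. Qed.

Lemma integ_le f g : measurable_fun setT f -> integ g ->
  (forall x, `|f x| <= g x) -> integ f.
Proof.
move=> mf ig fg; apply: (le_integrable measurableT _ _ ig).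
  exact/measurable_EFinP.
by move=> x _ /=; rewrite lee_fin (le_trans (fg x))// ler_norm.
Qed.

Lemma integD f g : integ f -> integ g -> integ (fun x => f x + g x).
Proof.
move=> If Ig; rewrite (_ : EFin \o _ = ((EFin \o f) \+ (EFin \o g))%E)//.
exact: integrableD.
Qed.

Lemma integB f g : integ f -> integ g -> integ (fun x => f x - g x).
Proof.
move=> If Ig; rewrite (_ : EFin \o _ = ((EFin \o f) \- (EFin \o g))%E)//.
exact: integrableB.
Qed.

Lemma integZ f c : integ f -> integ (fun x => c * f x).
Proof.
move=> If; rewrite (_ : EFin \o _ = (fun x => c%:E * (EFin \o f) x)%E)//.
exact: integrableZl.
Qed.

Lemma integ_norm f : integ f -> integ (fun x => `|f x|).
Proof. exact: integrable_norm. Qed.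

Lemma RintD f g : integ f -> integ g -> \I (fun x => f x + g x) = \I f + \I g.
Proof. by move=> If Ig; exact: RintegralD. Qed.

Lemma RintB f g : integ f -> integ g -> \I (fun x => f x - g x) = \I f - \I g.
Proof. by move=> If Ig; exact: RintegralB. Qed.

Lemma RintZ f c : integ f -> \I (fun x => c * f x) = c * \I f.
Proof. by move=> If; exact: RintegralZl. Qed.

Lemma RintZr f c : integ f -> \I (fun x => f x * c) = \I f * c.
Proof. by move=> If; exact: RintegralZr. Qed.

Lemma RintN f : integ f -> \I (fun x => - f x) = - \I f.
Proof.
move=> If; rewrite -[RHS]mulN1r -RintZ//.
by apply: eq_Rintegral => x _; rewrite mulN1r.
Qed.

Lemma le_Rint f g : integ f -> integ g -> (forall x, f x <= g x) -> \I f <= \I g.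
Proof. by move=> If Ig fg; apply: le_Rintegral. Qed.

Lemma Rint_abs_le f g : measurable_fun setT f -> integ g ->
  (forall x, `|f x| <= g x) -> `|\I f| <= \I g.
Proof.
move=> mf ig fg; have If := integ_le mf ig fg.
apply: (le_trans (le_normr_Rintegral _ If)) => //.
by apply: le_Rint => //; exact: integ_norm.
Qed.

Lemma Rint_EFin f : integ f -> (\I f)%:E = (\int[mu]_x (f x)%:E)%E.
Proof. by move=> If; rewrite /Rintegral fineK// integrable_fin_num. Qed.

Lemma Rint_dct (f_ : nat -> R -> R) f g :
  (forall n, measurable_fun setT (f_ n)) -> integ g ->
  (forall n x, `|f_ n x| <= g x) ->
  (forall x, f_ n x @[n --> \oo] --> f x) ->
  integ f /\ \I (f_ n) @[n --> \oo] --> \I f.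
Proof.
move=> mf ig fg ff.
have mf' : measurable_fun setT f.
  by apply: (measurable_fun_cvg mf) => x _; exact: ff.
have [] := @dominated_convergence _ _ _ mu setT measurableT
  (fun n x => (f_ n x)%:E) (EFin \o f) (EFin \o g).
- by move=> n; apply/measurable_EFinP; exact: mf.
- by apply/measurable_EFinP; exact: mf'.
- by apply/aeW => x _; apply: cvg_EFin; [exact: nearW|exact: ff].
- by [].
- by apply/aeW => x n _; rewrite lee_fin.
- move=> If _ cvgI; split; first exact: If.
  apply: fine_cvg; rewrite fineK ?integrable_fin_num//; exact: cvgI.
Qed.

(** A right limit at 0 is tested on positive sequences. Each one is shifted past the index where it
    enters ]0, a[, so the domination is asked for on that interval only. *)
Lemma Rint_dct_right (f_ : R -> R -> R) f g (a : R) :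
  (forall t, 0 < t < a -> measurable_fun setT (f_ t)) -> 0 < a -> integ g ->
  (forall t x, 0 < t < a -> `|f_ t x| <= g x) ->
  (forall x, f_ t x @[t --> 0^'+] --> f x) ->
  integ f /\ \I (f_ t) @[t --> 0^'+] --> \I f.
Proof.
move=> mf a0 ig fg ff.
have H (u : nat -> R) : (forall n, 0 < u n) -> u n @[n --> \oo] --> 0 ->
    integ f /\ \I (f_ (u n)) @[n --> \oo] --> \I f.
  move=> u0 uc.
  have [N _ HN] : \forall n \near \oo, u n < a by exact: cvgr_lt uc _ a0.
  have uN n : 0 < u (n + N)%N < a by rewrite u0 HN//= leq_addl.
  have [] := @Rint_dct (fun n => f_ (u (n + N)%N)) f g.
  - by move=> n; exact: mf.
  - exact: ig.
  - by move=> n x; exact: fg.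
  - move=> x; have /cvg_at_rightP := ff x; move=> /(_ (fun n => u (n + N)%N)).
    by apply; split => //; rewrite (cvg_shiftn N u).
  - by move=> If c; split => //; rewrite -(cvg_shiftn N).
split.
  apply: (H (fun n => n.+1%:R^-1) _ _).1 => //.
  exact: (@cvg_harmonic R).
by apply/cvg_at_rightP => u [u0 uc]; exact: (H u u0 uc).2.
Qed.

Lemma measurable_sec1 d1 d2 (T1 : measurableType d1) (T2 : measurableType d2)
  d3 (T3 : measurableType d3) (f : T1 * T2 -> T3) x :
  measurable_fun setT f -> measurable_fun setT (fun y => f (x, y)).
Proof.
by move=> mf; apply: (measurableT_comp mf); exact: measurable_fun_pair.
Qed.

Lemma measurable_sec2 d1 d2 (T1 : measurableType d1) (T2 : measurableType d2)
  d3 (T3 : measurableType d3) (f : T1 * T2 -> T3) y :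
  measurable_fun setT f -> measurable_fun setT (fun x => f (x, y)).
Proof.
by move=> mf; apply: (measurableT_comp mf); exact: measurable_fun_pair.
Qed.

(** The integral is by definition the difference of the integrals of the positive and negative
    parts, and Tonelli's theorem makes both measurable in the parameter, integrable or not. *)
Lemma measurable_Rint_param d (T : measurableType d) (f : T * R -> R) :
  measurable_fun setT f ->
  measurable_fun setT (fun x => \I (fun y => f (x, y))).
Proof.
move=> mf; have mfE : measurable_fun setT (EFin \o f) by apply/measurable_EFinP.
rewrite /Rintegral; apply: (measurableT_comp (@fine_measurable R setT _)) => //.
rewrite (_ : (fun x => _) = (fubini_F mu (EFin \o f)^\+%E \-
    fubini_F mu (EFin \o f)^\-%E)%E); last first.
  apply/funext => x; rewrite /fubini_F [LHS]integralE.
  by congr (_ - _)%E; apply: eq_integral => y _;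
    rewrite ?funeposE ?funenegE.
apply: emeasurable_funB; apply: measurable_fun_fubini_tonelli_F => //.
- exact: measurable_funepos.
- exact: measurable_funeneg.
Qed.

Lemma Rint_fubini (f : R -> R -> R) (a b : R -> R) :
  measurable_fun setT (fun z : R * R => f z.1 z.2) -> integ a -> integ b ->
  (forall x y, `|f x y| <= a x * b y) ->
  [/\ (forall x, integ (f x)), (forall y, integ (f ^~ y)),
      integ (fun x => \I (f x)) &
      \I (fun x => \I (f x)) = \I (fun y => \I (fun x => f x y))].
Proof.
move=> mf ia ib fab.
have m1 x : measurable_fun setT (f x) := measurable_sec1 x mf.
have m2 y : measurable_fun setT (f ^~ y) := measurable_sec2 y mf.
have i1 x : integ (f x).
  by apply: (integ_le (m1 x) (integZ (a x) ib)) => y; exact: fab.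
have i2 y : integ (f ^~ y).
  apply: (integ_le (m2 y) (integZ (b y) ia)) => x.
  by rewrite mulrC; exact: fab.
have iI : integ (fun x => \I (f x)).
  apply: (@integ_le _ (fun x => `|a x| * \I (fun y => `|b y|))).
  - exact: (measurable_Rint_param mf).
  - rewrite (_ : (fun _ => _) = (fun x => \I (fun y => `|b y|) * `|a x|)).
      by apply: integZ; exact: integ_norm.
    by apply/funext => x; rewrite mulrC.
  - move=> x; rewrite -RintZ; last exact: integ_norm.
    apply: Rint_abs_le => //; first by apply: integZ; exact: integ_norm.
    by move=> y; rewrite (le_trans (fab x y))// -normrM ler_norm.
split => //.
have iab : (mu \x mu)%E.-integrable setT (EFin \o (fun z : R * R => f z.1 z.2)).
  apply/integrable12ltyP; first exact/measurable_EFinP.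
  apply: (@le_lt_trans _ _ (\int[mu]_x (`|a x| * \I (fun y => `|b y|))%:E)%E).
    apply: ge0_le_integral => //.
    - move=> x _; exact: integral_ge0.
    - apply: (@measurable_fun_fubini_tonelli_F _ _ _ _ _ mu
        (fun z : R * R => `|(f z.1 z.2)%:E|%E)) => //.
      by apply: measurableT_comp => //; exact/measurable_EFinP.
    - apply/measurable_EFinP; apply: measurable_funM => //.
      by apply: measurableT_comp => //; exact: integ_measurable.
    - move=> x _ /=; rewrite -RintZ; last exact: integ_norm.
      rewrite Rint_EFin; last by apply: integZ; exact: integ_norm.
      apply: ge0_le_integral => //.
      + by apply/measurable_EFinP; exact: (measurableT_comp _ (m1 x)).
      + apply/measurable_EFinP; apply: measurable_funM => //.
        by apply: measurableT_comp => //; exact: integ_measurable.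
      + by move=> y _; rewrite lee_fin (le_trans (fab x y))// -normrM ler_norm.
  have : integ (fun x => `|a x| * \I (fun y => `|b y|)).
    rewrite (_ : (fun _ => _) = (fun x => \I (fun y => `|b y|) * `|a x|)).
      by apply: integZ; exact: integ_norm.
    by apply/funext => x; rewrite mulrC.
  by move/(integrable_lty measurableT).
have := Fubini iab; rewrite /= => E.
rewrite /Rintegral; congr fine.
transitivity (\int[mu]_x \int[mu]_y (f x y)%:E)%E.
  by apply: eq_integral => x _; rewrite -Rint_EFin.
rewrite E; apply: eq_integral => y _; rewrite -[in LHS]Rint_EFin//.
Qed.

(** The pushforward under x -> c x + b, rescaled by c, agrees with Lebesgue measure on half-open
    intervals, so uniqueness of the latter applies. *)
Lemma lebesgue_measure_affine (c b : R) (A : set R) : 0 < c -> measurable A ->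
  mu ((fun x => c * x + b) @^-1` A) = (c^-1%:E * mu A)%E.
Proof.
move=> c0 mA.
have mphi : measurable_fun [set: R] (fun x : R => c * x + b).
  by apply: measurable_funD => //; exact: measurable_funM.
pose phi : measurableTypeR R -> measurableTypeR R := fun x => c * x + b.
pose c' : {nonneg R} := NngNum (ltW c0).
have E : mu A = mscale c' (pushforward mu phi) A.
  move=> m; apply: lebesgue_measure_unique => //= _ [[u v]] _ <-.
  rewrite /mscale/= /pushforward.
  rewrite (_ : phi @^-1` _ = `]((u - b) / c), ((v - b) / c)]%classic); last first.
    apply/seteqP; split => x /=; rewrite !in_itv/= /phi.
      by rewrite ltr_pdivrMr// ler_pdivlMr// ltrBlDr lerBrDr mulrC.
    by rewrite ltr_pdivrMr// ler_pdivlMr// ltrBlDr lerBrDr mulrC.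
  rewrite !lebesgue_measure_itv/= !lte_fin ltr_pM2r ?invr_gt0// ltrD2r.
  case: ifPn => uv; last by rewrite mule0.
  by rewrite -EFinB -EFinM; congr EFin; field; rewrite gt_eqF.
rewrite (E mphi) /mscale/= muleA -EFinM mulVf ?gt_eqF// mul1e.
by [].
Qed.

Lemma ge0_integral_affine (c b : R) (f : R -> \bar R) : 0 < c ->
  measurable_fun setT f -> (forall x, 0 <= f x)%E ->
  (\int[mu]_x f (c * x + b)%R = c^-1%:E * \int[mu]_x f x)%E.
Proof.
move=> c0 mf f0.
pose phi : measurableTypeR R -> measurableTypeR R := fun x => c * x + b.
have mphi : measurable_fun setT phi.
  by apply: measurable_funD => //; exact: measurable_funM.
have iv0 : 0 <= c^-1 by rewrite invr_ge0 ltW.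
pose c' : {nonneg R} := NngNum iv0.
have := @ge0_integral_pushforward _ _ _ _ R phi mphi mu setT f measurableT mf.
rewrite preimage_setT => <-; last by move=> y _; exact: f0.
rewrite -(ge0_integral_mscale mu measurableT c')//.
apply: eq_measure_integral => A mA _.
transitivity (mu ((fun x => c * x + b) @^-1` A)) => //.
by rewrite lebesgue_measure_affine.
Qed.

Lemma ge0_integral_refl (f : R -> \bar R) :
  measurable_fun setT f -> (forall x, 0 <= f x)%E ->
  (\int[mu]_x f (- x)%R = \int[mu]_x f x)%E.
Proof.
move=> mf f0.
pose phi : measurableTypeR R -> measurableTypeR R := -%R.
have mphi : measurable_fun setT phi by exact: oppr_measurable.
have := @ge0_integral_pushforward _ _ _ _ R phi mphi mu setT f measurableT mf.
rewrite preimage_setT => <-; last by move=> y _; exact: f0.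
by apply: eq_measure_integral => A mA _; rewrite -[RHS]lebesgue_measureN.
Qed.

Lemma integ_affine (c b : R) f : 0 < c -> integ f ->
  integ (fun x => f (c * x + b)).
Proof.
move=> c0 /integrableP [mf fi]; apply/integrableP; split.
  by apply: (measurableT_comp mf); apply: measurable_funD.
have mA : measurable_fun setT (fun x => `|(f x)%:E|)%E by exact: measurableT_comp.
have E := @ge0_integral_affine c b (fun x => `|(f x)%:E|)%E c0 mA
  (fun x => abse_ge0 _).
rewrite [ltLHS](_ : _ = c^-1%:E * \int[mu]_x `|(f x)%:E|)%E; last exact: E.
by rewrite lte_mul_pinfty ?lee_fin ?invr_ge0 ?(ltW c0).
Qed.

Lemma Rint_affine (c b : R) f : 0 < c -> integ f ->
  \I (fun x => f (c * x + b)) = c^-1 * \I f.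
Proof.
move=> c0 fi; apply: EFin_inj; rewrite EFinM !Rint_EFin//; last exact: integ_affine.
have mE : measurable_fun setT (EFin \o f) by case/integrableP: fi.
have E1 := @ge0_integral_affine c b (fun x => (f x)%:E)^\+%E c0 (measurable_funepos mE)
  (fun x => funepos_ge0 _ x).
have E2 := @ge0_integral_affine c b (fun x => (f x)%:E)^\-%E c0 (measurable_funeneg mE)
  (fun x => funeneg_ge0 _ x).
rewrite integralE [in RHS]integralE muleBr//.
  by rewrite -E1 -E2; congr (_ - _)%E; apply: eq_integral => x _;
    rewrite ?funeposE ?funenegE.
apply: fin_num_adde_defl; rewrite fin_numN.
have := integrable_neg_fin_num measurableT fi; exact.
Qed.

Lemma integ_refl f : integ f -> integ (fun x => f (- x)).
Proof.
move=> /integrableP [mf fi]; apply/integrableP; split.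
  exact: (measurableT_comp mf).
have mA : measurable_fun setT (fun x => `|(f x)%:E|)%E by exact: measurableT_comp.
have E := @ge0_integral_refl (fun x => `|(f x)%:E|)%E mA (fun x => abse_ge0 _).
by rewrite [ltLHS](_ : _ = \int[mu]_x `|(f x)%:E|)%E; last exact: E.
Qed.

Lemma Rint_refl f : integ f -> \I (fun x => f (- x)) = \I f.
Proof.
move=> fi; apply: EFin_inj; rewrite !Rint_EFin//; last exact: integ_refl.
have mE : measurable_fun setT (EFin \o f) by case/integrableP: fi.
have E1 := @ge0_integral_refl (fun x => (f x)%:E)^\+%E (measurable_funepos mE)
  (fun x => funepos_ge0 _ x).
have E2 := @ge0_integral_refl (fun x => (f x)%:E)^\-%E (measurable_funeneg mE)
  (fun x => funeneg_ge0 _ x).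
rewrite integralE [RHS]integralE -E1 -E2; congr (_ - _)%E;
  by apply: eq_integral => x _; rewrite ?funeposE ?funenegE.
Qed.

Lemma is_derive_Rint (f f' : R -> R -> R) (a d : R) (G : R -> R) :
  0 < d ->
  (forall x, `|x - a| < d -> integ (f x)) ->
  (forall x y, `|x - a| < d -> is_derive x 1 (f ^~ y) (f' x y)) ->
  integ G -> (forall x y, `|x - a| < d -> `|f' x y| <= G y) ->
  is_derive a 1 (fun x => \I (f x)) (\I (f' a)).
Proof.
move=> d0 fi fd Gi fG.
have inI x : `]a - d, a + d[%classic x -> `|x - a| < d.
  by rewrite /= in_itv/= => /andP[? ?]; rewrite ltr_norml; lra.
have Ia : `]a - d, a + d[%classic a.
  by rewrite /= in_itv/= ltrBlDr !ltrDl d0.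
have pE x y : `|x - a| < d -> partial1of2 f x y = f' x y.
  by move=> /fd-/(_ y) D; rewrite partial1of2E derive_val.
have H1 : forall x y, `]a - d, a + d[%classic x -> [set: R] y ->
   derivable (f ^~ y) x 1 by move=> x y /inI/fd-/(_ y) D _.
have H2 : forall x y, `]a - d, a + d[%classic x -> [set: R] y ->
   `|partial1of2 f x y| <= G y.
  by move=> x y /inI xI _; rewrite pE//; exact: fG.
have G0 y : 0 <= G y by rewrite (le_trans _ (fG a y _))// subrr normr0.
have fi' x : `]a - d, a + d[%classic x -> integ (f x) by move/inI/fi.
apply: DeriveDef.
  exact: (@derivable_under_integral R _ _ mu f setT measurableT a _ _ Ia fi' H1 G G0 Gi H2).
have := @differentiation_under_integral R _ _ mu f setT measurableT a _ _ Ia fi' H1 G G0 Gi H2.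
rewrite derive1E => ->; apply: eq_Rintegral => y _; rewrite pE// subrr normr0//.
Qed.

Lemma Rint_FTC (F f : R -> R) (a b : R) : a <= b ->
  (forall x, a <= x <= b -> is_derive x 1 F (f x)) ->
  (forall x, a <= x <= b -> {for x, continuous f}) ->
  mu.-integrable `[a, b]%classic (EFin \o f) /\
  Rintegral mu `[a, b]%classic f = F b - F a.
Proof.
move=> ab dF cf.
have cW : {within `[a, b], continuous f}.
  by apply: continuous_in_subspaceT => x; rewrite inE/= in_itv/=; exact: cf.
split; first by apply: continuous_compact_integrable => //; exact: segment_compact.
move: ab; rewrite le_eqVlt => /orP[/eqP <-|ab].
  by rewrite set_itv1 Rintegral_set1 subrr.
have cF x : a <= x <= b -> {for x, continuous F}.
  move=> xab; apply: differentiable_continuous; apply/derivable1_diffP.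
  by have [] := dF x xab.
rewrite /Rintegral (@continuous_FTC2 R f F a b)//.
- split.
  + by move=> x /[!in_itv]/= /andP[ax xb]; have [] := dF x; rewrite ?(ltW ax) ?(ltW xb).
  + by apply: cvg_at_right_filter; apply: cF; rewrite lexx ltW.
  + by apply: cvg_at_left_filter; apply: cF; rewrite lexx ltW.
- move=> x /[!in_itv]/= /andP[ax xb]; rewrite derive1E.
  have D : is_derive x 1 F (f x) by apply: dF; rewrite (ltW ax) (ltW xb).
  by rewrite derive_val.
Qed.

Lemma tonelli_in (D1 D2 : set R) (f : R -> R -> \bar R) :
  measurable D1 -> measurable D2 ->
  measurable_fun setT (fun z : R * R => f z.1 z.2) ->
  (forall x y, 0 <= f x y)%E ->
  (\int[mu]_(x in D1) \int[mu]_(y in D2) f x y =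
   \int[mu]_(y in D2) \int[mu]_(x in D1) f x y)%E.
Proof.
move=> mD1 mD2 mf f0.
rewrite integral_mkcond [in RHS]integral_mkcond.
pose g x y := ((\1_D1 x * \1_D2 y)%:E * f x y)%E.
transitivity (\int[mu]_x \int[mu]_y g x y)%E.
  apply: eq_integral => x _; rewrite /patch.
  have m2 := measurable_sec1 x mf.
  case: ifPn => xD.
    rewrite integral_mkcond; apply: eq_integral => y _.
    rewrite /g /patch !indicE xD mul1r; case: ifPn => yD; first by rewrite mul1e.
    by rewrite mul0e.
  by rewrite integral0_eq// => y _; rewrite /g indicE (negbTE xD) mul0r mul0e.
transitivity (\int[mu]_y \int[mu]_x g x y)%E; last first.
  apply: eq_integral => y _; rewrite /patch.
  case: ifPn => yD.
    rewrite [RHS]integral_mkcond; apply: eq_integral => x _.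
    rewrite /g /patch !indicE yD mulr1; case: ifPn => xD; first by rewrite mul1e.
    by rewrite mul0e.
  by rewrite integral0_eq// => x _; rewrite /g !indicE (negbTE yD) mulr0 mul0e.
apply: (@fubini_tonelli _ _ _ _ _ mu mu (fun z : R * R => g z.1 z.2)).
  apply: emeasurable_funM => //; apply/measurable_EFinP.
  apply: measurable_funM.
    by apply: (measurableT_comp (@measurable_indic _ _ R setT D1 mD1)).
  by apply: (measurableT_comp (@measurable_indic _ _ R setT D2 mD2)).
by move=> z; rewrite mule_ge0// lee_fin mulr_ge0.
Qed.

End base.

(** * Poisson kernels *)

Section kernels.
Context {R : realType}.
Local Notation mu := (@lebesgue_measure R).
Local Notation "\I f" := (Rintegral mu setT f) (at level 10).
Implicit Types (t z x y : R) (w : R -> R).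

Lemma is_deriveMr (f : R -> R) c x l : is_derive x 1 f l ->
  is_derive x 1 (fun x => f x * c) (l * c).
Proof.
move=> D; rewrite (_ : (fun x => f x * c) = c *: f); last first.
  by apply/funext => u; rewrite /= mulrC.
by apply: is_derive_eq; rewrite /GRing.scale /= mulrC.
Qed.

(* The Poisson kernel Pk and its conjugate Qk: Ak = d_z Pk = d_t Qk,
   Ck = d_t Pk = - d_z Qk, Dk = d_z Ak = - d_t Ck and Ek = d_t Ak = d_z Ck. *)
Definition rk t z : R := (z ^+ 2 + t ^+ 2)^-1.
Definition Pk t z : R := pi^-1 * t * rk t z.
Definition Qk t z : R := pi^-1 * z * rk t z.
Definition Ak t z : R := - (2 * pi^-1) * t * z * rk t z ^+ 2.
Definition Ck t z : R := pi^-1 * (z ^+ 2 - t ^+ 2) * rk t z ^+ 2.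
Definition Dk t z : R := pi^-1 * (6 * t * z ^+ 2 - 2 * t ^+ 3) * rk t z ^+ 3.
Definition Ek t z : R := pi^-1 * (6 * t ^+ 2 * z - 2 * z ^+ 3) * rk t z ^+ 3.

Lemma den_gt0 t z : 0 < t -> 0 < z ^+ 2 + t ^+ 2.
Proof. by move=> t0; rewrite ltr_wpDl ?sqr_ge0 ?exprn_gt0. Qed.

Lemma rk_gt0 t z : 0 < t -> 0 < rk t z.
Proof. by move=> t0; rewrite invr_gt0 den_gt0. Qed.

Lemma rk_mul t z : 0 < t -> (z ^+ 2 + t ^+ 2) * rk t z = 1.
Proof. by move=> t0; rewrite divff// gt_eqF// den_gt0. Qed.

Lemma is_derive_rkz t z : 0 < t -> is_derive z 1 (rk t) (- (2 * z) * rk t z ^+ 2).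
Proof.
move=> t0; have d0 := den_gt0 z t0.
apply: is_derive_eq; first by apply: is_deriveV; rewrite gt_eqF.
by rewrite -exprVn -/(rk t z) /GRing.scale /=; ring.
Qed.

Lemma is_derive_rkt t z : 0 < t ->
  is_derive t 1 (rk^~ z) (- (2 * t) * rk t z ^+ 2).
Proof.
move=> t0; have d0 := den_gt0 z t0.
apply: is_derive_eq; first by apply: is_deriveV; rewrite gt_eqF.
by rewrite -exprVn -/(rk t z) /GRing.scale /=; ring.
Qed.

Lemma rk_lin t z : 0 < t -> t ^+ 2 * rk t z = 1 - z ^+ 2 * rk t z.
Proof. by move=> t0; rewrite -(rk_mul z t0); ring. Qed.

Lemma is_derive_Pkz t z : 0 < t -> is_derive z 1 (Pk t) (Ak t z).
Proof.
move=> t0; have D := is_derive_rkz z t0; apply: is_derive_eq.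
by rewrite /Ak/= /GRing.scale/=; ring.
Qed.

Lemma is_derive_Pkt t z : 0 < t -> is_derive t 1 (Pk^~ z) (Ck t z).
Proof.
move=> t0; have D := is_derive_rkt z t0; apply: is_derive_eq.
rewrite /Ck/= /GRing.scale/=.
have /eqP := rk_mul z t0; rewrite -subr_eq0 => /eqP E.
apply/eqP; rewrite -subr_eq0; apply/eqP.
(* The difference of the two sides is a multiple of (z^2 + t^2) [rk] - 1, which vanishes. [ring]
   cannot see this relation, so the multiple is exhibited; the same device serves for the other
   derivatives. *)
transitivity (- pi^-1 * rk t z * ((z ^+ 2 + t ^+ 2) * rk t z - 1));
   last by rewrite E; ring.
by ring.
Qed.

Lemma is_derive_Qkz t z : 0 < t -> is_derive z 1 (Qk t) (- Ck t z).
Proof.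
move=> t0; have D := is_derive_rkz z t0; apply: is_derive_eq.
rewrite /Ck/= /GRing.scale/=.
have /eqP := rk_mul z t0; rewrite -subr_eq0 => /eqP E.
apply/eqP; rewrite -subr_eq0; apply/eqP.
transitivity (- pi^-1 * rk t z * ((z ^+ 2 + t ^+ 2) * rk t z - 1));
   last by rewrite E; ring.
by ring.
Qed.

Lemma is_derive_Qkt t z : 0 < t -> is_derive t 1 (Qk^~ z) (Ak t z).
Proof.
move=> t0; have D := is_derive_rkt z t0; apply: is_derive_eq.
by rewrite /Ak/= /GRing.scale/=; ring.
Qed.

Lemma is_derive_Akz t z : 0 < t -> is_derive z 1 (Ak t) (Dk t z).
Proof.
move=> t0; have D := is_derive_rkz z t0; apply: is_derive_eq.
rewrite /Dk/= /GRing.scale/=.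
have /eqP := rk_mul z t0; rewrite -subr_eq0 => /eqP E.
apply/eqP; rewrite -subr_eq0; apply/eqP.
transitivity (2 * pi^-1 * t * rk t z ^+ 2 * ((z ^+ 2 + t ^+ 2) * rk t z - 1));
   last by rewrite E; ring.
by ring.
Qed.

Lemma is_derive_Akt t z : 0 < t -> is_derive t 1 (Ak^~ z) (Ek t z).
Proof.
move=> t0; have D := is_derive_rkt z t0; apply: is_derive_eq.
rewrite /Ek/= /GRing.scale/=.
have /eqP := rk_mul z t0; rewrite -subr_eq0 => /eqP E.
apply/eqP; rewrite -subr_eq0; apply/eqP.
transitivity (2 * pi^-1 * z * rk t z ^+ 2 * ((z ^+ 2 + t ^+ 2) * rk t z - 1));
   last by rewrite E; ring.
by ring.
Qed.

Lemma is_derive_Ckz t z : 0 < t -> is_derive z 1 (Ck t) (Ek t z).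
Proof.
move=> t0; have D := is_derive_rkz z t0; apply: is_derive_eq.
rewrite /Ek/= /GRing.scale/=.
have /eqP := rk_mul z t0; rewrite -subr_eq0 => /eqP E.
apply/eqP; rewrite -subr_eq0; apply/eqP.
transitivity (- 2 * pi^-1 * z * rk t z ^+ 2 * ((z ^+ 2 + t ^+ 2) * rk t z - 1));
   last by rewrite E; ring.
by ring.
Qed.

Lemma is_derive_Ckt t z : 0 < t -> is_derive t 1 (Ck^~ z) (- Dk t z).
Proof.
move=> t0; have D := is_derive_rkt z t0; apply: is_derive_eq.
rewrite /Dk/= /GRing.scale/=.
have /eqP := rk_mul z t0; rewrite -subr_eq0 => /eqP E.
apply/eqP; rewrite -subr_eq0; apply/eqP.
transitivity (2 * pi^-1 * t * rk t z ^+ 2 * ((z ^+ 2 + t ^+ 2) * rk t z - 1));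
   last by rewrite E; ring.
by ring.
Qed.

Lemma rk_sq_le t z : 0 < t -> 0 <= z ^+ 2 * rk t z <= 1.
Proof.
move=> t0; have r0 := ltW (rk_gt0 z t0); rewrite mulr_ge0 ?sqr_ge0//=.
by rewrite -(rk_mul z t0) ler_wpM2r// lerDl sqr_ge0.
Qed.

Lemma rk_tz_le t z : 0 < t -> `|2 * t * z * rk t z| <= 1.
Proof.
move=> t0; have r0 := ltW (rk_gt0 z t0).
rewrite normrM (ger0_norm r0) -[leRHS](rk_mul z t0) ler_wpM2r// ler_norml.
have := sqr_ge0 (z - t); have := sqr_ge0 (z + t); nra.
Qed.

Lemma ipi_gt0 : 0 < pi^-1 :> R. Proof. by rewrite invr_gt0 pi_gt0. Qed.

Lemma norm_Ak_le t z : 0 < t -> `|Ak t z| <= pi^-1 * rk t z.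
Proof.
move=> t0; have r0 := rk_gt0 z t0.
rewrite (_ : Ak t z = - (pi^-1 * rk t z) * (2 * t * z * rk t z)); last first.
  by rewrite /Ak; ring.
have k0 : 0 < pi^-1 * rk t z by rewrite mulr_gt0 ?ipi_gt0.
by rewrite normrM normrN (gtr0_norm k0) ler_piMr ?rk_tz_le// ltW.
Qed.

Lemma norm_Ck_le t z : 0 < t -> `|Ck t z| <= pi^-1 * rk t z.
Proof.
move=> t0; have r0 := rk_gt0 z t0.
rewrite (_ : Ck t z = (pi^-1 * rk t z) * (z ^+ 2 * rk t z - t ^+ 2 * rk t z));
  last by rewrite /Ck; ring.
have k0 : 0 < pi^-1 * rk t z by rewrite mulr_gt0 ?ipi_gt0.
rewrite normrM (gtr0_norm k0) ler_piMr ?(ltW k0)//.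
by rewrite rk_lin// ler_norml; have := rk_sq_le z t0; lra.
Qed.

Lemma norm_Dk_le t z : 0 < t -> `|Dk t z| <= 6 * pi^-1 / t * rk t z.
Proof.
move=> t0; have r0 := rk_gt0 z t0; have p0 := ipi_gt0.
rewrite (_ : Dk t z = (pi^-1 / t * rk t z) * (t ^+ 2 * rk t z) *
   (6 * (z ^+ 2 * rk t z) - 2 * (t ^+ 2 * rk t z))); last first.
  by rewrite /Dk; move: pi^-1 (rk t z) => c r; field; exact: lt0r_neq0.
have H := rk_sq_le z t0.
have k0 : 0 < pi^-1 / t * rk t z by rewrite mulr_gt0// divr_gt0.
rewrite -mulrA normrM (gtr0_norm k0).
rewrite (_ : 6 * pi^-1 / t * rk t z = (pi^-1 / t * rk t z) * 6); last by ring.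
rewrite ler_pM2l// rk_lin//; move: (z ^+ 2 * rk t z) H => a H.
by rewrite normrM -[leRHS]mul1r ler_pM// ler_norml; lra.
Qed.

Lemma Pk_gt0 t z : 0 < t -> 0 < Pk t z.
Proof. by move=> t0; rewrite /Pk !mulr_gt0 ?ipi_gt0 ?rk_gt0. Qed.

Lemma norm_Ak_Pk t z : 0 < t -> `|Ak t z| <= t^-1 * Pk t z.
Proof.
move=> t0; rewrite (_ : _ * _ = pi^-1 * rk t z) ?norm_Ak_le//.
by rewrite /Pk; move: pi^-1 (rk t z) => c r; field; exact: lt0r_neq0.
Qed.

Lemma norm_Ck_Pk t z : 0 < t -> `|Ck t z| <= t^-1 * Pk t z.
Proof.
move=> t0; rewrite (_ : _ * _ = pi^-1 * rk t z) ?norm_Ck_le//.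
by rewrite /Pk; move: pi^-1 (rk t z) => c r; field; exact: lt0r_neq0.
Qed.

(** A Harnack-type comparison: heights above t/2 are controlled by height t. It provides the
    majorant for differentiation in t under the integral sign. *)
Lemma rk_t_le t u z : 0 < t -> t / 2 < u -> rk u z <= 4 * rk t z.
Proof.
move=> t0 tu; have u0 : 0 < u by rewrite (le_lt_trans _ tu)// divr_ge0// ltW.
have -> : 4 * rk t z = ((z ^+ 2 + t ^+ 2) / 4)^-1 by rewrite invfM invrK mulrC.
rewrite /rk lef_pV2 ?posrE ?divr_gt0 ?den_gt0//.
have : (t / 2) ^+ 2 <= u ^+ 2 by rewrite ler_pXn2r ?nnegrE ?divr_ge0 ?ltW.
by have := sqr_ge0 z; rewrite expr_div_n; nra.
Qed.

(** The counterpart in x: a displacement smaller than t/2 costs a factor 2, which gives the local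
    majorant for x-derivatives. *)
Lemma rk_shift_le t x x0 y : 0 < t -> `|x - x0| < t / 2 ->
  rk t (x - y) <= 2 * rk t (x0 - y).
Proof.
move=> t0 xx0.
have -> : 2 * rk t (x0 - y) = (((x0 - y) ^+ 2 + t ^+ 2) / 2)^-1.
  by rewrite invfM invrK mulrC.
rewrite /rk lef_pV2 ?posrE ?divr_gt0 ?den_gt0//.
have : (x - x0) ^+ 2 <= (t / 2) ^+ 2.
  rewrite -(@real_normK _ (x - x0)) ?num_real//.
  by rewrite ler_pXn2r ?nnegrE ?divr_ge0 ?(ltW xx0) ?(ltW t0).
have := sqr_ge0 ((x - y) + (x - x0)).
rewrite expr_div_n => H1 H2; nra.
Qed.

Lemma measurable_rkc d (T : measurableType d) (f g : T -> R) :
  measurable_fun setT f -> measurable_fun setT g ->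
  measurable_fun setT (fun p => rk (f p) (g p)).
Proof.
move=> mf mg; apply: measurable_funV.
by apply: measurable_funD; apply: measurable_funX.
Qed.

Lemma measurable_Pkc d (T : measurableType d) (f g : T -> R) :
  measurable_fun setT f -> measurable_fun setT g ->
  measurable_fun setT (fun p => Pk (f p) (g p)).
Proof.
move=> mf mg; apply: measurable_funM; last exact: measurable_rkc.
exact: measurable_funM.
Qed.

Lemma measurable_Qkc d (T : measurableType d) (f g : T -> R) :
  measurable_fun setT f -> measurable_fun setT g ->
  measurable_fun setT (fun p => Qk (f p) (g p)).
Proof.
move=> mf mg; apply: measurable_funM; last exact: measurable_rkc.
exact: measurable_funM.
Qed.

Lemma measurable_Akc d (T : measurableType d) (f g : T -> R) :
  measurable_fun setT f -> measurable_fun setT g ->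
  measurable_fun setT (fun p => Ak (f p) (g p)).
Proof.
move=> mf mg; apply: measurable_funM; last first.
  by apply: measurable_funX; exact: measurable_rkc.
by apply: measurable_funM => //; exact: measurable_funM.
Qed.

Lemma measurable_Ckc d (T : measurableType d) (f g : T -> R) :
  measurable_fun setT f -> measurable_fun setT g ->
  measurable_fun setT (fun p => Ck (f p) (g p)).
Proof.
move=> mf mg; apply: measurable_funM; last first.
  by apply: measurable_funX; exact: measurable_rkc.
apply: measurable_funM => //.
by apply: measurable_funB; exact: measurable_funX.
Qed.

Lemma measurable_Dkc d (T : measurableType d) (f g : T -> R) :
  measurable_fun setT f -> measurable_fun setT g ->
  measurable_fun setT (fun p => Dk (f p) (g p)).
Proof.
move=> mf mg; apply: measurable_funM; last first.
  by apply: measurable_funX; exact: measurable_rkc.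
apply: measurable_funM => //; apply: measurable_funB.
  apply: measurable_funM; first exact: measurable_funM.
  exact: measurable_funX.
by apply: measurable_funM => //; exact: measurable_funX.
Qed.

Lemma measurable_rkT t : measurable_fun setT (rk t).
Proof. exact: measurable_rkc. Qed.

Lemma integ_rk1 : integ (rk 1 : R -> R) /\ \I (rk 1) = pi.
Proof.
have E : (\int[mu]_x (rk 1 x)%:E = pi%:E)%E.
  have rkE x : rk 1 x = (oneDsqr x)^-1 by rewrite /rk /oneDsqr expr1n addrC.
  rewrite (@ge0_symfun_integralT R (rk 1)).
  - rewrite -set_itvcy.
    under eq_integral do rewrite rkE.
    by rewrite integral0y_oneDsqr -EFinM; congr EFin; field.
  - by move=> x; rewrite ltW// rk_gt0.
  - rewrite (_ : rk 1 = (fun x => (oneDsqr x)^-1)); first exact: continuous_oneDsqrV.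
    by apply/funext => x; rewrite rkE.
  - by move=> x; rewrite /= /rk sqrrN.
split; last by rewrite /Rintegral E.
apply/integrableP; split; first by apply/measurable_EFinP; exact: measurable_rkT.
rewrite [ltLHS](_ : _ = \int[mu]_x (rk 1 x)%:E)%E ?E ?ltry//.
by rewrite -E; apply: eq_integral => x _ /=; rewrite gtr0_norm// rk_gt0.
Qed.

Lemma integ_rk t : 0 < t -> integ (rk t) /\ \I (rk t) = pi / t.
Proof.
move=> t0; have [i1 E1] := integ_rk1.
have ti : 0 < t^-1 by rewrite invr_gt0.
have E : rk t = (fun z => t ^- 2 * rk 1 (t^-1 * z + 0)).
  apply/funext => z; rewrite /rk; have := den_gt0 z t0; move=> d0.
  have d1 : (t^-1 * z + 0) ^+ 2 + 1 ^+ 2 != 0 by rewrite gt_eqF// den_gt0.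
  rewrite -invfM; congr (_^-1).
  by field; rewrite gt_eqF.
rewrite E; split; first by apply: integZ; exact: integ_affine.
rewrite RintZ; last exact: integ_affine.
by rewrite Rint_affine// E1; field; rewrite gt_eqF.
Qed.

Lemma integ_rk_shift t x : 0 < t -> integ (fun y => rk t (x - y)) /\
  \I (fun y => rk t (x - y)) = pi / t.
Proof.
move=> t0; have [i1 E1] := integ_rk t0.
have E : (fun y => rk t (x - y)) = (fun y => rk t (1 * y + - x)).
  by apply/funext => y; rewrite /rk; congr (_ + _)^-1; ring.
rewrite E; split; first exact: integ_affine.
by rewrite Rint_affine// E1 invr1 mul1r.
Qed.

Lemma integ_Pk_shift t x : 0 < t -> integ (fun y => Pk t (x - y)) /\
  \I (fun y => Pk t (x - y)) = 1.
Proof.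
move=> t0; have [i1 E1] := integ_rk_shift x t0.
split; first exact: integZ.
rewrite RintZ// E1; have := lt0r_neq0 (pi_gt0 R).
by move: pi => c c0; field; rewrite lt0r_neq0.
Qed.

Definition cv (k : R -> R) w x : R := \I (fun y => k (x - y) * w y).

Definition bmeas w := measurable_fun setT w /\ exists B, forall y, `|w y| <= B.

Lemma integ_cv (k : R -> R) w c t x : 0 < t -> measurable_fun setT k ->
  (forall z, `|k z| <= c * rk t z) -> bmeas w ->
  integ (fun y => k (x - y) * w y).
Proof.
move=> t0 mk kc [mw [B wB]].
apply: (@integ_le _ _ (fun y => (c * B) * rk t (x - y))).
- apply: measurable_funM => //; apply: (measurableT_comp mk).
  exact: measurable_funB.
- by apply: integZ; have [] := integ_rk_shift x t0.
- move=> y; rewrite normrM mulrAC; apply: ler_pM => //.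
Qed.

Lemma is_derive_cv (k k' : R -> R) w (c t x0 : R) : 0 < t ->
  (forall z, is_derive z 1 k (k' z)) -> (forall z, `|k' z| <= c * rk t z) ->
  bmeas w -> (forall x, integ (fun y => k (x - y) * w y)) ->
  is_derive x0 1 (cv k w) (cv k' w x0).
Proof.
move=> t0 dk kc [mw [B wB]] ik.
have c0 : 0 <= c.
  by rewrite -(pmulr_lge0 _ (rk_gt0 0 t0)) (le_trans _ (kc 0)).
have B0 : 0 <= B by rewrite (le_trans _ (wB 0)).
apply: (@is_derive_Rint _ (fun x y => k (x - y) * w y)
   (fun x y => k' (x - y) * w y) x0 (t / 2)
   (fun y => (c * 2 * B) * rk t (x0 - y))).
- by rewrite divr_gt0.
- by move=> x _; exact: ik.
- move=> x y _; have D := dk (x - y).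
  by apply: is_deriveMr; apply: is_derive_eq; rewrite subr0 mulr1.
- by apply: integZ; have [] := integ_rk_shift x0 t0.
- move=> x y xx0; rewrite normrM.
  rewrite (_ : c * 2 * B * rk t (x0 - y) = c * (2 * rk t (x0 - y)) * B); last by ring.
  apply: ler_pM => //; apply: (le_trans (kc _)); apply: ler_wpM2l => //.
  exact: rk_shift_le.
Qed.

Lemma is_derive_cvt (k k' : R -> R -> R) w (c t x0 : R) : 0 < t ->
  (forall s z : R, 0 < s -> is_derive s 1 (k^~ z) (k' s z)) ->
  (forall s z, t / 2 < s -> `|k' s z| <= c * rk t z) ->
  bmeas w -> (forall s, 0 < s -> integ (fun y => k s (x0 - y) * w y)) ->
  is_derive t 1 (fun s => cv (k s) w x0) (cv (k' t) w x0).
Proof.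
move=> t0 dk kc [mw [B wB]] ik.
have t2 : 0 < t / 2 by rewrite divr_gt0.
have tt2 s : `|s - t| < t / 2 -> t / 2 < s.
  by rewrite ltr_norml => /andP[h _]; lra.
have c0 : 0 <= c.
  rewrite -(pmulr_lge0 _ (rk_gt0 0 t0)) (le_trans _ (kc t 0 _))//; lra.
have B0 : 0 <= B by rewrite (le_trans _ (wB 0)).
apply: (@is_derive_Rint _ (fun s y => k s (x0 - y) * w y)
   (fun s y => k' s (x0 - y) * w y) t (t / 2)
   (fun y => (c * B) * rk t (x0 - y))) => //.
- by move=> s /tt2 s2; apply: ik; exact: lt_trans s2.
- move=> s y /tt2 s2; have D := dk s (x0 - y) (lt_trans t2 s2).
  exact: is_deriveMr.
- by apply: integZ; have [] := integ_rk_shift x0 t0.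
- move=> s y /tt2 s2; rewrite normrM mulrAC; apply: ler_pM => //.
  exact: kc.
Qed.
End kernels.

(** * Poisson integrals and Green's formula on rectangles *)

Section green.
Context {R : realType}.
Local Notation mu := (@lebesgue_measure R).
Local Notation "\I f" := (Rintegral mu setT f) (at level 10).
Implicit Types (t x y z : R) (w h : R -> R).

Lemma continuous_cv (k : R -> R) w (c t : R) : 0 < t -> continuous k ->
  (forall z, `|k z| <= c * rk t z) -> bmeas w -> continuous (cv k w).
Proof.
move=> t0 ck kc bw x0; have [mw [B wB]] := bw.
have mk : measurable_fun setT k by exact: continuous_measurable_fun.
have inI x : `]x0 - t / 2, x0 + t / 2[%classic x -> `|x - x0| < t / 2.
  by rewrite /= in_itv/= => /andP[? ?]; rewrite ltr_norml; lra.
apply: (@continuity_under_integral R _ _ mu (fun x y => k (x - y) * w y) setT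
   measurableT (x0 - t / 2) (x0 + t / 2) _ _
   (fun y => c * 2 * B * rk t (x0 - y))).
- by move=> x _; exact: (integ_cv x t0 mk kc bw).
- apply/aeW => y _ x _; apply: cvgMr_tmp.
  apply: (@continuous_comp _ _ _ (fun x => x - y) k); last exact: ck.
  by apply: cvgB; [exact: cvg_id|exact: cvg_cst].
- by apply: integZ; have [] := integ_rk_shift x0 t0.
- move=> x /inI xx0; apply/aeW => y _; rewrite normrM.
  have c0 : 0 <= c.
    by rewrite -(pmulr_lge0 _ (rk_gt0 0 t0)) (le_trans _ (kc 0)).
  rewrite (_ : c * 2 * B * rk t (x0 - y) = c * (2 * rk t (x0 - y)) * B); last by ring.
  apply: ler_pM => //; apply: (le_trans (kc _)); apply: ler_wpM2l => //.
  exact: rk_shift_le.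
- rewrite inE /= in_itv/=; have : 0 < t / 2 by rewrite divr_gt0.
  lra.
Qed.

Lemma continuous_cvt (k : R -> R -> R) w (c t x0 : R) : 0 < t ->
  (forall s z, 0 < s -> {for s, continuous (k^~ z)}) ->
  (forall s, measurable_fun setT (k s)) ->
  (forall s z, t / 2 < s -> `|k s z| <= c * rk t z) -> bmeas w ->
  {for t, continuous (fun s => cv (k s) w x0)}.
Proof.
move=> t0 ck mk kc bw; have [mw [B wB]] := bw.
have t2 : 0 < t / 2 by rewrite divr_gt0.
have inI s : `]t / 2, t * 2[%classic s -> t / 2 < s.
  by rewrite /= in_itv/= => /andP[? ?].
apply: (@continuity_under_integral R _ _ mu (fun s y => k s (x0 - y) * w y) setT
   measurableT (t / 2) (t * 2) _ _
   (fun y => c * B * rk t (x0 - y))).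
- by move=> s /inI s2; apply: (@integ_cv _ _ _ c t) => // z; exact: kc.
- apply/aeW => y _ s; rewrite inE => /inI s2; apply: cvgMr_tmp.
  by apply: ck; exact: lt_trans s2.
- by apply: integZ; have [] := integ_rk_shift x0 t0.
- move=> s /inI s2; apply/aeW => y _; rewrite normrM mulrAC; apply: ler_pM => //.
  exact: kc.
- rewrite inE /= in_itv/=; lra.
Qed.

Lemma measurable_cv2 (k : R -> R -> R) w :
  (forall d (T : measurableType d) (f g : T -> R), measurable_fun setT f ->
     measurable_fun setT g -> measurable_fun setT (fun p => k (f p) (g p))) ->
  measurable_fun setT w ->
  measurable_fun setT (fun p : R * R => cv (k p.2) w p.1).
Proof.
move=> mk mw; apply: (@measurable_Rint_param R _ _
  (fun q : (R * R) * R => k q.1.2 (q.1.1 - q.2) * w q.2)).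
apply: measurable_funM; last exact: (measurableT_comp mw).
apply: mk; first by apply: (measurableT_comp measurable_snd).
by apply: measurable_funB => //; apply: (measurableT_comp measurable_fst).
Qed.

Lemma cv_le (k k' : R -> R) w w' c t x : 0 < t ->
  measurable_fun setT k -> measurable_fun setT k' ->
  (forall z, `|k' z| <= c * rk t z) -> bmeas w -> bmeas w' ->
  (forall z, `|k z| <= k' z) -> (forall y, `|w y| <= w' y) ->
  `|cv k w x| <= cv k' w' x.
Proof.
move=> t0 mk mk' kc bw bw' kk ww.
have mB : measurable_fun setT (fun y => x - y) by exact: measurable_funB.
apply: Rint_abs_le.
- by apply: measurable_funM; [exact: (measurableT_comp mk)|exact: bw.1].
- exact: (integ_cv _ t0 mk' kc).
- by move=> y; rewrite normrM ler_pM.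
Qed.

Lemma norm_Pk_le t z : 0 < t -> `|Pk t z| <= pi^-1 * t * rk t z.
Proof. by move=> t0; rewrite gtr0_norm ?Pk_gt0. Qed.

Lemma bmeas_norm w : bmeas w -> bmeas (fun y => `|w y|).
Proof.
move=> [mw [B wB]]; split; first exact: measurableT_comp.
by exists B => y; rewrite normr_id.
Qed.

Lemma integ_PkM w t x : 0 < t -> bmeas w -> integ (fun y => Pk t (x - y) * w y).
Proof.
move=> t0 bw; apply: (integ_cv _ t0 _ (fun z => norm_Pk_le z t0) bw).
exact: measurable_Pkc.
Qed.

Lemma cv_Pk_norm w t x : 0 < t -> bmeas w ->
  `|cv (Pk t) w x| <= cv (Pk t) (fun y => `|w y|) x.
Proof.
move=> t0 bw; apply: (cv_le _ t0 _ _ (fun z => norm_Pk_le z t0)) => //.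
- exact: measurable_Pkc.
- exact: measurable_Pkc.
- exact: bmeas_norm.
- by move=> z; rewrite gtr0_norm ?Pk_gt0.
Qed.

Lemma cv_bound (k : R -> R) w c t x : 0 < t -> measurable_fun setT k ->
  (forall z, `|k z| <= c * Pk t z) -> bmeas w ->
  `|cv k w x| <= c * cv (Pk t) (fun y => `|w y|) x.
Proof.
move=> t0 mk kc bw.
rewrite -RintZ; last by apply: integ_PkM => //; exact: bmeas_norm.
have [mw [B wB]] := bw; apply: Rint_abs_le.
- apply: measurable_funM => //; apply: (measurableT_comp mk).
  exact: measurable_funB.
- by apply: integZ; apply: integ_PkM => //; exact: bmeas_norm.
- by move=> y; rewrite normrM mulrA ler_wpM2r.
Qed.

Lemma norm_Dk_Pk t z : 0 < t -> `|Dk t z| <= 6 / t ^+ 2 * Pk t z.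
Proof.
move=> t0; apply: (le_trans (norm_Dk_le z t0)).
by rewrite /Pk le_eqVlt; apply/orP; left; apply/eqP; move: pi^-1 (rk t z) => c r;
  field; exact: lt0r_neq0.
Qed.

Lemma cv_Pk_le w B t x : 0 < t -> bmeas w -> (forall y, `|w y| <= B) ->
  `|cv (Pk t) w x| <= B.
Proof.
move=> t0 bw wB; have [i1 E1] := integ_Pk_shift x t0.
rewrite -[leRHS]mul1r -E1 -RintZr//.
apply: Rint_abs_le.
- by apply: integ_measurable; exact: integ_PkM.
- rewrite (_ : (fun _ => _) = (fun y => B * Pk t (x - y))); first exact: integZ.
  by apply/funext => y; rewrite mulrC.
- by move=> y; rewrite normrM gtr0_norm ?Pk_gt0// ler_wpM2l// ltW// Pk_gt0.
Qed.

(** The graph of u^c lies above its tangent at m. This is Young's inequality with the conjugate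
    exponents c and c / (c - 1). *)
Lemma powR_tangent (c u m : R) : 1 < c -> 0 <= u -> 0 < m ->
  c * m `^ (c - 1) * u <= u `^ c + (c - 1) * m `^ c.
Proof.
move=> c1 u0 m0; have c0 : 0 < c by lra.
have q0 : 0 < c / (c - 1) by rewrite divr_gt0//; lra.
have cE : c^-1 + (c / (c - 1))^-1 = 1 by field; rewrite !gt_eqF//; lra.
have := @conjugate_powR R u (m `^ (c - 1)) c (c / (c - 1)) u0 (powR_ge0 _ _) c0 q0 cE.
rewrite -powRrM (_ : (c - 1) * (c / (c - 1)) = c); last by field; rewrite gt_eqF//; lra.
move=> H; have := ler_wpM2l (ltW c0) H.
rewrite (_ : c * (u `^ c / c + _) = u `^ c + (c - 1) * m `^ c); last first.
  by field; rewrite !gt_eqF//; lra.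
by rewrite mulrA mulrAC.
Qed.

(** Jensen's inequality for the probability density P_t(x - .): the tangent inequality at the mean m
    is integrated. If m = 0 there is no tangent to use, but the left-hand side vanishes. *)
Lemma jensen_Pk w (c t x : R) : 1 < c -> 0 < t -> bmeas w -> (forall y, 0 <= w y) ->
  cv (Pk t) w x `^ c <= cv (Pk t) (fun y => w y `^ c) x.
Proof.
move=> c1 t0 bw w0; have [mw [B wB]] := bw.
have bwc : bmeas (fun y => w y `^ c).
  split; first exact: measurable_fun_powR.
  exists (B `^ c) => y; rewrite ger0_norm ?powR_ge0//.
  apply: ge0_ler_powR; rewrite ?nnegrE//; first lra.
    by rewrite (le_trans _ (wB 0)).
  by rewrite (le_trans _ (wB y))// ler_norm.
have P0 y : 0 <= Pk t (x - y) by rewrite ltW// Pk_gt0.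
have : 0 <= cv (Pk t) w x by apply: Rintegral_ge0 => y _; rewrite mulr_ge0.
rewrite le_eqVlt => /orP[/eqP <-|m0].
  rewrite powR0 ?gt_eqF//; last lra.
  by apply: Rintegral_ge0 => y _; rewrite mulr_ge0// powR_ge0.
set m := cv _ w x in m0 *.
have [i1 E1] := integ_Pk_shift x t0.
have H : \I (fun y => c * m `^ (c - 1) * (Pk t (x - y) * w y)) <=
   \I (fun y => Pk t (x - y) * w y `^ c + (c - 1) * m `^ c * Pk t (x - y)).
  apply: le_Rint.
  - by apply: integZ; exact: integ_PkM.
  - by apply: integD; [exact: integ_PkM|exact: integZ].
  - move=> y; have := powR_tangent c1 (w0 y) m0; move/(ler_wpM2l (P0 y)).
    by move: (w y `^ c) (m `^ c) (m `^ _) => a b d; lra.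
rewrite RintZ in H; last exact: integ_PkM.
rewrite RintD in H; [|exact: integ_PkM|exact: integZ].
rewrite RintZ// E1 in H; move: H.
rewrite -/(cv (Pk t) w x) -/m -/(cv (Pk t) (fun y => w y `^ c) x).
have cE : m * m `^ (c - 1) = m `^ c by rewrite mulr_powRB1 ?ltW//; lra.
by rewrite -(mulrA c) [_ * m]mulrC cE; lra.
Qed.

(** Jensen's inequality at each point, then Tonelli: by symmetry the kernel has mass 1 in its other
    variable as well. *)
Lemma integ_powR_jensen w (c t : R) : 1 < c -> 0 < t -> bmeas w -> (forall y, 0 <= w y) ->
  (\int[mu]_x (cv (Pk t) w x `^ c)%:E <= \int[mu]_x (w x `^ c)%:E)%E.
Proof.
move=> c1 t0 bw w0; have [mw [B wB]] := bw.
have bwc : bmeas (fun y => w y `^ c).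
  split; first exact: measurable_fun_powR.
  exists (B `^ c) => y; rewrite ger0_norm ?powR_ge0//.
  apply: ge0_ler_powR; rewrite ?nnegrE//; first lra.
    by rewrite (le_trans _ (wB 0)).
  by rewrite (le_trans _ (wB y))// ler_norm.
apply: (@le_trans _ _ (\int[mu]_x \int[mu]_y (Pk t (x - y) * w y `^ c)%:E)%E).
  apply: ge0_le_integral => //.
  - by move=> x _; rewrite lee_fin powR_ge0.
  - apply/measurable_EFinP; apply: measurable_fun_powR.
    apply: (measurable_sec2 t (@measurable_cv2 Pk w _ mw)).
    by move=> *; exact: measurable_Pkc.
  - apply: (@measurable_fun_fubini_tonelli_F _ _ _ _ _ mu
      (fun z : R * R => (Pk t (z.1 - z.2) * w z.2 `^ c)%:E)) => //.
      apply/measurable_EFinP; apply: measurable_funM.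
        by apply: measurable_Pkc => //; exact: measurable_funB.
      by apply: measurable_fun_powR; exact: (measurableT_comp mw).
    by move=> z; rewrite lee_fin mulr_ge0// ?powR_ge0// ltW// Pk_gt0.
  - move=> x _; rewrite -Rint_EFin; last exact: integ_PkM.
    by rewrite lee_fin; exact: jensen_Pk.
rewrite (tonelli_in measurableT measurableT) => //; last 2 first.
- apply/measurable_EFinP; apply: measurable_funM.
    by apply: measurable_Pkc => //; exact: measurable_funB.
  by apply: measurable_fun_powR; exact: (measurableT_comp mw).
- by move=> x y; rewrite lee_fin mulr_ge0// ?powR_ge0// ltW// Pk_gt0.
apply: ge0_le_integral => //.
- by move=> y _; apply: integral_ge0 => x _; rewrite lee_fin mulr_ge0// ?powR_ge0// ltW// Pk_gt0.
- apply: (@measurable_fun_fubini_tonelli_G _ _ _ _ _ mu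
      (fun z : R * R => (Pk t (z.1 - z.2) * w z.2 `^ c)%:E)) => //.
    apply/measurable_EFinP; apply: measurable_funM.
      by apply: measurable_Pkc => //; exact: measurable_funB.
    by apply: measurable_fun_powR; exact: (measurableT_comp mw).
  by move=> z; rewrite lee_fin mulr_ge0// ?powR_ge0// ltW// Pk_gt0.
- by apply/measurable_EFinP; exact: measurable_fun_powR.
- move=> y _; have [i1 E1] := integ_Pk_shift y t0.
  rewrite [leLHS](_ : _ = \int[mu]_x (w y `^ c * Pk t (y - x))%:E)%E; last first.
    apply: eq_integral => x _.
    by rewrite mulrC /Pk /rk -[(x - y) ^+ 2]sqrrN opprB.
  by rewrite -Rint_EFin; [rewrite RintZ// E1 mulr1|exact: integZ].
Qed.

Lemma Rintegral_indic (D : set R) (f : R -> R) :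
  Rintegral mu D f = \I (fun x => \1_D x * f x).
Proof.
rewrite Rintegral_mkcond; apply: eq_Rintegral => x _.
by rewrite /patch indicE; case: ifP => _; rewrite ?mul1r ?mul0r.
Qed.

Lemma integrable_indic (D : set R) (f : R -> R) : measurable D ->
  mu.-integrable D (EFin \o f) <-> integ (fun x => \1_D x * f x).
Proof.
move=> mD; rewrite integrable_mkcond//.
rewrite (_ : (EFin \o f) \_ D = EFin \o (fun x => \1_D x * f x))//.
apply/funext => x; rewrite /patch/= indicE.
by case: ifP => _; rewrite ?mul1r ?mul0r.
Qed.

Lemma Rint0 : \I (fun _ : R => 0 : R) = 0.
Proof. by rewrite Rintegral_cst// mul0r. Qed.

Lemma Rint_swap_in (A B : set R) (K : R) (f : R -> R -> R) :
  measurable A -> measurable B -> integ (\1_A : R -> R) -> integ (\1_B : R -> R) ->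
  measurable_fun setT (fun z : R * R => f z.1 z.2) ->
  (forall y t, A y -> B t -> `|f y t| <= K) ->
  [/\ (forall y, A y -> mu.-integrable B (EFin \o f y)),
    mu.-integrable A (EFin \o (fun y => Rintegral mu B (f y))) &
   Rintegral mu A (fun y => Rintegral mu B (f y)) =
   Rintegral mu B (fun t => Rintegral mu A (f^~ t))].
Proof.
move=> mA mB iA iB mf fK.
pose g y t := \1_A y * (\1_B t * f y t).
have mg : measurable_fun setT (fun z : R * R => g z.1 z.2).
  apply: measurable_funM.
    by apply: (measurableT_comp (@measurable_indic _ _ R setT A mA)).
  apply: measurable_funM => //.
  by apply: (measurableT_comp (@measurable_indic _ _ R setT B mB)).
have gK y t : `|g y t| <= (K * \1_A y) * \1_B t.
  rewrite /g !normrM !indicE; have [yA|yA] := boolP (y \in A); last first.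
    by rewrite normr0 !mul0r mulr0 mul0r.
  have [tB|tB] := boolP (t \in B); last by rewrite normr0 !mul0r !mulr0.
  rewrite normr1 !mul1r !mulr1; apply: fK.
    by rewrite inE in yA.
  by rewrite inE in tB.
have [i1 _ i2 E] := @Rint_fubini R g (fun y => K * \1_A y) \1_B mg
  (integZ K iA) iB gK.
have z0 := Rint0.
have gE y : \I (g y) = \1_A y * Rintegral mu B (f y).
  rewrite [in RHS]Rintegral_indic /g [\1_A y]indicE.
  have [yA|yA] := boolP (y \in A).
    by rewrite mul1r; apply: eq_Rintegral => t _; rewrite mul1r.
  by rewrite mul0r -[RHS]z0; apply: eq_Rintegral => t _; rewrite mul0r.
split.
- move=> y yA; apply/(integrable_indic _ mB).
  have := i1 y; rewrite /g indicE mem_set//.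
  by under eq_fun do rewrite mul1r.
- apply/(integrable_indic _ mA).
  by have := i2; under eq_fun do rewrite gE.
- transitivity (\I (fun y => \I (g y))).
    by rewrite Rintegral_indic; apply: eq_Rintegral => y _; rewrite gE.
  rewrite E [RHS]Rintegral_indic.
  apply: eq_Rintegral => t _; rewrite [in RHS]Rintegral_indic /g.
  have [tB|tB] := boolP (t \in B); rewrite !indicE ?tB ?(negbTE tB).
    rewrite mul1r; apply: eq_Rintegral => y _.
    by rewrite mul1r indicE.
  rewrite mul0r -[RHS]z0; apply: eq_Rintegral => y _.
  by rewrite mul0r mulr0.
Qed.

Lemma integ_indic_itv (a b : R) : integ (\1_(`[a, b]%classic) : R -> R).
Proof.
have := (@integrable_indic `[a, b]%classic (cst 1) (measurable_itv _)).1.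
rewrite (_ : (fun x => _ * cst 1 x) = \1_(`[a, b]%classic)); last first.
  by apply/funext => x /=; rewrite mulr1.
apply; apply: continuous_compact_integrable; first exact: segment_compact.
by move=> z; exact: cvg_cst.
Qed.

Lemma integrable_addR (A : set R) (f g : R -> R) : measurable A ->
  mu.-integrable A (EFin \o f) -> mu.-integrable A (EFin \o g) ->
  mu.-integrable A (EFin \o (fun x => f x + g x)).
Proof.
move=> mA iF iG; rewrite (_ : EFin \o _ = ((EFin \o f) \+ (EFin \o g))%E)//.
exact: integrableD.
Qed.

Lemma Rint_addR (A : set R) (f g : R -> R) : measurable A ->
  mu.-integrable A (EFin \o f) -> mu.-integrable A (EFin \o g) ->
  Rintegral mu A (fun x => f x + g x) = Rintegral mu A f + Rintegral mu A g.
Proof. by move=> mA iF iG; exact: RintegralD. Qed.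

(** The divergence theorem for the field with components q along y and p along t. Each half of [s]
    is integrated by the fundamental theorem of calculus in its own variable; the q half needs a
    Fubini exchange, for which the uniform bound K suffices on a rectangle. *)
Lemma green_rect (p q pt qy : R -> R -> R) (N t0 t1 K : R) :
  0 <= N -> t0 <= t1 ->
  (forall y t, t0 <= t <= t1 -> is_derive t 1 (p y) (pt y t)) ->
  (forall y t, t0 <= t <= t1 -> {for t, continuous (pt y)}) ->
  (forall y t, t0 <= t <= t1 -> is_derive y 1 (q^~ t) (qy y t)) ->
  (forall y t, t0 <= t <= t1 -> {for y, continuous (qy^~ t)}) ->
  measurable_fun setT (fun z : R * R => pt z.1 z.2) ->
  measurable_fun setT (fun z : R * R => qy z.1 z.2) ->
  (forall y t, t0 <= t <= t1 -> `|pt y t| <= K) ->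
  (forall y t, t0 <= t <= t1 -> `|qy y t| <= K) ->
  let A := `[- N, N]%classic in let B := `[t0, t1]%classic in
  let s y t := pt y t + qy y t in
  [/\ (forall y, A y -> mu.-integrable B (EFin \o s y)),
      mu.-integrable A (EFin \o (fun y => Rintegral mu B (s y))) &
   Rintegral mu A (fun y => Rintegral mu B (s y)) =
     Rintegral mu A (fun y => p y t1 - p y t0) +
     Rintegral mu B (fun t => q N t - q (- N) t)].
Proof.
move=> N0 t01 dp cp dq cq mpt mqy Kp Kq A B s.
have NN : - N <= N by rewrite (le_trans _ N0)// oppr_le0.
have mA : measurable A by exact: measurable_itv.
have mB : measurable B by exact: measurable_itv.
have iA : integ (\1_A : R -> R) by exact: integ_indic_itv.
have iB : integ (\1_B : R -> R) by exact: integ_indic_itv.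
have Bt t : B t -> t0 <= t <= t1 by rewrite /B/= in_itv/=.
have FA t : B t -> Rintegral mu A (qy^~ t) = q N t - q (- N) t.
  by move=> /Bt tB; have [_ ->] := @Rint_FTC R (q^~ t) (qy^~ t) (- N) N NN
  (fun y _ => dq y t tB) (fun y _ => cq y t tB).
have FB y : Rintegral mu B (pt y) = p y t1 - p y t0.
  by have [_ ->] := @Rint_FTC R (p y) (pt y) t0 t1 t01 (dp y) (cp y).
clearbody A B.
have [ip1 ip2 _] := Rint_swap_in mA mB iA iB mpt (fun y t _ tB => Kp y t (Bt t tB)).
have [iq1 iq2 Eq] := Rint_swap_in mA mB iA iB mqy (fun y t _ tB => Kq y t (Bt t tB)).
have sE y : A y -> Rintegral mu B (s y) = Rintegral mu B (pt y) + Rintegral mu B (qy y).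
  by move=> yA; rewrite -(Rint_addR mB (ip1 y yA) (iq1 y yA)).
have sA : mu.-integrable A (EFin \o (fun y => Rintegral mu B (s y))).
  apply: (@eq_integrable _ _ _ mu A mA (EFin \o (fun y => Rintegral mu B (pt y) +
      Rintegral mu B (qy y)))).
    by move=> y; rewrite inE => yA /=; rewrite sE.
  exact: (integrable_addR mA ip2 iq2).
split; [by move=> y yA; exact: (integrable_addR mB (ip1 y yA) (iq1 y yA))|exact: sA|].
transitivity (Rintegral mu A
    (fun y => Rintegral mu B (pt y) + Rintegral mu B (qy y))).
  by apply: eq_Rintegral => y; rewrite inE => yA; rewrite sE.
rewrite (Rint_addR mA ip2 iq2) Eq; congr (_ + _).
  by apply: eq_Rintegral => y _; exact: FB.
by apply: eq_Rintegral => t; rewrite inE => tB; exact: FA.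
Qed.

End green.

(** * A weighted square function estimate *)

Section bell.
Context {R : realType}.
Implicit Types (v w : R).

(** The derivative is kept as w^a times the logarithmic derivative of w, so that [b1] and [b2]
    contain no powers of w other than w^a and w^c. *)
Lemma is_derive_powRc (w : R -> R) (w1 s a : R) : 0 < w s -> is_derive s 1 w w1 ->
  is_derive s 1 (fun s => w s `^ a) (a * w s `^ a * (w1 / w s)).
Proof.
move=> w0 D; have D2 := is_derive1_powR a w0.
apply: is_derive_eq; first exact: (@is_derive1_comp _ (@powR R ^~ a) w).
rewrite powRB ?powRr1 ?(ltW w0) ?(gt_eqF w0) ?implybT//.
by field; rewrite gt_eqF.
Qed.

(* b0 = v^2 w^a + k w^c along a line; b1 and b2 are its first and second
   derivatives in terms of those of v and w. *)
Definition b0 a c k v w : R := v ^+ 2 * w `^ a + k * w `^ c.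
Definition b1 a c k v v1 w w1 : R :=
  2 * v * v1 * w `^ a + (a * v ^+ 2 * w `^ a + k * c * w `^ c) * (w1 / w).
Definition b2 a c k v v1 v2 w w1 w2 : R :=
  2 * v1 ^+ 2 * w `^ a + 2 * v * v2 * w `^ a + 4 * a * v * v1 * w `^ a * (w1 / w) +
  (a * (a - 1) * v ^+ 2 * w `^ a + k * c * (c - 1) * w `^ c) * (w1 / w) ^+ 2 +
  (a * v ^+ 2 * w `^ a + k * c * w `^ c) * (w2 / w).

Lemma is_derive_b0 a c k (v w : R -> R) (v1 w1 s : R) : 0 < w s ->
  is_derive s 1 v v1 -> is_derive s 1 w w1 ->
  is_derive s 1 (fun s => b0 a c k (v s) (w s)) (b1 a c k (v s) v1 (w s) w1).
Proof.
move=> w0 dv dw; have Da := is_derive_powRc a w0 dw.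
have Dc := is_derive_powRc c w0 dw.
rewrite /b0; apply: is_derive_eq; rewrite /b1 /GRing.scale /=.
by move: (w1 / w s) => r; ring.
Qed.

Lemma is_derive_b1 a c k (v w v1 w1 : R -> R) (v2 w2 s : R) : 0 < w s ->
  is_derive s 1 v (v1 s) -> is_derive s 1 w (w1 s) ->
  is_derive s 1 v1 v2 -> is_derive s 1 w1 w2 ->
  is_derive s 1 (fun s => b1 a c k (v s) (v1 s) (w s) (w1 s))
    (b2 a c k (v s) (v1 s) v2 (w s) (w1 s) w2).
Proof.
move=> w0 dv dw dv1 dw1; have Da := is_derive_powRc a w0 dw.
have Dc := is_derive_powRc c w0 dw.
have w00 : w s != 0 by rewrite gt_eqF.
have Di : is_derive s 1 (fun s => (w s)^-1) (- (w s) ^- 2 *: w1 s) by exact: is_deriveV.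
rewrite /b1; apply: is_derive_eq; rewrite /b2 /GRing.scale /=.
by move: (w s `^ a) (w s `^ c) => A B; field.
Qed.

(* For k = kap and harmonic v, w, the Laplacian of b0 dominates |grad v|^2 w^a. *)
Definition kap a c k0 : R := k0 * (4 * a ^+ 2 + `|a * (a - 1)|) / (c * (c - 1)).

Lemma kap_ge0 a c k0 : 1 < c -> 0 <= k0 -> 0 <= kap a c k0.
Proof.
move=> c1 k00; rewrite /kap divr_ge0// mulr_ge0//; [|lra|lra].
by rewrite addr_ge0// mulr_ge0// sqr_ge0.
Qed.

(** Terms with second derivatives cancel by harmonicity. In each direction, with r = w1 / w, the
    cross term 4 a v v1 r is absorbed by the square (v1 + 2 a v r)^2. What is left over is at most
    (4 a^2 + |a (a - 1)|) v^2 w^a r^2, and [kap] is chosen so that k c (c - 1) w^c r^2 pays for it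
    through v^2 w^a <= k0 w^c. *)
Lemma b2_ge a c k0 v v1x v2x v1t v2t w w1x w2x w1t w2t : 1 < c -> 0 < w ->
  v ^+ 2 * w `^ a <= k0 * w `^ c -> v2x + v2t = 0 -> w2x + w2t = 0 ->
  (v1x ^+ 2 + v1t ^+ 2) * w `^ a <=
  b2 a c (kap a c k0) v v1x v2x w w1x w2x +
  b2 a c (kap a c k0) v v1t v2t w w1t w2t.
Proof.
move=> c1 w0 H v2 w2.
have A0 : 0 <= w `^ a := powR_ge0 _ _.
have cc0 : 0 < c * (c - 1) by rewrite mulr_gt0//; lra.
have kE : kap a c k0 * c * (c - 1) = k0 * (4 * a ^+ 2 + `|a * (a - 1)|).
  by rewrite /kap; field; rewrite !gt_eqF//; lra.
have one v1 r : v1 ^+ 2 * w `^ a <= 2 * v1 ^+ 2 * w `^ a +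
   4 * a * v * v1 * w `^ a * r + (a * (a - 1) * v ^+ 2 * w `^ a +
   kap a c k0 * c * (c - 1) * w `^ c) * r ^+ 2.
  rewrite kE; move: (w `^ a) (w `^ c) A0 H => A C A0 H.
  have H1 : 0 <= (4 * a ^+ 2 + `|a * (a - 1)|) * r ^+ 2 * (k0 * C - v ^+ 2 * A).
    by rewrite mulr_ge0 ?subr_ge0// mulr_ge0 ?sqr_ge0// addr_ge0// mulr_ge0 ?sqr_ge0.
  have H2 : 0 <= (v1 + 2 * a * v * r) ^+ 2 * A by rewrite mulr_ge0 ?sqr_ge0.
  have H3 : 0 <= (`|a * (a - 1)| + a * (a - 1)) * (v ^+ 2 * A * r ^+ 2).
    rewrite mulr_ge0//; last by rewrite mulr_ge0 ?sqr_ge0// mulr_ge0 ?sqr_ge0.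
    by rewrite -lerBlDr sub0r -normrN ler_norm.
  move: `|a * (a - 1)| H1 H2 H3 => m H1 H2 H3; lra.
have := one v1x (w1x / w); have := one v1t (w1t / w).
have -> : v2t = - v2x by lra.
have -> : w2t = - w2x by lra.
rewrite /b2 !mulNr; lra.
Qed.

Section bounds.
Variables (a c k0 t v vb w : R).
Hypotheses (c1 : 1 < c) (k00 : 0 <= k0) (t0 : 0 < t) (w0 : 0 < w).
Hypotheses (vvb : `|v| <= vb) (H : vb ^+ 2 * w `^ a <= k0 * w `^ c).
Let k := kap a c k0.

(** The mechanism of all bounds below: a product of two among v, v1, v2 is at most vb^2 times powers
    of 1/t, and the hypothesis turns vb^2 w^a into k0 w^c. *)
Let prod_le x y (u1 u2 : R) : `|x| <= vb * u1 -> `|y| <= vb * u2 -> 0 <= u1 -> 0 <= u2 ->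
  `|x * y * w `^ a| <= k0 * w `^ c * (u1 * u2).
Proof.
move=> hx hy hu1 hu2; rewrite !normrM (ger0_norm (powR_ge0 _ _)).
have vb0 : 0 <= vb by rewrite (le_trans _ vvb).
apply: (@le_trans _ _ (vb * u1 * (vb * u2) * w `^ a)).
  by rewrite ler_wpM2r ?powR_ge0// ler_pM.
rewrite (_ : _ * _ * _ = vb ^+ 2 * w `^ a * (u1 * u2)); last by ring.
by rewrite ler_wpM2r// mulr_ge0.
Qed.

Lemma norm_b0_le : `|b0 a c k v w| <= (k0 + k) * w `^ c.
Proof.
have k_ge0 : 0 <= k := kap_ge0 _ c1 k00.
rewrite /b0 (le_trans (ler_normD _ _))// mulrDl lerD//.
  by have := @prod_le v v 1 1; rewrite !mulr1 expr2; apply.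
by rewrite ger0_norm// mulr_ge0// powR_ge0.
Qed.

Lemma norm_b1_le v1 w1 : `|v1| <= t^-1 * vb -> `|w1| <= t^-1 * w ->
  `|b1 a c k v v1 w w1| <= (2 * k0 + `|a| * k0 + k * c) * w `^ c / t.
Proof.
have kk0 : 0 <= k := kap_ge0 a c1 k00.
have cc0 : 0 <= c by rewrite ltW// (lt_trans _ c1).
have kc : 0 <= k * c * w `^ c := mulr_ge0 (mulr_ge0 kk0 cc0) (powR_ge0 _ _).
move=> hv1 hw1; have k_ge0 : 0 <= k := kap_ge0 _ c1 k00.
have C0 := powR_ge0 w c; have ti : 0 < t^-1 by rewrite invr_gt0.
have r1 : `|w1 / w| <= t^-1.
  by rewrite normrM normfV (gtr0_norm w0) ler_pdivrMr.
have P1 : `|v * v1 * w `^ a| <= k0 * w `^ c * (1 * t^-1).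
  by apply: prod_le => //; [rewrite mulr1|rewrite mulrC|exact: ltW].
have P2 : `|v * v * w `^ a| <= k0 * w `^ c * (1 * 1).
  by apply: prod_le => //; rewrite mulr1.
rewrite /b1 (_ : _ + _ = 2 * (v * v1 * w `^ a) + (a * (v * v * w `^ a) + k * c * w `^ c) * (w1 / w)); last by ring.
rewrite (le_trans (ler_normD _ _))//.
rewrite (_ : _ / t = 2 * (k0 * w `^ c * (1 * t^-1)) +
  (`|a| * (k0 * w `^ c * (1 * 1)) + k * c * w `^ c) * t^-1); last by ring.
apply: lerD; first by rewrite normrM ger0_norm// ler_wpM2l.
rewrite normrM ler_pM// (le_trans (ler_normD _ _))// lerD//.
  by rewrite normrM ler_wpM2l.
by rewrite ger0_norm.
Qed.

Lemma norm_b2_le v1 v2 w1 w2 : `|v1| <= t^-1 * vb -> `|w1| <= t^-1 * w ->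
  `|v2| <= 6 / t ^+ 2 * vb -> `|w2| <= 6 / t ^+ 2 * w ->
  `|b2 a c k v v1 v2 w w1 w2| <= (14 * k0 + 4 * `|a| * k0 + `|a * (a - 1)| * k0
     + k * c * (c - 1) + 6 * (`|a| * k0 + k * c)) * w `^ c / t ^+ 2.
Proof.
have kk0 : 0 <= k := kap_ge0 a c1 k00.
have cc0 : 0 <= c by rewrite ltW// (lt_trans _ c1).
have kc : 0 <= k * c * w `^ c := mulr_ge0 (mulr_ge0 kk0 cc0) (powR_ge0 _ _).
have kcc : 0 <= k * c * (c - 1) * w `^ c.
  have cc1 : 0 <= c - 1 by rewrite subr_ge0 ltW.
  exact: mulr_ge0 (mulr_ge0 (mulr_ge0 kk0 cc0) cc1) (powR_ge0 _ _).
move=> hv1 hw1 hv2 hw2; have k_ge0 : 0 <= k := kap_ge0 _ c1 k00.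
have C0 := powR_ge0 w c; have ti : 0 < t^-1 by rewrite invr_gt0.
have ti2 : 0 < 6 / t ^+ 2 by rewrite divr_gt0// exprn_gt0.
have r1 : `|w1 / w| <= t^-1.
  by rewrite normrM normfV (gtr0_norm w0) ler_pdivrMr.
have r2 : `|w2 / w| <= 6 / t ^+ 2.
  by rewrite normrM normfV (gtr0_norm w0) ler_pdivrMr.
have P1 : `|v * v1 * w `^ a| <= k0 * w `^ c * (1 * t^-1).
  by apply: prod_le => //; [rewrite mulr1|rewrite mulrC|exact: ltW].
have P0 : `|v * v * w `^ a| <= k0 * w `^ c * (1 * 1).
  by apply: prod_le => //; rewrite mulr1.
have P3 : `|v1 * v1 * w `^ a| <= k0 * w `^ c * (t^-1 * t^-1).
  by apply: prod_le => //; [rewrite mulrC|rewrite mulrC|exact: ltW|exact: ltW].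
have P4 : `|v * v2 * w `^ a| <= k0 * w `^ c * (1 * (6 / t ^+ 2)).
  by apply: prod_le => //; [rewrite mulr1|rewrite mulrC|exact: ltW].
rewrite /b2 (_ : _ + _ = 2 * (v1 * v1 * w `^ a) + 2 * (v * v2 * w `^ a) +
   4 * (a * (v * v1 * w `^ a) * (w1 / w)) +
   (a * (a - 1) * (v * v * w `^ a) + k * c * (c - 1) * w `^ c) * ((w1 / w) * (w1 / w)) +
   (a * (v * v * w `^ a) + k * c * w `^ c) * (w2 / w)); last by ring.
rewrite (_ : _ / t ^+ 2 = 2 * (k0 * w `^ c * (t^-1 * t^-1)) +
  2 * (k0 * w `^ c * (1 * (6 / t ^+ 2))) +
  4 * (`|a| * (k0 * w `^ c * (1 * t^-1)) * t^-1) +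
  (`|a * (a - 1)| * (k0 * w `^ c * (1 * 1)) + k * c * (c - 1) * w `^ c) * (t^-1 * t^-1) +
  (`|a| * (k0 * w `^ c * (1 * 1)) + k * c * w `^ c) * (6 / t ^+ 2)); last first.
  by move: `|a| `|_| => aa bb; field; rewrite gt_eqF.
rewrite (le_trans (ler_normD _ _))// lerD//; last first.
  rewrite normrM ler_pM// (le_trans (ler_normD _ _))// lerD//.
    by rewrite normrM ler_wpM2l.
  by rewrite ger0_norm.
rewrite (le_trans (ler_normD _ _))// lerD//; last first.
  rewrite normrM ler_pM//; last by rewrite normrM ler_pM.
  rewrite (le_trans (ler_normD _ _))// lerD//.
    by rewrite normrM ler_wpM2l.
  by rewrite ger0_norm.
rewrite (le_trans (ler_normD _ _))// lerD//; last first.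
  rewrite normrM ger0_norm// ler_wpM2l// normrM ler_pM//.
  by rewrite normrM ler_wpM2l.
rewrite (le_trans (ler_normD _ _))// lerD//.
  by rewrite normrM ger0_norm// ler_wpM2l.
by rewrite normrM ger0_norm// ler_wpM2l.
Qed.
End bounds.
End bell.

(** * Derivatives of Poisson integrals of bounded functions *)

Section poisson_derivatives.
Context {R : realType}.
Local Notation mu := (@lebesgue_measure R).
Variable h : R -> R.
Hypothesis bh : bmeas h.
Implicit Types (t x y z : R).

Lemma cvN (k : R -> R) x : integ (fun y => k (x - y) * h y) ->
  cv (fun z => - k z) h x = - cv k h x.
Proof.
move=> ik; rewrite /cv -RintN//; apply: eq_Rintegral => y _.
by rewrite mulNr.
Qed.

Lemma measurable_PkT t : measurable_fun setT (Pk t : R -> R).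
Proof. exact: measurable_Pkc. Qed.
Lemma measurable_AkT t : measurable_fun setT (Ak t : R -> R).
Proof. exact: measurable_Akc. Qed.
Lemma measurable_CkT t : measurable_fun setT (Ck t : R -> R).
Proof. exact: measurable_Ckc. Qed.
Lemma measurable_DkT t : measurable_fun setT (Dk t : R -> R).
Proof. exact: measurable_Dkc. Qed.

Lemma integ_AkM t x : 0 < t -> integ (fun y => Ak t (x - y) * h y).
Proof.
move=> t0; apply: (integ_cv _ t0 _ (fun z => norm_Ak_le z t0) bh).
exact: measurable_AkT.
Qed.
Lemma integ_CkM t x : 0 < t -> integ (fun y => Ck t (x - y) * h y).
Proof.
move=> t0; apply: (integ_cv _ t0 _ (fun z => norm_Ck_le z t0) bh).
exact: measurable_CkT.
Qed.
Lemma integ_DkM t x : 0 < t -> integ (fun y => Dk t (x - y) * h y).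
Proof.
move=> t0; apply: (integ_cv _ t0 _ (fun z => norm_Dk_le z t0) bh).
exact: measurable_DkT.
Qed.

Lemma norm_Ck_le2 t s z : 0 < t -> t / 2 < s -> `|Ck s z| <= pi^-1 * 4 * rk t z.
Proof.
move=> t0 ts; have s0 : 0 < s by rewrite (lt_trans _ ts)// divr_gt0.
apply: (le_trans (norm_Ck_le z s0)); rewrite -mulrA ler_wpM2l ?(ltW (ipi_gt0))//.
exact: rk_t_le.
Qed.

Lemma norm_Dk_le2 t s z : 0 < t -> t / 2 < s ->
  `|Dk s z| <= 12 * pi^-1 / t * 4 * rk t z.
Proof.
move=> t0 ts; have s0 : 0 < s by rewrite (lt_trans _ ts)// divr_gt0.
apply: (le_trans (norm_Dk_le z s0)).
have p0 := @ipi_gt0 R.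
rewrite -[leRHS]mulrA; apply: ler_pM.
- by rewrite mulr_ge0 ?invr_ge0 ?(ltW s0)// mulr_ge0// ltW.
- exact/ltW/rk_gt0.
- rewrite (_ : 12 * _ / t = 6 * pi^-1 * (t / 2)^-1); last by move: pi^-1 => c; field; rewrite gt_eqF.
  rewrite ler_wpM2l ?mulr_ge0 ?(ltW p0)// lef_pV2 ?posrE ?divr_gt0//; exact: ltW.
- exact: rk_t_le.
Qed.

Lemma dVx t x : 0 < t -> is_derive x 1 (cv (Pk t) h) (cv (Ak t) h x).
Proof.
move=> t0; apply: (is_derive_cv _ t0 _ (fun z => norm_Ak_le z t0) bh).
  by move=> z; exact: is_derive_Pkz.
by move=> y; exact: integ_PkM.
Qed.

Lemma dVxx t x : 0 < t -> is_derive x 1 (cv (Ak t) h) (cv (Dk t) h x).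
Proof.
move=> t0; apply: (is_derive_cv _ t0 _ (fun z => norm_Dk_le z t0) bh).
  by move=> z; exact: is_derive_Akz.
by move=> y; exact: integ_AkM.
Qed.

Lemma dVt t x : 0 < t -> is_derive t 1 (fun s => cv (Pk s) h x) (cv (Ck t) h x).
Proof.
move=> t0; apply: (is_derive_cvt t0 _ (fun s z => norm_Ck_le2 z t0) bh).
  by move=> s z s0; exact: is_derive_Pkt.
by move=> s s0; exact: integ_PkM.
Qed.

(** Harmonicity: the second t-derivative is minus the second x-derivative, so the single kernel [Dk]
    serves for both. *)
Lemma dVtt t x : 0 < t ->
  is_derive t 1 (fun s => cv (Ck s) h x) (- cv (Dk t) h x).
Proof.
move=> t0; rewrite -cvN; last exact: integ_DkM.
apply: (@is_derive_cvt _ _ (fun s z => - Dk s z) _ (12 * pi^-1 / t * 4) t x t0 _ _ bh).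
- by move=> s z s0; exact: is_derive_Ckt.
- by move=> s z ts; rewrite normrN; exact: norm_Dk_le2.
- by move=> s s0; exact: integ_CkM.
Qed.

Lemma continuous_Dkz t : 0 < t -> continuous (Dk t : R -> R).
Proof.
move=> t0 z; have D := is_derive_rkz z t0.
apply: differentiable_continuous; apply/derivable1_diffP.
exact: ex_derive.
Qed.

Lemma continuous_Dkt t z : 0 < t -> {for t, continuous (Dk^~ z : R -> R)}.
Proof.
move=> t0; have D := is_derive_rkt z t0.
apply: differentiable_continuous; apply/derivable1_diffP.
exact: ex_derive.
Qed.

Lemma cVxx t : 0 < t -> continuous (cv (Dk t) h).
Proof.
move=> t0; apply: (continuous_cv t0 _ (fun z => norm_Dk_le z t0) bh).
exact: continuous_Dkz.
Qed.

Lemma cVtt t x : 0 < t -> {for t, continuous (fun s => cv (Dk s) h x)}.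
Proof.
move=> t0; apply: (continuous_cvt t0 _ _ (fun s z => norm_Dk_le2 z t0) bh).
  by move=> s z s0; exact: continuous_Dkt.
by move=> s; exact: measurable_DkT.
Qed.

Lemma derive_cont (f : R -> R) l x : is_derive x 1 f l -> {for x, continuous f}.
Proof.
by move=> D; apply: differentiable_continuous; apply/derivable1_diffP; case: D.
Qed.

Lemma bVx t x : 0 < t ->
  `|cv (Ak t) h x| <= t^-1 * cv (Pk t) (fun y => `|h y|) x.
Proof.
move=> t0; apply: (cv_bound _ t0 _ (fun z => norm_Ak_Pk z t0) bh).
exact: measurable_AkT.
Qed.
Lemma bVt t x : 0 < t ->
  `|cv (Ck t) h x| <= t^-1 * cv (Pk t) (fun y => `|h y|) x.
Proof.
move=> t0; apply: (cv_bound _ t0 _ (fun z => norm_Ck_Pk z t0) bh).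
exact: measurable_CkT.
Qed.
Lemma bVxx t x : 0 < t ->
  `|cv (Dk t) h x| <= 6 / t ^+ 2 * cv (Pk t) (fun y => `|h y|) x.
Proof.
move=> t0; apply: (cv_bound _ t0 _ (fun z => norm_Dk_Pk z t0) bh).
exact: measurable_DkT.
Qed.

Lemma mV2 : measurable_fun setT (fun p : R * R => cv (Pk p.2) h p.1).
Proof.
by apply: measurable_cv2; [move=> *; exact: measurable_Pkc|case: bh].
Qed.
Lemma mVx2 : measurable_fun setT (fun p : R * R => cv (Ak p.2) h p.1).
Proof.
by apply: measurable_cv2; [move=> *; exact: measurable_Akc|case: bh].
Qed.
Lemma mVt2 : measurable_fun setT (fun p : R * R => cv (Ck p.2) h p.1).
Proof.
by apply: measurable_cv2; [move=> *; exact: measurable_Ckc|case: bh].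
Qed.
Lemma mVxx2 : measurable_fun setT (fun p : R * R => cv (Dk p.2) h p.1).
Proof.
by apply: measurable_cv2; [move=> *; exact: measurable_Dkc|case: bh].
Qed.
End poisson_derivatives.

(** * Green's formula for t and b0(V, W) on rectangles *)

Section carleson.
Context {R : realType}.
Local Notation mu := (@lebesgue_measure R).
Implicit Types (t x y z : R).

Lemma measurable_fun_integral_in (A B : set R) (f : R -> R -> R) :
  measurable A -> measurable B ->
  measurable_fun setT (fun z : R * R => f z.1 z.2) ->
  (forall y t, B t -> 0 <= f y t) ->
  measurable_fun A (fun y => \int[mu]_(t in B) (f y t)%:E)%E.
Proof.
move=> mA mB mf f0; apply: measurable_funTS.
under eq_fun do rewrite integral_mkcond.
apply: (@measurable_fun_fubini_tonelli_F _ _ _ _ _ mu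
  (fun z : R * R => ((fun t => (f z.1 t)%:E) \_ B) z.2)).
  apply: (eq_measurable_fun (fun z : R * R => (\1_B z.2 * f z.1 z.2)%:E)).
    move=> z _; rewrite /patch indicE.
    by case: ifP => _; rewrite ?mul1r ?mul0r.
  apply/measurable_EFinP; apply: measurable_funM => //.
  by apply: (measurableT_comp (@measurable_indic _ _ R setT B mB)).
move=> z; rewrite /patch; case: ifPn => //; rewrite inE => Bz.
by rewrite lee_fin f0.
Qed.

Lemma Rint_in_EFin (A : set R) (f : R -> R) : measurable A ->
  mu.-integrable A (EFin \o f) ->
  (Rintegral mu A f)%:E = (\int[mu]_(x in A) (f x)%:E)%E.
Proof. by move=> mA iF; rewrite /Rintegral fineK// integrable_fin_num. Qed.

(** An infinite right-hand side leaves nothing to prove, and a finite one supplies the integrability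
    of F. *)
Lemma Rint_le_ge0 (A : set R) (F G : R -> R) : measurable A ->
  measurable_fun A F -> measurable_fun A G -> (forall x, A x -> `|F x| <= G x) ->
  ((Rintegral mu A F)%:E <= \int[mu]_(x in A) (G x)%:E)%E.
Proof.
move=> mA mF mG FG.
have G0 x : A x -> (0 <= (G x)%:E)%E by move=> /FG; rewrite lee_fin; exact: le_trans.
have [->|Gfin] := eqVneq (\int[mu]_(x in A) (G x)%:E)%E +oo%E; first by rewrite leey.
have iG : mu.-integrable A (EFin \o G).
  apply/integrableP; split; first exact/measurable_EFinP.
  rewrite [ltLHS](_ : _ = \int[mu]_(x in A) (G x)%:E)%E ?ltey//.
  apply: eq_integral => x; rewrite inE => Ax /=.
  by rewrite ger0_norm//; have := G0 x Ax; rewrite lee_fin.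
have iF : mu.-integrable A (EFin \o F).
  apply: (@le_integrable _ _ _ mu _ mA (EFin \o F) _ _ _ iG).
    exact/measurable_EFinP.
  by move=> x Ax /=; rewrite lee_fin (le_trans (FG x Ax))// ler_norm.
rewrite /Rintegral fineK ?integrable_fin_num//.
by apply: le_integral => // x; rewrite inE => Ax;
  rewrite lee_fin (le_trans (ler_norm _))// FG.
Qed.

Variables (a c k0 : R) (h w : R -> R).
Hypotheses (c1 : 1 < c) (k00 : 0 <= k0) (bh : bmeas h) (bw : bmeas w).
Hypothesis w0 : forall y, 0 <= w y.
Local Notation V x t := (cv (Pk t) h x).
Local Notation Vb x t := (cv (Pk t) (fun y => `|h y|) x).
Local Notation W x t := (cv (Pk t) w x).
Hypothesis W0 : forall x t, 0 < t -> 0 < W x t.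
Hypothesis HV : forall x t, 0 < t -> Vb x t ^+ 2 * W x t `^ a <= k0 * W x t `^ c.
Let k := kap a c k0.
Local Notation bf x t := (b0 a c k (V x t) (W x t)).
Local Notation bx x t := (b1 a c k (V x t) (cv (Ak t) h x) (W x t) (cv (Ak t) w x)).
Local Notation bt x t := (b1 a c k (V x t) (cv (Ck t) h x) (W x t) (cv (Ck t) w x)).
Local Notation bxx x t := (b2 a c k (V x t) (cv (Ak t) h x) (cv (Dk t) h x)
  (W x t) (cv (Ak t) w x) (cv (Dk t) w x)).
Local Notation btt x t := (b2 a c k (V x t) (cv (Ck t) h x) (- cv (Dk t) h x)
  (W x t) (cv (Ck t) w x) (- cv (Dk t) w x)).
(** [M1] and [M2] are the constants of the bounds on [b1] and [b2]. [M0] bounds t b_t - b, the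
    boundary term of Green's formula on horizontal edges, and, being at least [M1], also t b_x on
    the vertical ones. *)
Definition M1 : R := 2 * k0 + `|a| * k0 + k * c.
Definition M2 : R := 14 * k0 + 4 * `|a| * k0 + `|a * (a - 1)| * k0
     + k * c * (c - 1) + 6 * (`|a| * k0 + k * c).
Definition M0 : R := M1 + (k0 + k).

Let wE : (fun y => `|w y|) = w.
Proof. by apply/funext => y; rewrite ger0_norm. Qed.

Let dbx x t : 0 < t -> is_derive x 1 (fun x => bf x t) (bx x t).
Proof.
by move=> t0; apply: (@is_derive_b0 _ a c k (fun x => V x t) (fun x => W x t));
  [exact: W0|exact: dVx|exact: dVx].
Qed.
Let dbt x t : 0 < t -> is_derive t 1 (fun t => bf x t) (bt x t).
Proof.
by move=> t0; apply: (@is_derive_b0 _ a c k (fun t => V x t) (fun t => W x t));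
  [exact: W0|exact: dVt|exact: dVt].
Qed.
Let dbxx x t : 0 < t -> is_derive x 1 (fun x => bx x t) (bxx x t).
Proof.
by move=> t0; apply: (@is_derive_b1 _ a c k (fun x => V x t) (fun x => W x t)
   (fun x => cv (Ak t) h x) (fun x => cv (Ak t) w x));
  [exact: W0|exact: dVx|exact: dVx|exact: dVxx|exact: dVxx].
Qed.
Let dbtt x t : 0 < t -> is_derive t 1 (fun t => bt x t) (btt x t).
Proof.
by move=> t0; apply: (@is_derive_b1 _ a c k (fun t => V x t) (fun t => W x t)
   (fun t => cv (Ck t) h x) (fun t => cv (Ck t) w x));
  [exact: W0|exact: dVt|exact: dVt|exact: dVtt|exact: dVtt].
Qed.

Let bbf x t : 0 < t -> `|bf x t| <= (k0 + k) * W x t `^ c.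
Proof.
move=> t0; apply: (@norm_b0_le _ a c k0 _ (Vb x t)) => //; last exact: HV.
exact: cv_Pk_norm.
Qed.
Let bbx x t : 0 < t -> `|bx x t| <= M1 * W x t `^ c / t.
Proof.
move=> t0; apply: (@norm_b1_le _ a c k0 t _ (Vb x t)) => //.
- exact: W0.
- exact: cv_Pk_norm.
- exact: HV.
- exact: bVx.
- by have := bVx bw x t0; rewrite wE.
Qed.
Let bbt x t : 0 < t -> `|bt x t| <= M1 * W x t `^ c / t.
Proof.
move=> t0; apply: (@norm_b1_le _ a c k0 t _ (Vb x t)) => //.
- exact: W0.
- exact: cv_Pk_norm.
- exact: HV.
- exact: bVt.
- by have := bVt bw x t0; rewrite wE.
Qed.
Let bbxx x t : 0 < t -> `|bxx x t| <= M2 * W x t `^ c / t ^+ 2.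
Proof.
move=> t0; apply: (@norm_b2_le _ a c k0 t _ (Vb x t)) => //.
- exact: W0.
- exact: cv_Pk_norm.
- exact: HV.
- exact: bVx.
- by have := bVx bw x t0; rewrite wE.
- exact: bVxx.
- by have := bVxx bw x t0; rewrite wE.
Qed.
Let bbtt x t : 0 < t -> `|btt x t| <= M2 * W x t `^ c / t ^+ 2.
Proof.
move=> t0; apply: (@norm_b2_le _ a c k0 t _ (Vb x t)) => //.
- exact: W0.
- exact: cv_Pk_norm.
- exact: HV.
- exact: bVt.
- by have := bVt bw x t0; rewrite wE.
- by rewrite normrN; exact: bVxx.
- by rewrite normrN; have := bVxx bw x t0; rewrite wE.
Qed.

Let cW_powR (W1 : R -> R) s e : 0 < W1 s -> {for s, continuous W1} ->
  {for s, continuous (fun s => W1 s `^ e)}.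
Proof.
move=> W10 cW; apply: (@continuous_comp _ _ _ W1 (@powR R ^~ e)) => //.
exact: (derive_cont (is_derive1_powR e W10)).
Qed.

Let b2_cont (v v1 v2 W1 w1 w2 : R -> R) s : 0 < W1 s ->
  {for s, continuous v} -> {for s, continuous v1} -> {for s, continuous v2} ->
  {for s, continuous W1} -> {for s, continuous w1} -> {for s, continuous w2} ->
  {for s, continuous (fun s => b2 a c k (v s) (v1 s) (v2 s) (W1 s) (w1 s) (w2 s))}.
Proof.
move=> W10 cv cv1 cv2 cW cw1 cw2.
have cWa := @cW_powR W1 s a W10 cW; have cWc := @cW_powR W1 s c W10 cW.
have cV : {for s, continuous (fun s => (W1 s)^-1)}.
  by apply: cvgV => //; rewrite gt_eqF.
have c_ (r : R) : {for s, continuous (fun _ : R => r)} by exact: cvg_cst.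
have cM (f g : R -> R) : {for s, continuous f} -> {for s, continuous g} ->
  {for s, continuous (fun s => f s * g s)} by move=> cf cg; exact: cvgM.
have cD (f g : R -> R) : {for s, continuous f} -> {for s, continuous g} ->
  {for s, continuous (fun s => f s + g s)} by move=> cf cg; exact: cvgD.
have cX (f : R -> R) : {for s, continuous f} ->
  {for s, continuous (fun s => f s ^+ 2)} by move=> cf; exact: cM.
exact: (cD _ _ (cD _ _ (cD _ _ (cD _ _ (cM _ _ (cM _ _ (c_ _) (cX _ cv1)) cWa)
  (cM _ _ (cM _ _ (cM _ _ (c_ _) cv) cv2) cWa))
  (cM _ _ (cM _ _ (cM _ _ (cM _ _ (c_ _) cv) cv1) cWa) (cM _ _ cw1 cV)))
  (cM _ _ (cD _ _ (cM _ _ (cM _ _ (c_ _) (cX _ cv)) cWa) (cM _ _ (c_ _) cWc)) (cX _ (cM _ _ cw1 cV))))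
  (cM _ _ (cD _ _ (cM _ _ (cM _ _ (c_ _) (cX _ cv)) cWa) (cM _ _ (c_ _) cWc)) (cM _ _ cw2 cV))).
Qed.

Let b0_meas (v W1 : R * R -> R) :
  measurable_fun setT v -> measurable_fun setT W1 ->
  measurable_fun setT (fun s => b0 a c k (v s) (W1 s)).
Proof.
move=> mv mW.
have mWa := measurable_fun_powR a mW; have mWc := measurable_fun_powR c mW.
rewrite /b0.
repeat first [assumption | exact: measurable_cst | apply: measurable_funD
 | apply: measurable_funM | apply: measurable_funX].
Qed.

Let b1_meas (v v1 W1 w1 : R * R -> R) :
  measurable_fun setT v -> measurable_fun setT v1 ->
  measurable_fun setT W1 -> measurable_fun setT w1 ->
  measurable_fun setT (fun s => b1 a c k (v s) (v1 s) (W1 s) (w1 s)).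
Proof.
move=> mv mv1 mW mw1.
have mWa := measurable_fun_powR a mW; have mWc := measurable_fun_powR c mW.
have mV := measurable_funV mW.
rewrite /b1.
repeat first [assumption | exact: measurable_cst | apply: measurable_funD
 | apply: measurable_funM | apply: measurable_funX].
Qed.

Let b2_meas (v v1 v2 W1 w1 w2 : R * R -> R) :
  measurable_fun setT v -> measurable_fun setT v1 -> measurable_fun setT v2 ->
  measurable_fun setT W1 -> measurable_fun setT w1 -> measurable_fun setT w2 ->
  measurable_fun setT (fun s => b2 a c k (v s) (v1 s) (v2 s) (W1 s) (w1 s) (w2 s)).
Proof.
move=> mv mv1 mv2 mW mw1 mw2.
have mWa := measurable_fun_powR a mW; have mWc := measurable_fun_powR c mW.
have mV := measurable_funV mW.
rewrite /b2.
repeat first [assumption | exact: measurable_cst | apply: measurable_funD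
 | apply: measurable_funM | apply: measurable_funX].
Qed.

Let mCc : measurable_fun setT (fun z : R * R => W z.1 z.2 `^ c).
Proof. by apply: measurable_fun_powR; exact: mV2. Qed.

Let M1_ge0 : 0 <= M1.
Proof.
have kk0 : 0 <= k := kap_ge0 a c1 k00.
have c0 : 0 <= c by rewrite ltW// (lt_trans _ c1).
have k1 := mulr_ge0 kk0 c0; have k2 := mulr_ge0 (normr_ge0 a) k00.
by apply: addr_ge0 => //; apply: addr_ge0 => //; apply: mulr_ge0.
Qed.
Let M2_ge0 : 0 <= M2.
Proof.
have kk0 : 0 <= k := kap_ge0 a c1 k00.
have c0 : 0 <= c by rewrite ltW// (lt_trans _ c1).
have c10 : 0 <= c - 1 by rewrite subr_ge0 ltW.
have k1 := mulr_ge0 kk0 c0; have k2 := mulr_ge0 (normr_ge0 a) k00.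
have k3 := mulr_ge0 (normr_ge0 (a * (a - 1))) k00; have k4 := mulr_ge0 k1 c10.
have e1 : 0 <= 14 * k0 by apply: mulr_ge0.
have e2 : 0 <= 4 * `|a| * k0 by rewrite -mulrA; apply: mulr_ge0.
have e3 : 0 <= 6 * (`|a| * k0 + k * c) by apply: mulr_ge0 => //; apply: addr_ge0.
by rewrite /M2; do 4 (apply: addr_ge0 => //).
Qed.
Let M0_ge0 : 0 <= M0.
Proof. by apply: addr_ge0 => //; apply: addr_ge0 => //; exact: kap_ge0. Qed.

Let Kg x t := t * (cv (Ck t) h x ^+ 2 + cv (Ak t) h x ^+ 2) * W x t `^ a.

Let mKg : measurable_fun setT (fun z : R * R => Kg z.1 z.2).
Proof.
apply: measurable_funM.
  apply: measurable_funM => //; apply: measurable_funD; apply: measurable_funX.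
  - exact: mVt2.
  - exact: mVx2.
by apply: measurable_fun_powR; exact: mV2.
Qed.

Let Kg_ge0 x t : 0 < t -> 0 <= Kg x t.
Proof.
by move=> t0; rewrite /Kg mulr_ge0 ?powR_ge0// mulr_ge0 ?(ltW t0)// addr_ge0 ?sqr_ge0.
Qed.

(** Since t is harmonic, the field with components t b_x and t b_t - b has divergence t times the
    Laplacian of b, which is at least t |grad V|^2 W^a by [b2_ge]. All boundary terms are at most
    [M0] W^c. *)
Lemma carleson_rect (N t0 t1 : R) : 0 <= N -> 0 < t0 -> t0 <= t1 ->
  (\int[mu]_(y in `[(- N)%R, N]) \int[mu]_(t in `[t0, t1])
     (t * (cv (Ck t) h y ^+ 2 + cv (Ak t) h y ^+ 2) * W y t `^ a)%:E <=
   \int[mu]_(y in `[(- N)%R, N]) (M0 * (W y t1 `^ c + W y t0 `^ c))%:E +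
   \int[mu]_(t in `[t0, t1]) (M0 * (W N t `^ c + W (- N)%R t `^ c))%:E)%E.
Proof.
move=> N0 t00 t01.
have tpos t : t0 <= t <= t1 -> 0 < t by move=> /andP[h1 _]; exact: lt_le_trans h1.
have [Bw wB] := bw.2.
have WB x t : 0 < t -> W x t `^ c <= Bw `^ c.
  move=> t0'; apply: ge0_ler_powR; rewrite ?nnegrE ?(ltW (W0 _ t0'))//.
  - by rewrite ltW// (lt_trans _ c1).
  - by rewrite (le_trans _ (wB 0)).
  - by rewrite (le_trans (ler_norm _))//; exact: cv_Pk_le.
pose p y t := t * bt y t - bf y t.
pose q y t := t * bx y t.
pose pt y t := t * btt y t.
pose qy y t := t * bxx y t.
have dp y t : t0 <= t <= t1 -> is_derive t 1 (p y) (pt y t).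
  move=> /tpos tp; have D1 := dbt y tp; have D2 := dbtt y tp.
  by apply: is_derive_eq; rewrite /GRing.scale /= /pt; ring.
have dq y t : t0 <= t <= t1 -> is_derive y 1 (q^~ t) (qy y t).
  move=> /tpos tp; have D2 := dbxx y tp.
  by apply: is_derive_eq; rewrite /GRing.scale /= /qy; ring.
have cp y t : t0 <= t <= t1 -> {for t, continuous (pt y)}.
  move=> /tpos tp; apply: cvgM; first exact: cvg_id.
  apply: (@b2_cont (fun t => V y t) (fun t => cv (Ck t) h y) (fun t => - cv (Dk t) h y)
    (fun t => W y t) (fun t => cv (Ck t) w y) (fun t => - cv (Dk t) w y)).
  - exact: W0.
  - exact: derive_cont (dVt bh y tp).
  - exact: derive_cont (dVtt bh y tp).
  - by apply: cvgN; exact: cVtt.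
  - exact: derive_cont (dVt bw y tp).
  - exact: derive_cont (dVtt bw y tp).
  - by apply: cvgN; exact: cVtt.
have cq y t : t0 <= t <= t1 -> {for y, continuous (qy^~ t)}.
  move=> /tpos tp; apply: cvgM; first exact: cvg_cst.
  apply: (@b2_cont (fun y => V y t) (fun y => cv (Ak t) h y) (fun y => cv (Dk t) h y)
    (fun y => W y t) (fun y => cv (Ak t) w y) (fun y => cv (Dk t) w y)).
  - exact: W0.
  - exact: derive_cont (dVx bh y tp).
  - exact: derive_cont (dVxx bh y tp).
  - exact: cVxx.
  - exact: derive_cont (dVx bw y tp).
  - exact: derive_cont (dVxx bw y tp).
  - exact: cVxx.
have mpt : measurable_fun setT (fun z : R * R => pt z.1 z.2).
  apply: measurable_funM => //; apply: b2_meas.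
  - exact: mV2.
  - exact: mVt2.
  - by apply: measurable_funN; exact: mVxx2.
  - exact: mV2.
  - exact: mVt2.
  - by apply: measurable_funN; exact: mVxx2.
have mqy : measurable_fun setT (fun z : R * R => qy z.1 z.2).
  apply: measurable_funM => //; apply: b2_meas.
  - exact: mV2.
  - exact: mVx2.
  - exact: mVxx2.
  - exact: mV2.
  - exact: mVx2.
  - exact: mVxx2.
have Kb (X y t : R) : t0 <= t <= t1 -> `|X| <= M2 * W y t `^ c / t ^+ 2 ->
    `|t * X| <= M2 * Bw `^ c / t0.
  move=> tt; have tp := tpos t tt; rewrite normrM (gtr0_norm tp) => HX.
  apply: (@le_trans _ _ (t * (M2 * W y t `^ c / t ^+ 2))).
    by rewrite ler_wpM2l// ltW.
  rewrite (_ : t * _ = M2 * W y t `^ c / t); last by field; rewrite gt_eqF.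
  apply: ler_pM.
  - by rewrite mulr_ge0// powR_ge0.
  - by rewrite invr_ge0 ltW.
  - by rewrite ler_wpM2l// WB.
  - by rewrite lef_pV2 ?posrE//; case/andP: tt.
have Kp y t : t0 <= t <= t1 -> `|pt y t| <= M2 * Bw `^ c / t0.
  by move=> tt; apply: (Kb _ y) => //; apply: bbtt; exact: tpos.
have Kq y t : t0 <= t <= t1 -> `|qy y t| <= M2 * Bw `^ c / t0.
  by move=> tt; apply: (Kb _ y) => //; apply: bbxx; exact: tpos.
have [i1 i2 E] := green_rect N0 t01 dp cp dq cq mpt mqy Kp Kq.
set A := `[(- N), N]%classic in i1 i2 E *; set B := `[t0, t1]%classic in i1 i2 E *.
have mA : measurable A by exact: measurable_itv.
have mB : measurable B by exact: measurable_itv.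
have Bt t : B t -> t0 <= t <= t1 by rewrite /B/= in_itv/=.
clearbody A B.
have mbx : measurable_fun setT (fun z : R * R => bx z.1 z.2).
  by apply: b1_meas; [exact: mV2|exact: mVx2|exact: mV2|exact: mVx2].
have mbt : measurable_fun setT (fun z : R * R => bt z.1 z.2).
  by apply: b1_meas; [exact: mV2|exact: mVt2|exact: mV2|exact: mVt2].
have mbf : measurable_fun setT (fun z : R * R => bf z.1 z.2).
  by apply: b0_meas; exact: mV2.
have mp t : measurable_fun setT (p^~ t).
  apply: (@measurable_sec2 _ _ _ _ _ _ (fun z : R * R => p z.1 z.2)).
  by apply: measurable_funB => //; exact: measurable_funM.
have mq y : measurable_fun setT (q y).
  apply: (@measurable_sec1 _ _ _ _ _ _ (fun z : R * R => q z.1 z.2)).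
  exact: measurable_funM.
have pb y t : 0 < t -> `|p y t| <= M0 * W y t `^ c.
  move=> tp; rewrite /p (le_trans (ler_normB _ _))// /M0 mulrDl lerD ?bbf//.
  rewrite normrM (gtr0_norm tp) -ler_pdivlMl// mulrC.
  exact: bbt.
have qb y t : 0 < t -> `|q y t| <= M0 * W y t `^ c.
  move=> tp; rewrite /q (@le_trans _ _ (M1 * W y t `^ c))//.
    rewrite normrM (gtr0_norm tp) -ler_pdivlMl// mulrC.
    exact: bbx.
  rewrite ler_wpM2r ?powR_ge0// /M0 lerDl addr_ge0//; exact: kap_ge0.
apply: (@le_trans _ _ (Rintegral mu A (fun y => Rintegral mu B (fun t => pt y t + qy y t)))%:E).
  rewrite (Rint_in_EFin mA i2).
  apply: ge0_le_integral => //.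
  - move=> y _; apply: integral_ge0 => t /Bt/tpos tp; rewrite lee_fin.
    exact: Kg_ge0.
  - apply: (@measurable_fun_integral_in _ _ (fun y t => Kg y t)) => // y t /Bt/tpos tp.
    exact: Kg_ge0.
  - by case/integrableP : i2.
  - move=> y Ay; rewrite (Rint_in_EFin mB (i1 y Ay)).
    apply: ge0_le_integral => //.
    + by move=> t /Bt/tpos tp; rewrite lee_fin; exact: Kg_ge0.
    + apply/measurable_EFinP; apply: measurable_funTS.
      exact: (measurable_sec1 y mKg).
    + by case/integrableP : (i1 y Ay).
    + move=> t /Bt/tpos tp; rewrite lee_fin /pt /qy -mulrDr -mulrA ler_wpM2l ?(ltW tp)//.
      apply: b2_ge => //.
      * exact: W0.
      * apply: le_trans (HV y tp); rewrite ler_wpM2r ?powR_ge0//.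
        rewrite -(@real_normK _ (V y t)) ?num_real// ler_pXn2r ?nnegrE//.
          exact: cv_Pk_norm.
        by rewrite (le_trans _ (cv_Pk_norm y tp bh)).
      * by rewrite addNr.
      * by rewrite addNr.
rewrite E EFinD; apply: leeD; apply: Rint_le_ge0 => //.
- by apply: measurable_funTS; apply: measurable_funB.
- apply: measurable_funTS; apply: measurable_funM => //; apply: measurable_funD.
    exact: (measurable_sec2 t1 mCc).
  exact: (measurable_sec2 t0 mCc).
- move=> y _; rewrite mulrDr (le_trans (ler_normB _ _))// lerD// pb//.
  by rewrite (lt_le_trans _ t01).
- by apply: measurable_funTS; apply: measurable_funB.
- apply: measurable_funTS; apply: measurable_funM => //; apply: measurable_funD.
    exact: (measurable_sec1 N mCc).
  exact: (measurable_sec1 (- N) mCc).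
- by move=> t /Bt/tpos tp; rewrite mulrDr (le_trans (ler_normB _ _))// lerD// qb.
Qed.
End carleson.

(** * From rectangles to the half-plane *)

Section halfplane.
Context {R : realType}.
Local Notation mu := (@lebesgue_measure R).
Local Open Scope ereal_scope.

Lemma integral_prod_in (A B : set R) (f : R -> R -> R) :
  measurable A -> measurable B ->
  measurable_fun setT (fun z : R * R => f z.1 z.2) ->
  (forall y t, B t -> 0 <= f y t)%R ->
  \int[mu \x mu]_(z in A `*` B) (f z.1 z.2)%:E =
  \int[mu]_(x in A) \int[mu]_(y in B) (f x y)%:E.
Proof.
move=> mA mB mf f0.
have mAB : measurable (A `*` B : set (R * R)) by exact: measurableX.
rewrite integral_mkcond fubini_tonelli1.
- rewrite [RHS]integral_mkcond; apply: eq_integral => x _.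
  rewrite /fubini_F /patch; case: ifPn => xA.
    rewrite [RHS]integral_mkcond; apply: eq_integral => y _; rewrite /patch.
    rewrite in_setX/= xA/=; by case: ifP.
  by apply: integral0_eq => y _; rewrite in_setX/= (negbTE xA).
- apply/(measurable_restrictT _ _).1 => //; apply: measurable_funTS.
  exact/measurable_EFinP.
- move=> z; rewrite /patch; case: ifPn => //; rewrite inE => -[_ Bz].
  by rewrite lee_fin f0.
Qed.

(** Monotone convergence along the rectangles [-n, n] x [1/(n+1), n+1], which exhaust the
    half-plane. *)
Lemma rect_to_half (f : R -> R -> R) (K : \bar R) :
  measurable_fun setT (fun z : R * R => f z.1 z.2) ->
  (forall y t : R, 0 < t -> 0 <= f y t)%R ->
  (forall N t0 t1 : R, (0 <= N)%R -> (0 < t0)%R -> (t0 <= t1)%R ->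
    \int[mu]_(y in `[(- N)%R, N]) \int[mu]_(t in `[t0, t1]) (f y t)%:E <= K) ->
  \int[mu]_y \int[mu]_(t in `]0%R, +oo[) (f y t)%:E <= K.
Proof.
move=> mf f0 HK.
have mB : measurable (`]0%R, +oo[%classic : set R) by exact: measurable_itv.
rewrite -integral_prod_in//; last first.
  by move=> y t; rewrite /= in_itv/= andbT; exact: f0.
pose S n : set (R * R) := `[(- n%:R)%R, n%:R]%classic `*` `[(n.+1%:R^-1)%R, n.+1%:R]%classic.
have SU : \bigcup_n S n = setT `*` `]0%R, +oo[%classic.
  apply/seteqP; split => [[y t] [n _ [_ /=]]|[y t] [_ /=]].
    rewrite !in_itv/= andbT => /andP[h _]; split => //=.
    by apply: lt_le_trans h; rewrite invr_gt0.
  rewrite in_itv/= andbT => t0.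
  have [n1 h1] : exists n : nat, (`|y| < n%:R)%R.
    by exists (Num.truncn `|y|).+1; rewrite truncnS_gt.
  have [n2 h2] : exists n : nat, (t < n%:R)%R.
    by exists (Num.truncn t).+1; rewrite truncnS_gt.
  have [n3 h3] : exists n : nat, (t^-1 < n%:R)%R.
    by exists (Num.truncn t^-1).+1; rewrite truncnS_gt.
  exists (n1 + n2 + n3)%N => //; split => /=; rewrite in_itv/=.
    rewrite -ler_norml (le_trans (ltW h1))// ler_nat -addnA leq_addr//.
  apply/andP; split.
    rewrite -[leRHS]invrK lef_pV2 ?posrE ?invr_gt0// (le_trans (ltW h3))//.
    by rewrite ler_nat -addnS (leq_trans (leqnSn _))// leq_addl.
  rewrite (le_trans (ltW h2))// ler_nat.
  by rewrite (addnC n1) -addnA -addnS leq_addr.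
rewrite -SU.
have mS n : measurable (S n) by apply: measurableX; exact: measurable_itv.
have St n z : S n z -> (0 < z.2)%R.
  case=> _ /=; rewrite in_itv/= => /andP[h _]; apply: lt_le_trans h.
  by rewrite invr_gt0.
have ndS : nondecreasing_seq S.
  move=> m n mn; apply/subsetPset => -[y t] [] /=; rewrite !in_itv/=.
  move=> /andP[h1 h2] /andP[h3 h4]; split; rewrite /= in_itv/=; apply/andP; split.
  - by rewrite (le_trans _ h1)// lerN2 ler_nat.
  - by rewrite (le_trans h2)// ler_nat.
  - by rewrite (le_trans _ h3)// lef_pV2 ?posrE// ler_nat.
  - by rewrite (le_trans h4)// ler_nat.
have mfE n : measurable_fun (S n) (fun z : R * R => (f z.1 z.2)%:E).
  by apply/measurable_EFinP; exact: measurable_funTS.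
have fS n z : S n z -> 0 <= (f z.1 z.2)%:E.
  by move=> /St tz; rewrite lee_fin f0.
have cvg : (fun n => \int[mu \x mu]_(z in S n) (f z.1 z.2)%:E) @ \oo -->
    \int[mu \x mu]_(z in \bigcup_n S n) (f z.1 z.2)%:E.
  exact: ge0_nondecreasing_set_cvg_integral.
rewrite -(cvg_lim _ cvg)//; apply: lime_le; first by apply/cvg_ex; eexists; exact: cvg.
apply: nearW => n; rewrite integral_prod_in//.
- apply: HK => //.
  by rewrite (@le_trans _ _ 1%R)// ?invf_le1 ?ler1n.
- move=> y t; rewrite /= in_itv/= => /andP[h _]; apply: f0.
  by apply: lt_le_trans h; rewrite invr_gt0.
Qed.

(** If X exceeded c, then m would stay above a positive constant on a half-line and could not be
    integrable. This removes the lateral boundary terms by averaging over N instead of by pointwise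
    decay. *)
Lemma le_integral_shift_average (X K c : \bar R) (m : R -> \bar R) (N0 : R) :
  measurable_fun setT m -> (forall N, 0 <= m N) -> 0 <= c ->
  (forall N, (N0 <= N)%R -> X <= c + m N) ->
  \int[mu]_N m N < +oo -> X <= c.
Proof.
move=> mm m0 c0 H mfin.
rewrite leNgt; apply/negP => cX.
have cfin : c \is a fin_num by rewrite ge0_fin_numE// (lt_le_trans cX) ?leey.
have [d d0 dX] : exists2 d : R, (0 < d)%R & c + d%:E <= X.
  have [->|Xfin] := eqVneq X +oo; first by exists 1%R => //; rewrite leey.
  have Xf : X \is a fin_num.
    by rewrite ge0_fin_numE ?ltey// (le_trans c0)// ltW.
  exists (fine X - fine c)%R; first by rewrite subr_gt0 fine_lt.
  by rewrite -(fineK cfin) -(fineK Xf) -EFinD lee_fin /= addrC subrK.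
have dm N : (N0 <= N)%R -> d%:E <= m N.
  move=> /H XN; have := le_trans dX XN.
  by rewrite leeD2lE.
have : \int[mu]_(N in `[N0, +oo[) (cst d%:E) N <= \int[mu]_N m N.
  apply: (@le_trans _ _ (\int[mu]_(N in `[N0, +oo[) m N)).
    apply: ge0_le_integral => //.
    - by move=> x _; rewrite lee_fin ltW.
    - exact: measurable_funTS.
    - by move=> x /=; rewrite in_itv/= andbT; exact: dm.
  by apply: ge0_subset_integral => //; exact: measurable_itv.
rewrite integral_cst//= lebesgue_measure_itv/= ltry mulry gtr0_sg// mul1e.
by move=> /(lt_le_trans mfin); rewrite ltxx.
Qed.

Lemma integral_scaleD (A : set R) (k : R) (f g : R -> R) : measurable A ->
  (0 <= k)%R -> measurable_fun setT f -> measurable_fun setT g ->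
  (forall x, 0 <= f x)%R -> (forall x, 0 <= g x)%R ->
  \int[mu]_(x in A) (k * (f x + g x))%:E =
  k%:E * (\int[mu]_(x in A) (f x)%:E + \int[mu]_(x in A) (g x)%:E).
Proof.
move=> mA k0 mf mg f0 g0.
have mf' : measurable_fun A (EFin \o f).
  by apply/measurable_EFinP; exact: measurable_funTS.
have mg' : measurable_fun A (EFin \o g).
  by apply/measurable_EFinP; exact: measurable_funTS.
rewrite -ge0_integralD//; last 2 first.
- by move=> x _; rewrite lee_fin.
- by move=> x _; rewrite lee_fin.
rewrite -ge0_integralZl//.
- exact: emeasurable_funD.
- by move=> x _; rewrite adde_ge0 ?lee_fin.
Qed.
End halfplane.

(** * The weighted square function estimate on the half-plane *)

Section carleson_final.
Context {R : realType}.
Local Notation mu := (@lebesgue_measure R).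
Variables (a c k0 : R) (h w : R -> R).
Hypotheses (c1 : 1 < c) (k00 : 0 <= k0) (bh : bmeas h) (bw : bmeas w).
Hypothesis w0 : forall y, 0 <= w y.
Local Notation W x t := (cv (Pk t) w x).
Hypothesis W0 : forall x t, 0 < t -> 0 < W x t.
Hypothesis HV : forall x t, 0 < t ->
  cv (Pk t) (fun y => `|h y|) x ^+ 2 * W x t `^ a <= k0 * W x t `^ c.

(** A fixed rectangle is widened to an arbitrary N. The horizontal edges cost at most 2 [M0] G
    because P_t contracts L^c, and the lateral contribution m(N) is integrable in N by Tonelli, so
    it can be discarded. The summand 1 keeps the constant positive, so that the right-hand side is
    infinite whenever G is. *)
Lemma carleson :
  (\int[mu]_y \int[mu]_(t in `]0%R, +oo[)
     (t * (cv (Ck t) h y ^+ 2 + cv (Ak t) h y ^+ 2) * W y t `^ a)%:E <=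
   (2 * M0 a c k0 + 1)%:E * \int[mu]_y (w y `^ c)%:E)%E.
Proof.
have M00 : 0 <= M0 a c k0.
  have kk0 : 0 <= kap a c k0 := kap_ge0 a c1 k00.
  have cc : 0 <= c by rewrite ltW// (lt_trans _ c1).
  have e1 := mulr_ge0 (normr_ge0 a) k00; have e2 := mulr_ge0 kk0 cc.
  rewrite /M0 /M1; apply: addr_ge0; last by apply: addr_ge0.
  by apply: addr_ge0 => //; apply: addr_ge0 => //; apply: mulr_ge0.
have [M ME] : exists M, M = M0 a c k0 by exists (M0 a c k0).
move: M00; rewrite -ME => M00.
set G := (\int[mu]_y (w y `^ c)%:E)%E.
have G0 : (0 <= G)%E by apply: integral_ge0 => y _; rewrite lee_fin powR_ge0.
have [GE|Gfin] := eqVneq G +oo%E.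
  by rewrite GE mulry gtr0_sg ?mul1e ?leey// ltr_wpDl// mulr_ge0.
have Gf : G \is a fin_num by rewrite ge0_fin_numE// ltey.
have WG t : 0 < t -> (\int[mu]_y (W y t `^ c)%:E <= G)%E.
  by move=> t0; exact: integ_powR_jensen.
have mCc : measurable_fun setT (fun z : R * R => W z.1 z.2 `^ c).
  by apply: measurable_fun_powR; exact: mV2.
have mWt t : measurable_fun setT (fun y => W y t `^ c) := measurable_sec2 t mCc.
have mWN y : measurable_fun setT (fun t => W y t `^ c) := measurable_sec1 y mCc.
apply: rect_to_half.
- apply: measurable_funM.
    apply: measurable_funM => //; apply: measurable_funD; apply: measurable_funX.
    + exact: mVt2.
    + exact: mVx2.
  by apply: measurable_fun_powR; exact: mV2.
- move=> y t t0; rewrite mulr_ge0 ?powR_ge0// mulr_ge0 ?(ltW t0)//.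
  by rewrite addr_ge0 ?sqr_ge0.
move=> N0 t0 t1 N00 t00 t01.
have tpos t : `[t0, t1]%classic t -> 0 < t.
  by rewrite /= in_itv/= => /andP[h1 _]; exact: lt_le_trans h1.
pose m (N : R) := (\int[mu]_(t in `[t0, t1])
   (M * (W N t `^ c + W (- N)%R t `^ c))%:E)%E.
have mA N : measurable (`[(- N)%R, N]%classic : set R) by exact: measurable_itv.
have mCn : measurable_fun setT (fun z : R * R => W (- z.1) z.2 `^ c).
  have mp : measurable_fun setT (fun z : R * R => (- z.1, z.2)).
    apply: measurable_fun_pair; last exact: measurable_snd.
    exact: (measurableT_comp (@oppr_measurable R setT) measurable_fst).
  exact: (measurableT_comp mCc mp).
have m2 : measurable_fun setT (fun z : R * R =>
   M * (W z.1 z.2 `^ c + W (- z.1) z.2 `^ c)).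
  apply: measurable_funM; first exact: measurable_cst.
  apply: measurable_funD; first exact: mCc.
  exact: mCn.
have mm : measurable_fun setT m.
  apply: (@measurable_fun_integral_in _ _ _ (fun N t =>
    M * (W N t `^ c + W (- N) t `^ c))) => //.
  by move=> y t _; rewrite mulr_ge0// addr_ge0// powR_ge0.
have m0 N : (0 <= m N)%E.
  by apply: integral_ge0 => t _; rewrite lee_fin mulr_ge0// addr_ge0// powR_ge0.
have bnd (A : set R) t : measurable A -> 0 < t ->
    (\int[mu]_(y in A) (W y t `^ c)%:E <= G)%E.
  move=> mA' tp; apply: le_trans (WG t tp); apply: ge0_subset_integral => //.
    by apply/measurable_EFinP; exact: mWt.
  by move=> y _; rewrite lee_fin powR_ge0.
have step N : N0 <= N -> (\int[mu]_(y in `[(- N0)%R, N0]) \int[mu]_(t in `[t0, t1])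
     (t * (cv (Ck t) h y ^+ 2 + cv (Ak t) h y ^+ 2) * W y t `^ a)%:E <=
     (2 * M + 1)%:E * G + m N)%E.
  move=> N0N; have N1 : 0 <= N by rewrite (le_trans N00).
  apply: (@le_trans _ _ (\int[mu]_(y in `[(- N)%R, N]) \int[mu]_(t in `[t0, t1])
     (t * (cv (Ck t) h y ^+ 2 + cv (Ak t) h y ^+ 2) * W y t `^ a)%:E)%E).
    apply: ge0_subset_integral => //.
    - apply: (@measurable_fun_integral_in _ _ _ (fun y t =>
        t * (cv (Ck t) h y ^+ 2 + cv (Ak t) h y ^+ 2) * W y t `^ a)) => //.
        apply: measurable_funM.
          apply: measurable_funM => //; apply: measurable_funD; apply: measurable_funX.
          + exact: mVt2.
          + exact: mVx2.
        by apply: measurable_fun_powR; exact: mV2.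
      move=> y t /tpos tp; rewrite mulr_ge0 ?powR_ge0// mulr_ge0 ?(ltW tp)//.
      by rewrite addr_ge0 ?sqr_ge0.
    - move=> y _; apply: integral_ge0 => t /tpos tp.
      rewrite lee_fin mulr_ge0 ?powR_ge0// mulr_ge0 ?(ltW tp)//.
      by rewrite addr_ge0 ?sqr_ge0.
    - move=> y /=; rewrite !in_itv/= => /andP[h1 h2].
      by rewrite (le_trans h2)// (le_trans _ h1)// lerN2.
  apply: (le_trans (carleson_rect c1 k00 bh bw w0 W0 HV N1 t00 t01)).
  rewrite -ME; apply: leeD => //.
  rewrite (integral_scaleD (mA N) M00 (mWt t1) (mWt t0)
    (fun=> powR_ge0 _ _) (fun=> powR_ge0 _ _)).
  apply: (@le_trans _ _ (M%:E * (G + G))%E).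
    apply: lee_wpmul2l; first by rewrite lee_fin.
    by apply: leeD; apply: bnd => //; rewrite (lt_le_trans t00).
  rewrite -(fineK Gf) -EFinD -!EFinM lee_fin.
  have : 0 <= fine G by exact: fine_ge0.
  by move: (fine G) => v v0; rewrite mulrDl mulrDr mul1r -mulrA mulr_natl mulr2n lerDl.
apply: (@le_integral_shift_average R _ +oo%E _ m N0) => //.
- by rewrite mule_ge0// lee_fin addr_ge0// mulr_ge0.
rewrite /m (tonelli_in measurableT (measurable_itv _)); last 2 first.
- exact/measurable_EFinP.
- by move=> y t; rewrite lee_fin mulr_ge0// addr_ge0// powR_ge0.
apply: (@le_lt_trans _ _ (\int[mu]_(t in `[t0, t1]) cst (M%:E * (G + G)) t)%E).
  apply: ge0_le_integral.
  - exact: measurable_itv.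
  - move=> t _; apply: integral_ge0 => y _.
    by rewrite lee_fin mulr_ge0// addr_ge0// powR_ge0.
  - apply: measurable_funTS.
    apply: (@measurable_fun_fubini_tonelli_G _ _ _ _ _ mu (fun z : R * R =>
       (M * (W z.1 z.2 `^ c + W (- z.1) z.2 `^ c))%:E)).
      exact/measurable_EFinP.
    by move=> z; rewrite lee_fin mulr_ge0// addr_ge0// powR_ge0.
  - exact: measurable_cst.
  - move=> t /tpos tp /=.
    have mN : measurable_fun setT (fun y : R => W (- y) t `^ c) := measurable_sec2 t mCn.
    rewrite (integral_scaleD measurableT M00 (mWt t) mN
      (fun=> powR_ge0 _ _) (fun=> powR_ge0 _ _)).
    apply: lee_wpmul2l; first by rewrite lee_fin.
    apply: leeD; first exact: WG.
    rewrite (ge0_integral_refl (f := fun y => (W y t `^ c)%:E)); first exact: WG.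
      by apply/measurable_EFinP; exact: mWt.
    by move=> y; rewrite lee_fin powR_ge0.
rewrite integral_cst//= lebesgue_measure_itv/=.
rewrite -(fineK Gf) -EFinD -EFinM; case: ifP => _; last by rewrite mule0 ltry.
by rewrite -EFinB -EFinM ltry.
Qed.
End carleson_final.

(** * Fourier transforms of the kernels *)

Section fourier_kernels.
Context {R : realType}.
Local Notation mu := (@lebesgue_measure R).
Local Notation "\I f" := (Rintegral mu setT f) (at level 10).
Implicit Types (a s t x y z xi : R).

Lemma measurable_fun_cos d (T : measurableType d) (f : T -> R) :
  measurable_fun setT f -> measurable_fun setT (fun p => cos (f p)).
Proof.
apply: measurableT_comp; apply: continuous_measurable_fun; exact: continuous_cos.
Qed.

Lemma measurable_fun_sin d (T : measurableType d) (f : T -> R) :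
  measurable_fun setT f -> measurable_fun setT (fun p => sin (f p)).
Proof.
apply: measurableT_comp; apply: continuous_measurable_fun; exact: continuous_sin.
Qed.

Lemma measurable_fun_expR d (T : measurableType d) (f : T -> R) :
  measurable_fun setT f -> measurable_fun setT (fun p => expR (f p)).
Proof.
apply: measurableT_comp; apply: continuous_measurable_fun; exact: continuous_expR.
Qed.

Lemma norm_cos_le1 x : `|cos x| <= 1.
Proof. by rewrite ler_norml cos_geN1 cos_le1. Qed.

Lemma norm_sin_le1 x : `|sin x| <= 1.
Proof. by rewrite ler_norml sin_geN1 sin_le1. Qed.

Lemma Rint_odd (f : R -> R) : integ f -> (forall x, f (- x) = - f x) -> \I f = 0.
Proof.
move=> fi fN; have := Rint_refl fi.
rewrite (_ : (fun x => f (- x)) = (fun x => - f x)); last exact/funext.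
by rewrite RintN// => H; lra.
Qed.

Lemma Rint_even (f F : R -> R) (L : R) : integ f -> (forall x, f (- x) = f x) ->
  (forall x, 0 <= x -> is_derive x 1 F (f x)) ->
  (forall x, 0 <= x -> {for x, continuous f}) ->
  F n%:R @[n --> \oo] --> L -> \I f = 2 * (L - F 0).
Proof.
move=> fi fN dF cf FL.
have mf := integ_measurable fi.
(* One interval is open at 0 and the other closed, so that g1 n x + g2 n (- x) counts the origin
   once and equals f x everywhere as soon as n > |x|. *)
pose g1 n x : R := \1_(`]0, n%:R]%classic) x * f x.
pose g2 n x : R := \1_(`[0, n%:R]%classic) x * f x.
have mg1 n : measurable_fun setT (g1 n).
  by apply: measurable_funM => //; apply: measurable_indic.
have mg2 n : measurable_fun setT (g2 n).
  by apply: measurable_funM => //; apply: measurable_indic.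
have ind (A : set R) x : `|\1_A x * f x| <= `|f x|.
  by rewrite normrM indicE; case: (_ \in _); rewrite ?normr1 ?mul1r// normr0 mul0r.
have i1 n : integ (g1 n).
  by apply: (integ_le (mg1 n) (integ_norm fi)) => x; exact: ind.
have i2 n : integ (g2 n).
  by apply: (integ_le (mg2 n) (integ_norm fi)) => x; exact: ind.
have E2 n : \I (g2 n) = F n%:R - F 0.
  rewrite -Rintegral_indic; have [_ ->//] := @Rint_FTC _ F f 0 n%:R (ler0n _ _)
    (fun x h => dF x (andP h).1) (fun x h => cf x (andP h).1).
have E1 n : \I (g1 n) = F n%:R - F 0.
  rewrite -E2 -!Rintegral_indic; apply: Rintegral_itv_obnd_cbnd.
  by have /(integrable_indic f (measurable_itv _)) := i1 n.
have [] := @Rint_dct _ (fun n x => g1 n x + g2 n (- x)) f (fun x => `|f x| + `|f x|).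
- by move=> n; apply: measurable_funD => //; exact: (measurableT_comp (mg2 n)).
- by apply: integD; exact: integ_norm.
- move=> n x; rewrite (le_trans (ler_normD _ _))// lerD ?ind//.
  by rewrite -(fN x); exact: ind.
- move=> x; apply: cvg_near_cst.
  near=> n; rewrite /g1 /g2 !indicE fN -mulrDl.
  have xn : `|x| < n%:R by near: n; exact: nbhs_infty_gtr.
  move: xn; rewrite ltr_norml => /andP[nx xn].
  rewrite !mem_setE !in_itv/=.
  have [x0|x0] := ltP 0 x.
    by rewrite (ltW xn)/= oppr_ge0 leNgt x0/= addr0 mul1r.
  rewrite oppr_ge0 x0/= lerNl (ltW nx)/= add0r mul1r//.
move=> _ lim1.
have lim2 : \I (fun x => g1 n x + g2 n (- x)) @[n --> \oo] --> (L - F 0) + (L - F 0).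
  rewrite (_ : (fun n => _) = (fun n => (F n%:R - F 0) + (F n%:R - F 0))).
    by apply: cvgD; apply: cvgB => //; exact: cvg_cst.
  apply/funext => n; rewrite RintD//; last exact: integ_refl.
  by rewrite Rint_refl// E1 E2.
have := cvg_unique _ lim1 lim2; move=> -> //; rewrite -mulr2n mulr_natl//.
Unshelve. all: end_near. Qed.

(** The multiplier of the Poisson semigroup, that is, the Fourier transform of P_t when t > 0. *)
Definition ek t xi : R := expR (- (2 * pi * t * `|xi|)).

Lemma ek_gt0 t xi : 0 < ek t xi. Proof. exact: expR_gt0. Qed.

Lemma measurable_ekc d (T : measurableType d) (f g : T -> R) :
  measurable_fun setT f -> measurable_fun setT g ->
  measurable_fun setT (fun p => ek (f p) (g p)).
Proof.
move=> mf mg; apply: measurable_fun_expR; apply: (measurableT_comp (@oppr_measurable R setT)).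
by apply: measurable_funM; [exact: measurable_funM|exact: measurableT_comp].
Qed.

Lemma ek_le1 t xi : 0 <= t -> ek t xi <= 1.
Proof. by move=> t0; rewrite -expR0 ler_expR oppr_le0 !mulr_ge0// pi_ge0. Qed.

(** With u = pi t |xi| this is e^(-2u) <= (1 + u)^(-2) <= 1 / (1 + u^2). *)
Lemma ek_rk t xi : 0 < t -> ek t xi <= (pi * t) ^- 2 * rk (pi * t)^-1 xi.
Proof.
move=> t0; have c0 : 0 < pi * t by rewrite mulr_gt0 ?pi_gt0.
rewrite /ek (_ : 2 * pi * t * `|xi| = (pi * t * `|xi|) + (pi * t * `|xi|)); last by ring.
move: (pi * t) c0 => c c0.
have u0 : 0 <= c * `|xi| by rewrite mulr_ge0// ltW.
have e1 : expR (- (c * `|xi|)) <= (1 + c * `|xi|)^-1.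
  by rewrite expRN lef_pV2 ?posrE ?expR_gt0 ?ltr_wpDr//; exact: expR_ge1Dx.
rewrite opprD expRD; apply: (@le_trans _ _ ((1 + c * `|xi|)^-1 * (1 + c * `|xi|)^-1)).
  by apply: ler_pM => //; exact: ltW (expR_gt0 _).
rewrite -!invfM lef_pV2 ?posrE.
- rewrite mulrDr -!exprMn divff ?gt_eqF// expr1n.
  rewrite exprMn -(@real_normK _ xi) ?num_real// -exprMn; move: u0.
  by move: (c * _) => u u0; rewrite mulrDl mul1r mulrDr mulr1 -expr2; lra.
- by rewrite mulr_gt0// ltr_wpDr.
- by rewrite mulr_gt0 ?exprn_gt0// den_gt0// invr_gt0.
Qed.

Lemma integ_ek t : 0 < t -> integ (ek t).
Proof.
move=> t0; have c0 : 0 < (pi * t)^-1 by rewrite invr_gt0 mulr_gt0 ?pi_gt0.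
apply: (@integ_le _ _ (fun x => (pi * t) ^- 2 * rk (pi * t)^-1 x)).
- by apply: measurable_ekc.
- by apply: integZ; exact: (integ_rk c0).1.
- by move=> x; rewrite gtr0_norm ?ek_gt0//; exact: ek_rk.
Qed.

Lemma ekD s t xi : ek (s + t) xi = ek s xi * ek t xi.
Proof. by rewrite /ek -expRD; congr expR; ring. Qed.

(** The exponential is split into two equal factors, and one of them absorbs |xi| through e^x >= 1 +
    x. *)
Lemma ek_abs_le t xi : 0 < t -> 2 * pi * `|xi| * ek t xi <= 2 / t * ek (t / 2) xi.
Proof.
move=> t0; rewrite {1}(_ : t = t / 2 + t / 2); last lra.
rewrite ekD mulrA; apply: ler_wpM2r; first exact/ltW/ek_gt0.
rewrite /ek expRN ler_pdivrMr ?expR_gt0//.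
have := expR_ge1Dx (2 * pi * (t / 2) * `|xi|); set e := expR _ => h.
have t1 : 0 < 2 / t by rewrite divr_gt0.
apply: (@le_trans _ _ (2 / t * (2 * pi * (t / 2) * `|xi|))).
  by rewrite le_eqVlt; apply/orP; left; apply/eqP; move: pi => c; field; rewrite gt_eqF.
by rewrite ler_wpM2l ?(ltW t1)//; lra.
Qed.

Lemma integ_ekM t (c : R -> R) : 0 < t -> measurable_fun setT c ->
  (forall x, `|c x| <= 1) -> integ (fun xi => ek t xi * c xi).
Proof.
move=> t0 mc c1; apply: (integ_le _ (integ_ek t0)).
  by apply: measurable_funM => //; exact: measurable_ekc.
by move=> x; rewrite normrM (gtr0_norm (ek_gt0 _ _)) ler_piMr// ltW ?ek_gt0.
Qed.

Lemma measurable_trig (c : R) : measurable_fun setT (fun xi : R => cos (c * xi)) /\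
  measurable_fun setT (fun xi : R => sin (c * xi)).
Proof.
split; first by apply: measurable_fun_cos; exact: measurable_funM.
by apply: measurable_fun_sin; exact: measurable_funM.
Qed.

Lemma integ_ek_cos t c : 0 < t -> integ (fun xi => ek t xi * cos (c * xi)).
Proof.
move=> t0; apply: integ_ekM t0 _ _; first exact: (measurable_trig _).1.
by move=> x; exact: norm_cos_le1.
Qed.

Lemma integ_ek_sin t c : 0 < t -> integ (fun xi => ek t xi * sin (c * xi)).
Proof.
move=> t0; apply: integ_ekM t0 _ _; first exact: (measurable_trig _).2.
by move=> x; exact: norm_sin_le1.
Qed.

Lemma cvg_expN (c : R) : 0 < c -> expR (- (c * n%:R)) @[n --> \oo] --> (0 : R).
Proof.
move=> c0; rewrite (_ : (fun n => _) = (fun n => expR (- c) ^+ n)).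
  by apply: cvg_expr; rewrite gtr0_norm ?expR_gt0// expR_lt1 oppr_lt0.
by apply/funext => n; rewrite -expRM_natr mulNr.
Qed.

Lemma ek_cos t y : 0 < t ->
  \I (fun xi => ek t xi * cos (2 * pi * y * xi)) = Pk t y.
Proof.
move=> t0; have p0 := pi_gt0 R.
pose a := 2 * pi * t; pose w := 2 * pi * y.
have a0 : 0 < a by rewrite /a !mulr_gt0.
have aw : 0 < a ^+ 2 + w ^+ 2 by rewrite ltr_wpDr ?sqr_ge0// exprn_gt0.
(* An explicit antiderivative of e^(-a x) cos(w x), tending to 0 at infinity. *)
pose F x := expR (- (a * x)) * (w * sin (w * x) - a * cos (w * x)) / (a ^+ 2 + w ^+ 2).
have mc : measurable_fun setT (fun xi : R => cos (2 * pi * y * xi)).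
  by apply: measurable_fun_cos; exact: measurable_funM.
transitivity (2 * (0 - F 0)); last first.
  rewrite /F !mulr0 oppr0 expR0 sin0 cos0 !mulr0 mulr1 sub0r mul1r sub0r.
  rewrite /Pk /rk /a /w; move: (aw); rewrite /a /w => aw'.
  have yt := den_gt0 y t0.
  by move: pi p0 aw' => c c0 aw'; field; rewrite !gt_eqF.
apply: (@Rint_even _ F 0).
- exact: integ_ek_cos.
- by move=> x; rewrite /ek normrN mulrN cosN.
- move=> x x0; rewrite /ek ger0_norm// -/a -/w /F.
  by apply: is_derive_eq; rewrite /GRing.scale /=; field; rewrite gt_eqF.
- move=> x x0; apply: continuousM.
    apply: continuous_comp; last exact: continuous_expR.
    apply: continuousN; apply: continuousM; first exact: cst_continuous.
    exact: norm_continuous.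
  apply: continuous_comp; last exact: continuous_cos.
  by apply: cvgM; [exact: cvg_cst|exact: cvg_id].
- apply: norm_cvg0; apply: (@squeeze_cvgr _ _ _ _ (fun=> 0)
   (fun n : nat => (`|w| + a) / (a ^+ 2 + w ^+ 2) * expR (- (a * n%:R)))).
  + near=> n; rewrite normr_ge0/= /F normrM (gtr0_norm (_ : 0 < _^-1)) ?invr_gt0//.
    rewrite normrM (gtr0_norm (expR_gt0 _)) [leRHS]mulrC -mulrA ler_wpM2l ?(ltW (expR_gt0 _))//.
    rewrite ler_wpM2r ?invr_ge0 ?(ltW aw)//.
    rewrite (le_trans (ler_normB _ _))// (normrM w) (normrM a) (gtr0_norm a0) lerD//.
      by rewrite ler_piMr// norm_sin_le1.
    by rewrite ler_piMr ?(ltW a0)// norm_cos_le1.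
  + exact: cvg_cst.
  + by rewrite -[X in _ --> X](mulr0 ((`|w| + a) / (a ^+ 2 + w ^+ 2))); apply: cvgMr; exact: cvg_expN.
Unshelve. all: end_near. Qed.

Lemma ek_sin t y : 0 < t ->
  \I (fun xi => ek t xi * sin (2 * pi * y * xi)) = 0.
Proof.
move=> t0; apply: Rint_odd.
  exact: integ_ek_sin.
by move=> x; rewrite /ek normrN mulrN sinN mulrN.
Qed.

(** The scaling y = t z + x moves the dependence on t from the kernel into the argument of w, where
    dominated convergence and continuity at x apply. *)
Lemma cv_Pk_lim w x : bmeas w -> {for x, continuous w} ->
  cv (Pk t) w x @[t --> 0^'+] --> w x.
Proof.
move=> [mw [B wB]] cw; have B0 : 0 <= B by rewrite (le_trans _ (wB 0)).
have [i1 E1] := @integ_Pk_shift R 1 0 ltr01.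
have i1' : integ (Pk 1 : R -> R).
  have := integ_refl i1; congr (_.-integrable _ _); apply/funext => y /=.
  by rewrite sub0r opprK.
have E1' : \I (Pk 1 : R -> R) = 1.
  rewrite -(Rint_refl i1') -[RHS]E1; apply: eq_Rintegral => y _.
  by rewrite sub0r.
have E t : 0 < t -> cv (Pk t) w x = \I (fun z => Pk 1 z * w (t * z + x)).
  move=> t0; have iF := integ_PkM x t0 (conj mw (ex_intro _ B wB)).
  have := Rint_affine x t0 iF; rewrite -/(cv _ _ _) => h.
  have -> : cv (Pk t) w x = t * (t^-1 * cv (Pk t) w x).
    by rewrite mulrA divff ?mul1r ?gt_eqF.
  rewrite -h -RintZ; last exact: (integ_affine x t0 iF).
  apply: eq_Rintegral => z _; rewrite mulrA; congr (_ * _).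
  rewrite /Pk /rk; have d1 := den_gt0 z ltr01; have d2 := den_gt0 (x - (t * z + x)) t0.
  have e1 : (x - (t * z + x)) ^+ 2 + t ^+ 2 = t ^+ 2 * (z ^+ 2 + 1 ^+ 2) by ring.
  by rewrite e1; move: pi^-1 => c; field; rewrite !gt_eqF// -[X in _ + X](expr1n _ 2).
have [|||||_] := @Rint_dct_right _ (fun t z => Pk 1 z * w (t * z + x))
   (fun z => Pk 1 z * w x) (fun z => B * Pk 1 z) 1.
- move=> t _; apply: measurable_funM; first exact: integ_measurable.
  by apply: (measurableT_comp mw); apply: measurable_funD.
- by [].
- exact: integZ.
- move=> t z _; rewrite normrM mulrC ler_pM// gtr0_norm// Pk_gt0//.
- move=> z; apply: cvgM; first exact: cvg_cst.
  have cz : t * z + x @[t --> 0^'+] --> x.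
    apply: cvg_at_right_filter.
    have : {for 0, continuous (fun t => t * z + x)}.
      apply: cvgD; last exact: cvg_cst.
      by apply: cvgM; [exact: cvg_id|exact: cvg_cst].
    by rewrite /prop_for /continuous_at mul0r add0r.
  exact: (cvg_comp _ _ cz cw).
rewrite RintZr// E1' mul1r => lim1.
apply: cvg_trans lim1; apply: near_eq_cvg; near=> t; rewrite E//.
Unshelve. all: end_near. Qed.

Lemma integ_Pk t : 0 < t -> integ (Pk t).
Proof. by move=> t0; apply: integZ; exact: (integ_rk t0).1. Qed.

Lemma PkN t z : Pk t (- z) = Pk t z.
Proof. by rewrite /Pk /rk sqrrN. Qed.

Lemma integ_PkcM t (c : R -> R) : 0 < t -> measurable_fun setT c ->
  (forall x, `|c x| <= 1) -> integ (fun y => Pk t y * c y).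
Proof.
move=> t0 mc c1; apply: (integ_le _ (integ_Pk t0)).
  by apply: measurable_funM => //; exact: measurable_PkT.
by move=> x; rewrite normrM (gtr0_norm (Pk_gt0 _ t0)) ler_piMr// ltW ?Pk_gt0.
Qed.

(** Fourier inversion by hand. By [ek_cos] and Fubini, the Poisson integral at height s of [ek t] is
    the integral of [ek s y] [Pk t y] cos(2 pi y xi). As s tends to 0, [cv_Pk_lim] evaluates one
    side and dominated convergence the other. *)
Lemma Pk_cos t xi : 0 < t ->
  \I (fun y => Pk t y * cos (2 * pi * y * xi)) = ek t xi.
Proof.
move=> t0; have p0 := pi_gt0 R.
have bw : bmeas (ek t).
  split; first exact: measurable_ekc.
  by exists 1 => y; rewrite gtr0_norm ?ek_gt0// ek_le1// ltW.
have cw : {for xi, continuous (ek t)}.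
  apply: continuous_comp; last exact: continuous_expR.
  apply: continuousN; apply: continuousM; first exact: cst_continuous.
  exact: norm_continuous.
have lim1 := cv_Pk_lim bw cw.
have mc : measurable_fun setT (fun y : R => cos (2 * pi * y * xi)).
  rewrite (_ : (fun y => _) = (fun y => cos ((2 * pi * xi) * y))).
    exact: (measurable_trig _).1.
  by apply/funext => y; congr cos; ring.
have E s : 0 < s -> cv (Pk s) (ek t) xi =
    \I (fun y => ek s y * (Pk t y * cos (2 * pi * y * xi))).
  move=> s0.
  have [||_ _ _ H] := @Rint_fubini _ (fun eta y =>
     ek t eta * (ek s y * cos (2 * pi * (xi - eta) * y))) (ek t) (ek s) _
     (integ_ek t0) (integ_ek s0) _.
  - apply: measurable_funM; first exact: measurable_ekc.
    apply: measurable_funM; first exact: measurable_ekc.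
    apply: measurable_fun_cos; apply: measurable_funM => //.
    by apply: measurable_funM => //; exact: measurable_funB.
  - move=> eta y; rewrite normrM (gtr0_norm (ek_gt0 _ _)) ler_wpM2l ?(ltW (ek_gt0 _ _))//.
    by rewrite normrM (gtr0_norm (ek_gt0 _ _)) ler_piMr ?(ltW (ek_gt0 _ _))// norm_cos_le1.
  transitivity (\I (fun eta => \I (fun y =>
   ek t eta * (ek s y * cos (2 * pi * (xi - eta) * y))))).
  apply: eq_Rintegral => eta _.
  rewrite (RintZ _ (integ_ek_cos _ s0)) (ek_cos _ s0) mulrC//.
  rewrite H; apply: eq_Rintegral => y _.
  have i1 := integ_ek_cos (2 * pi * y) t0.
  have i2 := integ_ek_sin (2 * pi * y) t0.
  rewrite -(ek_cos y t0).
  transitivity (\I (fun eta => ek s y * cos (2 * pi * y * xi) *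
     (ek t eta * cos (2 * pi * y * eta)) + ek s y * sin (2 * pi * y * xi) *
     (ek t eta * sin (2 * pi * y * eta)))).
    apply: eq_Rintegral => eta _.
    rewrite (_ : 2 * pi * (xi - eta) * y = 2 * pi * y * xi - 2 * pi * y * eta); last by ring.
    by rewrite cosB; ring.
  rewrite (RintD (integZ _ i1) (integZ _ i2)).
  by rewrite (RintZ _ i1) (RintZ _ i2) (ek_sin _ t0) mulr0 addr0; ring.
have [|||||_ lim2] := @Rint_dct_right _
   (fun s y => ek s y * (Pk t y * cos (2 * pi * y * xi)))
   (fun y => Pk t y * cos (2 * pi * y * xi)) (Pk t) 1.
- move=> s _; apply: measurable_funM; first exact: measurable_ekc.
  by apply: measurable_funM => //; exact: measurable_PkT.
- by [].
- exact: integ_Pk.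
- move=> s y /andP[s0 _]; rewrite normrM (gtr0_norm (ek_gt0 _ _)).
  rewrite (@le_trans _ _ `|Pk t y * cos (2 * pi * y * xi)|)//.
    by rewrite ler_piMl// ek_le1// ltW.
  by rewrite normrM (gtr0_norm (Pk_gt0 _ t0)) ler_piMr ?(ltW (Pk_gt0 _ t0))// norm_cos_le1.
- move=> y; rewrite -[X in _ --> X]mul1r; apply: cvgM; last exact: cvg_cst.
  have -> : 1 = ek 0 y :> R by rewrite /ek mulr0 mul0r oppr0 expR0.
  apply: cvg_at_right_filter.
  have : {for 0, continuous (fun s => ek s y)}.
    apply: continuous_comp; last exact: continuous_expR.
    apply: continuousN; apply: continuousM; last exact: cst_continuous.
    by apply: cvgM; [exact: cvg_cst|exact: cvg_id].
  by [].
have lim3 : cv (Pk s) (ek t) xi @[s --> 0^'+] -->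
    \I (fun y => Pk t y * cos (2 * pi * y * xi)).
  apply: cvg_trans lim2; apply: near_eq_cvg; near=> s; rewrite E//.
exact: (cvg_unique _ lim3 lim1).
Unshelve. all: end_near. Qed.

Lemma Pk_sin t xi : 0 < t ->
  \I (fun y => Pk t y * sin (2 * pi * y * xi)) = 0.
Proof.
move=> t0; apply: Rint_odd.
  apply: integ_PkcM => //; last by move=> x; exact: norm_sin_le1.
  rewrite (_ : (fun y => _) = (fun y => sin ((2 * pi * xi) * y))).
    exact: (measurable_trig _).2.
  by apply/funext => y; congr sin; ring.
by move=> x; rewrite PkN mulrN mulNr sinN mulrN.
Qed.

Lemma integ_Pk_trig t c : 0 < t -> integ (fun y => Pk t y * cos (c * y)) /\
  integ (fun y => Pk t y * sin (c * y)).
Proof.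
move=> t0; split; apply: integ_PkcM t0 _ _.
- exact: (measurable_trig _).1.
- by move=> x; exact: norm_cos_le1.
- exact: (measurable_trig _).2.
- by move=> x; exact: norm_sin_le1.
Qed.

Lemma bmeas_cos c : bmeas (fun y : R => cos (c * y)).
Proof. by split; [exact: (measurable_trig _).1|exists 1 => y; exact: norm_cos_le1]. Qed.

Lemma bmeas_sin c : bmeas (fun y : R => sin (c * y)).
Proof. by split; [exact: (measurable_trig _).2|exists 1 => y; exact: norm_sin_le1]. Qed.

Lemma cv_shift (k w : R -> R) x : integ (fun y => k (x - y) * w y) ->
  cv k w x = \I (fun z => k z * w (x - z)).
Proof.
move=> ik; have := Rint_refl (integ_affine x ltr01 (integ_refl ik)).
have i1 := integ_affine x ltr01 ik.
have := Rint_affine x ltr01 ik; rewrite invr1 mul1r => E.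
rewrite /cv -E -(Rint_refl i1) => _; apply: eq_Rintegral => z _.
by congr (k _ * w _); ring.
Qed.

Lemma cv_Pk_cos t xi x : 0 < t ->
  cv (Pk t) (fun y => cos (2 * pi * y * xi)) x = ek t xi * cos (2 * pi * x * xi).
Proof.
move=> t0; have E y : cos (2 * pi * y * xi) = cos (2 * pi * xi * y) by congr cos; ring.
have [j1 j2] := integ_Pk_trig (2 * pi * xi) t0.
rewrite cv_shift; last first.
  under [X in EFin \o X]eq_fun do rewrite E.
  exact: (integ_PkM x t0 (bmeas_cos _)).
transitivity (\I (fun z => cos (2 * pi * x * xi) * (Pk t z * cos (2 * pi * xi * z)) +
   sin (2 * pi * x * xi) * (Pk t z * sin (2 * pi * xi * z)))).
  apply: eq_Rintegral => z _.
  rewrite (_ : 2 * pi * (x - z) * xi = 2 * pi * x * xi - 2 * pi * xi * z); last by ring.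
  by rewrite cosB; ring.
rewrite (RintD (integZ _ j1) (integZ _ j2)) (RintZ _ j1) (RintZ _ j2).
rewrite -(Pk_cos xi t0) mulrC [X in _ + _ * X](_ : _ = 0) ?mulr0 ?addr0; last first.
  by rewrite -(Pk_sin xi t0); apply: eq_Rintegral => y _; congr (_ * sin _); ring.
by congr (_ * _); apply: eq_Rintegral => y _; rewrite E.
Qed.

Lemma cv_Pk_sin t xi x : 0 < t ->
  cv (Pk t) (fun y => sin (2 * pi * y * xi)) x = ek t xi * sin (2 * pi * x * xi).
Proof.
move=> t0; have E y : sin (2 * pi * y * xi) = sin (2 * pi * xi * y) by congr sin; ring.
have [j1 j2] := integ_Pk_trig (2 * pi * xi) t0.
rewrite cv_shift; last first.
  under [X in EFin \o X]eq_fun do rewrite E.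
  exact: (integ_PkM x t0 (bmeas_sin _)).
transitivity (\I (fun z => sin (2 * pi * x * xi) * (Pk t z * cos (2 * pi * xi * z)) +
   - cos (2 * pi * x * xi) * (Pk t z * sin (2 * pi * xi * z)))).
  apply: eq_Rintegral => z _.
  rewrite (_ : 2 * pi * (x - z) * xi = 2 * pi * x * xi - 2 * pi * xi * z); last by ring.
  by rewrite sinB; ring.
rewrite (RintD (integZ _ j1) (integZ _ j2)) (RintZ _ j1) (RintZ _ j2).
rewrite -(Pk_cos xi t0) mulrC [X in _ + _ * X](_ : _ = 0) ?mulr0 ?addr0; last first.
  by rewrite -(Pk_sin xi t0); apply: eq_Rintegral => y _; congr (_ * sin _); ring.
by congr (_ * _); apply: eq_Rintegral => y _; congr (_ * cos _); ring.
Qed.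

(* The trigonometric integral with amplitudes u and v: for g smooth and compactly
   supported, fraclap s g = FT (m * FC g) (m * FS g) with m = (2 pi |xi|)^s. *)
Definition FT (u v : R -> R) x : R :=
  \I (fun xi => u xi * cos (2 * pi * x * xi) + v xi * sin (2 * pi * x * xi)).

Lemma trig_sum_le (u v c d : R) : `|c| <= 1 -> `|d| <= 1 ->
  `|u * c + v * d| <= `|u| + `|v|.
Proof.
move=> c1 d1; rewrite (le_trans (ler_normD _ _))// !normrM.
by rewrite lerD// ler_piMr.
Qed.

Lemma measurable_FTi (u v : R -> R) : measurable_fun setT u -> measurable_fun setT v ->
  measurable_fun setT (fun z : R * R =>
    u z.2 * cos (2 * pi * z.1 * z.2) + v z.2 * sin (2 * pi * z.1 * z.2)).
Proof.
move=> mu' mv.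
have m1 : measurable_fun setT (fun z : R * R => 2 * pi * z.1 * z.2).
  by apply: measurable_funM => //; exact: measurable_funM.
apply: measurable_funD; apply: measurable_funM.
- exact: (measurableT_comp mu' measurable_snd).
- exact: measurable_fun_cos.
- exact: (measurableT_comp mv measurable_snd).
- exact: measurable_fun_sin.
Qed.

Lemma integ_FT u v x : integ u -> integ v ->
  integ (fun xi => u xi * cos (2 * pi * x * xi) + v xi * sin (2 * pi * x * xi)).
Proof.
move=> iu iv; apply: (integ_le _ (integD (integ_norm iu) (integ_norm iv))).
  exact: (measurable_sec1 x (measurable_FTi (integ_measurable iu) (integ_measurable iv))).
by move=> xi; apply: trig_sum_le; [exact: norm_cos_le1|exact: norm_sin_le1].
Qed.

Lemma bmeas_FT u v : integ u -> integ v -> bmeas (FT u v).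
Proof.
move=> iu iv; split.
  exact: (measurable_Rint_param (measurable_FTi (integ_measurable iu) (integ_measurable iv))).
exists (\I (fun xi => `|u xi| + `|v xi|)) => x; apply: Rint_abs_le.
- exact: (measurable_sec1 x (measurable_FTi (integ_measurable iu) (integ_measurable iv))).
- exact: (integD (integ_norm iu) (integ_norm iv)).
- by move=> xi; apply: trig_sum_le; [exact: norm_cos_le1|exact: norm_sin_le1].
Qed.

Lemma cv_Pk_FT u v t x : 0 < t -> integ u -> integ v ->
  cv (Pk t) (FT u v) x = FT (fun xi => ek t xi * u xi) (fun xi => ek t xi * v xi) x.
Proof.
move=> t0 iu iv; have [i1 E1] := integ_Pk_shift x t0.
pose f y xi := Pk t (x - y) * (u xi * cos (2 * pi * y * xi) + v xi * sin (2 * pi * y * xi)).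
have [||_ _ _ H] := @Rint_fubini _ f (fun y => Pk t (x - y))
  (fun xi => `|u xi| + `|v xi|) _ i1 (integD (integ_norm iu) (integ_norm iv)).
- apply: measurable_funM; last exact: (measurable_FTi (integ_measurable iu) (integ_measurable iv)).
  by apply: measurable_Pkc => //; exact: measurable_funB.
- move=> y xi; rewrite /f normrM (gtr0_norm (Pk_gt0 _ t0)) ler_wpM2l ?(ltW (Pk_gt0 _ t0))//.
  by apply: trig_sum_le; [exact: norm_cos_le1|exact: norm_sin_le1].
transitivity (\I (fun y => \I (f y))).
  by apply: eq_Rintegral => y _; rewrite /f (RintZ _ (integ_FT y iu iv)).
rewrite H; apply: eq_Rintegral => xi _; rewrite /f.
have E y : cos (2 * pi * y * xi) = cos (2 * pi * xi * y) by congr cos; ring.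
have E' y : sin (2 * pi * y * xi) = sin (2 * pi * xi * y) by congr sin; ring.
have j1 : integ (fun y => Pk t (x - y) * cos (2 * pi * y * xi)).
  under [X in EFin \o X]eq_fun do rewrite E.
  exact: (integ_PkM x t0 (bmeas_cos _)).
have j2 : integ (fun y => Pk t (x - y) * sin (2 * pi * y * xi)).
  under [X in EFin \o X]eq_fun do rewrite E'.
  exact: (integ_PkM x t0 (bmeas_sin _)).
transitivity (\I (fun y => u xi * (Pk t (x - y) * cos (2 * pi * y * xi)) +
   v xi * (Pk t (x - y) * sin (2 * pi * y * xi)))).
  by apply: eq_Rintegral => y _; ring.
rewrite (RintD (integZ _ j1) (integZ _ j2)) (RintZ _ j1) (RintZ _ j2).
by rewrite -!/(cv _ _ _) (cv_Pk_cos _ _ t0) (cv_Pk_sin _ _ t0); ring.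
Qed.

(** The semigroup law: P_t is the trigonometric integral of [ek t], P_s multiplies amplitudes by
    [ek s], and exponentials multiply. *)
Lemma cv_Pk_Pk s t x : 0 < s -> 0 < t -> cv (Pk s) (Pk t) x = Pk (s + t) x.
Proof.
move=> s0 t0; have z0 : integ (fun _ : R => 0 : R).
  by have := integZ 0 (integ_ek s0); congr (_.-integrable _ _); apply/funext => y /=; rewrite mul0r.
have FTe r y : 0 < r -> FT (ek r) (fun=> 0) y = Pk r y.
  move=> r0; rewrite -(ek_cos y r0); apply: eq_Rintegral => xi _.
  by rewrite mul0r addr0.
rewrite -(FTe (s + t)) ?addr_gt0//.
rewrite (_ : Pk t = FT (ek t) (fun=> 0)); last by apply/funext => y; rewrite FTe.
rewrite (cv_Pk_FT _ s0 (integ_ek t0) z0); apply: eq_Rintegral => xi _.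
by rewrite -ekD mulr0.
Qed.
End fourier_kernels.

(** * Semigroup identities for the derivative kernels, and power weights *)

Section fourier_semigroup.
Context {R : realType}.
Local Notation mu := (@lebesgue_measure R).
Local Notation "\I f" := (Rintegral mu setT f) (at level 10).
Implicit Types (a s t x y z xi : R).

(** Amplitudes are required to be integrable only after Poisson damping, which leaves room for the
    growth of symbols such as 2 pi xi and 2 pi |xi|. *)
Definition damped (u : R -> R) := measurable_fun setT u /\
  forall t, 0 < t -> integ (fun xi => ek t xi * u xi).

Lemma damped_integ u : integ u -> damped u.
Proof.
move=> iu; split; first exact: integ_measurable.
move=> t t0; apply: (integ_le _ (integ_norm iu)).
  by apply: measurable_funM; [exact: measurable_ekc|exact: integ_measurable].
move=> x; rewrite normrM (gtr0_norm (ek_gt0 _ _)) ler_piMl//.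
by rewrite ek_le1// ltW.
Qed.

Lemma damped_bmeas u : bmeas u -> damped u.
Proof.
move=> [mu' [B uB]]; split => // t t0.
apply: (integ_le _ (integZ B (integ_ek t0))).
  by apply: measurable_funM => //; exact: measurable_ekc.
move=> x; rewrite normrM (gtr0_norm (ek_gt0 _ _)) mulrC ler_wpM2r//.
exact: ltW (ek_gt0 _ _).
Qed.

Lemma damped_abs u (c : R -> R) : damped u -> measurable_fun setT c ->
  (forall xi, `|c xi| <= 2 * pi * `|xi|) -> damped (fun xi => c xi * u xi).
Proof.
move=> [mu' iu] mc cl; split; first exact: measurable_funM.
move=> t t0; have t2 : 0 < t / 2 by rewrite divr_gt0.
apply: (integ_le _ (integZ (2 / t) (integ_norm (iu _ t2)))).
  by apply: measurable_funM; [exact: measurable_ekc|exact: measurable_funM].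
move=> xi; rewrite !normrM !(gtr0_norm (ek_gt0 _ _)) !mulrA ler_wpM2r//.
rewrite mulrC; apply: le_trans (ek_abs_le xi t0).
by rewrite ler_wpM2r// ltW// ek_gt0.
Qed.

Lemma FT_derx u v t x : 0 < t -> damped u -> damped v ->
  is_derive x 1 (FT (fun xi => ek t xi * u xi) (fun xi => ek t xi * v xi))
    (FT (fun xi => ek t xi * (2 * pi * xi * v xi))
        (fun xi => ek t xi * (- (2 * pi * xi) * u xi)) x).
Proof.
move=> t0 [mu' iu] [mv iv]; have t2 : 0 < t / 2 by rewrite divr_gt0.
apply: (@is_derive_Rint _
  (fun x xi => ek t xi * u xi * cos (2 * pi * x * xi) + ek t xi * v xi * sin (2 * pi * x * xi))
  (fun x xi => ek t xi * (2 * pi * xi * v xi) * cos (2 * pi * x * xi) +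
     ek t xi * (- (2 * pi * xi) * u xi) * sin (2 * pi * x * xi)) x 1
  (fun xi => 2 / t * (`|ek (t / 2) xi * u xi| + `|ek (t / 2) xi * v xi|))).
- by [].
- by move=> y _; apply: integ_FT; [exact: iu|exact: iv].
- move=> y xi _; apply: is_derive_eq; rewrite /GRing.scale /=; ring.
- by apply: integZ; apply: integD; apply: integ_norm; [exact: iu|exact: iv].
- move=> y xi _.
  rewrite (le_trans (trig_sum_le _ _ (norm_cos_le1 _) (norm_sin_le1 _)))//.
  have e0 := ek_abs_le xi t0.
  rewrite !normrM !normrN !normrM !(gtr0_norm (ek_gt0 _ _)) (gtr0_norm (pi_gt0 R)).
  rewrite (ger0_norm (_ : 0 <= 2))// addrC.
  rewrite (_ : _ + _ = 2 * pi * `|xi| * ek t xi * (`|u xi| + `|v xi|)); last by ring.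
  rewrite -mulrDr mulrA; apply: ler_wpM2r => //; exact: addr_ge0.
Qed.

Lemma FT_dert u v t x : 0 < t -> damped u -> damped v ->
  is_derive t 1 (fun s => FT (fun xi => ek s xi * u xi) (fun xi => ek s xi * v xi) x)
    (FT (fun xi => ek t xi * (- (2 * pi * `|xi|) * u xi))
        (fun xi => ek t xi * (- (2 * pi * `|xi|) * v xi)) x).
Proof.
move=> t0 [mu' iu] [mv iv]; have t2 : 0 < t / 2 by rewrite divr_gt0.
have t4 : 0 < t / 2 / 2 by rewrite divr_gt0.
have tt2 s : `|s - t| < t / 2 -> t / 2 < s.
  by rewrite ltr_norml => /andP[h _]; lra.
apply: (@is_derive_Rint _
  (fun s xi => ek s xi * u xi * cos (2 * pi * x * xi) + ek s xi * v xi * sin (2 * pi * x * xi))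
  (fun s xi => ek s xi * (- (2 * pi * `|xi|) * u xi) * cos (2 * pi * x * xi) +
     ek s xi * (- (2 * pi * `|xi|) * v xi) * sin (2 * pi * x * xi)) t (t / 2)
  (fun xi => 2 / (t / 2) * (`|ek (t / 2 / 2) xi * u xi| + `|ek (t / 2 / 2) xi * v xi|))) => //.
- by move=> s /tt2 s2; apply: integ_FT; [apply: iu|apply: iv]; exact: lt_trans s2.
- move=> s xi _; rewrite /ek; apply: is_derive_eq; rewrite /GRing.scale /=; ring.
- by apply: integZ; apply: integD; apply: integ_norm; [exact: iu|exact: iv].
- move=> s xi /tt2 s2.
  rewrite (le_trans (trig_sum_le _ _ (norm_cos_le1 _) (norm_sin_le1 _)))//.
  have e0 := ek_abs_le xi t2.
  have e1 : ek s xi <= ek (t / 2) xi.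
    rewrite /ek ler_expR lerN2 ler_wpM2r// ler_wpM2l ?(ltW s2)//.
    by rewrite mulr_ge0// pi_ge0.
  rewrite !normrM !normrN !normrM !(gtr0_norm (ek_gt0 _ _)) (gtr0_norm (pi_gt0 R)).
  rewrite (ger0_norm (_ : 0 <= 2))// normr_id.
  rewrite (_ : _ + _ = 2 * pi * `|xi| * ek s xi * (`|u xi| + `|v xi|)); last by ring.
  rewrite -mulrDr mulrA; apply: ler_wpM2r; first exact: addr_ge0.
  by apply: le_trans e0; rewrite ler_wpM2l// mulr_ge0// mulr_ge0// pi_ge0.
Qed.

Section extension.
Variables (w u v : R -> R).
Hypotheses (bw : bmeas w) (du : damped u) (dv : damped v).
Hypothesis Pw : forall t x, 0 < t ->
  cv (Pk t) w x = FT (fun xi => ek t xi * u xi) (fun xi => ek t xi * v xi) x.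

(** Uniqueness of derivatives: both sides are the x-derivative of the same Poisson integral,
    computed on the kernel and on the Fourier side. *)
Lemma cv_Ak_FT t x : 0 < t -> cv (Ak t) w x =
  FT (fun xi => ek t xi * (2 * pi * xi * v xi))
     (fun xi => ek t xi * (- (2 * pi * xi) * u xi)) x.
Proof.
move=> t0; have D1 := dVx bw x t0; have D2 := FT_derx x t0 du dv.
rewrite -(@derive_val _ _ _ _ _ _ _ D1) -(@derive_val _ _ _ _ _ _ _ D2).
by congr ('D_1 _ x); apply/funext => y; exact: Pw.
Qed.

Lemma cv_Ck_FT t x : 0 < t -> cv (Ck t) w x =
  FT (fun xi => ek t xi * (- (2 * pi * `|xi|) * u xi))
     (fun xi => ek t xi * (- (2 * pi * `|xi|) * v xi)) x.
Proof.
move=> t0; have D1 := dVt bw x t0; have D2 := FT_dert x t0 du dv.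
rewrite -(@derive_val _ _ _ _ _ _ _ D1) -(@derive_val _ _ _ _ _ _ _ D2).
apply: near_eq_derive; near=> s; apply: Pw; near: s.
exact: lt_nbhsr.
Unshelve. all: end_near. Qed.
End extension.

Lemma bmeas_Pk t : 0 < t -> bmeas (Pk t : R -> R).
Proof.
move=> t0; split; first exact: measurable_PkT.
exists (pi^-1 * t * t ^- 2) => y; rewrite gtr0_norm ?Pk_gt0//.
rewrite /Pk ler_wpM2l ?mulr_ge0 ?(ltW t0) ?(ltW (ipi_gt0))//.
by rewrite /rk lef_pV2 ?posrE ?den_gt0 ?exprn_gt0// lerDr sqr_ge0.
Qed.

Lemma cv_Ak_Pk s t x : 0 < s -> 0 < t -> cv (Ak s) (Pk t) x = Ak (s + t) x.
Proof.
move=> s0 t0; have D1 := dVx (bmeas_Pk t0) x s0.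
have D2 := is_derive_Pkz x (addr_gt0 s0 t0).
rewrite -(@derive_val _ _ _ _ _ _ _ D1) -(@derive_val _ _ _ _ _ _ _ D2).
by congr ('D_1 _ x); apply/funext => y; exact: cv_Pk_Pk.
Qed.

Lemma cv_Ck_Pk s t x : 0 < s -> 0 < t -> cv (Ck s) (Pk t) x = Ck (s + t) x.
Proof.
move=> s0 t0; have D1 := dVt (bmeas_Pk t0) x s0.
have D2 : is_derive s 1 (fun r => Pk (r + t) x) (Ck (s + t) x).
  have D3 := is_derive_Pkt x (addr_gt0 s0 t0).
  have D4 : is_derive s 1 (fun r => r + t) 1 by apply: is_derive_eq; rewrite addr0.
  have := @is_derive1_comp _ (Pk^~ x) (fun r => r + t) s _ _ D3 D4.
  by rewrite mulr1.
rewrite -(@derive_val _ _ _ _ _ _ _ D1) -(@derive_val _ _ _ _ _ _ _ D2).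
apply: near_eq_derive; near=> r; apply: cv_Pk_Pk => //; near: r.
exact: lt_nbhsr.
Unshelve. all: end_near. Qed.

Lemma integ_shift f x : integ f -> integ (fun y => f (y - x)) /\
  \I (fun y => f (y - x)) = \I f.
Proof.
move=> fi; have i1 := integ_affine (- x) ltr01 fi.
have := Rint_affine (- x) ltr01 fi; rewrite invr1 mul1r => <-.
have E : (fun y => f (y - x)) = (fun y => f (1 * y - x)).
  by apply/funext => y; rewrite mul1r.
by rewrite E.
Qed.

Lemma cv_Pk_cv (k : R -> R) (c s t x : R) h : 0 < s -> 0 < t ->
  measurable_fun setT k -> (forall z, `|k z| <= c * rk s z) -> integ h ->
  cv (Pk t) (cv k h) x = cv (cv k (Pk t)) h x.
Proof.
move=> s0 t0 mk kc ih; have [i1 E1] := integ_Pk_shift x t0.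
have c0 : 0 <= c by rewrite -(pmulr_lge0 _ (rk_gt0 0 s0)) (le_trans _ (kc 0)).
have kB z : `|k z| <= c * s ^- 2.
  apply: (le_trans (kc z)); rewrite ler_wpM2l// /rk.
  by rewrite lef_pV2 ?posrE ?den_gt0 ?exprn_gt0// lerDr sqr_ge0.
pose f u y := Pk t (x - u) * (k (u - y) * h y).
have mB : measurable_fun setT (fun z : R * R => k (z.1 - z.2)).
  by apply: (measurableT_comp mk); exact: measurable_funB.
have [||i2 _ _ H] := @Rint_fubini _ f (fun u => Pk t (x - u))
  (fun y => c * s ^- 2 * `|h y|) _ i1 (integZ _ (integ_norm ih)).
- apply: measurable_funM.
    by apply: measurable_Pkc => //; exact: measurable_funB.
  by apply: measurable_funM => //; exact: (measurableT_comp (integ_measurable ih)).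
- move=> u y; rewrite /f normrM (gtr0_norm (Pk_gt0 _ t0)) normrM.
  by rewrite ler_wpM2l ?(ltW (Pk_gt0 _ t0))// ler_wpM2r.
have ik u : integ (fun y => k (u - y) * h y).
  apply: (integ_le _ (integZ (c * s ^- 2) (integ_norm ih))).
    by apply: measurable_funM; [exact: (measurable_sec1 u mB)|exact: integ_measurable].
  by move=> y; rewrite normrM ler_wpM2r.
transitivity (\I (fun u => \I (f u))).
  by apply: eq_Rintegral => u _; rewrite /f (RintZ _ (ik u)).
rewrite H; apply: eq_Rintegral => y _; rewrite /f.
have ikP X : integ (fun z => k (X - z) * Pk t z).
  exact: (integ_cv X s0 mk kc (bmeas_Pk t0)).
rewrite (cv_shift (ikP _)).
have ikP2 : integ (fun z => k z * Pk t (x - y - z)).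
  have := integ_affine (- (x - y)) ltr01 (integ_refl (ikP (x - y))).
  congr (_.-integrable _ _); apply/funext => z /=; rewrite mul1r.
  by congr (_%:E); congr (k _ * Pk _ _); ring.
rewrite mulrC -(RintZ (h y) ikP2).
have [_ <-] := integ_shift y (integZ (h y) ikP2).
apply: eq_Rintegral => u _ /=.
by rewrite (_ : x - y - (u - y) = x - u); ring.
Qed.

Lemma cv_Pk_Ak s t x h : 0 < s -> 0 < t -> integ h ->
  cv (Pk t) (cv (Ak s) h) x = cv (Ak (s + t)) h x.
Proof.
move=> s0 t0 ih.
rewrite (cv_Pk_cv x s0 t0 (measurable_AkT s) (fun z => norm_Ak_le z s0) ih).
by congr (cv _ h x); apply/funext => z; exact: cv_Ak_Pk.
Qed.

Lemma cv_Pk_Ck s t x h : 0 < s -> 0 < t -> integ h ->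
  cv (Pk t) (cv (Ck s) h) x = cv (Ck (s + t)) h x.
Proof.
move=> s0 t0 ih.
rewrite (cv_Pk_cv x s0 t0 (measurable_CkT s) (fun z => norm_Ck_le z s0) ih).
by congr (cv _ h x); apply/funext => z; exact: cv_Ck_Pk.
Qed.

(* Jensen for the Poisson kernel, in semigroup form. *)
Lemma sq_cv_double (k : R -> R -> R) t x h : 0 < t -> bmeas (cv (k t) h) ->
  cv (Pk t) (cv (k t) h) x = cv (k (t + t)) h x ->
  cv (k (t + t)) h x ^+ 2 <= cv (Pk t) (fun y => cv (k t) h y ^+ 2) x.
Proof.
move=> t0 bk <-; have bk' := bmeas_norm bk.
have c2 : 1 < 2 :> R by lra.
have := jensen_Pk x c2 t0 bk' (fun y => normr_ge0 _).
rewrite powR_mulrn; last first.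
  by apply: Rintegral_ge0 => y _; rewrite mulr_ge0// ltW// Pk_gt0.
move=> H; apply: le_trans (le_trans _ H) _.
  rewrite -[leLHS]real_normK ?num_real// ler_pXn2r ?nnegrE//; first exact: cv_Pk_norm.
  by rewrite (le_trans _ (cv_Pk_norm x t0 bk)).
rewrite le_eqVlt; apply/orP; left; apply/eqP; apply: eq_Rintegral => y _.
by rewrite powR_mulrn// real_normK ?num_real.
Qed.

(** Here one iterated integral of |f| is bounded instead of |f| itself by a product; [gamma_FT] uses
    this form, where that iterated integral is known exactly. *)
Lemma Rint_fubini_gen (f : R -> R -> R) (G : R -> R) :
  measurable_fun setT (fun z : R * R => f z.1 z.2) ->
  (forall x, integ (f x)) -> (forall y, integ (f ^~ y)) -> integ G ->
  (forall y, \I (fun x => `|f x y|) <= G y) ->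
  \I (fun x => \I (f x)) = \I (fun y => \I (fun x => f x y)).
Proof.
move=> mf i1 i2 iG fG.
have iab : (mu \x mu)%E.-integrable setT (EFin \o (fun z : R * R => f z.1 z.2)).
  apply/integrable21ltyP; first exact/measurable_EFinP.
  apply: (@le_lt_trans _ _ (\int[mu]_y (G y)%:E)%E); last first.
    exact: (integrable_lty measurableT iG).
  apply: ge0_le_integral => //.
  - by move=> y _; exact: integral_ge0.
  - apply: (@measurable_fun_fubini_tonelli_G _ _ _ _ _ mu
      (fun z : R * R => `|(f z.1 z.2)%:E|%E)) => //.
    by apply: measurableT_comp => //; exact/measurable_EFinP.
  - by apply/measurable_EFinP; exact: integ_measurable.
  - move=> y _ /=; rewrite -Rint_EFin; last exact: integ_norm.
    by rewrite lee_fin.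
have := Fubini iab; rewrite /= => E.
rewrite /Rintegral; congr fine.
transitivity (\int[mu]_x \int[mu]_y (f x y)%:E)%E.
  by apply: eq_integral => x _; rewrite -[in RHS]Rint_EFin.
by rewrite E; apply: eq_integral => y _; rewrite -[in LHS]Rint_EFin.
Qed.

(** The density r^(s-1) of the half-line. The indicator removes r <= 0, where [powR] has default
    values, so that integrals can be taken over the whole line. *)
Definition pw s r : R := \1_(`]0, +oo[%classic) r * r `^ (s - 1).

Lemma pw_ge0 s r : 0 <= pw s r.
Proof. by rewrite /pw mulr_ge0// powR_ge0. Qed.

Lemma pwE s r : 0 < r -> pw s r = r `^ (s - 1).
Proof. by move=> r0; rewrite /pw indicE mem_set ?mul1r//= in_itv/= r0. Qed.

Lemma pw0 s r : r <= 0 -> pw s r = 0.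
Proof.
move=> r0; rewrite /pw indicE memNset ?mul0r//= in_itv/= andbT.
by apply/negP; rewrite -leNgt.
Qed.

Lemma measurable_pw s : measurable_fun setT (pw s).
Proof.
apply: measurable_funM; first by apply: measurable_indic.
exact: measurable_powR.
Qed.

End fourier_semigroup.

(** * Superposition operators and a Schur test *)

Section schur.
Context {R : realType}.
Local Notation mu := (@lebesgue_measure R).
Implicit Types (a s t x y z r u : R).
Local Open Scope ereal_scope.

Lemma lei (f g : R -> \bar R) : measurable_fun setT f -> measurable_fun setT g ->
  (forall x, 0 <= f x) -> (forall x, f x <= g x) ->
  \int[mu]_x f x <= \int[mu]_x g x.
Proof. by move=> mf mg f0 fg; apply: ge0_le_integral. Qed.

Lemma measurable_EF d (T : measurableType d) (f : T -> R) :
  measurable_fun setT f -> measurable_fun setT (fun p => (f p)%:E).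
Proof. by move=> mf; exact/measurable_EFinP. Qed.

Lemma eiD (f g : R -> \bar R) : measurable_fun setT f -> measurable_fun setT g ->
  (forall x, 0 <= f x) -> (forall x, 0 <= g x) ->
  \int[mu]_x (f x + g x) = \int[mu]_x f x + \int[mu]_x g x.
Proof. by move=> mf mg f0 g0; rewrite ge0_integralD. Qed.

Lemma eiZ (k : \bar R) (f : R -> \bar R) : measurable_fun setT f ->
  (forall x, 0 <= f x) -> 0 <= k -> \int[mu]_x (k * f x) = k * \int[mu]_x f x.
Proof. by move=> mf f0 k0; rewrite ge0_integralZl. Qed.

Lemma eiZD (k l : R) (f g : R -> R) : (0 <= k)%R -> (0 <= l)%R ->
  measurable_fun setT f -> measurable_fun setT g ->
  (forall x, 0 <= f x)%R -> (forall x, 0 <= g x)%R ->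
  \int[mu]_x ((k * f x)%:E + (l * g x)%:E) =
  k%:E * \int[mu]_x (f x)%:E + l%:E * \int[mu]_x (g x)%:E.
Proof.
move=> k0 l0 mf mg f0 g0; have mf' := measurable_EF mf; have mg' := measurable_EF mg.
have f0' x : 0 <= (f x)%:E by rewrite lee_fin.
have g0' x : 0 <= (g x)%:E by rewrite lee_fin.
rewrite eiD.
- rewrite -!eiZ//; do ?by rewrite lee_fin.
- by apply: measurable_EF; exact: measurable_funM.
- by apply: measurable_EF; exact: measurable_funM.
- by move=> x; rewrite lee_fin mulr_ge0.
- by move=> x; rewrite lee_fin mulr_ge0.
Qed.

Lemma integral_bigcup_le (S : nat -> set R) (f : R -> \bar R) K :
  nondecreasing_seq S -> (forall n, measurable (S n)) -> measurable_fun setT f ->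
  (forall x, 0 <= f x) -> (forall n, \int[mu]_(x in S n) f x <= K) ->
  \int[mu]_(x in \bigcup_n S n) f x <= K.
Proof.
move=> ndS mS mf f0 fK.
have cvg : (fun n => \int[mu]_(x in S n) f x) @ \oo -->
    \int[mu]_(x in \bigcup_n S n) f x.
  apply: ge0_nondecreasing_set_cvg_integral => //.
  by move=> n; exact: measurable_funTS.
rewrite -(cvg_lim _ cvg)//; apply: lime_le; first by apply/cvg_ex; eexists; exact: cvg.
exact: nearW.
Qed.

Lemma integral_indic_mul (D : set R) (f : R -> R) : measurable D ->
  \int[mu]_x (\1_D x * f x)%:E = \int[mu]_(x in D) (f x)%:E.
Proof.
move=> mD; rewrite [RHS]integral_mkcond; apply: eq_integral => x _.
by rewrite /patch indicE; case: ifP => _; rewrite ?mul1r ?mul0r.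
Qed.

Lemma integral_itv_powR (p a b : R) : (0 < a)%R -> (a <= b)%R -> p != 0%R ->
  \int[mu]_(r in `[a, b]) (r `^ (p - 1))%:E = ((b `^ p - a `^ p) / p)%:E.
Proof.
move=> a0 ab p0.
have [||i E] := @Rint_FTC _ (fun r => (p^-1 * r `^ p)%R) (fun r => (r `^ (p - 1))%R) a b ab.
- move=> x /andP[ax _]; have x0 := lt_le_trans a0 ax.
  have D := @is_derive1_powR _ p x x0.
  by apply: is_derive_eq; rewrite /GRing.scale /= mulrA mulVf// mul1r.
- move=> x /andP[ax _]; have x0 := lt_le_trans a0 ax.
  have D := @is_derive1_powR _ (p - 1) x x0.
  exact: (derive_cont D).
rewrite -(Rint_in_EFin (measurable_itv _) i) E.
by congr EFin; rewrite mulrBl ![(_ / p)%R]mulrC.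
Qed.

Lemma pw_near0 s b : (0 < s)%R -> (0 < b)%R ->
  \int[mu]_r (\1_(`]-oo, b]%classic) r * pw s r)%:E <= (b `^ s / s)%:E.
Proof.
move=> s0 b0; pose S n : set R := `[(b / n.+1%:R)%R, b]%classic.
have bn n : (0 < b / n.+1%:R)%R by rewrite divr_gt0.
have bnb n : (b / n.+1%:R <= b)%R by rewrite ler_pdivrMr// ler_pMr// ler1n.
have SU : \bigcup_n S n = `]0%R, b]%classic.
  apply/seteqP; split => [r [n _]|r].
    by rewrite /S /= !in_itv/= => /andP[h ->]; rewrite (lt_le_trans (bn n) h).
  rewrite /= in_itv/= => /andP[r0 rb]; exists (Num.truncn (b / r)) => //.
  rewrite /S /= in_itv/= rb andbT.
  rewrite ler_pdivrMr// mulrC -ler_pdivrMr//.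
  by rewrite ltW// truncnS_gt.
have -> : \int[mu]_r (\1_(`]-oo, b]%classic) r * pw s r)%:E =
    \int[mu]_(r in \bigcup_n S n) (r `^ (s - 1))%:E.
  rewrite -[RHS]integral_indic_mul ?SU; last exact: measurable_itv.
  apply: eq_integral => r _; congr EFin; rewrite /pw mulrA; congr (_ * _)%R.
  rewrite !indicE !mem_setE !in_itv/= andbT andbC.
  by case: (0 < r)%R; rewrite ?mulr0 ?mulr1 ?andbT ?andbF.
apply: integral_bigcup_le.
- move=> m n mn; apply/subsetPset => r; rewrite /S /= !in_itv/= => /andP[h ->].
  by rewrite andbT (le_trans _ h)// ler_pM2l// lef_pV2 ?posrE// ler_nat.
- by move=> n; exact: measurable_itv.
- by apply/measurable_EFinP; exact: measurable_powR.
- by move=> r; rewrite lee_fin powR_ge0.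
- move=> n; rewrite integral_itv_powR ?gt_eqF// lee_fin.
  by rewrite ler_pM2r ?invr_gt0// gerBl powR_ge0.
Qed.

Lemma pw_far s a : (s < 1)%R -> (0 < a)%R ->
  \int[mu]_r (\1_(`[a, +oo[%classic) r * pw (s - 1) r)%:E <= (a `^ (s - 1) / (1 - s))%:E.
Proof.
move=> s1 a0; pose S n : set R := `[a, (a + n%:R)%R]%classic.
have SU : \bigcup_n S n = `[a, +oo[%classic.
  apply/seteqP; split => [r [n _]|r].
    by rewrite /S /= !in_itv/= => /andP[-> _].
  rewrite /= in_itv/= andbT => ar; exists (Num.truncn (r - a)).+1 => //.
  rewrite /S /= in_itv/= ar/=.
  by rewrite -lerBlDl ltW// truncnS_gt.
have -> : \int[mu]_r (\1_(`[a, +oo[%classic) r * pw (s - 1) r)%:E =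
    \int[mu]_(r in \bigcup_n S n) (r `^ (s - 1 - 1))%:E.
  rewrite -[RHS]integral_indic_mul ?SU; last exact: measurable_itv.
  apply: eq_integral => r _; congr EFin; rewrite /pw mulrA; congr (_ * _)%R.
  rewrite !indicE !mem_setE !in_itv/= !andbT.
  by case: (leP a r) => ar; rewrite ?mul0r// (lt_le_trans a0 ar) mulr1.
apply: integral_bigcup_le.
- move=> m n mn; apply/subsetPset => r; rewrite /S /= !in_itv/= => /andP[-> h].
  by rewrite (le_trans h)//= lerD2l ler_nat.
- by move=> n; exact: measurable_itv.
- by apply/measurable_EFinP; exact: measurable_powR.
- by move=> r; rewrite lee_fin powR_ge0.
- move=> n; rewrite integral_itv_powR ?lerDl//; last by rewrite lt_eqF// subr_lt0.
  rewrite lee_fin.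
  have s10 : (0 < 1 - s)%R by rewrite subr_gt0.
  have -> : ((s - 1)^-1 = - (1 - s)^-1)%R by rewrite -invrN opprB.
  by rewrite mulrN -mulNr opprB ler_pM2r ?invr_gt0// gerBl powR_ge0.
Qed.

Lemma ge0_integral_shift (f : R -> \bar R) b : measurable_fun setT f ->
  (forall x, 0 <= f x) -> \int[mu]_x f (x + b)%R = \int[mu]_x f x.
Proof.
move=> mf f0; have := @ge0_integral_affine R 1%R b f ltr01 mf f0.
by rewrite invr1 mul1e => <-; apply: eq_integral => x _; rewrite mul1r.
Qed.

Lemma measurable_pwc d (T : measurableType d) (f : T -> R) s :
  measurable_fun setT f -> measurable_fun setT (fun p => pw s (f p)).
Proof. by move=> mf; exact: (measurableT_comp (measurable_pw s)). Qed.

Lemma measurable_indicc d (T : measurableType d) (D : set R) (f : T -> R) :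
  measurable D -> measurable_fun setT f ->
  measurable_fun setT (fun p => (\1_D (f p) : R)).
Proof. by move=> mD mf; apply: (measurableT_comp _ mf); exact: measurable_indic. Qed.

Definition pwc s : R := (1 / s + 1 / (1 - s))%R.

Lemma pwc_gt0 s : (0 < s < 1)%R -> (0 < pwc s)%R.
Proof. by move=> /andP[? ?]; rewrite addr_gt0// divr_gt0// subr_gt0. Qed.

Lemma powR_pred x p : (0 < x)%R -> (x `^ (p - 1) = x `^ p / x)%R.
Proof.
by move=> x0; rewrite powRD ?(gt_eqF x0) ?implybT// powRN powRr1 ?ltW.
Qed.

(** The integral is split at r = t. Below, 1 / (t + r) <= 1 / t; above, 1 / (t + r) <= 1 / r, which
    turns [pw s] into [pw (s - 1)]. *)
Lemma pw_div s t : (0 < s < 1)%R -> (0 < t)%R ->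
  \int[mu]_r (pw s r / (t + r))%:E <= (t `^ (s - 1) * pwc s)%:E.
Proof.
move=> /andP[s0 s1] t0.
have mA : measurable (`]-oo, t]%classic : set R) by exact: measurable_itv.
have mB : measurable (`[t, +oo[%classic : set R) by exact: measurable_itv.
have m1 : measurable_fun setT (fun r => \1_(`]-oo, t]%classic) r * pw s r)%R.
  by apply: measurable_funM; [exact: measurable_indic|exact: measurable_pw].
have m2 : measurable_fun setT (fun r => \1_(`[t, +oo[%classic) r * pw (s - 1) r)%R.
  by apply: measurable_funM; [exact: measurable_indic|exact: measurable_pw].
apply: (@le_trans _ _ (\int[mu]_r ((t^-1 * (\1_(`]-oo, t]%classic) r * pw s r))%:E +
   (\1_(`[t, +oo[%classic) r * pw (s - 1) r)%:E))).
  apply: lei.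
  - apply/measurable_EFinP; apply: measurable_funM; first exact: measurable_pw.
    by apply: measurable_funV; exact: measurable_funD.
  - by apply: emeasurable_funD; apply/measurable_EFinP => //; exact: measurable_funM.
  - move=> r; have [r0|r0] := leP r 0%R; first by rewrite (pw0 s r0) mul0r.
    by rewrite lee_fin mulr_ge0 ?pw_ge0// invr_ge0 addr_ge0// ltW.
  - move=> r; have [r0|r0] := leP r 0%R; first by rewrite !pw0// mul0r !mulr0 adde0.
    rewrite -EFinD lee_fin !indicE !mem_setE !in_itv/= andbT.
    have p0 := pw_ge0 s r; have p1 := pw_ge0 (s - 1) r.
    have [rt|tr] := leP r t.
      apply: (@le_trans _ _ (t^-1 * (1%:R * pw s r))%R).
        rewrite mul1r mulrC ler_wpM2r// lef_pV2 ?posrE ?addr_gt0//.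
        by rewrite lerDl ltW.
      by rewrite lerDl mulr_ge0.
    rewrite mul0r mulr0 add0r (ltW tr) mul1r !pwE// [leRHS]powR_pred//.
    by rewrite ler_wpM2l ?powR_ge0// lef_pV2 ?posrE ?addr_gt0// lerDr ltW.
rewrite ge0_integralD//; last 4 first.
- by move=> r _; rewrite lee_fin mulr_ge0 ?invr_ge0 ?(ltW t0)// mulr_ge0// pw_ge0.
- by apply/measurable_EFinP; exact: measurable_funM.
- by move=> r _; rewrite lee_fin mulr_ge0// pw_ge0.
- exact/measurable_EFinP.
under eq_integral do rewrite EFinM.
rewrite ge0_integralZl//; last 3 first.
- exact/measurable_EFinP.
- by move=> r _; rewrite lee_fin mulr_ge0// pw_ge0.
- by rewrite lee_fin invr_ge0 ltW.
apply: (@le_trans _ _ (t^-1%:E * (t `^ s / s)%:E + (t `^ (s - 1) / (1 - s))%:E)).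
  by apply: leeD; [rewrite lee_wpmul2l ?lee_fin ?invr_ge0 ?(ltW t0)// pw_near0|exact: pw_far].
rewrite -EFinM -EFinD lee_fin /pwc powR_pred//.
by rewrite le_eqVlt; apply/orP; left; apply/eqP; field; rewrite !gt_eqF// subr_gt0.
Qed.

(** A bound for the Beta integral. It is split at u/2, and on each half the nonsingular factor is at
    most its value at u/2; the powers of u cancel since s1 + s2 = 1. *)
Lemma pw_beta s1 s2 u : (0 < s1)%R -> (0 < s2)%R -> (s1 + s2 = 1)%R ->
  \int[mu]_t (pw s2 t * pw s1 (u - t))%:E <= (1 / s1 + 1 / s2)%:E.
Proof.
move=> s10 s20 s12.
have [u0|u0] := leP u 0%R.
  rewrite integral0_eq ?lee_fin ?addr_ge0 ?divr_ge0 ?ltW// => t _.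
  have [t0|t0] := leP t 0%R; first by rewrite (pw0 s2 t0) mul0r.
  by rewrite (pw0 s1) ?mulr0// subr_le0 (le_trans u0)// ltW.
pose b := (u / 2)%R; have b0 : (0 < b)%R by rewrite divr_gt0.
pose I r : R := \1_(`]-oo, b]%classic) r.
have mI : measurable_fun setT I by apply: measurable_indic.
have mF s : measurable_fun setT (fun r => I r * pw s r)%R.
  by apply: measurable_funM => //; exact: measurable_pw.
have mG : measurable_fun setT (fun r => I (u - r) * pw s1 (u - r))%R.
  by apply: (measurableT_comp (mF s1)); exact: measurable_funB.
apply: (@le_trans _ _ (\int[mu]_t ((b `^ (s1 - 1) * (I t * pw s2 t))%:E +
    (b `^ (s2 - 1) * (I (u - t) * pw s1 (u - t)))%:E))).
  apply: lei.
  - apply/measurable_EFinP; apply: measurable_funM; first exact: measurable_pw.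
    by apply: measurable_pwc; exact: measurable_funB.
  - by apply: emeasurable_funD; apply/measurable_EFinP; exact: measurable_funM.
  - by move=> t; rewrite lee_fin mulr_ge0 ?pw_ge0.
  - move=> t; rewrite -EFinD lee_fin /I !indicE !mem_setE !in_itv/=.
    have p1 := pw_ge0 s1 (u - t)%R; have p2 := pw_ge0 s2 t.
    have mono s v : (0 < s < 1)%R -> (b <= v)%R -> (pw s v <= b `^ (s - 1))%R.
      move=> /andP[s0 s1'] bv; rewrite pwE ?(lt_le_trans b0)//.
      rewrite -(opprB 1%R s) !powRN lef_pV2 ?posrE ?powR_gt0 ?(lt_le_trans b0)//.
      have v0 := lt_le_trans b0 bv.
      by apply: ge0_ler_powR; rewrite ?nnegrE ?subr_ge0// ltW.
    have s1' : (0 < s1 < 1)%R by rewrite s10/=; lra.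
    have s2' : (0 < s2 < 1)%R by rewrite s20/=; lra.
    have ub : (u = b + b)%R by rewrite /b; lra.
    have [tb|tb] := leP t b.
      rewrite mul1r mulrC; apply: (@le_trans _ _ (b `^ (s1 - 1) * pw s2 t)%R).
        by rewrite ler_wpM2r// mono// ub; lra.
      by rewrite lerDl !mulr_ge0 ?powR_ge0.
    have -> : (u - t <= b)%R by rewrite ub; lra.
    rewrite mul0r mulr0 add0r mul1r ler_wpM2r//.
    by rewrite mono// ltW.
have Ipw s r : (0 <= I r * pw s r)%R by rewrite mulr_ge0// pw_ge0.
rewrite (eiZD (powR_ge0 _ _) (powR_ge0 _ _) (mF s2) mG (Ipw s2) (fun r => Ipw s1 (u - r)%R)).
have -> : \int[mu]_r (I (u - r) * pw s1 (u - r))%:E = \int[mu]_r (I r * pw s1 r)%:E.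
  have e1 := @ge0_integral_shift (fun r => (I r * pw s1 r)%:E) u
     ((measurable_EFinP _ _).2 (mF s1)) (fun r => Ipw s1 r).
  have m3 : measurable_fun setT (fun r => (I (r + u) * pw s1 (r + u))%:E).
    by apply/measurable_EFinP; apply: (measurableT_comp (mF s1)); exact: measurable_funD.
  rewrite -e1 -(@ge0_integral_refl _ _ m3) => [|r]; last by rewrite lee_fin.
  by apply: eq_integral => r _; rewrite addrC.
apply: (@le_trans _ _ ((b `^ (s1 - 1))%:E * (b `^ s2 / s2)%:E +
    (b `^ (s2 - 1))%:E * (b `^ s1 / s1)%:E)).
  by apply: leeD; rewrite lee_wpmul2l ?lee_fin ?powR_ge0// pw_near0.
rewrite -!EFinM -EFinD lee_fin !mulrA -!powRD ?(gt_eqF b0) ?implybT//.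
rewrite (_ : s1 - 1 + s2 = 0)%R; last lra.
rewrite (_ : s2 - 1 + s1 = 0)%R; last lra.
by rewrite powRr0 addrC.
Qed.

(** A product of integrals is a double integral, so a pointwise bound by two products can be
    integrated. Everything is nonnegative and may be infinite. *)
Lemma mul_integral_le (f1 g1 f2 g2 f3 g3 : R -> \bar R) (k l : \bar R) :
  measurable_fun setT f1 -> measurable_fun setT g1 ->
  measurable_fun setT f2 -> measurable_fun setT g2 ->
  measurable_fun setT f3 -> measurable_fun setT g3 ->
  (forall x, 0 <= f1 x) -> (forall x, 0 <= g1 x) -> (forall x, 0 <= f2 x) ->
  (forall x, 0 <= g2 x) -> (forall x, 0 <= f3 x) -> (forall x, 0 <= g3 x) ->
  0 <= k -> 0 <= l ->
  (forall x y, f1 x * g1 y <= k * (f2 x * g2 y) + l * (f3 x * g3 y)) ->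
  (\int[mu]_x f1 x) * (\int[mu]_x g1 x) <=
  k * ((\int[mu]_x f2 x) * (\int[mu]_x g2 x)) +
  l * ((\int[mu]_x f3 x) * (\int[mu]_x g3 x)).
Proof.
move=> mf1 mg1 mf2 mg2 mf3 mg3 f10 g10 f20 g20 f30 g30 k0 l0 H.
have I0 f : (forall x, 0 <= f x) -> 0 <= \int[mu]_x f x.
  by move=> f0; exact: integral_ge0.
have mZ (c : \bar R) f : measurable_fun setT f -> measurable_fun setT (fun x : R => c * f x).
  by move=> mf; exact: measurable_funeM.
have step x : f1 x * \int[mu]_y g1 y <=
    (k * \int[mu]_y g2 y) * f2 x + (l * \int[mu]_y g3 y) * f3 x.
  have kf : 0 <= k * f2 x by exact: mule_ge0.
  have lf : 0 <= l * f3 x by exact: mule_ge0.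
  rewrite -eiZ//; apply: (@le_trans _ _ (\int[mu]_y ((k * f2 x) * g2 y + (l * f3 x) * g3 y))).
    apply: lei; first exact: mZ.
    - by apply: emeasurable_funD; exact: mZ.
    - by move=> y; exact: mule_ge0.
    - by move=> y; rewrite -!muleA.
  rewrite eiD; [|exact: mZ|exact: mZ|by move=> y; exact: mule_ge0|by move=> y; exact: mule_ge0].
  rewrite !eiZ// le_eqVlt; apply/orP; left; apply/eqP.
  by congr (_ + _); rewrite -!muleA; congr (_ * _); rewrite muleC.
rewrite muleC -eiZ//; last exact: I0.
apply: (@le_trans _ _ (\int[mu]_x ((k * \int[mu]_y g2 y) * f2 x + (l * \int[mu]_y g3 y) * f3 x))).
  apply: lei; first exact: mZ.
  - by apply: emeasurable_funD; exact: mZ.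
  - by move=> x; apply: mule_ge0 => //; exact: I0.
  - by move=> x; rewrite muleC.
have K2 : 0 <= k * \int[mu]_y g2 y by apply: mule_ge0 => //; exact: I0.
have K3 : 0 <= l * \int[mu]_y g3 y by apply: mule_ge0 => //; exact: I0.
rewrite eiD; [|exact: mZ|exact: mZ|by move=> y; exact: mule_ge0|by move=> y; exact: mule_ge0].
rewrite !eiZ// le_eqVlt; apply/orP; left; apply/eqP.
by congr (_ + _); rewrite -!muleA; congr (_ * _); rewrite muleC.
Qed.

Lemma amgm_weight (W a b : R) : (0 < W)%R -> (0 <= a)%R -> (0 <= b)%R ->
  (a * b <= W * a ^+ 2 + W^-1 * b ^+ 2)%R.
Proof.
move=> W0 a0 b0.
have h1 : (0 <= W * (a - b / W) ^+ 2)%R by rewrite mulr_ge0 ?sqr_ge0// ltW.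
have h2 : (W * (a - b / W) ^+ 2 = W * a ^+ 2 + W^-1 * b ^+ 2 - 2 * (a * b))%R.
  by field; rewrite gt_eqF.
have : (0 <= a * b)%R by rewrite mulr_ge0.
by rewrite h2 in h1; move: h1; lra.
Qed.

(* The superposition operator whose kernel inverts a fractional derivative of
   order [s] along the semigroup. *)
Definition TT s (f : R -> R) t : \bar R := \int[mu]_r (pw s r * f (t + r))%:E.

Lemma measurable_TT d (T : measurableType d) s (f : T -> R -> R) (g : T -> R) :
  measurable_fun setT (fun z : T * R => f z.1 z.2) -> measurable_fun setT g ->
  (forall p t, (0 <= f p t)%R) ->
  measurable_fun setT (fun p => TT s (f p) (g p)).
Proof.
move=> mf mg f0.
apply: (@measurable_fun_fubini_tonelli_F _ _ _ _ _ mu (fun z : T * R =>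
   (pw s z.2 * f z.1 (g z.1 + z.2))%:E)).
  apply/measurable_EFinP; apply: measurable_funM; first by apply: measurable_pwc.
  apply: (measurableT_comp mf (g := fun z : T * R => (z.1, g z.1 + z.2)%R)).
  apply: measurable_fun_pair => //; apply: measurable_funD => //.
  exact: (measurableT_comp mg).
by move=> z; rewrite lee_fin mulr_ge0 ?pw_ge0.
Qed.

Lemma TT_ge0 s f t : (forall t, 0 <= f t)%R -> 0 <= TT s f t.
Proof. by move=> f0; apply: integral_ge0 => r _; rewrite lee_fin mulr_ge0 ?pw_ge0. Qed.

(** By [pw_div] the second factor is at most a constant times t^(s2-1). After the substitution u = t
    + r and Tonelli, the t-integral that remains is the Beta integral of [pw_beta]. The absolute
    value around t + r only serves to make the integrand nonnegative on the whole line. *)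
Lemma pw_kernel_bound s1 s2 (F : R -> R) : (0 < s1)%R -> (0 < s2)%R ->
  (s1 + s2 = 1)%R -> measurable_fun setT F -> (forall u, 0 <= F u)%R ->
  \int[mu]_(t in `]0%R, +oo[) ((\int[mu]_r (pw s1 r * F (t + r))%:E) *
     (\int[mu]_r (pw s2 r / `|t + r|)%:E)) <=
  (pwc s2 * (1 / s1 + 1 / s2))%:E * \int[mu]_u (\1_(`]0%R, +oo[%classic) u * F u)%:E.
Proof.
move=> s10 s20 s12 mF F0.
have s2' : (0 < s2 < 1)%R by rewrite s20/=; lra.
have c0 := pwc_gt0 s2'.
have mp : measurable_fun setT (fun z : R * R => (pw s1 z.2 * F (z.1 + z.2))%:E).
  apply/measurable_EFinP; apply: measurable_funM; first exact: measurable_pwc.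
  by apply: (measurableT_comp mF); exact: measurable_funD.
have m1 : measurable_fun setT (fun t => \int[mu]_r (pw s1 r * F (t + r))%:E).
  apply: (@measurable_fun_fubini_tonelli_F _ _ _ _ _ mu (fun z : R * R =>
    (pw s1 z.2 * F (z.1 + z.2))%:E)) => // z.
  by rewrite lee_fin mulr_ge0 ?pw_ge0.
have m2 : measurable_fun setT (fun t => \int[mu]_r (pw s2 r / `|t + r|)%:E).
  apply: (@measurable_fun_fubini_tonelli_F _ _ _ _ _ mu (fun z : R * R =>
    (pw s2 z.2 / `|z.1 + z.2|)%:E)) => //.
    apply: measurable_EF; apply: measurable_funM; first exact: measurable_pwc.
    by apply: measurable_funV; apply: measurableT_comp => //; exact: measurable_funD.
  by move=> z; rewrite lee_fin divr_ge0 ?pw_ge0.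
have j0 t : 0 <= \int[mu]_r (pw s2 r / `|t + r|)%:E.
  by apply: integral_ge0 => r _; rewrite lee_fin divr_ge0 ?pw_ge0.
have i0 t : 0 <= \int[mu]_r (pw s1 r * F (t + r))%:E.
  by apply: integral_ge0 => r _; rewrite lee_fin mulr_ge0 ?pw_ge0.
apply: (@le_trans _ _ (\int[mu]_t ((pwc s2)%:E * ((pw s2 t)%:E *
    \int[mu]_r (pw s1 r * F (t + r))%:E)))).
  rewrite integral_mkcond; apply: lei.
  - apply/(measurable_restrictT _ _).1 => //.
    by apply: measurable_funTS; exact: emeasurable_funM.
  - apply: emeasurable_funM => //; apply: emeasurable_funM => //.
    by apply: measurable_EF; exact: measurable_pw.
  - by move=> t; rewrite /patch; case: ifPn => // _; exact: mule_ge0.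
  - move=> t; rewrite /patch; case: ifPn => tp; last first.
      by apply: mule_ge0; [|apply: mule_ge0]; rewrite ?lee_fin ?(ltW c0) ?pw_ge0.
    move: tp; rewrite mem_setE in_itv/= andbT => t0.
    rewrite muleA -EFinM muleC lee_wpmul2r//.
    rewrite [leLHS](_ : _ = \int[mu]_r (pw s2 r / (t + r))%:E).
      by rewrite (le_trans (pw_div s2' t0))// lee_fin pwE// mulrC.
    apply: eq_integral => r _; have [r0|r0] := leP r 0%R; first by rewrite (pw0 _ r0) !mul0r.
    by rewrite gtr0_norm// addr_gt0.
rewrite ge0_integralZl//; last 3 first.
- by apply: emeasurable_funM => //; apply/measurable_EFinP; exact: measurable_pw.
- by move=> t _; rewrite mule_ge0 ?lee_fin ?pw_ge0.
- by rewrite lee_fin ltW.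
rewrite EFinM -muleA; apply: lee_wpmul2l; first by rewrite lee_fin ltW.
have mq : measurable_fun setT (fun z : R * R => (pw s1 (z.2 - z.1) * F z.2)%:E).
  apply/measurable_EFinP; apply: measurable_funM.
    by apply: measurable_pwc; exact: measurable_funB.
  exact: (measurableT_comp mF).
have mq2 : measurable_fun setT (fun z : R * R => (pw s2 z.1)%:E * (pw s1 (z.2 - z.1) * F z.2)%:E).
  by apply: emeasurable_funM => //; apply/measurable_EFinP; exact: measurable_pwc.
have q0 t u : 0 <= (pw s1 (u - t) * F u)%:E by rewrite lee_fin mulr_ge0 ?pw_ge0.
have Q0 t u : 0 <= (pw s2 t)%:E * (pw s1 (u - t) * F u)%:E.
  by apply: mule_ge0 => //; rewrite lee_fin pw_ge0.
rewrite [leLHS](_ : _ = \int[mu]_t \int[mu]_u ((pw s2 t)%:E * (pw s1 (u - t) * F u)%:E)).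
  rewrite (tonelli_in measurableT measurableT) => //.
  have mI : measurable_fun setT (fun u => (\1_(`]0%R, +oo[%classic) u * F u)%R).
    by apply: measurable_funM => //; apply: measurable_indic.
  rewrite -(eiZ (measurable_EF mI)); last 2 first.
  - by move=> u; rewrite lee_fin mulr_ge0.
  - by rewrite lee_fin addr_ge0// divr_ge0// ltW.
  apply: lei.
  - apply: (@measurable_fun_fubini_tonelli_G _ _ _ _ _ mu (fun z : R * R =>
      (pw s2 z.1)%:E * (pw s1 (z.2 - z.1) * F z.2)%:E)) => // z.
  - by apply: emeasurable_funM => //; exact: measurable_EF.
  - by move=> u; apply: integral_ge0 => t _.
  - move=> u.
    have [u0|u0] := leP u 0%R.
      have r0 : 0 <= (1 / s1 + 1 / s2)%:E * (\1_(`]0%R, +oo[%classic) u * F u)%:E.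
        by apply: mule_ge0; rewrite lee_fin ?mulr_ge0// addr_ge0// divr_ge0// ltW.
      rewrite integral0_eq// => t _.
      have [t0|t0] := leP t 0%R; first by rewrite (pw0 s2 t0) mul0e.
      by rewrite (pw0 s1) ?mul0r ?mule0// subr_le0 (le_trans u0)// ltW.
    have -> : (\1_(`]0%R, +oo[%classic) u * F u = F u)%R.
      by rewrite indicE mem_setE in_itv/= u0/= mul1r.
    rewrite [leLHS](_ : _ = \int[mu]_t ((F u)%:E * (pw s2 t * pw s1 (u - t))%:E)).
      rewrite ge0_integralZl//; last 3 first.
      + apply/measurable_EFinP; apply: measurable_funM; first exact: measurable_pw.
        by apply: measurable_pwc; exact: measurable_funB.
      + by move=> t _; rewrite lee_fin mulr_ge0 ?pw_ge0.
      + by rewrite lee_fin.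
      by rewrite muleC lee_wpmul2r ?lee_fin// pw_beta.
    by apply: eq_integral => t _; rewrite -!EFinM; congr EFin; ring.
apply: eq_integral => t _.
rewrite -ge0_integralZl//; last 3 first.
- exact: (measurable_sec1 t mp).
- by move=> r _; rewrite lee_fin mulr_ge0 ?pw_ge0.
- by rewrite lee_fin pw_ge0.
have mr : measurable_fun setT (fun u => (pw s2 t)%:E * (pw s1 (u - t) * F u)%:E).
  exact: (measurable_sec1 t mq2).
rewrite -(ge0_integral_shift t mr)=> //.
by apply: eq_integral => r _; rewrite addrK (addrC r).
Qed.

Definition schurC s1 s2 : R := ((pwc s1 + pwc s2) * (1 / s1 + 1 / s2))%R.

(** The product f(t+x) g(t+y) is split by the arithmetic-geometric inequality with weight w
    (t+x)/(t+y). The square of f then meets the kernel 1/(t+y) and the square of g the kernel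
    1/(t+x), and [pw_kernel_bound] treats both. The free parameter w is what later allows a weight
    depending on the space variable. *)
Lemma schur s1 s2 (f g : R -> R) w : (0 < s1)%R -> (0 < s2)%R ->
  (s1 + s2 = 1)%R -> (0 < w)%R -> measurable_fun setT f -> measurable_fun setT g ->
  (forall u, 0 <= f u)%R -> (forall u, 0 <= g u)%R ->
  \int[mu]_(t in `]0%R, +oo[) (TT s1 f t * TT s2 g t) <=
  (schurC s1 s2)%:E *
    (w%:E * \int[mu]_u (\1_(`]0%R, +oo[%classic) u * (`|u| * f u ^+ 2))%:E +
     (w^-1)%:E * \int[mu]_u (\1_(`]0%R, +oo[%classic) u * (`|u| * g u ^+ 2))%:E).
Proof.
move=> s10 s20 s12 w0 mf mg f0 g0.
have s1' : (0 < s1 < 1)%R by rewrite s10/=; lra.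
have s2' : (0 < s2 < 1)%R by rewrite s20/=; lra.
have c1 := pwc_gt0 s1'; have c2 := pwc_gt0 s2'.
pose F (h : R -> R) (u : R) : R := (`|u| * h u ^+ 2)%R.
have F0 h u : (0 <= F h u)%R by rewrite mulr_ge0 ?sqr_ge0.
have mF h : measurable_fun setT h -> measurable_fun setT (F h).
  move=> mh; apply: measurable_funM; first exact: normr_measurable.
  exact: measurable_funX.
pose A s h t := \int[mu]_r (pw s r * F h (t + r))%:E.
pose B s t := \int[mu]_r (pw s r / `|t + r|)%:E.
have mm1 s h t : measurable_fun setT h -> measurable_fun setT (fun r => (pw s r * h (t + r))%:E).
  move=> mh; apply: measurable_EF; apply: measurable_funM; first exact: measurable_pw.
  by apply: (measurableT_comp mh); exact: measurable_funD.
have mm2 s t : measurable_fun setT (fun r => (pw s r / `|t + r|)%:E).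
  apply: measurable_EF; apply: measurable_funM; first exact: measurable_pw.
  by apply: measurable_funV; apply: measurableT_comp => //; exact: measurable_funD.
have mB s : measurable_fun setT (B s).
  apply: (@measurable_fun_fubini_tonelli_F _ _ _ _ _ mu (fun z : R * R =>
    (pw s z.2 / `|z.1 + z.2|)%:E)) => //.
    apply: measurable_EF; apply: measurable_funM; first exact: measurable_pwc.
    by apply: measurable_funV; apply: measurableT_comp => //; exact: measurable_funD.
  by move=> z; rewrite lee_fin divr_ge0 ?pw_ge0.
have mA s h : measurable_fun setT h -> measurable_fun setT (A s h).
  move=> mh; apply: (@measurable_fun_fubini_tonelli_F _ _ _ _ _ mu (fun z : R * R =>
    (pw s z.2 * F h (z.1 + z.2))%:E)) => // [|z]; last by rewrite lee_fin mulr_ge0 ?pw_ge0.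
  apply: measurable_EF; apply: measurable_funM; first exact: measurable_pwc.
  by apply: (measurableT_comp (mF h mh)); exact: measurable_funD.
have p0 s h t r : (forall u, 0 <= h u)%R -> 0 <= (pw s r * h (t + r))%:E.
  by move=> h0; rewrite lee_fin mulr_ge0 ?pw_ge0.
have q0 s t r : 0 <= (pw s r / `|t + r|)%:E by rewrite lee_fin divr_ge0 ?pw_ge0.
have A0 s h t : 0 <= A s h t by apply: integral_ge0 => r _; exact: p0.
have B0 s t : 0 <= B s t by exact: integral_ge0.
have pt t : (0 < t)%R -> TT s1 f t * TT s2 g t <=
    w%:E * (A s1 f t * B s2 t) + (w^-1)%:E * (A s2 g t * B s1 t).
  move=> t0; rewrite [A s2 g t * _]muleC; apply: mul_integral_le.
  - exact: mm1.
  - exact: mm1.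
  - exact: (mm1 s1 (F f) t (mF _ mf)).
  - exact: mm2.
  - exact: mm2.
  - exact: (mm1 s2 (F g) t (mF _ mg)).
  - by move=> r; exact: p0.
  - by move=> r; exact: p0.
  - by move=> r; exact: (p0 s1 (F f)).
  - by move=> r; exact: q0.
  - by move=> r; exact: q0.
  - by move=> r; exact: (p0 s2 (F g)).
  - by rewrite lee_fin ltW.
  - by rewrite lee_fin invr_ge0 ltW.
  move=> x y; rewrite -!EFinM -EFinD lee_fin.
  have [x0|x0] := leP x 0%R; first by rewrite !(pw0 _ x0) !mul0r !mulr0 addr0.
  have [y0|y0] := leP y 0%R; first by rewrite !(pw0 _ y0) !mul0r !mulr0 addr0.
  rewrite /F !gtr0_norm ?addr_gt0//.
  have X0 : (0 < t + x)%R by rewrite addr_gt0.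
  have Y0 : (0 < t + y)%R by rewrite addr_gt0.
  rewrite (_ : w * _ + _ = pw s1 x * pw s2 y * (w * (t + x) / (t + y) * f (t + x) ^+ 2 +
    (w * (t + x) / (t + y))^-1 * g (t + y) ^+ 2))%R; last first.
    by move: (pw _ _) (pw _ _) => a b; field; rewrite !gt_eqF.
  rewrite mulrACA; apply: ler_wpM2l.
    exact: mulr_ge0 (pw_ge0 _ _) (pw_ge0 _ _).
  have W0 : (0 < w * (t + x) / (t + y))%R by rewrite divr_gt0// mulr_gt0.
  exact: amgm_weight W0 (f0 _) (g0 _).
have mAB s s' h : measurable_fun setT h -> measurable_fun setT (fun t => A s h t * B s' t).
  by move=> mh; apply: emeasurable_funM; [exact: mA|exact: mB].
have AB0 s s' h t : 0 <= A s h t * B s' t by exact: mule_ge0.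
have mD : measurable (`]0%R, +oo[%classic : set R) by exact: measurable_itv.
apply: (@le_trans _ _ (\int[mu]_(t in `]0%R, +oo[)
   (w%:E * (A s1 f t * B s2 t) + (w^-1)%:E * (A s2 g t * B s1 t)))).
  apply: ge0_le_integral => //.
  - by move=> t _; apply: mule_ge0; exact: TT_ge0.
  - apply: measurable_funTS; apply: emeasurable_funM.
      by apply: (@measurable_TT _ _ s1 (fun _ => f) id) => //; exact: (measurableT_comp mf).
    by apply: (@measurable_TT _ _ s2 (fun _ => g) id) => //; exact: (measurableT_comp mg).
  - apply: measurable_funTS; apply: emeasurable_funD; apply: measurable_funeM; exact: mAB.
  - by move=> t; rewrite /= in_itv/= andbT => t0; exact: pt.
rewrite ge0_integralD//; last 4 first.
- by move=> t _; apply: mule_ge0 => //; rewrite lee_fin ltW.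
- by apply: measurable_funTS; apply: measurable_funeM; exact: mAB.
- by move=> t _; apply: mule_ge0 => //; rewrite lee_fin invr_ge0 ltW.
- by apply: measurable_funTS; apply: measurable_funeM; exact: mAB.
rewrite !ge0_integralZl//; last 4 first.
- by apply: measurable_funTS; exact: mAB.
- by rewrite lee_fin invr_ge0 ltW.
- by apply: measurable_funTS; exact: mAB.
- by rewrite lee_fin ltW.
have G0 h : 0 <= \int[mu]_u (\1_(`]0%R, +oo[%classic) u * F h u)%:E.
  by apply: integral_ge0 => u _; rewrite lee_fin mulr_ge0.
have i12 : (0 <= 1 / s1 + 1 / s2)%R by rewrite addr_ge0// divr_ge0// ltW.
have wG h v : (0 < v)%R -> 0 <= v%:E * \int[mu]_u (\1_(`]0%R, +oo[%classic) u * F h u)%:E.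
  by move=> v0; apply: mule_ge0 => //; rewrite lee_fin ltW.
have wi0 : (0 < w^-1)%R by rewrite invr_gt0.
rewrite [leRHS]ge0_muleDr; [|exact: wG w0|exact: wG wi0]; apply: leeD.
  rewrite muleCA lee_wpmul2l ?lee_fin ?(ltW w0)//.
  apply: (le_trans (pw_kernel_bound s10 s20 s12 (mF f mf) (F0 f))).
  by rewrite lee_wpmul2r// lee_fin ler_wpM2r// lerDr ltW.
rewrite muleCA lee_wpmul2l ?lee_fin ?invr_ge0 ?(ltW w0)//.
have s21 : (s2 + s1 = 1)%R by rewrite addrC.
apply: (le_trans (pw_kernel_bound s20 s10 s21 (mF g mg) (F0 g))).
by rewrite lee_wpmul2r// lee_fin (addrC (1 / s2)%R) ler_wpM2r// lerDl ltW.
Qed.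
End schur.

(** * Maximal function weights *)

Section maximal.
Context {R : realType}.
Local Notation mu := (@lebesgue_measure R).
Local Notation "\I f" := (Rintegral mu setT f) (at level 10).
Implicit Types (a s t x y z r u : R).

Lemma measurable_ei1 d (T : measurableType d) (f : T -> R -> \bar R) :
  measurable_fun setT (fun z : T * R => f z.1 z.2) -> (forall p y, (0 <= f p y)%E) ->
  measurable_fun setT (fun p => \int[mu]_y f p y)%E.
Proof.
move=> mf f0.
by apply: (@measurable_fun_fubini_tonelli_F _ _ _ _ _ mu (fun z : T * R => f z.1 z.2)).
Qed.

Lemma measurable_ei2 (f : R -> R -> \bar R) :
  measurable_fun setT (fun z : R * R => f z.1 z.2) -> (forall x y, (0 <= f x y)%E) ->
  measurable_fun setT (fun y => \int[mu]_x f x y)%E.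
Proof.
move=> mf f0.
by apply: (@measurable_fun_fubini_tonelli_G _ _ _ _ _ mu (fun z : R * R => f z.1 z.2)).
Qed.

(** A zero of the Poisson integral at a single point would force w = 0 almost everywhere, because
    the kernel is positive. *)
Lemma cv_Pk_pos w t x : 0 < t -> bmeas w -> (forall y, 0 <= w y) ->
  (0 < \int[mu]_y (w y)%:E)%E -> 0 < cv (Pk t) w x.
Proof.
move=> t0 bw w0 wI; have iw := integ_PkM x t0 bw.
have p0 y : 0 <= Pk t (x - y) * w y by rewrite mulr_ge0// ltW// Pk_gt0.
rewrite lt_neqAle; apply/andP; split; last exact: Rintegral_ge0.
apply/eqP => /esym E; move: wI; rewrite lt_neqAle => /andP[/eqP + _]; apply.
have H0 : (\int[mu]_y `|(Pk t (x - y) * w y)%:E| = 0)%E.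
  transitivity ((cv (Pk t) w x)%:E); last by rewrite E.
  rewrite (Rint_EFin iw); apply: eq_integral => y _.
  by rewrite gee0_abs ?lee_fin.
have mw : measurable_fun setT (fun y => (Pk t (x - y) * w y)%:E).
  exact: measurable_EF (integ_measurable iw).
have /(ae_eq_integral_abs mu measurableT mw) h := H0.
have mw' : measurable_fun setT (fun y => (w y)%:E) := measurable_EF bw.1.
have : (\int[mu]_y `|(w y)%:E| = 0)%E.
  apply/(ae_eq_integral_abs mu measurableT mw').
  apply: filterS h => y /= + _ => /(_ I) [] /eqP.
  by rewrite mulf_eq0 gt_eqF ?Pk_gt0//= => /eqP ->.
by move=> <-; apply: eq_integral => y _; rewrite gee0_abs ?lee_fin.
Qed.

Lemma Pk_tail t a : 0 < t -> 0 <= a ->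
  (\int[mu]_(x in `[a, +oo[) (- Ak t x)%:E = (Pk t a)%:E)%E.
Proof.
move=> t0 a0.
rewrite (@ge0_continuous_FTC2y _ (fun x => - Ak t x) (fun x => - Pk t x) a 0).
- by rewrite sub0e -EFinN opprK.
- move=> x ax; have x0 := le_trans a0 ax.
  rewrite /Ak -!mulNr opprK mulr_ge0 ?sqr_ge0// mulr_ge0// mulr_ge0 ?(ltW t0)//.
  by rewrite mulr_ge0// ltW// ipi_gt0.
- apply: continuous_subspaceT => x; apply: continuousN.
  exact: (derive_cont (is_derive_Akz x t0)).
- rewrite -oppr0; apply: cvgN.
  apply: (@squeeze_cvgr _ _ _ _ (fun=> 0) (fun x => pi^-1 * t * x^-1)).
  + near=> x; have x1 : 1 <= x by near: x; exact: nbhs_pinfty_ge.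
    rewrite (ltW (Pk_gt0 _ t0))/= /Pk ler_wpM2l//.
      by rewrite mulr_ge0 ?(ltW t0)// ltW// ipi_gt0.
    have xp : 0 < x by rewrite (lt_le_trans _ x1).
    rewrite /rk lef_pV2 ?posrE ?den_gt0//.
    by rewrite (@le_trans _ _ (x ^+ 2))// ?lerDl ?sqr_ge0// expr2 ler_peMl// (le_trans _ x1).
  + exact: cvg_cst.
  + rewrite -[X in _ --> X](mulr0 (pi^-1 * t)); apply: cvgMr.
    apply/gtr0_cvgV0; last exact: cvg_id.
    by near=> x; near: x; exact: nbhs_pinfty_gt.
- by move=> x _; have [] := is_derive_Pkz x t0 => + _; exact: derivableN.
- apply: cvg_at_right_filter; apply: cvgN.
  exact: (derive_cont (is_derive_Pkz a t0)).
- move=> x _; rewrite derive1E; have D := is_derive_Pkz x t0.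
  by rewrite deriveN// derive_val.
Unshelve. all: end_near. Qed.

Variable E : set R.
Hypotheses (mE : measurable E) (E0 : (0 < mu E)%E) (Efin : (mu E < +oo)%E).

Lemma bmeas_indic (D : set R) : measurable D -> bmeas (\1_D : R -> R).
Proof.
move=> mD; split; first exact: measurable_indic.
by exists 1 => y; rewrite ger0_norm// indicE lern1 leq_b1.
Qed.

Lemma int_indic (D : set R) : measurable D -> (\int[mu]_x (\1_D x)%:E = mu D)%E.
Proof. by move=> mD; rewrite integral_indic// setIT. Qed.

Lemma integ_indic (D : set R) : measurable D -> (mu D < +oo)%E ->
  integ (\1_D : R -> R).
Proof.
move=> mD Df; apply/integrableP; split; first by apply: measurable_EF; exact: measurable_indic.
rewrite (_ : (\int[mu]_x _)%E = mu D)// -int_indic//; apply: eq_integral => x _.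
by rewrite /= ger0_norm.
Qed.

Lemma loc_indic : locally_integrable setT (\1_E : R -> R).
Proof. by apply: open_integrable_locally; [exact: openT|exact: integ_indic]. Qed.

Lemma HL_le1 x : (HL_maximal (\1_E : R -> R) x <= 1)%E.
Proof.
apply: ub_ereal_sup => _ /= [r] /[!in_itv]/= /[!andbT] r0 <-.
rewrite /iavg lebesgue_measure_ball ?(ltW r0)//.
rewrite inver mulrn_eq0/= (gt_eqF r0).
rewrite lee_pdivrMl ?mulrn_wgt0// mule1.
rewrite -(lebesgue_measure_ball x (ltW r0)) -[leRHS]mul1e -integral_cst; last exact: measurable_ball.
apply: ge0_le_integral => //.
- exact: measurable_ball.
- by apply: measurable_funTS; apply: measurable_EF; apply: measurableT_comp => //; exact: measurable_indic.
- by move=> y _; rewrite lee_fin ger0_norm// indicE lern1 leq_b1.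
Qed.

Definition MM x : R := fine (HL_maximal (\1_E : R -> R) x).

Lemma MM_EFin x : (MM x)%:E = HL_maximal (\1_E : R -> R) x.
Proof.
rewrite /MM fineK// ge0_fin_numE ?(le_lt_trans (HL_le1 x)) ?ltry//.
by apply: HL_maximalT_ge0; exact: loc_indic.
Qed.

Lemma MM_ge0 x : 0 <= MM x.
Proof. by apply: fine_ge0; apply: HL_maximalT_ge0; exact: loc_indic. Qed.

Lemma MM_le1 x : MM x <= 1.
Proof. by rewrite -lee_fin MM_EFin HL_le1. Qed.

Lemma measurable_MM : measurable_fun setT MM.
Proof.
apply: (measurableT_comp (@fine_measurable R setT _)) => //.
by apply: measurable_HL_maximal; exact: loc_indic.
Qed.

Lemma ball_MM x r : 0 < r ->
  (\int[mu]_y (\1_E y * \1_(ball x r) y)%:E <= (2 * r * MM x)%:E)%E.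
Proof.
move=> r0; have : (iavg (\1_E : R -> R) (ball x r) <= (MM x)%:E)%E.
  by rewrite MM_EFin; apply: ereal_sup_ubound; exists r => //=; rewrite in_itv/= r0.
rewrite /iavg lebesgue_measure_ball ?(ltW r0)//.
rewrite inver mulrn_eq0/= (gt_eqF r0) lee_pdivrMl ?mulrn_wgt0// -EFinM.
rewrite -[X in (X * _)%:E]mulr_natl => h; apply: le_trans h.
rewrite [leLHS](_ : _ = \int[mu]_(y in ball x r) (\1_E y)%:E)%E.
  rewrite le_eqVlt; apply/orP; left; apply/eqP; apply: eq_integral => y _.
  by rewrite ger0_norm.
rewrite -(integral_indic_mul (\1_E : R -> R)); last exact: measurable_ball.
by apply: eq_integral => y _; rewrite mulrC.
Qed.

(** P_t is a superposition of indicators of balls: P_t(z) is the integral of - [Ak t r] over r >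
    |z|. The ball of radius r contributes at most 2 r times the maximal function, and 2 r |[Ak t r]|
    <= 4 [Pk t r], a function of integral 4. *)
Lemma Pk_le_MM t x : 0 < t -> cv (Pk t) (\1_E) x <= 4 * MM x.
Proof.
move=> t0; have bE := bmeas_indic mE.
have A0 r : 0 <= r -> 0 <= - Ak t r.
  move=> r0; rewrite /Ak -!mulNr opprK mulr_ge0 ?sqr_ge0// mulr_ge0// mulr_ge0 ?(ltW t0)//.
  by rewrite mulr_ge0// ltW// ipi_gt0.
pose H r : R := \1_(`[0, +oo[%classic) r * `|Ak t r|.
have H0 r : 0 <= H r by rewrite mulr_ge0.
have mH : measurable_fun setT H.
  apply: measurable_funM; first exact: measurable_indic.
  by apply: measurableT_comp => //; exact: measurable_AkT.
have HE z : (Pk t z)%:E = (\int[mu]_r (H r * \1_(`]`|z|, +oo[%classic) r)%:E)%E.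
  rewrite (_ : Pk t z = Pk t `|z|); last first.
    by rewrite /Pk /rk real_normK ?num_real.
  rewrite -Pk_tail// -integral_itv_obnd_cbnd; last first.
    apply: measurable_funTS; apply: measurable_EF.
    by apply: (measurableT_comp (@oppr_measurable R setT)); exact: measurable_AkT.
  rewrite -(integral_indic_mul (fun r => - Ak t r)); last exact: measurable_itv.
  apply: eq_integral => r _; congr EFin; rewrite /H mulrC.
  have [zr|zr] := ltP `|z| r; last first.
    by rewrite [\1__ _]indicE memNset ?mulr0 ?mul0r//= in_itv/= andbT; apply/negP; rewrite -leNgt.
  have r0 : 0 <= r by rewrite (le_trans _ (ltW zr)).
  congr (_ * _); rewrite indicE mem_setE in_itv/= r0 mul1r.
  by rewrite ler0_norm// -oppr_ge0 A0.
have mf3 : measurable_fun setT (fun z : R * R =>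
    (\1_E z.1 * (H z.2 * \1_(`]`|x - z.1|, +oo[%classic) z.2))%:E).
  apply: measurable_EF; apply: measurable_funM; first exact: measurable_indicc.
  apply: measurable_funM; first exact: (measurableT_comp mH).
  rewrite (_ : (fun z : R * R => _) = (fun z : R * R => \1_(`]0, +oo[%classic) (z.2 - `|x - z.1|) : R)).
    apply: measurable_indicc; first exact: measurable_itv.
    apply: measurable_funB => //; apply: measurableT_comp => //.
    exact: measurable_funB.
  by apply/funext => z; rewrite !indicE !mem_setE !in_itv/= !andbT subr_gt0.
rewrite -lee_fin (Rint_EFin (integ_PkM x t0 bE)).
rewrite [leLHS](_ : _ = \int[mu]_y \int[mu]_r
   (\1_E y * (H r * \1_(`]`|x - y|, +oo[%classic) r))%:E)%E; last first.
  apply: eq_integral => y _; rewrite mulrC EFinM HE -eiZ.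
  - by apply: eq_integral => r _; rewrite -EFinM.
  - by apply: measurable_EF; apply: measurable_funM => //; apply: measurable_indic.
  - by move=> r; rewrite lee_fin mulr_ge0.
  - by rewrite lee_fin.
rewrite (tonelli_in measurableT measurableT) => //; last first.
  by move=> y r; rewrite lee_fin !mulr_ge0.
have iP := integ_Pk t0.
have eP : \I (Pk t) = 1.
  rewrite -(integ_Pk_shift 0 t0).2; apply: eq_Rintegral => y _.
  by rewrite sub0r PkN.
rewrite -[leRHS]mul1e (_ : 1%E = (\int[mu]_r (Pk t r)%:E)%E); last by rewrite -(Rint_EFin iP) eP.
rewrite muleC -eiZ; last 3 first.
- exact: measurable_EF (integ_measurable iP).
- by move=> r; rewrite lee_fin ltW// Pk_gt0.
- by rewrite lee_fin mulr_ge0// MM_ge0.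
apply: lei.
- apply: (@measurable_fun_fubini_tonelli_G _ _ _ _ _ mu (fun z : R * R =>
    (\1_E z.1 * (H z.2 * \1_(`]`|x - z.1|, +oo[%classic) z.2))%:E)) => // z.
  by rewrite lee_fin !mulr_ge0.
- by apply: measurable_funeM; exact: measurable_EF (integ_measurable iP).
- by move=> r; apply: integral_ge0 => y _; rewrite lee_fin !mulr_ge0.
- move=> r; have RH0 : (0 <= (4 * MM x)%:E * (Pk t r)%:E)%E.
    apply: mule_ge0; rewrite lee_fin; last exact/ltW/Pk_gt0.
    by rewrite mulr_ge0// MM_ge0.
  have [r0|r0] := leP r 0.
    rewrite integral0_eq// => y _.
    have -> : \1_(`]`|x - y|, +oo[%classic) r = 0 :> R.
      rewrite indicE memNset//= in_itv/= andbT.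
      by apply/negP; rewrite -leNgt (le_trans r0).
    by rewrite !mulr0.
  rewrite [leLHS](_ : _ = \int[mu]_y ((H r)%:E * (\1_E y * \1_(ball x r) y)%:E))%E; last first.
    apply: eq_integral => y _; rewrite -EFinM; congr EFin.
    rewrite mulrCA; congr (_ * (_ * _)); rewrite !indicE mem_setE in_itv/= andbT.
    have [xy|xy] := ltP `|x - y| r; first by rewrite mem_set.
    by rewrite memNset//= /ball/= => /(le_lt_trans xy); rewrite ltxx.
  rewrite eiZ; last 3 first.
  - apply: measurable_EF; apply: measurable_funM; first exact: measurable_indic.
    by apply: measurable_indic; exact: measurable_ball.
  - by move=> y; rewrite lee_fin mulr_ge0.
  - by rewrite lee_fin.
  apply: (@le_trans _ _ ((H r)%:E * (2 * r * MM x)%:E)%E).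
    by apply: lee_wpmul2l; [rewrite lee_fin|exact: ball_MM].
  rewrite -!EFinM lee_fin /H indicE mem_setE in_itv/= (ltW r0) mul1r.
  rewrite mulrA [leRHS]mulrAC; apply: ler_wpM2r; first exact: MM_ge0.
  rewrite ler0_norm -?oppr_ge0 ?A0 ?(ltW r0)//.
  have := rk_sq_le r t0; rewrite /Ak /Pk => /andP[_ h].
  have p0 := @ipi_gt0 R; have k0 := rk_gt0 r t0.
  rewrite (_ : - _ * _ = 4 * (pi^-1 * t * rk t r) * (r ^+ 2 * rk t r)); last by ring.
  by rewrite ler_piMr// mulr_ge0// mulr_ge0 ?(ltW k0)// mulr_ge0 ?ltW.
Qed.

(** Positivity is inherited from the Poisson integral; it makes powers of [MM] with negative
    exponent meaningful. *)
Lemma MM_gt0 x : 0 < MM x.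
Proof.
have t1 : 0 < 1 :> R by [].
have := cv_Pk_pos x t1 (bmeas_indic mE) (fun y => _) => /(_ _ _)/wrap[].
  by move=> y.
  by rewrite int_indic.
by move=> /lt_le_trans -/(_ _ (Pk_le_MM x t1)); rewrite pmulr_rgt0.
Qed.

Lemma measurable_gtMM l : measurable [set x | l < MM x].
Proof.
have -> : [set x | l < MM x] = setT `&` MM @^-1` `]l, +oo[.
  by apply/seteqP; split => x /=; rewrite in_itv/= andbT; tauto.
by apply: measurable_MM; [exact: measurableT|exact: measurable_itv].
Qed.

Lemma MM_weak (l : R) : 0 < l ->
  (\int[mu]_x (\1_[set x | (l < MM x)%R] x)%:E <= (3 / l)%:E * mu E)%E.
Proof.
move=> l0; have := maximal_inequality loc_indic l0.
have -> : (\int[mu]_y `|(\1_E y)%:E|)%E = mu E.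
  by rewrite -int_indic//; apply: eq_integral => y _; rewrite gee0_abs// lee_fin.
have S : [set x | (l%:E < HL_maximal (\1_E : R -> R) x)%E] = [set x | (l < MM x)%R].
  by apply/seteqP; split => x /=; rewrite -MM_EFin lte_fin.
rewrite S => h; rewrite int_indic//.
exact: measurable_gtMM.
Qed.

(** A layer-cake argument with a cheap lower bound: (m/4)^s is at most the integral of l^(s-1) over
    [m/4, m/2], whence the factor 4^s. The weak-type inequality turns l^(s-1) into 3 l^(s-2), which
    is integrable at 0 because s > 1, and l stays below 1 because [MM] does. *)
Lemma MM_powR (s : R) : 1 < s ->
  (\int[mu]_x (MM x `^ s)%:E <= (4 `^ s * (3 / (s - 1)))%:E * mu E)%E.
Proof.
move=> s1; have s0 : 0 < s by lra.
pose K (x l : R) : R := \1_(`]0, +oo[%classic) (MM x - l) * pw s l.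
have K0 x l : 0 <= K x l by rewrite mulr_ge0 ?pw_ge0.
have K0' x l : (0 <= (K x l)%:E)%E by rewrite lee_fin.
have mK : measurable_fun setT (fun z : R * R => (K z.1 z.2)%:E).
  apply: measurable_EF; apply: measurable_funM; last exact: measurable_pwc.
  apply: measurable_indicc; first exact: measurable_itv.
  by apply: measurable_funB => //; exact: (measurableT_comp measurable_MM).
have KE x l : \1_(`]0, +oo[%classic) (MM x - l) = \1_[set x | (l < MM x)%R] x :> R.
  by rewrite !indicE mem_setE in_itv/= andbT subr_gt0 mem_setE.
apply: (@le_trans _ _ ((4 `^ s)%:E * \int[mu]_x \int[mu]_l (K x l)%:E)%E).
  rewrite -eiZ; last 3 first.
  - by apply: measurable_ei1 => // x l; rewrite lee_fin.
  - by move=> x; apply: integral_ge0 => l _; rewrite lee_fin.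
  - by rewrite lee_fin powR_ge0.
  apply: lei.
  - by apply: measurable_EF; apply: measurable_fun_powR; exact: measurable_MM.
  - apply: measurable_funeM.
    by apply: measurable_ei1 => // x l; rewrite lee_fin.
  - by move=> x; rewrite lee_fin powR_ge0.
  move=> x; have M0 := MM_gt0 x; set m := MM x in M0 *.
  have m4 : 0 < m / 4 by rewrite divr_gt0.
  have m42 : m / 4 <= m / 2 by lra.
  have e4 : (m / 4) `^ (s - 1) * (m / 4) = (m / 4) `^ s.
    by rewrite mulrC mulr_powRB1// ltW.
  apply: (@le_trans _ _ ((4 `^ s)%:E * ((m / 4) `^ s)%:E)%E).
    by rewrite -EFinM lee_fin -powRM ?(ltW m4)// mulrCA divff ?mulr1.
  apply: lee_wpmul2l; first by rewrite lee_fin powR_ge0.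
  rewrite -e4.
  have -> : ((m / 4) `^ (s - 1) * (m / 4))%:E =
     (\int[mu]_l ((m / 4) `^ (s - 1) * \1_(`[(m / 4)%R, (m / 2)%R]%classic) l)%:E)%E.
    under eq_integral do rewrite EFinM.
    rewrite eiZ; last 3 first.
    - by apply: measurable_EF; apply: measurable_indic.
    - by move=> l; rewrite lee_fin.
    - by rewrite lee_fin powR_ge0.
    rewrite int_indic; last exact: measurable_itv.
    rewrite lebesgue_measure_itv/= lte_fin ltr_pM2l// ltf_pV2 ?posrE// ltr_nat/=.
    by rewrite -EFinB -EFinM; congr (_ * _)%:E; lra.
  apply: lei.
  - by apply: measurable_EF; apply: measurable_funM => //; apply: measurable_indic.
  - exact: (measurable_sec1 x mK).
  - by move=> l; rewrite lee_fin mulr_ge0 ?powR_ge0.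
  - move=> l; rewrite lee_fin /K -/m.
    have [lm|lm] := boolP (l \in `[m / 4, m / 2]%classic); last first.
      by rewrite indicE (negbTE lm) mulr0 mulr_ge0 ?pw_ge0.
    move: lm; rewrite mem_setE in_itv/= => /andP[l1 l2].
    rewrite !indicE !mem_setE !in_itv/= l1 l2 andbT mulr1 (_ : 0 < m - l); last lra.
    rewrite mul1r pwE; last exact: lt_le_trans l1.
    by apply: ge0_ler_powR; rewrite ?nnegrE ?(ltW m4)//; lra.
rewrite EFinM -muleA; apply: lee_wpmul2l; first by rewrite lee_fin powR_ge0.
rewrite (tonelli_in measurableT measurableT mK K0').
pose I (l : R) : R := \1_(`]-oo, 1]%classic) l * pw (s - 1) l.
have mI : measurable_fun setT I.
  by apply: measurable_funM; [exact: measurable_indic|exact: measurable_pw].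
have s10 : 0 < s - 1 by lra.
have := pw_near0 s10 ltr01; rewrite powR1 => hI.
apply: (@le_trans _ _ ((3%:E * mu E) * \int[mu]_l (I l)%:E)%E); last first.
  rewrite (_ : ((3 / (s - 1))%:E * mu E = 3%:E * mu E * ((s - 1)^-1)%:E)%E).
    apply: lee_wpmul2l; first exact: mule_ge0.
    by rewrite -[(s - 1)^-1]mul1r.
  by rewrite EFinM muleAC.
rewrite -eiZ; last 3 first.
- exact: measurable_EF.
- by move=> l; rewrite lee_fin mulr_ge0 ?pw_ge0.
- exact: mule_ge0.
apply: lei.
- by apply: measurable_ei2 => // x l; rewrite lee_fin.
- by apply: measurable_funeM; exact: measurable_EF.
- by move=> l; apply: integral_ge0 => x _; rewrite lee_fin.
move=> l; have R0 : (0 <= 3%:E * mu E * (I l)%:E)%E.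
  by apply: mule_ge0; [exact: mule_ge0|rewrite lee_fin mulr_ge0 ?pw_ge0].
have [l0|l0] := leP l 0.
  by rewrite integral0_eq// => x _; rewrite /K (pw0 _ l0) mulr0.
have [l1|l1] := leP l 1; last first.
  rewrite integral0_eq// => x _; rewrite /K indicE memNset ?mul0r//= in_itv/= andbT subr_gt0.
  by apply/negP; rewrite -leNgt (le_trans (MM_le1 x))// ltW.
have mD : measurable [set x | (l < MM x)%R].
  exact: measurable_gtMM.
rewrite [leLHS](_ : _ = \int[mu]_x ((pw s l)%:E * (\1_[set x | (l < MM x)%R] x)%:E))%E; last first.
  by apply: eq_integral => x _; rewrite /K KE mulrC.
rewrite eiZ; last 3 first.
- by apply: measurable_EF; exact: measurable_indic.
- by move=> x; rewrite lee_fin.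
- by rewrite lee_fin pw_ge0.
apply: (@le_trans _ _ ((pw s l)%:E * ((3 / l)%:E * mu E))%E).
  by apply: lee_wpmul2l; [rewrite lee_fin pw_ge0|exact: MM_weak].
rewrite muleA -EFinM muleAC -EFinM; apply: lee_wpmul2r; first exact: measure_ge0.
rewrite lee_fin /I indicE mem_setE in_itv/= l1 mul1r !pwE// [X in _ <= 3 * X]powR_pred//.
by rewrite mulrCA.
Qed.
End maximal.

(** * The bilinear form on functions bounded by indicators *)

Section restricted.
Context {R : realType}.
Local Notation mu := (@lebesgue_measure R).
Implicit Types (a s t x y z r u : R).

Lemma integral_in_indic (D : set R) (f : R -> \bar R) :
  (\int[mu]_(x in D) f x = \int[mu]_x ((\1_D x)%:E * f x))%E.
Proof.
rewrite integral_mkcond; apply: eq_integral => x _.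
by rewrite /patch indicE; case: ifP => _; rewrite ?mul1e ?mul0e.
Qed.

(* NN g x t is comparable to the length of the gradient of P_t * g at x. *)
Definition NN (g : R -> R) x t : R := `|cv (Ak t) g x| + `|cv (Ck t) g x|.
Definition G2 (g : R -> R) x t : R := cv (Ck t) g x ^+ 2 + cv (Ak t) g x ^+ 2.

Definition BB s1 s2 (g h : R -> R) : \bar R :=
  (\int[mu]_x \int[mu]_(t in `]0%R, +oo[) (TT s1 (NN g x) t * TT s2 (NN h x) t))%E.

Lemma NN_ge0 g x t : 0 <= NN g x t. Proof. by rewrite addr_ge0. Qed.
Lemma G2_ge0 g x t : 0 <= G2 g x t. Proof. by rewrite addr_ge0 ?sqr_ge0. Qed.

Lemma NN_sq g x t : NN g x t ^+ 2 <= 2 * G2 g x t.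
Proof.
rewrite /NN /G2 -(@real_normK _ (cv (Ck t) g x)) ?num_real//.
rewrite -(@real_normK _ (cv (Ak t) g x)) ?num_real//.
move: `|_| `|_| => p q; have := sqr_ge0 (p - q); rewrite sqrrB sqrrD (mulrC q p).
by move: (p ^+ 2) (q ^+ 2) (p * q) => *; lra.
Qed.

Lemma measurable_NN g : bmeas g -> measurable_fun setT (fun z : R * R => NN g z.1 z.2).
Proof.
move=> bg; apply: measurable_funD; apply: measurableT_comp => //.
- exact: mVx2.
- exact: mVt2.
Qed.

Lemma measurable_G2 g : bmeas g -> measurable_fun setT (fun z : R * R => G2 g z.1 z.2).
Proof.
by move=> bg; apply: measurable_funD; apply: measurable_funX; [exact: mVt2|exact: mVx2].
Qed.

(** In the application k0 is a power of eta; linearity pulls it out of the constant of the square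
    function estimate. *)
Lemma M0_lin a c k : M0 a c k = k * M0 a c (1 : R).
Proof. by rewrite /M0 /M1 /kap; ring. Qed.

Lemma M0_ge0 a c k : 1 < c -> 0 <= k -> 0 <= M0 a c k.
Proof.
move=> c1 k00; have kk0 : 0 <= kap a c k := kap_ge0 a c1 k00.
have cc : 0 <= c by rewrite ltW// (lt_trans _ c1).
have e1 := mulr_ge0 (normr_ge0 a) k00; have e2 := mulr_ge0 kk0 cc.
rewrite /M0 /M1; apply: addr_ge0; last by apply: addr_ge0.
by apply: addr_ge0 => //; apply: addr_ge0 => //; apply: mulr_ge0.
Qed.

(** The square of the Littlewood-Paley g-function, with [NN] in the place of the length of the
    gradient. *)
Definition sqf (g : R -> R) x : \bar R :=
  (\int[mu]_u (\1_(`]0%R, +oo[%classic) u * (`|u| * NN g x u ^+ 2))%:E)%E.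

Lemma sqi_ge0 g x u :
  (0 <= (\1_(`]0%R, +oo[%classic) u * (`|u| * NN g x u ^+ 2))%:E)%E.
Proof. by rewrite lee_fin; apply: mulr_ge0 => //; apply: mulr_ge0 => //; exact: sqr_ge0. Qed.

Lemma sqf_ge0 g x : (0 <= sqf g x)%E.
Proof. by apply: integral_ge0 => u _; exact: sqi_ge0. Qed.

Lemma measurable_sqi g : bmeas g -> measurable_fun setT (fun z : R * R =>
  (\1_(`]0%R, +oo[%classic) z.2 * (`|z.2| * NN g z.1 z.2 ^+ 2))%:E).
Proof.
move=> bg; apply: measurable_EF; apply: measurable_funM; first exact: measurable_indicc.
apply: measurable_funM; first exact: measurableT_comp.
by apply: measurable_funX; exact: measurable_NN.
Qed.

Lemma measurable_sqf g : bmeas g -> measurable_fun setT (sqf g).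
Proof.
move=> bg; apply: (measurable_ei1 (measurable_sqi bg)) => x u.
exact: sqi_ge0.
Qed.

Lemma carleson_indic (a c k0 : R) (h w : R -> R) : 1 < c -> 0 <= k0 ->
  bmeas h -> bmeas w -> (forall y, 0 <= w y) ->
  (forall x t, 0 < t -> 0 < cv (Pk t) w x) ->
  (forall x t, 0 < t -> cv (Pk t) (fun y => `|h y|) x ^+ 2 * cv (Pk t) w x `^ a <=
     k0 * cv (Pk t) w x `^ c) ->
  (\int[mu]_y \int[mu]_t (\1_(`]0%R, +oo[%classic) t *
      (t * G2 h y t * cv (Pk t) w y `^ a))%:E <=
   (2 * M0 a c k0 + 1)%:E * \int[mu]_y (w y `^ c)%:E)%E.
Proof.
move=> c1 k00 bh bw w0 W0 HV; apply: le_trans (carleson c1 k00 bh bw w0 W0 HV).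
rewrite le_eqVlt; apply/orP; left; apply/eqP; apply: eq_integral => y _.
by rewrite (integral_indic_mul (fun t => t * G2 h y t * cv (Pk t) w y `^ a)).
Qed.

Lemma measurable_carl g w a : bmeas g -> bmeas w ->
  measurable_fun setT (fun z : R * R => (\1_(`]0%R, +oo[%classic) z.2 *
      (z.2 * G2 g z.1 z.2 * cv (Pk z.2) w z.1 `^ a))%:E).
Proof.
move=> bg bw; apply: measurable_EF; apply: measurable_funM; first exact: measurable_indicc.
apply: measurable_funM; last by apply: measurable_fun_powR; exact: mV2.
by apply: measurable_funM => //; exact: measurable_G2.
Qed.

Lemma carl_ge0 g w a y t : (0 <= (\1_(`]0%R, +oo[%classic) t *
      (t * G2 g y t * cv (Pk t) w y `^ a))%:E)%E.
Proof.
rewrite lee_fin indicE mem_setE in_itv/= andbT.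
have [t0|_] := ltP 0 t; last by rewrite mul0r.
by rewrite mul1r mulr_ge0 ?powR_ge0// mulr_ge0 ?G2_ge0// ltW.
Qed.

Section sets.
Variables (E : set R) (g : R -> R).
Hypotheses (mE : measurable E) (E0 : (0 < mu E)%E) (Efin : (mu E < +oo)%E).
Hypotheses (bg : bmeas g) (gE : forall y, `|g y| <= \1_E y).

Lemma indic_powR (D : set R) c y : 0 < c -> (\1_D y : R) `^ c = \1_D y.
Proof.
by move=> c0; rewrite indicE; case: (_ \in _); rewrite ?powR1 ?powR0 ?gt_eqF.
Qed.

(** [carleson_indic] with W = P_t 1_E, a = - b and c = 2 - b, where c > 1 because b < 1. From |g| <=
    1_E the extension of |g| is at most W, so k0 = 1 is admissible. Since W is at most 4 times the
    maximal function, M^(-b) <= 4^b W^(-b). *)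
Lemma weighted_sqf_small b : 0 < b < 1 ->
  (\int[mu]_x ((MM E x `^ (- b))%:E * sqf g x) <=
   (2 * 4 `^ b * (2 * M0 (- b) (2 - b) 1 + 1))%:E * mu E)%E.
Proof.
move=> /andP[b0 b1]; have bE := bmeas_indic mE.
have E0' y : 0 <= (\1_E y : R) by rewrite indicE.
have W0 x t : 0 < t -> 0 < cv (Pk t) (\1_E) x.
  by move=> t0; apply: cv_Pk_pos => //; rewrite int_indic.
have c1 : 1 < 2 - b by lra.
have HV x t : 0 < t -> cv (Pk t) (fun y => `|g y|) x ^+ 2 * cv (Pk t) (\1_E) x `^ (- b) <=
    1 * cv (Pk t) (\1_E) x `^ (2 - b).
  move=> t0; rewrite mul1r; have w0 := W0 x t t0.
  have v0 : 0 <= cv (Pk t) (fun y => `|g y|) x.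
    by apply: Rintegral_ge0 => y _; rewrite mulr_ge0// ltW// Pk_gt0.
  have vw : cv (Pk t) (fun y => `|g y|) x <= cv (Pk t) (\1_E) x.
    apply: le_Rint; [exact: integ_PkM (bmeas_norm bg)|exact: integ_PkM|].
    by move=> y; rewrite ler_wpM2l// ltW// Pk_gt0.
  rewrite powRD ?(gt_eqF w0) ?implybT// powR_mulrn ?(ltW w0)//.
  by rewrite ler_wpM2r ?powR_ge0// ler_pXn2r ?nnegrE ?(ltW w0).
have := carleson_indic c1 ler01 bg bE E0' W0 HV.
have -> : (\int[mu]_y ((\1_E y : R) `^ (2 - b))%:E = mu E)%E.
  by rewrite -int_indic//; apply: eq_integral => y _; rewrite indic_powR//; lra.
move=> H; set K := 2 * M0 _ _ _ + 1 in H *.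
have b4 : 0 <= 2 * 4 `^ b by rewrite mulr_ge0// powR_ge0.
rewrite EFinM -muleA; apply: le_trans (lee_wpmul2l _ H); last by rewrite lee_fin.
have mC := measurable_carl (- b) bg bE.
have C0 := carl_ge0 g (\1_E) (- b).
have mM : measurable_fun setT (fun x => (MM E x `^ (- b))%:E).
  by apply: measurable_EF; apply: measurable_fun_powR; exact: measurable_MM.
rewrite -eiZ; last 3 first.
- exact: (measurable_ei1 mC C0).
- by move=> x; exact: integral_ge0.
- by rewrite lee_fin.
apply: lei.
- by apply: emeasurable_funM => //; exact: measurable_sqf.
- by apply: measurable_funeM; exact: (measurable_ei1 mC C0).
- by move=> x; apply: mule_ge0; rewrite ?sqf_ge0// lee_fin powR_ge0.
move=> x; rewrite /sqf -eiZ; last 3 first.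
- exact: (measurable_sec1 x (measurable_sqi bg)).
- by move=> u; exact: sqi_ge0.
- by rewrite lee_fin powR_ge0.
rewrite -eiZ; last 3 first.
- exact: (measurable_sec1 x mC).
- by move=> u; exact: C0.
- by rewrite lee_fin.
apply: lei.
- by apply: measurable_funeM; exact: (measurable_sec1 x (measurable_sqi bg)).
- by apply: measurable_funeM; exact: (measurable_sec1 x mC).
- by move=> u; apply: mule_ge0; [rewrite lee_fin powR_ge0|exact: sqi_ge0].
move=> u; rewrite -!EFinM lee_fin indicE mem_setE in_itv/= andbT.
have [u0|_] := ltP 0 u; last by rewrite !mul0r !mulr0.
have m0 := MM_gt0 mE E0 Efin x; have w0 := W0 x u u0.
have wm := Pk_le_MM mE Efin x u0.
have Mw : MM E x `^ (- b) <= 4 `^ b * cv (Pk u) (\1_E) x `^ (- b).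
  rewrite !powRN -[X in X * _]invrK -invfM lef_pV2 ?posrE ?powR_gt0//; last first.
    by rewrite mulr_gt0 ?invr_gt0 ?powR_gt0.
  rewrite ler_pdivrMl ?powR_gt0// -powRM ?(ltW m0)//.
  by apply: ge0_ler_powR; rewrite ?nnegrE ?(ltW b0) ?(ltW w0)// mulr_ge0// ltW.
rewrite !mul1r (gtr0_norm u0).
rewrite (_ : 2 * 4 `^ b * _ = (4 `^ b * cv (Pk u) (\1_E) x `^ (- b)) * (u * (2 * G2 g x u))).
  apply: ler_pM => //; first exact: powR_ge0.
    by rewrite mulr_ge0 ?sqr_ge0// ltW.
  by rewrite ler_pM2l//; exact: NN_sq.
by move: (_ `^ _) (_ `^ _) (G2 _ _ _) => p q r; ring.
Qed.
End sets.

Section large.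
Variables (E F : set R) (h : R -> R).
Hypotheses (mE : measurable E) (E0 : (0 < mu E)%E) (Efin : (mu E < +oo)%E).
Hypotheses (mF : measurable F) (Ffin : (mu F < +oo)%E).
Hypotheses (bh : bmeas h) (hF : forall y, `|h y| <= \1_F y).

Lemma integ_h : integ h.
Proof. by apply: (integ_le bh.1 (integ_indic mF Ffin)). Qed.

Lemma bmeas_cvA t : 0 < t -> bmeas (cv (Ak t) h).
Proof.
move=> t0; split; first exact: (measurable_sec2 t (mVx2 bh)).
have [mh [B hB]] := bmeas_norm bh; exists (t^-1 * B) => y.
apply: le_trans (bVx bh y t0) _; rewrite ler_wpM2l ?invr_ge0 ?(ltW t0)//.
apply: le_trans (ler_norm _) _; apply: cv_Pk_le => //; exact: bmeas_norm.
Qed.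

Lemma bmeas_cvC t : 0 < t -> bmeas (cv (Ck t) h).
Proof.
move=> t0; split; first exact: (measurable_sec2 t (mVt2 bh)).
have [mh [B hB]] := bmeas_norm bh; exists (t^-1 * B) => y.
apply: le_trans (bVt bh y t0) _; rewrite ler_wpM2l ?invr_ge0 ?(ltW t0)//.
apply: le_trans (ler_norm _) _; apply: cv_Pk_le => //; exact: bmeas_norm.
Qed.

Lemma bmeas_sq f : bmeas f -> bmeas (fun y => f y ^+ 2).
Proof.
move=> [mf [B fB]]; split; first exact: measurable_funX.
exists (B ^+ 2) => y; rewrite normrX ler_pXn2r ?nnegrE//.
by rewrite (le_trans _ (fB y)).
Qed.

Lemma G2_double x t : 0 < t -> G2 h x (2 * t) <= cv (Pk t) (fun y => G2 h y t) x.
Proof.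
move=> t0; have E2 : 2 * t = t + t by ring.
have bA := bmeas_cvA t0; have bC := bmeas_cvC t0.
have sA := @sq_cv_double R (fun t => Ak t) t x h t0 bA (cv_Pk_Ak x t0 t0 integ_h).
have sC := @sq_cv_double R (fun t => Ck t) t x h t0 bC (cv_Pk_Ck x t0 t0 integ_h).
rewrite E2 /G2; apply: le_trans (lerD sC sA) _.
rewrite -RintD; [|exact: integ_PkM (bmeas_sq bC)|exact: integ_PkM (bmeas_sq bA)].
rewrite le_eqVlt; apply/orP; left; apply/eqP; apply: eq_Rintegral => y _.
by rewrite mulrDr.
Qed.

(* After [u = 2 t], the semigroup inequality [G2_double] moves the Poisson
   average from |k_t * h|^2 onto the weight. *)
Lemma weighted_sqf_large (v w : R -> R) : bmeas v -> bmeas w ->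
  (forall x, 0 <= v x) -> (forall x, v x <= w x) ->
  (\int[mu]_x ((v x)%:E * sqf h x) <=
   8%:E * \int[mu]_y \int[mu]_t (\1_(`]0%R, +oo[%classic) t *
      (t * G2 h y t * cv (Pk t) w y `^ 1))%:E)%E.
Proof.
move=> bv bw v0 vw.
have mG := measurable_G2 bh.
pose H x t : R := cv (Pk t) (fun y => G2 h y t) x.
have mH : measurable_fun setT (fun z : R * R => H z.1 z.2).
  apply: (@measurable_Rint_param R _ _ (fun q : (R * R) * R =>
     Pk q.1.2 (q.1.1 - q.2) * G2 h q.2 q.1.2)).
  apply: measurable_funM.
    apply: measurable_Pkc; first exact: (measurableT_comp measurable_snd measurable_fst).
    by apply: measurable_funB => //; exact: (measurableT_comp measurable_fst measurable_fst).
  have mp : measurable_fun setT (fun q : (R * R) * R => (q.2, q.1.2)).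
    apply: measurable_fun_pair => //.
    exact: (measurableT_comp measurable_snd measurable_fst).
  exact: (measurableT_comp mG mp).
pose I t : R := \1_(`]0%R, +oo[%classic) t.
have I0 t : 0 <= I t by [].
have mI : measurable_fun setT I by apply: measurable_indic.
have G0 y t : 0 <= G2 h y t := G2_ge0 h y t.
have H0 x t : 0 < t -> 0 <= H x t.
  by move=> t0; apply: Rintegral_ge0 => y _; rewrite mulr_ge0// ltW// Pk_gt0.
have IH0 x t : 0 <= I t * (t * H x t).
  rewrite /I indicE mem_setE in_itv/= andbT; have [t0|_] := ltP 0 t; last by rewrite mul0r.
  by rewrite mul1r mulr_ge0 ?H0// ltW.
have mIH : measurable_fun setT (fun z : R * R => (I z.2 * (z.2 * H z.1 z.2))%:E).
  apply: measurable_EF; apply: measurable_funM; first exact: (measurableT_comp mI).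
  exact: measurable_funM.
have IH0' x t : (0 <= (I t * (t * H x t))%:E)%E by rewrite lee_fin.
have step1 x : (sqf h x <= 8%:E * \int[mu]_t (I t * (t * H x t))%:E)%E.
  have := @ge0_integral_affine R 2 0 (fun u => (\1_(`]0%R, +oo[%classic) u *
     (`|u| * NN h x u ^+ 2))%:E) (ltr0Sn _ _)
     (measurable_sec1 x (measurable_sqi bh)) (sqi_ge0 h x) => E2.
  have -> : sqf h x = (2%:E * (2^-1%:E * sqf h x))%E.
    by rewrite muleA -EFinM divff// mul1e.
  (* One factor 2 is the Jacobian of u = 2 t; the factor 4 combines the weight 2 t with the 2 of
     [NN_sq]. *)
  rewrite -E2 -[8](_ : 2 * 4 = 8 :> R); last by ring.
  rewrite EFinM -muleA; apply: lee_wpmul2l; first by rewrite lee_fin.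
  have mI1 : measurable_fun setT (fun t => (I t * (t * H x t))%:E) := measurable_sec1 x mIH.
  rewrite -eiZ//; apply: lei.
  - have mq : measurable_fun setT (fun t : R => 2 * t + 0).
      by apply: measurable_funD => //; exact: measurable_funM.
    exact: (measurableT_comp (measurable_sec1 x (measurable_sqi bh)) mq).
  - exact: measurable_funeM.
  - by move=> t; exact: sqi_ge0.
  - move=> t; rewrite -EFinM lee_fin addr0 /I !indicE !mem_setE !in_itv/= !andbT pmulr_rgt0//.
    have [t0|_] := ltP 0 t; last by rewrite !mul0r mulr0.
    rewrite !mul1r gtr0_norm ?mulr_gt0//.
    have t20 : 0 <= 2 * t by rewrite mulr_ge0// ltW.
    apply: (le_trans (ler_wpM2l t20 (NN_sq h x (2 * t)))).
    rewrite (_ : 2 * t * _ = 4 * (t * G2 h x (2 * t))); last by ring.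
    by rewrite ler_pM2l// ler_wpM2l ?(ltW t0)//; exact: G2_double.
have mv : measurable_fun setT (fun x => (v x)%:E) := measurable_EF bv.1.
have v0' x : (0 <= (v x)%:E)%E by rewrite lee_fin.
have mT1 : measurable_fun setT (fun x => \int[mu]_t (I t * (t * H x t))%:E)%E.
  exact: (measurable_ei1 mIH IH0').
apply: (@le_trans _ _ (8%:E * \int[mu]_x ((v x)%:E * \int[mu]_t (I t * (t * H x t))%:E))%E).
  rewrite -eiZ; last 3 first.
  - exact: emeasurable_funM.
  - by move=> x; apply: mule_ge0 => //; exact: integral_ge0.
  - by [].
  apply: lei.
  - by apply: emeasurable_funM => //; exact: measurable_sqf.
  - by apply: measurable_funeM; exact: emeasurable_funM.
  - by move=> x; apply: mule_ge0 => //; exact: sqf_ge0.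
  - by move=> x; rewrite muleCA; apply: lee_wpmul2l.
apply: lee_wpmul2l; first by rewrite lee_fin.
have mvI : measurable_fun setT (fun z : R * R => (v z.1)%:E * (I z.2 * (z.2 * H z.1 z.2))%:E)%E.
  by apply: emeasurable_funM => //; apply: measurable_EF; exact: (measurableT_comp bv.1).
have vI0 x t : (0 <= (v x)%:E * (I t * (t * H x t))%:E)%E by exact: mule_ge0.
rewrite [leLHS](_ : _ = \int[mu]_x \int[mu]_t ((v x)%:E * (I t * (t * H x t))%:E))%E; last first.
  apply: eq_integral => x _; rewrite eiZ//.
  exact: (measurable_sec1 x mIH).
rewrite (tonelli_in measurableT measurableT mvI vI0).
rewrite [leRHS](tonelli_in measurableT measurableT (measurable_carl 1 bh bw) (carl_ge0 h w 1)).
apply: lei.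
- exact: (measurable_ei2 mvI vI0).
- exact: (measurable_ei2 (measurable_carl 1 bh bw) (carl_ge0 h w 1)).
- by move=> t; exact: integral_ge0.
move=> t; have [t0|t0] := ltP 0 t; last first.
  rewrite integral0_eq; first by apply: integral_ge0 => y _; exact: carl_ge0.
  by move=> x _; rewrite /I indicE memNset ?mul0r ?mule0//= in_itv/= andbT; apply/negP; rewrite -leNgt.
have It : \1_(`]0%R, +oo[%classic) t = 1 :> R by rewrite indicE mem_setE in_itv/= t0.
have bG : bmeas (fun y => G2 h y t).
  have [_ [B1 h1]] := bmeas_sq (bmeas_cvA t0); have [_ [B2 h2]] := bmeas_sq (bmeas_cvC t0).
  split; first exact: (measurable_sec2 t mG).
  by exists (B2 + B1) => y; rewrite (le_trans (ler_normD _ _))// lerD.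
pose f x y : \bar R := ((v x * t) * (Pk t (x - y) * G2 h y t))%:E.
have mf : measurable_fun setT (fun z : R * R => f z.1 z.2).
  apply: measurable_EF; apply: measurable_funM.
    by apply: measurable_funM => //; exact: (measurableT_comp bv.1).
  apply: measurable_funM; last exact: (measurableT_comp bG.1).
  by apply: measurable_Pkc => //; exact: measurable_funB.
have f0 x y : (0 <= f x y)%E.
  rewrite lee_fin; apply: mulr_ge0; first by rewrite mulr_ge0// ltW.
  by apply: mulr_ge0 => //; rewrite ltW// Pk_gt0.
rewrite [leLHS](_ : _ = \int[mu]_x \int[mu]_y f x y)%E; last first.
  apply: eq_integral => x _; rewrite /I It mul1r -EFinM mulrA.
  by rewrite -RintZ ?Rint_EFin//; [exact: integZ (integ_PkM x t0 bG)|exact: integ_PkM].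
rewrite (tonelli_in measurableT measurableT mf f0).
apply: lei.
- exact: (measurable_ei2 mf f0).
- exact: (measurable_sec2 t (measurable_carl 1 bh bw)).
- by move=> y; exact: integral_ge0.
move=> y; rewrite It mul1r.
have W0 : 0 <= cv (Pk t) w y.
  by apply: Rintegral_ge0 => z _; exact: mulr_ge0 (ltW (Pk_gt0 _ t0)) (le_trans (v0 z) (vw z)).
rewrite powRr1//.
rewrite [leLHS](_ : _ = \int[mu]_x ((t * G2 h y t) * (Pk t (y - x) * v x))%:E)%E; last first.
  apply: eq_integral => x _; rewrite /f -(PkN t (x - y)) opprB; congr EFin; ring.
rewrite -Rint_EFin; last by apply: integZ; exact: integ_PkM.
rewrite RintZ; last exact: integ_PkM.
rewrite lee_fin; apply: ler_wpM2l; first by rewrite mulr_ge0// ltW.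
apply: le_Rint; [exact: integ_PkM|exact: integ_PkM|].
by move=> z; rewrite ler_wpM2l// ltW// Pk_gt0.
Qed.
End large.

Lemma powR_addr_le (p q c : R) : 0 <= p -> 0 <= q -> 0 <= c ->
  (p + q) `^ c <= 2 `^ c * (p `^ c + q `^ c).
Proof.
move=> p0 q0 c0.
have [pq|qp] := leP p q.
  apply: (@le_trans _ _ ((2 * q) `^ c)).
    by apply: ge0_ler_powR; rewrite ?nnegrE ?addr_ge0 ?mulr_ge0//; lra.
  by rewrite powRM// ler_wpM2l ?powR_ge0// lerDr powR_ge0.
apply: (@le_trans _ _ ((2 * p) `^ c)).
  by apply: ge0_ler_powR; rewrite ?nnegrE ?addr_ge0 ?mulr_ge0//; lra.
by rewrite powRM// ler_wpM2l ?powR_ge0// lerDl powR_ge0.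
Qed.

Section large_weight.
Variables (E F : set R) (h : R -> R) (eps b eta : R).
Hypotheses (mE : measurable E) (E0 : (0 < mu E)%E) (Efin : (mu E < +oo)%E).
Hypotheses (mF : measurable F) (Ffin : (mu F < +oo)%E).
Hypotheses (bh : bmeas h) (hF : forall y, `|h y| <= \1_F y).
Hypotheses (e0 : 0 < eps) (e1 : eps <= 1) (b0 : 0 < b) (b1 : b <= 1).
Hypotheses (be : 1 < b * (1 + eps)) (eta0 : 0 < eta).

Let v x := MM E x `^ b.
(** The weight v knows nothing of the set F that carries h. Adding eta 1_F ensures eta P_t |h| <=
    P_t w at every scale. *)
Let w x := v x + eta * \1_F x.

Let v0 x : 0 <= v x. Proof. exact: powR_ge0. Qed.
Let vw x : v x <= w x. Proof. by rewrite lerDl mulr_ge0// ltW. Qed.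
Let w0 x : 0 <= w x. Proof. exact: le_trans (v0 x) (vw x). Qed.

Let v1 x : v x <= 1.
Proof.
apply: (@le_trans _ _ (1 `^ b)); last by rewrite powR1.
apply: ge0_ler_powR; rewrite ?nnegrE ?(ltW b0)//.
  exact: MM_ge0.
exact: MM_le1.
Qed.

Let bv : bmeas v.
Proof.
split; first by apply: measurable_fun_powR; exact: measurable_MM.
by exists 1 => y; rewrite (ger0_norm (v0 y)).
Qed.

Let bw : bmeas w.
Proof.
split.
  apply: measurable_funD; first exact: bv.1.
  by apply: measurable_funM => //; exact: measurable_indic.
exists (1 + eta * 1) => y; rewrite (ger0_norm (w0 y)); apply: lerD (v1 y) _.
by rewrite ler_wpM2l ?(ltW eta0)// indicE lern1 leq_b1.
Qed.

(** [MM] is at least a quarter of P_1 1_E, and [MM]^b >= [MM] because [MM] lies in ]0, 1] and b <=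
    1. By the semigroup law P_t w is then at least a quarter of P_(1+t) 1_E, which is positive. *)
Let W0 x t : 0 < t -> 0 < cv (Pk t) w x.
Proof.
move=> t0; have bE := bmeas_indic mE; have t1 : 0 < 1 + t by rewrite addr_gt0.
have H1 : 0 < cv (Pk (1 + t)) (\1_E) x.
  by apply: cv_Pk_pos => //; rewrite int_indic.
have iE := integ_indic mE Efin.
have := cv_Pk_cv x ltr01 t0 (measurable_PkT 1) (fun z => norm_Pk_le z ltr01) iE.
rewrite (_ : cv (Pk 1) (Pk t) = Pk (1 + t)) => [E2|]; last first.
  by apply/funext => z; rewrite cv_Pk_Pk.
have bc : bmeas (cv (Pk 1) (\1_E) : R -> R).
  split; first exact: (measurable_sec2 (1 : R) (mV2 bE)).
  exists 1 => y; apply: cv_Pk_le => // z.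
  by rewrite ger0_norm ?indicE ?lern1 ?leq_b1.
apply: (@lt_le_trans _ _ (4^-1 * cv (Pk (1 + t)) (\1_E) x)).
  by rewrite mulr_gt0// invr_gt0.
rewrite -E2 -RintZ; last exact: integ_PkM.
apply: le_Rint; [exact: integZ (integ_PkM x t0 bc)|exact: integ_PkM|].
move=> y; rewrite mulrCA ler_wpM2l ?(ltW (Pk_gt0 _ t0))//.
apply: le_trans (vw y); apply: (@le_trans _ _ (MM E y)).
  by rewrite ler_pdivrMl//; exact: Pk_le_MM.
have M0' := MM_gt0 mE E0 Efin y; have M1' := MM_le1 mE Efin y.
by rewrite -{1}(powRr1 (ltW M0')) /v ger_powR// ?M0' ?M1'.
Qed.

(** Let V be the extension of |h|. From V <= 1 and eps <= 1 follows V^2 <= V^eps, and eta V <= W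
    gives V^eps <= eta^(-eps) W^eps. *)
Let HV x t : 0 < t -> cv (Pk t) (fun y => `|h y|) x ^+ 2 * cv (Pk t) w x `^ 1 <=
   eta `^ (- eps) * cv (Pk t) w x `^ (1 + eps).
Proof.
move=> t0; have wp := W0 x t0; have bn := bmeas_norm bh.
set V := cv (Pk t) (fun y => `|h y|) x; set W := cv (Pk t) w x in wp *.
have V0 : 0 <= V by apply: Rintegral_ge0 => y _; rewrite mulr_ge0// ltW// Pk_gt0.
have V1 : V <= 1.
  apply: le_trans (ler_norm _) _; apply: cv_Pk_le => // y.
  by rewrite normr_id (le_trans (hF y))// indicE lern1 leq_b1.
have VW : eta * V <= W.
  rewrite -RintZ; last exact: integ_PkM.
  apply: le_Rint; [exact: integZ (integ_PkM x t0 bn)|exact: integ_PkM|].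
  move=> y; rewrite mulrCA ler_wpM2l ?(ltW (Pk_gt0 _ t0))// /w.
  by rewrite (@le_trans _ _ (eta * \1_F y))// ?lerDr// ler_wpM2l ?(ltW eta0).
have Wp : W `^ (1 + eps) = W `^ 1 * W `^ eps by rewrite powRD// (gt_eqF wp) implybT.
rewrite Wp mulrCA mulrC ler_wpM2l ?powR_ge0//.
apply: (@le_trans _ _ (V `^ eps)).
  move: V0; rewrite le_eqVlt => /orP[/eqP <-|Vp]; first by rewrite expr0n/= powR_ge0.
  rewrite -(powR_mulrn 2 (ltW Vp)); apply: ger_powR; first by rewrite Vp V1.
  by rewrite (le_trans e1)// ler1n.
rewrite powRN ler_pdivlMl ?powR_gt0// -powRM ?(ltW eta0)//.
by apply: ge0_ler_powR; rewrite ?nnegrE ?(ltW e0) ?(ltW wp) ?mulr_ge0// ltW.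
Qed.

(** The exponents are a = 1 and c = 1 + eps. The integral of w^(1 + eps) splits into a power b (1 +
    eps) > 1 of the maximal function, integrable by [MM_powR], and eta^(1 + eps) times the measure
    of F. *)
Lemma weighted_sqf_large_le :
  (\int[mu]_x ((MM E x `^ b)%:E * sqf h x) <=
   (8 * (2 * M0 1 (1 + eps) (eta `^ (- eps)) + 1) * 2 `^ (1 + eps))%:E *
    ((4 `^ (b * (1 + eps)) * (3 / (b * (1 + eps) - 1)))%:E * mu E +
     (eta `^ (1 + eps))%:E * mu F))%E.
Proof.
have c1 : 1 < 1 + eps by rewrite ltrDl.
have H1 := weighted_sqf_large mF Ffin bh hF bv bw v0 vw.
have H2 := carleson_indic c1 (powR_ge0 eta (- eps)) bh bw w0 W0 HV.
have k0 : 0 <= 2 * M0 1 (1 + eps) (eta `^ (- eps)) + 1.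
  by rewrite addr_ge0// mulr_ge0// M0_ge0// powR_ge0.
apply: (le_trans H1); rewrite -mulrA EFinM -muleA; apply: lee_wpmul2l => //.
apply: (le_trans H2); rewrite EFinM -muleA; apply: lee_wpmul2l; first by rewrite lee_fin.
have mM : measurable_fun setT (fun x => MM E x `^ (b * (1 + eps))).
  by apply: measurable_fun_powR; exact: measurable_MM.
have mI : measurable_fun setT (\1_F : R -> R) by exact: measurable_indic.
have p2 : 0 <= 2 `^ (1 + eps) :> R by exact: powR_ge0.
have pe : 0 <= eta `^ (1 + eps) by exact: powR_ge0.
apply: (@le_trans _ _ ((2 `^ (1 + eps))%:E * (\int[mu]_x (MM E x `^ (b * (1 + eps)))%:E +
   (eta `^ (1 + eps))%:E * \int[mu]_x (\1_F x)%:E))%E).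
  have iF0 x : 0 <= (\1_F x : R) by rewrite indicE.
  rewrite -[X in (X + _)%E]mul1e -(eiZD ler01 pe mM mI (fun=> powR_ge0 _ _) iF0).
  rewrite -eiZ; last 3 first.
  - by apply: emeasurable_funD; apply: measurable_EF; exact: measurable_funM.
  - move=> x; rewrite -EFinD lee_fin mul1r.
    exact: (addr_ge0 (powR_ge0 _ _) (mulr_ge0 pe (iF0 x))).
  - by rewrite lee_fin.
  apply: lei.
  - by apply: measurable_EF; apply: measurable_fun_powR; exact: bw.1.
  - apply: measurable_funeM.
    by apply: emeasurable_funD; apply: measurable_EF; exact: measurable_funM.
  - by move=> x; rewrite lee_fin powR_ge0.
  - move=> x; rewrite -EFinD -EFinM lee_fin mul1r /w.
    have c0 : 0 <= 1 + eps by rewrite addr_ge0// ltW.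
    apply: le_trans (powR_addr_le (v0 x) (mulr_ge0 (ltW eta0) (iF0 x)) c0) _.
    rewrite /v -powRrM powRM ?(ltW eta0)// indic_powR//.
    by rewrite addr_gt0.
apply: lee_wpmul2l; first by rewrite lee_fin.
rewrite int_indic//; apply: leeD => //.
exact: (MM_powR mE E0 Efin be).
Qed.
End large_weight.

Lemma restricted_bound s1 s2 kp : 0 < s1 -> 0 < s2 -> s1 + s2 = 1 ->
  0 < kp -> kp <= 1 / 4 -> exists2 C : R, 0 < C &
  forall (E F : set R) (g h : R -> R) (e f : R),
    measurable E -> measurable F -> bmeas g -> bmeas h ->
    (forall y, `|g y| <= \1_E y) -> (forall y, `|h y| <= \1_F y) ->
    0 < e -> e <= f -> (mu E <= e%:E)%E -> (mu F <= f%:E)%E ->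
    (BB s1 s2 g h <= (C * e * (f / e) `^ kp)%:E)%E.
Proof.
move=> s10 s20 s12 k0 k1.
(* This solves (1 - 2 kp)(1 + eps) = 1, and kp <= 1/4 amounts to eps <= 1. *)
pose eps := 2 * kp / (1 - 2 * kp).
have d0 : 0 < 1 - 2 * kp by lra.
have eps0 : 0 < eps by rewrite divr_gt0//; lra.
have eps1 : eps <= 1 by rewrite /eps ler_pdivrMr//; lra.
have epsE : (1 - 2 * kp) * (1 + eps) = 1 by rewrite /eps; field; rewrite gt_eqF.
have epsE2 : (1 - 2 * kp) * eps = 2 * kp by rewrite /eps; field; rewrite gt_eqF.
(* Both b < 1, for the small set, and b (1 + eps) > 1, for the large one, have to hold; any b
   strictly between 1 / (1 + eps) and 1 would do. *)
pose b := 1 - eps / 3.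
have b0 : 0 < b by rewrite /b; lra.
have b1 : b < 1 by rewrite /b; lra.
have be : 1 < b * (1 + eps).
  have : 0 <= eps * (1 - eps) by rewrite mulr_ge0 ?(ltW eps0)//; lra.
  by rewrite /b; nra.
pose Ca := 2 * 4 `^ b * (2 * M0 (- b) (2 - b) 1 + 1).
pose m0 := M0 1 (1 + eps) 1.
pose Cw := 4 `^ (b * (1 + eps)) * (3 / (b * (1 + eps) - 1)).
pose Cb := 8 * (2 * m0 + 1) * 2 `^ (1 + eps) * (Cw * 2 + 1).
have m00 : 0 <= m0 by apply: M0_ge0 => //; rewrite ltrDl.
have Ca0 : 0 <= Ca.
  have : 0 <= M0 (- b) (2 - b) 1 by apply: M0_ge0 => //; lra.
  by move=> h; rewrite /Ca mulr_ge0 ?mulr_ge0 ?powR_ge0// addr_ge0// mulr_ge0.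
have Cw0 : 0 <= Cw by rewrite mulr_ge0 ?powR_ge0// divr_ge0// subr_ge0 ltW.
have Cb0 : 0 < Cb.
  rewrite /Cb mulr_gt0//; last by rewrite ltr_wpDl// mulr_ge0.
  rewrite mulr_gt0 ?powR_gt0// mulr_gt0// ltr_wpDl// mulr_ge0//.
have S0 : 0 < schurC s1 s2.
  have a1 : 0 < s1 < 1 by rewrite s10/=; lra.
  have a2 : 0 < s2 < 1 by rewrite s20/=; lra.
  by rewrite /schurC mulr_gt0// addr_gt0// ?pwc_gt0// divr_gt0.
exists (schurC s1 s2 * (Ca * 2 + Cb)); first by rewrite mulr_gt0// ltr_wpDl// mulr_ge0.
move=> E F g h e f mE mF bg bh gE hF e0 ef Ee Ff.
(* E may be a null set. The added interval gives measure between e and 2 e, so that the maximal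
   function of the indicator of E' is positive. *)
pose E' := E `|` `[0, e]%classic.
have mI : measurable (`[0, e]%classic : set R) by exact: measurable_itv.
have mE' : measurable E' by exact: measurableU.
have muI : mu `[0, e]%classic = e%:E.
  by rewrite lebesgue_measure_itv/= lte_fin e0 -EFinB subr0.
have E0 : (0 < mu E')%E.
  apply: (@lt_le_trans _ _ e%:E); first by rewrite lte_fin.
  by rewrite -muI; apply: le_measure; rewrite ?inE//; exact: subsetUr.
have Ele : (mu E' <= (2 * e)%:E)%E.
  apply: le_trans (measureU2 _ _ _) _ => //.
  apply: (@le_trans _ _ (e%:E + e%:E)%E); last by rewrite -EFinD mulr_natl mulr2n.
  apply: leeD; first exact: Ee.
  by rewrite le_eqVlt; apply/orP; left; apply/eqP; exact: muI.
have Efin : (mu E' < +oo)%E by rewrite (le_lt_trans Ele)// ltry.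
have Ffin : (mu F < +oo)%E by rewrite (le_lt_trans Ff)// ltry.
have gE' y : `|g y| <= \1_E' y.
  apply: (le_trans (gE y)); rewrite !indicE ler_nat.
  have [yE|//] := boolP (y \in E).
  have -> : y \in E' by apply: mem_set; left; exact: set_mem.
  by [].
have f0 : 0 < f := lt_le_trans e0 ef.
pose rho := f / e; have rho1 : 1 <= rho by rewrite ler_pdivlMr// mul1r.
have rho0 : 0 < rho := lt_le_trans ltr01 rho1.
(* Chosen so that eta^(1 + eps) = e / f, which makes the contribution of F no larger than e. The
   price is the factor eta^(- eps) = rho^(2 kp) in the constant. *)
pose eta := rho `^ (- (1 - 2 * kp)).
have eta0 : 0 < eta by rewrite powR_gt0.
have etaE : eta `^ (1 + eps) = e / f.
  by rewrite /eta -powRrM mulNr epsE powR_inv1 ?(ltW rho0)// /rho invf_div.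
have etaE2 : eta `^ (- eps) = rho `^ (2 * kp).
  by rewrite /eta -powRrM mulrNN epsE2.
have HA := weighted_sqf_small mE' E0 Efin bg gE' (introT andP (conj b0 b1)).
have HB := weighted_sqf_large_le mE' E0 Efin mF Ffin bh hF eps0 eps1 b0 (ltW b1) be eta0.
have aux (m z : R) : 1 <= z -> 2 * (z * m) + 1 <= (2 * m + 1) * z.
  by move=> z1; rewrite [leRHS]mulrDl [1 * z]mul1r -(mulrA 2 m z) (mulrC m z) lerD2l.
have mm0 x : 0 < MM E' x := MM_gt0 mE' E0 Efin x.
have mMM (p : R) : measurable_fun setT (fun x => (MM E' x `^ p)%:E).
  by apply: measurable_EF; apply: measurable_fun_powR; exact: measurable_MM.
(* The weighted square function of g is of size e and that of h of size e rho^(2 kp); multiplying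
   the first by rho^kp and dividing the second by it makes both e rho^kp. *)
have nu0 : 0 < rho `^ kp by rewrite powR_gt0.
set nu := rho `^ kp in nu0.
have msA : measurable_fun setT (fun x => (MM E' x `^ (- b))%:E * sqf g x)%E.
  by apply: emeasurable_funM => //; exact: measurable_sqf.
have msB : measurable_fun setT (fun x => (MM E' x `^ b)%:E * sqf h x)%E.
  by apply: emeasurable_funM => //; exact: measurable_sqf.
have A0 x : (0 <= (MM E' x `^ (- b))%:E * sqf g x)%E.
  by apply: mule_ge0; [rewrite lee_fin powR_ge0|exact: sqf_ge0].
have B0 x : (0 <= (MM E' x `^ b)%:E * sqf h x)%E.
  by apply: mule_ge0; [rewrite lee_fin powR_ge0|exact: sqf_ge0].
have nu0' : (0 <= nu%:E)%E by rewrite lee_fin ltW.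
have nui0 : (0 <= (nu^-1)%:E)%E by rewrite lee_fin invr_ge0 ltW.
have mA1 := measurable_funeM nu%:E msA; have mB1 := measurable_funeM (nu^-1)%:E msB.
have A1 x := mule_ge0 nu0' (A0 x); have B1 x := mule_ge0 nui0 (B0 x).
have mAB := emeasurable_funD mA1 mB1.
apply: (@le_trans _ _ (\int[mu]_x ((schurC s1 s2)%:E *
   (nu%:E * ((MM E' x `^ (- b))%:E * sqf g x) +
    (nu^-1)%:E * ((MM E' x `^ b)%:E * sqf h x))))%E).
  have mT (s : R) k : bmeas k -> measurable_fun setT (fun z : R * R => TT s (NN k z.1) z.2).
    move=> bk; apply: (@measurable_TT _ _ _ s (fun z : R * R => NN k z.1) snd) => //.
    - have mp : measurable_fun setT (fun z : (R * R) * R => (z.1.1, z.2)).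
        apply: measurable_fun_pair => //; exact: (measurableT_comp measurable_fst measurable_fst).
      exact: (measurableT_comp (measurable_NN bk) mp).
    - by move=> z t; exact: NN_ge0.
  apply: lei.
  - rewrite (_ : (fun x => _) = (fun x => \int[mu]_t ((\1_(`]0%R, +oo[%classic) t)%:E *
        (TT s1 (NN g x) t * TT s2 (NN h x) t)))%E); last first.
      by apply/funext => x; rewrite integral_in_indic.
    apply: measurable_ei1; last first.
      move=> x t; apply: mule_ge0; first by rewrite lee_fin.
      by apply: mule_ge0; apply: TT_ge0 => r; exact: NN_ge0.
    apply: emeasurable_funM; first by apply: measurable_EF; exact: measurable_indicc.
    by apply: emeasurable_funM; exact: mT.
  - exact: (measurable_funeM (schurC s1 s2)%:E mAB).
  - move=> x; apply: integral_ge0 => t _.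
    by apply: mule_ge0; apply: TT_ge0 => r; exact: NN_ge0.
  (* Schur's test is applied at each x with its own weight, proportional to [MM]^(- b): this is how
     the maximal function enters. *)
  - move=> x; have w0 : 0 < nu * MM E' x `^ (- b) by rewrite mulr_gt0 ?powR_gt0.
    have := schur s10 s20 s12 w0 (measurable_sec1 x (measurable_NN bg))
      (measurable_sec1 x (measurable_NN bh)) (NN_ge0 g x) (NN_ge0 h x).
    by rewrite invfM powRN invrK -!/(sqf _ _) !EFinM -!muleA.
have S0' : (0 <= (schurC s1 s2)%:E)%E by rewrite lee_fin ltW.
rewrite (eiZ mAB (fun x => adde_ge0 (A1 x) (B1 x)) S0').
rewrite (eiD mA1 mB1 A1 B1) (eiZ msA A0 nu0') (eiZ msB B0 nui0).
rewrite (_ : schurC s1 s2 * _ * e * _ = schurC s1 s2 * ((Ca * 2 + Cb) * (e * nu))); last first.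
  by rewrite /nu /rho !mulrA.
rewrite [X in (_ <= X)%E]EFinM; apply: lee_wpmul2l; first exact: S0'.
have C1 : (nu%:E * \int[mu]_x ((MM E' x `^ (- b))%:E * sqf g x) <= (Ca * 2 * (e * nu))%:E)%E.
  apply: (@le_trans _ _ (nu%:E * (Ca%:E * (2 * e)%:E))%E).
    apply: lee_wpmul2l => //; apply: le_trans HA _; apply: lee_wpmul2l => //.
  by rewrite -!EFinM lee_fin le_eqVlt; apply/orP; left; apply/eqP; ring.
have C2 : ((nu^-1)%:E * \int[mu]_x ((MM E' x `^ b)%:E * sqf h x) <= (Cb * (e * nu))%:E)%E.
  apply: (@le_trans _ _ ((nu^-1)%:E * (((8 * (2 * m0 + 1) * 2 `^ (1 + eps)) * nu ^+ 2)%:E *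
     ((Cw * (2 * e) + e)%:E)))%E).
    apply: lee_wpmul2l => //; apply: le_trans HB _; rewrite etaE etaE2.
    have nn : rho `^ (2 * kp) = nu ^+ 2.
      by rewrite mulrC powRrM -/nu powR_mulrn// ltW.
    have nn1 : 1 <= nu ^+ 2.
      rewrite -nn; apply: (@le_trans _ _ (rho `^ 0)); first by rewrite powRr0.
      by apply: ler_powR => //; rewrite mulr_ge0// ltW.
    rewrite nn; apply: lee_pmul.
    - rewrite lee_fin mulr_ge0 ?powR_ge0// mulr_ge0// addr_ge0// mulr_ge0// M0_ge0//.
        by rewrite ltrDl.
      by rewrite (le_trans _ nn1).
    - by apply: adde_ge0; apply: mule_ge0 => //; rewrite lee_fin ?divr_ge0 ?ltW.
    - rewrite lee_fin [X in _ <= X]mulrAC ler_wpM2r ?powR_ge0// -mulrA ler_wpM2l//.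
      by rewrite M0_lin; exact: aux.
    - rewrite EFinD; apply: leeD.
        apply: (@le_trans _ _ (Cw%:E * (2 * e)%:E)%E); last by rewrite -EFinM.
        by apply: lee_wpmul2l; [rewrite lee_fin|exact: Ele].
      apply: (@le_trans _ _ ((e / f)%:E * f%:E)%E).
        by apply: lee_wpmul2l => //; rewrite lee_fin divr_ge0 ?ltW.
      by rewrite -EFinM lee_fin divfK ?gt_eqF.
  rewrite -!EFinM lee_fin le_eqVlt; apply/orP; left; apply/eqP; rewrite /Cb.
  by move: (2 `^ _) => T; field; rewrite gt_eqF.
apply: (@le_trans _ _ ((Ca * 2 * (e * nu))%:E + (Cb * (e * nu))%:E)%E); first exact: leeD.
by rewrite -EFinD lee_fin mulrDl.
Qed.
End restricted.

(** * Smooth compactly supported functions *)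

Section smooth.
Context {R : realType}.
Local Notation mu := (@lebesgue_measure R).
Local Notation "\I f" := (Rintegral mu setT f) (at level 10).
Implicit Types (a s t x y z r u : R) (f g : R -> R).

Definition smooth f := forall (n : nat) x, derivable (derive1n n f) x 1.

Lemma smooth_derive f : smooth f -> smooth (derive1 f).
Proof. by move=> sf n x; rewrite -derive1Sn; exact: sf. Qed.

Lemma smooth_is_derive f x : smooth f -> is_derive x 1 f ((derive1 f) x).
Proof. by move=> sf; rewrite derive1E; apply: DeriveDef => //; exact: (sf 0). Qed.

Lemma smooth_cont f : smooth f -> continuous f.
Proof. by move=> sf x; exact: (derive_cont (smooth_is_derive x sf)). Qed.

Lemma smooth_measurable f : smooth f -> measurable_fun setT f.
Proof. by move=> sf; apply: continuous_measurable_fun; exact: smooth_cont. Qed.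

Lemma is_derive_derive1 f g : (forall x, is_derive x 1 f (g x)) -> (derive1 f) = g.
Proof. by move=> D; apply/funext => x; rewrite derive1E; have := D x => Dx; rewrite derive_val. Qed.

(** Smoothness is proved through a class of functions stable under differentiation, which avoids
    formulas for higher derivatives. *)
Lemma smooth_ind (P : (R -> R) -> Prop) :
  (forall f, P f -> (forall x, derivable f x 1) /\ P (derive1 f)) ->
  forall f, P f -> smooth f.
Proof.
move=> H f Pf n; elim: n f Pf => [|n IH] f /H [df Pf'] x; first exact: df.
by rewrite derive1Sn; exact: IH.
Qed.

Lemma smoothD f g : smooth f -> smooth g -> smooth (fun x => f x + g x).
Proof.
move=> sf sg; pose P h := exists f g, [/\ smooth f, smooth g & h = fun x => f x + g x].
apply: (@smooth_ind P); last by exists f, g.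
move=> h [{}f [{}g [{}sf {}sg ->]]].
have D x : is_derive x 1 (fun x => f x + g x) ((derive1 f) x + (derive1 g) x).
  have D1 := smooth_is_derive x sf; have D2 := smooth_is_derive x sg.
  exact: is_deriveD.
split; first by move=> x; case: (D x).
rewrite (is_derive_derive1 D); exists (derive1 f), (derive1 g).
exact: And3 (smooth_derive sf) (smooth_derive sg) erefl.
Qed.

Lemma smoothM f g : smooth f -> smooth g -> smooth (fun x => f x * g x).
Proof.
(* Finite sums of products are stable under differentiation. *)
move=> sf sg.
pose P h := exists s : seq ((R -> R) * (R -> R)),
  (forall p, List.In p s -> smooth p.1 /\ smooth p.2) /\
  h = fun x => foldr (fun p r => p.1 x * p.2 x + r) 0 s.
apply: (@smooth_ind P); last first.
  exists [:: (f, g)]; split; first by move=> p [<-|[]]; exact: (conj sf sg).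
  by apply/funext => x /=; rewrite addr0.
move=> h [s [ss ->]].
pose d (s : seq ((R -> R) * (R -> R))) : seq ((R -> R) * (R -> R)) :=
  flatten [seq [:: (derive1 p.1, p.2); (p.1, derive1 p.2)] | p <- s].
pose S (s : seq ((R -> R) * (R -> R))) x : R := foldr (fun p r => p.1 x * p.2 x + r) 0 s.
have D x : is_derive x 1 (S s) (S (d s) x).
  elim: s ss => [|p s IH] ss; first exact: is_derive_cst.
  have [s1 s2] := ss p (or_introl erefl).
  have D1 := smooth_is_derive x s1; have D2 := smooth_is_derive x s2.
  have D3 := IH (fun q hq => ss q (or_intror hq)).
  rewrite (_ : S (p :: s) = fun y => p.1 y * p.2 y + S s y)//.
  apply: is_derive_eq; rewrite /GRing.scale /= -/(S _ _) -/(d s); ring.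
split; first by move=> x; case: (D x).
rewrite (is_derive_derive1 D); exists (d s); split; last by [].
elim: s ss {D} => [//|p s IH] ss q /= [<-|[<-|hq]].
- have [s1 s2] := ss p (or_introl erefl).
  exact: (conj (smooth_derive s1) s2).
- have [s1 s2] := ss p (or_introl erefl).
  exact: (conj s1 (smooth_derive s2)).
- exact: (IH (fun q' h' => ss q' (or_intror h')) q hq).
Qed.

Lemma smooth_cpt_derive f : smooth_cpt f -> smooth_cpt (derive1 f).
Proof.
move=> [sf [M fM]]; split; first exact: smooth_derive.
exists M => x Mx; rewrite derive1E.
rewrite (@near_eq_derive _ _ _ f (cst 0)) ?derive_cst//.
near=> y; rewrite fM//; near: y.
have : {for x, continuous (fun y : R => `|y|)} by exact: norm_continuous.
by move=> /cvgr_gt; apply.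
Unshelve. all: end_near. Qed.

Lemma smooth_cptM f g : smooth_cpt f -> smooth g -> smooth_cpt (fun x => f x * g x).
Proof.
move=> [sf [M fM]] sg; apply: (conj (smoothM sf sg)).
by exists M => x Mx; rewrite fM// mul0r.
Qed.

Lemma smooth_cptD f g : smooth_cpt f -> smooth_cpt g -> smooth_cpt (fun x => f x + g x).
Proof.
move=> [sf [M fM]] [sg [M' gM]]; apply: (conj (smoothD sf sg)).
by exists (Num.max M M') => x; rewrite gt_max => /andP[h1 h2]; rewrite fM// gM// addr0.
Qed.

Lemma smooth_cpt_supp f : smooth_cpt f ->
  exists M : R, 1 <= M /\ forall x, M < `|x| -> f x = 0.
Proof.
move=> [_ [M fM]]; exists (Num.max M 1); split; first by rewrite le_max lexx orbT.
by move=> x; rewrite gt_max => /andP[h _]; exact: fM.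
Qed.

Lemma smooth_cpt_smooth f : smooth_cpt f -> smooth f. Proof. by case. Qed.

Opaque smooth smooth_cpt.

Lemma smooth_cpt_bmeas f : smooth_cpt f -> bmeas f.
Proof.
move=> sf; have sm := smooth_cpt_smooth sf; have [M [M1 fM]] := smooth_cpt_supp sf.
split; first exact: smooth_measurable.
have MM : - M <= M by lra.
have cf : {within `[- M, M], continuous f} by apply: continuous_subspaceT; exact: smooth_cont.
have cfn : {within `[- M, M], continuous (fun x => - f x)}.
  by apply: continuous_subspaceT => x; apply: continuousN; exact: smooth_cont.
have [c1 _ h1] := EVT_max MM cf; have [c2 _ h2] := EVT_max MM cfn.
exists (`|f c1| + `|f c2|) => y.
have [yM|yM] := ltP M `|y|; first by rewrite fM// normr0 addr_ge0.
have yI : y \in `[- M, M] by rewrite in_itv/= -ler_norml.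
have := h1 y yI; have := h2 y yI.
have := ler_norm (f c1); have := ler_norm (- f c2); rewrite normrN.
have := normr_ge0 (f c1); have := normr_ge0 (f c2).
by move=> *; rewrite ler_norml; apply/andP; split; lra.
Qed.

Lemma smooth_cpt_integ f : smooth_cpt f -> integ f.
Proof.
move=> sf; have [M [M1 fM]] := smooth_cpt_supp sf; have [mf [B fB]] := smooth_cpt_bmeas sf.
apply: (@integ_le _ _ (fun x => B * \1_(`[- M, M]%classic) x)) => //.
  by apply: integZ; exact: integ_indic_itv.
move=> x; rewrite indicE mem_setE in_itv/= -ler_norml.
by have [xM|xM] := leP `|x| M; [rewrite mulr1|rewrite fM// normr0 mulr0].
Qed.

Lemma Rint_deriv0 (F F' : R -> R) (M : R) : (forall x, is_derive x 1 F (F' x)) ->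
  continuous F' -> (forall x, M < `|x| -> F x = 0) ->
  (forall x, M < `|x| -> F' x = 0) -> \I F' = 0.
Proof.
move=> dF cF FM F'M; pose N := `|M| + 1.
have MN : M < N by rewrite (le_lt_trans (ler_norm M))// ltrDl.
have N0 : 0 <= N by rewrite addr_ge0.
have [_] := @Rint_FTC R F F' (- N) N ltac:(lra) (fun x _ => dF x) (fun x _ => cF x).
rewrite !FM ?normrN ?ger0_norm// subrr => <-.
rewrite [RHS]Rintegral_indic; apply: eq_Rintegral => x _.
rewrite indicE mem_setE in_itv/= -ler_norml.
have [xN|xN] := leP `|x| N; first by rewrite mul1r.
by rewrite F'M ?mulr0// (lt_trans MN).
Qed.

Lemma Rint_parts f (F F' : R -> R) : smooth_cpt f -> (forall x, is_derive x 1 F (F' x)) ->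
  continuous F' -> \I (fun x => derive1 f x * F x + f x * F' x) = 0.
Proof.
move=> sf dF cF'; have [M [M1 fM]] := smooth_cpt_supp sf.
have sf' := smooth_cpt_derive sf; have [M' [M1' fM']] := smooth_cpt_supp sf'.
apply: (@Rint_deriv0 (fun x => f x * F x) _ (Num.max M M')).
- move=> x; have D1 := smooth_is_derive x (smooth_cpt_smooth sf); have D2 := dF x.
  by apply: is_derive_eq; rewrite /GRing.scale /=; ring.
- move=> x; apply: cvgD; apply: cvgM.
  + exact: (smooth_cont (smooth_cpt_smooth sf')).
  + exact: (derive_cont (dF x)).
  + exact: (smooth_cont (smooth_cpt_smooth sf)).
  + exact: cF'.
- by move=> x; rewrite gt_max => /andP[h _]; rewrite fM// mul0r.
- by move=> x; rewrite gt_max => /andP[h h']; rewrite fM// fM'// !mul0r addr0.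
Qed.

Lemma bmeas_integM f (c : R -> R) : integ f -> measurable_fun setT c ->
  (forall x, `|c x| <= 1) -> integ (fun x => f x * c x).
Proof.
move=> fi mc c1; apply: (integ_le _ (integ_norm fi)).
  by apply: measurable_funM => //; exact: integ_measurable.
by move=> x; rewrite normrM ler_piMr.
Qed.

Lemma trigE y xi : 2 * pi * y * xi = 2 * pi * xi * y :> R. Proof. by ring. Qed.

Lemma integ_FCi f xi : integ f -> integ (fun y => f y * cos (2 * pi * y * xi)).
Proof.
move=> fi; rewrite (_ : (fun y => _) = (fun y => f y * cos (2 * pi * xi * y))).
  apply: (bmeas_integM fi); first exact: (measurable_trig _).1.
  by move=> x; exact: norm_cos_le1.
by apply/funext => y; rewrite trigE.
Qed.

Lemma integ_FSi f xi : integ f -> integ (fun y => f y * sin (2 * pi * y * xi)).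
Proof.
move=> fi; rewrite (_ : (fun y => _) = (fun y => f y * sin (2 * pi * xi * y))).
  apply: (bmeas_integM fi); first exact: (measurable_trig _).2.
  by move=> x; exact: norm_sin_le1.
by apply/funext => y; rewrite trigE.
Qed.

Lemma measurable_trig2 (c : R -> R) f : measurable_fun setT f -> measurable_fun setT c ->
  measurable_fun setT (fun z : R * R => f z.2 * c (2 * pi * z.2 * z.1)).
Proof.
move=> mf mc; apply: measurable_funM; first exact: (measurableT_comp mf).
apply: (measurableT_comp mc); apply: measurable_funM => //.
exact: measurable_funM.
Qed.

Lemma measurable_FC f : measurable_fun setT f -> measurable_fun setT (FC f).
Proof.
move=> mf; apply: (@measurable_Rint_param R _ _ (fun z : R * R => f z.2 * cos (2 * pi * z.2 * z.1))).
by apply: measurable_trig2 => //; apply: measurable_fun_cos.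
Qed.

Lemma measurable_FS f : measurable_fun setT f -> measurable_fun setT (FS f).
Proof.
move=> mf; apply: (@measurable_Rint_param R _ _ (fun z : R * R => f z.2 * sin (2 * pi * z.2 * z.1))).
by apply: measurable_trig2 => //; apply: measurable_fun_sin.
Qed.

Lemma norm_FC_le f xi : integ f -> `|FC f xi| <= \I (fun y => `|f y|).
Proof.
move=> fi; apply: Rint_abs_le; last by move=> y; rewrite normrM ler_piMr// norm_cos_le1.
  exact: integ_measurable (integ_FCi xi fi).
exact: integ_norm.
Qed.

Lemma norm_FS_le f xi : integ f -> `|FS f xi| <= \I (fun y => `|f y|).
Proof.
move=> fi; apply: Rint_abs_le; last by move=> y; rewrite normrM ler_piMr// norm_sin_le1.
  exact: integ_measurable (integ_FSi xi fi).
exact: integ_norm.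
Qed.

Lemma bmeas_FC f : integ f -> bmeas (FC f).
Proof.
move=> fi; split; first exact: measurable_FC (integ_measurable fi).
by exists (\I (fun y => `|f y|)) => y; exact: norm_FC_le.
Qed.

Lemma bmeas_FS f : integ f -> bmeas (FS f).
Proof.
move=> fi; split; first exact: measurable_FS (integ_measurable fi).
by exists (\I (fun y => `|f y|)) => y; exact: norm_FS_le.
Qed.

Lemma FC_derive f xi : smooth_cpt f -> FC (derive1 f) xi = 2 * pi * xi * FS f xi.
Proof.
move=> sf; have fi := smooth_cpt_integ sf; have fi' := smooth_cpt_integ (smooth_cpt_derive sf).
have := @Rint_parts f (fun y => cos (2 * pi * y * xi))
  (fun y => - (2 * pi * xi) * sin (2 * pi * y * xi)) sf.
rewrite RintD; [|exact: integ_FCi|].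
  rewrite (_ : (fun x => f x * _) = (fun x => - (2 * pi * xi) * (f x * sin (2 * pi * x * xi)))).
    rewrite RintZ; last exact: integ_FSi.
    move=> H; apply/eqP; rewrite -subr_eq0 -mulNr; apply/eqP; apply: H.
      by move=> x; apply: is_derive_eq; rewrite /GRing.scale /=; ring.
    move=> x; apply: cvgM; first exact: cvg_cst.
    apply: continuous_comp; last exact: continuous_sin.
    by apply: cvgM; [apply: cvgM; [exact: cvg_cst|exact: cvg_id]|exact: cvg_cst].
  by apply/funext => x; ring.
rewrite (_ : (fun x => f x * _) = (fun x => - (2 * pi * xi) * (f x * sin (2 * pi * x * xi)))).
  by apply: integZ; exact: integ_FSi.
by apply/funext => x; ring.
Qed.

Lemma FS_derive f xi : smooth_cpt f -> FS (derive1 f) xi = - (2 * pi * xi) * FC f xi.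
Proof.
move=> sf; have fi := smooth_cpt_integ sf; have fi' := smooth_cpt_integ (smooth_cpt_derive sf).
have := @Rint_parts f (fun y => sin (2 * pi * y * xi))
  (fun y => (2 * pi * xi) * cos (2 * pi * y * xi)) sf.
rewrite RintD; [|exact: integ_FSi|].
  rewrite (_ : (fun x => f x * _) = (fun x => (2 * pi * xi) * (f x * cos (2 * pi * x * xi)))).
    rewrite RintZ; last exact: integ_FCi.
    move=> H; apply/eqP; rewrite -subr_eq0 mulNr opprK; apply/eqP; apply: H.
      by move=> x; apply: is_derive_eq; rewrite /GRing.scale /=; ring.
    move=> x; apply: cvgM; first exact: cvg_cst.
    apply: continuous_comp; last exact: continuous_cos.
    by apply: cvgM; [apply: cvgM; [exact: cvg_cst|exact: cvg_id]|exact: cvg_cst].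
  by apply/funext => x; ring.
rewrite (_ : (fun x => f x * _) = (fun x => (2 * pi * xi) * (f x * cos (2 * pi * x * xi)))).
  by apply: integZ; exact: integ_FCi.
by apply/funext => x; ring.
Qed.

Lemma FC_derive4 f xi : smooth_cpt f ->
  FC (derive1 (derive1 (derive1 (derive1 f)))) xi = (2 * pi * xi) ^+ 4 * FC f xi /\
  FS (derive1 (derive1 (derive1 (derive1 f)))) xi = (2 * pi * xi) ^+ 4 * FS f xi.
Proof.
move=> s0; have s1 := smooth_cpt_derive s0; have s2 := smooth_cpt_derive s1.
have s3 := smooth_cpt_derive s2.
set z := 2 * pi * xi.
have A : FC (derive1 (derive1 (derive1 (derive1 f)))) xi = z * (- z * (z * (- z * FC f xi))).
  exact: (etrans (FC_derive xi s3) (congr1 ( *%R z) (etrans (FS_derive xi s2)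
    (congr1 ( *%R (- z)) (etrans (FC_derive xi s1) (congr1 ( *%R z) (FS_derive xi s0))))))).
have B : FS (derive1 (derive1 (derive1 (derive1 f)))) xi = - z * (z * (- z * (z * FS f xi))).
  exact: (etrans (FS_derive xi s3) (congr1 ( *%R (- z)) (etrans (FC_derive xi s2)
    (congr1 ( *%R z) (etrans (FS_derive xi s1) (congr1 ( *%R (- z)) (FC_derive xi s0))))))).
split; [apply: (etrans A)|apply: (etrans B)].
  by move: (FC f xi) => w; ring.
by move: (FS f xi) => w; ring.
Qed.

(* Four integrations by parts make the transform O(xi^-4), so it stays integrable
   against symbols of size xi^2. *)
Lemma FC_decay f : smooth_cpt f -> exists2 K : R, 0 <= K & forall xi,
  (1 + (2 * pi * xi) ^+ 2) * `|FC f xi| <= K * rk 1 xi /\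
  (1 + (2 * pi * xi) ^+ 2) * `|FS f xi| <= K * rk 1 xi.
Proof.
move=> sf; have fi := smooth_cpt_integ sf.
have s4 := smooth_cpt_derive (smooth_cpt_derive (smooth_cpt_derive (smooth_cpt_derive sf))).
have i4 := smooth_cpt_integ s4.
set f4 := derive1 _ in s4 i4.
pose a := \I (fun y => `|f y|); pose b := \I (fun y => `|f4 y|).
have a0 : 0 <= a by apply: Rintegral_ge0.
have b0 : 0 <= b by apply: Rintegral_ge0.
exists (2 * (a + b)); first by rewrite mulr_ge0// addr_ge0.
move=> xi.
have key u : `|u| <= a -> `|(2 * pi * xi) ^+ 4 * u| <= b ->
    (1 + (2 * pi * xi) ^+ 2) * `|u| <= 2 * (a + b) * rk 1 xi.
  move=> ua; rewrite normrM.
  have z2 : xi ^+ 2 <= (2 * pi * xi) ^+ 2.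
    rewrite exprMn ler_peMl ?sqr_ge0// expr2.
    by have := pi_ge2 R; nra.
  rewrite (_ : (2 * pi * xi) ^+ 4 = ((2 * pi * xi) ^+ 2) ^+ 2); last by rewrite -exprM.
  rewrite ger0_norm ?sqr_ge0//; move: z2; set z := (_ * xi) ^+ 2 => z2 zb.
  have z0 : 0 <= z by exact: sqr_ge0.
  rewrite /rk expr1n ler_pdivlMr; last by rewrite ltr_pwDr// sqr_ge0.
  apply: (@le_trans _ _ ((1 + z) * `|u| * (z + 1))).
    by rewrite ler_wpM2l ?lerD2r// mulr_ge0// addr_ge0.
  have h : (1 + z) * `|u| * (z + 1) <= 2 * (`|u| + z ^+ 2 * `|u|).
    have : 0 <= `|u| * (z - 1) ^+ 2 by rewrite mulr_ge0// sqr_ge0.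
    by have := normr_ge0 u; move: (`|u|) => w; nra.
  by apply: (le_trans h); rewrite ler_pM2l// lerD.
have [eC eS] := FC_derive4 xi sf.
split; apply: key.
- exact: norm_FC_le.
- by rewrite -eC; exact: norm_FC_le.
- exact: norm_FS_le.
- by rewrite -eS; exact: norm_FS_le.
Qed.
End smooth.

(** * Fractional Laplacians and Poisson extensions *)

Section fractional.
Context {R : realType}.
Local Notation mu := (@lebesgue_measure R).
Local Notation "\I f" := (Rintegral mu setT f) (at level 10).
Implicit Types (a s t x y z r u xi : R) (f g : R -> R).

Definition gm s xi : R := (2 * pi * `|xi|) `^ s.

Lemma gm_ge0 s xi : 0 <= gm s xi. Proof. exact: powR_ge0. Qed.

Lemma lam_ge0 xi : 0 <= 2 * pi * `|xi| :> R.
Proof. by rewrite mulr_ge0// mulr_ge0// pi_ge0. Qed.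

Lemma gm_le s xi : 0 <= s -> s <= 1 -> gm s xi <= 1 + 2 * pi * `|xi|.
Proof.
move=> s0 s1; have l0 := lam_ge0 xi; rewrite /gm; move: (2 * pi * _) l0 => l l0.
have [l1|l1] := leP l 1.
  apply: (@le_trans _ _ 1); last by rewrite lerDl.
  apply: (@le_trans _ _ (1 `^ s)); last by rewrite powR1.
  by apply: ge0_ler_powR; rewrite ?nnegrE.
apply: (@le_trans _ _ (l `^ 1)); first by apply: ler_powR => //; exact: ltW.
by rewrite powRr1// lerDr.
Qed.

Lemma gm1 xi : gm 1 xi = 2 * pi * `|xi|.
Proof. by rewrite /gm powRr1// lam_ge0. Qed.

Lemma measurable_gm s : measurable_fun setT (gm s).
Proof.
by apply: measurable_fun_powR; apply: measurable_funM.
Qed.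

Lemma lin_sq_le xi : 1 + 2 * pi * `|xi| <= 2 * (1 + (2 * pi * xi) ^+ 2) :> R.
Proof.
have -> : (2 * pi * xi) ^+ 2 = (2 * pi * `|xi|) ^+ 2 :> R.
  by rewrite !exprMn real_normK ?num_real.
by move: (2 * pi * `|xi|) => l; have := sqr_ge0 (l - 1); nra.
Qed.

Lemma integ_symbol f (c : R -> R) : smooth_cpt f -> measurable_fun setT c ->
  (forall xi, `|c xi| <= 2 * (1 + (2 * pi * xi) ^+ 2)) ->
  integ (fun xi => c xi * FC f xi) /\ integ (fun xi => c xi * FS f xi).
Proof.
move=> sf mc cb; have fi := smooth_cpt_integ sf.
have [K K0 HK] := FC_decay sf; have i1 := (@integ_rk1 R).1.
split; apply: (integ_le _ (integZ (2 * K) i1)).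
- by apply: measurable_funM => //; exact: measurable_FC (integ_measurable fi).
- move=> xi; rewrite normrM -mulrA; apply: le_trans (_ : 2 * ((1 + (2 * pi * xi) ^+ 2) * `|FC f xi|) <= _).
    by rewrite mulrA ler_wpM2r.
  by rewrite ler_pM2l//; have [] := HK xi.
- by apply: measurable_funM => //; exact: measurable_FS (integ_measurable fi).
- move=> xi; rewrite normrM -mulrA; apply: le_trans (_ : 2 * ((1 + (2 * pi * xi) ^+ 2) * `|FS f xi|) <= _).
    by rewrite mulrA ler_wpM2r.
  by rewrite ler_pM2l//; have [] := HK xi.
Qed.

Lemma integ_gmF s f : 0 <= s -> s <= 1 -> smooth_cpt f ->
  integ (fun xi => gm s xi * FC f xi) /\ integ (fun xi => gm s xi * FS f xi).
Proof.
move=> s0 s1 sf; apply: (integ_symbol sf (measurable_gm s)) => xi.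
by rewrite ger0_norm ?gm_ge0// (le_trans (gm_le xi s0 s1))// lin_sq_le.
Qed.

Lemma fraclapE s f : fraclap s f =
  FT (fun xi => gm s xi * FC f xi) (fun xi => gm s xi * FS f xi).
Proof.
apply/funext => x; apply: eq_Rintegral => xi _.
by rewrite -/(gm s xi) mulrDr !mulrA.
Qed.

Lemma bmeas_fraclap s f : 0 <= s -> s <= 1 -> smooth_cpt f -> bmeas (fraclap s f).
Proof.
move=> s0 s1 sf; rewrite fraclapE; have [i1 i2] := integ_gmF s0 s1 sf.
exact: bmeas_FT.
Qed.

Lemma FT_derive (u v u' v' : R -> R) x : integ u -> integ v -> integ u' -> integ v' ->
  (forall xi, u' xi = 2 * pi * xi * v xi) -> (forall xi, v' xi = - (2 * pi * xi) * u xi) ->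
  is_derive x 1 (FT u v) (FT u' v' x).
Proof.
move=> iu iv iu' iv' hu hv.
apply: (@is_derive_Rint _
  (fun x xi => u xi * cos (2 * pi * x * xi) + v xi * sin (2 * pi * x * xi))
  (fun x xi => u' xi * cos (2 * pi * x * xi) + v' xi * sin (2 * pi * x * xi)) x 1
  (fun xi => `|u' xi| + `|v' xi|)) => //.
- by move=> y _; exact: integ_FT.
- by move=> y xi _; apply: is_derive_eq; rewrite /GRing.scale /= hu hv; ring.
- by apply: integD; exact: integ_norm.
- by move=> y xi _; exact: trig_sum_le (norm_cos_le1 _) (norm_sin_le1 _).
Qed.

Lemma fraclap1_derive f x : smooth_cpt f ->
  is_derive x 1 (fraclap 1 f) (fraclap 1 (derive1 f) x).
Proof.
move=> sf; rewrite !fraclapE; have sf' := smooth_cpt_derive sf.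
have [i1 i2] := integ_gmF ler01 (lexx 1) sf.
have [j1 j2] := integ_gmF ler01 (lexx 1) sf'.
apply: (FT_derive x i1 i2 j1 j2) => xi.
- by rewrite (FC_derive xi sf); ring.
- by rewrite (FS_derive xi sf); ring.
Qed.

(** The operator commutes with differentiation, so the functions of this form are a class to which
    [smooth_ind] applies. *)
Lemma smooth_fraclap1 f : smooth_cpt f -> smooth (fraclap 1 f).
Proof.
move=> sf; pose P (h : R -> R) := exists2 f, smooth_cpt f & h = fraclap 1 f.
apply: (@smooth_ind R P); last by exists f.
move=> h [{}f {}sf ->]; split; first by move=> x; case: (fraclap1_derive x sf).
exists (derive1 f); first exact: smooth_cpt_derive.
by apply: is_derive_derive1 => x; exact: fraclap1_derive.
Qed.

Lemma cv_Pk_smooth f t x : 0 < t -> smooth_cpt f ->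
  cv (Pk t) f x = FT (fun xi => ek t xi * FC f xi) (fun xi => ek t xi * FS f xi) x.
Proof.
move=> t0 sf; have fi := smooth_cpt_integ sf; have mf := integ_measurable fi.
pose F y xi := f y * (ek t xi * cos (2 * pi * (x - y) * xi)).
have [||_ _ _ H] := @Rint_fubini _ F (fun y => `|f y|) (ek t) _ (integ_norm fi) (integ_ek t0).
- apply: measurable_funM; first exact: (measurableT_comp mf).
  apply: measurable_funM; first exact: measurable_ekc.
  apply: measurable_fun_cos; apply: measurable_funM => //.
  by apply: measurable_funM => //; exact: measurable_funB.
- move=> y xi; rewrite /F normrM ler_wpM2l// normrM (gtr0_norm (ek_gt0 _ _)).
  by rewrite ler_piMr ?(ltW (ek_gt0 _ _))// norm_cos_le1.
transitivity (\I (fun y => \I (F y))).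
  apply: eq_Rintegral => y _; rewrite /F (RintZ _ (integ_ek_cos _ t0)) (ek_cos _ t0).
  by rewrite mulrC.
rewrite H; apply: eq_Rintegral => xi _; rewrite /F.
have i1 := integ_FCi xi fi; have i2 := integ_FSi xi fi.
transitivity (\I (fun y => ek t xi * cos (2 * pi * x * xi) * (f y * cos (2 * pi * y * xi)) +
    ek t xi * sin (2 * pi * x * xi) * (f y * sin (2 * pi * y * xi)))).
  apply: eq_Rintegral => y _.
  rewrite (_ : 2 * pi * (x - y) * xi = 2 * pi * x * xi - 2 * pi * y * xi); last by ring.
  by rewrite cosB; ring.
rewrite (RintD (integZ _ i1) (integZ _ i2)) (RintZ _ i1) (RintZ _ i2).
by rewrite -/(FC f xi) -/(FS f xi); ring.
Qed.

Lemma damped_FC f : smooth_cpt f -> damped (FC f) /\ damped (FS f).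
Proof.
move=> sf; have fi := smooth_cpt_integ sf.
by split; apply: damped_bmeas; [exact: bmeas_FC|exact: bmeas_FS].
Qed.

(** The half-Laplacian generates the Poisson semigroup up to sign: both sides have the symbol - 2 pi
    |xi| e^(-2 pi t |xi|). *)
Lemma cv_Ck_fraclap f t x : 0 < t -> smooth_cpt f ->
  cv (Ck t) f x = - cv (Pk t) (fraclap 1 f) x.
Proof.
move=> t0 sf; have [d1 d2] := damped_FC sf; have [i1 i2] := integ_gmF ler01 (lexx 1) sf.
rewrite (cv_Ck_FT (smooth_cpt_bmeas sf) d1 d2 (fun t x h => @cv_Pk_smooth f t x h sf) x t0).
rewrite fraclapE (cv_Pk_FT x t0 i1 i2) /FT -RintN.
  by apply: eq_Rintegral => xi _; rewrite !gm1; ring.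
apply: integ_FT; [exact: (damped_integ i1).2|exact: (damped_integ i2).2].
Qed.

(* cg is Euler's Gamma function. *)
Definition gF s r : R := pw s r * expR (- r).
Definition cg s : R := \I (gF s).

Lemma gF_ge0 s r : 0 <= gF s r.
Proof. by rewrite /gF mulr_ge0 ?pw_ge0// ltW// expR_gt0. Qed.

Lemma measurable_gF s : measurable_fun setT (gF s).
Proof.
apply: measurable_funM; first exact: measurable_pw.
by apply: measurable_fun_expR; exact: (measurableT_comp (@oppr_measurable R setT)).
Qed.

Lemma integ_pw_near0 s : 0 < s -> integ (fun r => \1_(`]-oo, 1]%classic) r * pw s r).
Proof.
move=> s0; apply/integrableP; split.
  apply: measurable_EF; apply: measurable_funM; last exact: measurable_pw.
  exact: measurable_indic.
apply: le_lt_trans (_ : (1 `^ s / s)%:E < +oo)%E; last exact: ltry.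
apply: le_trans (pw_near0 s0 ltr01); rewrite le_eqVlt; apply/orP; left; apply/eqP.
by apply: eq_integral => r _; rewrite /= ger0_norm// mulr_ge0 ?pw_ge0.
Qed.

Lemma integ_gF s : 0 < s -> s < 1 -> integ (gF s).
Proof.
move=> s0 s1; have p0 : 0 < (2 * pi)^-1 :> R by rewrite invr_gt0 mulr_gt0// pi_gt0.
(* The height (2 pi)^-1 is the one at which [ek] equals e^(-|r|); it majorises the integrand for r >
   1. *)
apply: (integ_le (measurable_gF s) (integD (integ_pw_near0 s0) (integ_ek p0))) => r.
rewrite ger0_norm ?gF_ge0// /gF.
have [r0|r0] := leP r 0; first by rewrite !(pw0 _ r0) mulr0 mul0r add0r ltW// ek_gt0.
have eE : ek (2 * pi)^-1 r = expR (- r).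
  rewrite /ek gtr0_norm//; congr (expR (- _)); have := pi_gt0 R.
  by move: pi => c c0; field; rewrite gt_eqF.
rewrite eE indicE mem_setE in_itv/=; have [r1|r1] := leP r 1.
  rewrite mul1r (@le_trans _ _ (pw s r))//; last by rewrite lerDl ltW// expR_gt0.
  by rewrite ler_piMr ?pw_ge0// -expR0 ler_expR oppr_le0 ltW.
rewrite mul0r add0r ler_piMl ?(ltW (expR_gt0 _))// pwE//.
apply: (@le_trans _ _ (r `^ 0)); last by rewrite powRr0.
by apply: ler_powR; [exact: ltW|rewrite subr_le0 ltW].
Qed.

Lemma cg_gt0 s : 0 < s -> s < 1 -> 0 < cg s.
Proof.
(* On [1, 2] the integrand is at least r^(-1) e^(-r), hence at least e^(-2) / 2. *)
move=> s0 s1; pose c : R := 2^-1 * expR (- 2).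
have c0 : 0 < c by rewrite mulr_gt0 ?expR_gt0.
apply: (@lt_le_trans _ _ (\I (fun r => c * \1_(`[1, 2]%classic) r))).
  rewrite RintZ; last exact: integ_indic_itv.
  have h : mu `[1%R, 2%R]%classic = 1%:E.
    rewrite lebesgue_measure_itv/= lte_fin ltr1n/= -EFinD; congr (_%:E); lra.
  rewrite mulr_gt0// /Rintegral (_ : integral _ _ _ = 1%:E)//=.
  by rewrite integral_indic// setIT.
apply: le_Rint; [exact: integZ (integ_indic_itv _ _)|exact: integ_gF|] => r.
rewrite indicE mem_setE in_itv/=.
have [/andP[r1 r2]|_] := boolP (1 <= r <= 2); last by rewrite mulr0 gF_ge0.
have r0 : 0 < r by lra.
rewrite mulr1 /gF pwE// /c ler_pM ?(ltW (expR_gt0 _))//; last by rewrite ler_expR lerN2.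
apply: (@le_trans _ _ (r `^ (- 1))).
  by rewrite powR_inv1 ?(ltW r0)// lef_pV2 ?posrE.
by apply: ler_powR => //; rewrite lerBrDl subrr ltW.
Qed.

(** The Gamma integral after the scaling by 2 pi |xi|. At xi = 0 the integral of r^(s-1)
    diverges. *)
Lemma gm_pw s xi : 0 < s -> s < 1 -> xi != 0 ->
  integ (fun r => pw s r * ek r xi) /\
  gm s xi * \I (fun r => pw s r * ek r xi) = cg s.
Proof.
move=> s0 s1 xi0; pose l := 2 * pi * `|xi|.
have l0 : 0 < l by rewrite /l mulr_gt0 ?normr_gt0// mulr_gt0// pi_gt0.
have i1 := integ_affine 0 l0 (integ_gF s0 s1).
have E := Rint_affine 0 l0 (integ_gF s0 s1).
have Fl r : gF s (l * r + 0) = l `^ (s - 1) * (pw s r * ek r xi).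
  rewrite /gF addr0; have [r0|r0] := leP r 0.
    by rewrite !pw0 ?mul0r ?mulr0// mulr_ge0_le0// ltW.
  rewrite (pwE s (mulr_gt0 l0 r0)) (pwE s r0) (powRM _ (ltW l0) (ltW r0)) mulrA.
  by rewrite /ek; congr (_ * expR (- _)); rewrite /l; ring.
have lp : 0 < l `^ (s - 1) by rewrite powR_gt0.
have i2 : integ (fun r => pw s r * ek r xi).
  have := integZ (l `^ (s - 1))^-1 i1; congr (_.-integrable _ _).
  by apply/funext => r /=; rewrite Fl mulrA mulVf ?mul1r// gt_eqF.
split => //; rewrite (_ : (fun r => gF s _) = (fun r => l `^ (s - 1) * (pw s r * ek r xi))) in E.
  rewrite (RintZ _ i2) in E; rewrite -/(cg s) in E.
  have -> : gm s xi = l * l `^ (s - 1) by rewrite mulr_powRB1// ltW.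
  by rewrite -mulrA E mulrA divff ?mul1r// gt_eqF.
exact/funext.
Qed.

(** [gm_pw] inserted under the trigonometric integral. The frequency 0, where the r-integral
    diverges, is neutralised by p 0 = q 0 = 0. For Fubini, the r-integral of the absolute value is
    exactly [cg s] times the damped amplitude. *)
Lemma gamma_FT s p q t x : 0 < s -> s < 1 -> 0 < t -> damped p -> damped q ->
  p 0 = 0 -> q 0 = 0 ->
  cg s * FT (fun xi => ek t xi * p xi) (fun xi => ek t xi * q xi) x =
  \I (fun r => pw s r * FT (fun xi => ek (t + r) xi * (gm s xi * p xi))
     (fun xi => ek (t + r) xi * (gm s xi * q xi)) x).
Proof.
move=> s0 s1 t0 dp dq p0 q0.
pose T xi := p xi * cos (2 * pi * x * xi) + q xi * sin (2 * pi * x * xi).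
have T0 : T 0 = 0 by rewrite /T p0 q0 !mul0r addr0.
pose f r xi := pw s r * (ek (t + r) xi * (gm s xi * T xi)).
have fE r xi : f r xi = ek t xi * T xi * (gm s xi * (pw s r * ek r xi)).
  by rewrite /f ekD; ring.
have iT r : 0 < r -> integ (fun xi => ek r xi * T xi).
  move=> r0; rewrite (_ : (fun xi => _) = (fun xi => ek r xi * p xi * cos (2 * pi * x * xi) +
    ek r xi * q xi * sin (2 * pi * x * xi))); last by apply/funext => xi; rewrite /T; ring.
  by apply: integ_FT; [exact: dp.2|exact: dq.2].
have mT : measurable_fun setT T.
  by apply: (measurable_sec1 x (measurable_FTi dp.1 dq.1)).
have dgm (u : R -> R) : damped u -> damped (fun xi => gm s xi * u xi).
  move=> du; split; first by apply: measurable_funM; [exact: measurable_gm|exact: du.1].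
  move=> r r0; have mabs : measurable_fun setT (fun xi : R => 2 * pi * `|xi|).
    by apply: measurable_funM => //; exact: normr_measurable.
  have d2 := damped_abs du mabs (fun xi => _).
  have {}d2 : damped (fun xi => 2 * pi * `|xi| * u xi).
    by apply: d2 => xi; rewrite ger0_norm// lam_ge0.
  apply: (integ_le _ (integD (integ_norm (du.2 r r0)) (integ_norm (d2.2 r r0)))).
    apply: measurable_funM; first exact: measurable_ekc.
    by apply: measurable_funM; [exact: measurable_gm|exact: du.1].
  move=> xi; rewrite !normrM !(gtr0_norm (ek_gt0 _ _)) -mulrDr ler_wpM2l ?(ltW (ek_gt0 _ _))//.
  rewrite -!normrM [`|2 * pi * _ * _|]normrM (ger0_norm (lam_ge0 _)) normrM.
  rewrite -[X in X + _]mul1r -mulrDl ler_wpM2r// ger0_norm ?gm_ge0// gm_le// ltW//.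
have igm r : 0 < r -> integ (fun xi => ek r xi * (gm s xi * T xi)).
  move=> r0; rewrite (_ : (fun xi => _) = (fun xi => ek r xi * (gm s xi * p xi) * cos (2 * pi * x * xi) +
    ek r xi * (gm s xi * q xi) * sin (2 * pi * x * xi))); last by apply/funext => xi; rewrite /T; ring.
  by apply: integ_FT; [exact: (dgm _ dp).2|exact: (dgm _ dq).2].
have z0 : integ (fun _ : R => 0 : R).
  by have := integZ 0 (integ_ek t0); congr (_.-integrable _ _); apply/funext => y /=; rewrite mul0r.
have ixi xi : integ (f ^~ xi).
  have [->|xi0] := eqVneq xi 0.
    rewrite (_ : f^~ 0 = fun=> 0)//; apply/funext => r.
    by rewrite fE T0 mulr0 mul0r.
  rewrite (_ : f^~ xi = fun r => ek t xi * T xi * gm s xi * (pw s r * ek r xi)).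
    by apply: integZ; exact: (gm_pw s0 s1 xi0).1.
  by apply/funext => r; rewrite fE; ring.
have RZ (c xi : R) : xi != 0 -> \I (fun r => c * gm s xi * (pw s r * ek r xi)) = c * cg s.
  move=> xi0; rewrite (RintZ _ (gm_pw s0 s1 xi0).1) -mulrA; congr (_ * _).
  exact: (gm_pw s0 s1 xi0).2.
have H := @Rint_fubini_gen R f (fun xi => cg s * `|ek t xi * T xi|).
transitivity (\I (fun xi => \I (fun r => f r xi))).
  rewrite -RintZ; last by apply: integ_FT; [exact: dp.2|exact: dq.2].
  apply: eq_Rintegral => xi _; have [->|xi0] := eqVneq xi 0.
    rewrite p0 q0 !mulr0 !mul0r addr0 mulr0 -[LHS]Rint0; apply: eq_Rintegral => r _.
    by rewrite fE T0 mulr0 mul0r.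
  transitivity (\I (fun r => ek t xi * T xi * gm s xi * (pw s r * ek r xi))).
    by rewrite (RZ _ _ xi0) /T; ring.
  by apply: eq_Rintegral => r _; rewrite fE; ring.
rewrite -H.
- apply: eq_Rintegral => r _; have [r0|r0] := leP r 0.
    rewrite /f (pw0 _ r0) mul0r -[RHS]Rint0; apply: eq_Rintegral => xi _; exact: mul0r.
  rewrite /f (RintZ _ (igm _ (addr_gt0 t0 r0))); congr (_ * _).
  by apply: eq_Rintegral => xi _; rewrite /T; ring.
- apply: measurable_funM; first exact: measurable_pwc.
  apply: measurable_funM; first by apply: measurable_ekc => //; exact: measurable_funD.
  by apply: measurable_funM; [exact: (measurableT_comp (measurable_gm s))|exact: (measurableT_comp mT)].
- move=> r; have [r0|r0] := leP r 0.
    by rewrite (_ : f r = fun=> 0)//; apply/funext => xi; rewrite /f (pw0 _ r0) mul0r.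
  by apply: integZ; apply: igm; rewrite addr_gt0.
- exact: ixi.
- by apply: integZ; apply: integ_norm; exact: iT.
- move=> xi; have [->|xi0] := eqVneq xi 0.
    rewrite T0 mulr0 normr0 mulr0 le_eqVlt; apply/orP; left; apply/eqP.
    rewrite -[RHS]Rint0; apply: eq_Rintegral => r _.
    by rewrite fE T0 mulr0 mul0r normr0.
  rewrite le_eqVlt; apply/orP; left; apply/eqP.
  transitivity (\I (fun r => `|ek t xi * T xi| * gm s xi * (pw s r * ek r xi))).
    apply: eq_Rintegral => r _; rewrite fE normrM -mulrA; congr (_ * _).
    apply: ger0_norm; apply: (mulr_ge0 (gm_ge0 _ _)); apply: (mulr_ge0 (pw_ge0 _ _)).
    exact: ltW (ek_gt0 _ _).
  by rewrite (RZ _ _ xi0) mulrC.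
Qed.

Lemma cv_smooth_FT f t x : 0 < t -> smooth_cpt f ->
  cv (Ak t) f x = FT (fun xi => ek t xi * (2 * pi * xi * FS f xi))
                     (fun xi => ek t xi * (- (2 * pi * xi) * FC f xi)) x /\
  cv (Ck t) f x = FT (fun xi => ek t xi * (- (2 * pi * `|xi|) * FC f xi))
                     (fun xi => ek t xi * (- (2 * pi * `|xi|) * FS f xi)) x.
Proof.
move=> t0 sf; have [d1 d2] := damped_FC sf.
have Pw t' x' (h : 0 < t') := @cv_Pk_smooth f t' x' h sf.
by split; [rewrite (cv_Ak_FT (smooth_cpt_bmeas sf) d1 d2 Pw x t0)|
  rewrite (cv_Ck_FT (smooth_cpt_bmeas sf) d1 d2 Pw x t0)].
Qed.

Lemma cv_fraclap_FT s f t x : 0 < s -> s < 1 -> 0 < t -> smooth_cpt f ->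
  cv (Ak t) (fraclap s f) x = FT (fun xi => ek t xi * (gm s xi * (2 * pi * xi * FS f xi)))
                     (fun xi => ek t xi * (gm s xi * (- (2 * pi * xi) * FC f xi))) x /\
  cv (Ck t) (fraclap s f) x = FT (fun xi => ek t xi * (gm s xi * (- (2 * pi * `|xi|) * FC f xi)))
                     (fun xi => ek t xi * (gm s xi * (- (2 * pi * `|xi|) * FS f xi))) x.
Proof.
move=> s0 s1 t0 sf; have [i1 i2] := integ_gmF (ltW s0) (ltW s1) sf.
have d1 := damped_integ i1; have d2 := damped_integ i2.
have Pw t' x' (h : 0 < t') : cv (Pk t') (fraclap s f) x' =
    FT (fun xi => ek t' xi * (gm s xi * FC f xi)) (fun xi => ek t' xi * (gm s xi * FS f xi)) x'.
  by rewrite fraclapE (cv_Pk_FT x' h i1 i2).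
have bf := bmeas_fraclap (ltW s0) (ltW s1) sf.
split; [rewrite (cv_Ak_FT bf d1 d2 Pw x t0)|rewrite (cv_Ck_FT bf d1 d2 Pw x t0)];
  by congr (FT _ _ x); apply/funext => xi; ring.
Qed.

Lemma damped_lin (c u : R -> R) : measurable_fun setT c ->
  (forall xi, `|c xi| <= 2 * pi * `|xi|) -> damped u -> damped (fun xi => c xi * u xi).
Proof. by move=> mc cb du; exact: damped_abs. Qed.

(** The triangle inequality in the superposition formula for each partial derivative; the factor 2
    appears because [NN] is a sum of two terms and each is bounded by the full [TT]. *)
Lemma gamma_NN s f t x : 0 < s -> s < 1 -> 0 < t -> smooth_cpt f ->
  ((NN f x t)%:E <= (2 * (cg s)^-1)%:E * TT s (NN (fraclap s f) x) t)%E.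
Proof.
move=> s0 s1 t0 sf; have c0 := cg_gt0 s0 s1.
have bf := bmeas_fraclap (ltW s0) (ltW s1) sf.
have [d1 d2] := damped_FC sf.
have mid : measurable_fun setT (fun xi : R => 2 * pi * xi) by exact: measurable_funM.
have mab : measurable_fun setT (fun xi : R => 2 * pi * `|xi|) by apply: measurable_funM.
have mNid : measurable_fun setT (fun xi : R => - (2 * pi * xi)).
  exact: (measurableT_comp (@oppr_measurable R setT) mid).
have mNab : measurable_fun setT (fun xi : R => - (2 * pi * `|xi|)).
  exact: (measurableT_comp (@oppr_measurable R setT) mab).
have ab xi : `|2 * pi * `|xi| | <= 2 * pi * `|xi| by rewrite ger0_norm ?lam_ge0.
have aid xi : `|2 * pi * xi| <= 2 * pi * `|xi|.
  by rewrite normrM ler_wpM2r// ger0_norm// mulr_ge0// pi_ge0.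
have aNb xi : `|- (2 * pi * `|xi|)| <= 2 * pi * `|xi| by rewrite normrN.
have aNid xi : `|- (2 * pi * xi)| <= 2 * pi * `|xi| by rewrite normrN.
have pA := damped_lin mid aid d2; have qA := damped_lin mNid aNid d1.
have pC := damped_lin mNab aNb d1; have qC := damped_lin mNab aNb d2.
have [eA eC] := cv_smooth_FT x t0 sf.
have mN : measurable_fun setT (fun r => NN (fraclap s f) x (t + r)).
  apply: (measurableT_comp (measurable_sec1 x (measurable_NN bf))).
  exact: measurable_funD.
have bound (k : R -> R -> R) : measurable_fun setT (fun z : R * R => cv (k z.2) (fraclap s f) z.1) ->
    (forall r, `|cv (k r) (fraclap s f) x| <= NN (fraclap s f) x r) ->
    cg s * cv (k t) f x = \I (fun r => pw s r * cv (k (t + r)) (fraclap s f) x) ->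
    (`|cv (k t) f x|%:E <= (cg s)^-1%:E * TT s (NN (fraclap s f) x) t)%E.
  move=> mk kN e; rewrite -[leLHS]mul1e -(mulVf (lt0r_neq0 c0)) EFinM -muleA.
  rewrite lee_pmul2l//; last by rewrite lte_fin invr_gt0.
  rewrite -EFinM -{1}(gtr0_norm c0) -normrM e.
  have mF : measurable_fun setT (fun r => pw s r * cv (k (t + r)) (fraclap s f) x).
    apply: measurable_funM; first exact: measurable_pw.
    by apply: (measurableT_comp (measurable_sec1 x mk)); exact: measurable_funD.
  have mG : measurable_fun setT (fun r => pw s r * NN (fraclap s f) x (t + r)).
    by apply: measurable_funM => //; exact: measurable_pw.
  have FG r : `|pw s r * cv (k (t + r)) (fraclap s f) x| <= pw s r * NN (fraclap s f) x (t + r).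
    by rewrite normrM (ger0_norm (pw_ge0 _ _)) ler_wpM2l ?pw_ge0.
  have [->|Gfin] := eqVneq (TT s (NN (fraclap s f) x) t) +oo%E; first by rewrite leey.
  have iG : integ (fun r => pw s r * NN (fraclap s f) x (t + r)).
    apply/integrableP; split; first exact: measurable_EF.
    rewrite (_ : integral _ _ _ = TT s (NN (fraclap s f) x) t); first by rewrite ltey.
    apply: eq_integral => r _ /=; congr (_%:E).
    by apply: ger0_norm; apply: mulr_ge0; [exact: pw_ge0|exact: NN_ge0].
  apply: le_trans (_ : (\I (fun r => pw s r * NN (fraclap s f) x (t + r)))%:E <= _)%E.
    by rewrite lee_fin; exact: (Rint_abs_le mF iG FG).
  by rewrite (Rint_EFin iG).
have hA : (`|cv (Ak t) f x|%:E <= (cg s)^-1%:E * TT s (NN (fraclap s f) x) t)%E.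
  apply: (bound (@Ak R)); [exact: mVx2|by move=> r; rewrite /NN lerDl|].
  rewrite eA (gamma_FT x s0 s1 t0 pA qA); [|by rewrite mulr0 mul0r|by rewrite mulr0 oppr0 mul0r].
  apply: eq_Rintegral => r _; have [r0|r0] := leP r 0; first by rewrite (pw0 _ r0) !mul0r.
  by rewrite (cv_fraclap_FT x s0 s1 (addr_gt0 t0 r0) sf).1.
have hC : (`|cv (Ck t) f x|%:E <= (cg s)^-1%:E * TT s (NN (fraclap s f) x) t)%E.
  apply: (bound (@Ck R)); [exact: mVt2|by move=> r; rewrite /NN lerDr|].
  rewrite eC (gamma_FT x s0 s1 t0 pC qC); [|by rewrite normr0 mulr0 oppr0 mul0r|by rewrite normr0 mulr0 oppr0 mul0r].
  apply: eq_Rintegral => r _; have [r0|r0] := leP r 0; first by rewrite (pw0 _ r0) !mul0r.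
  by rewrite (cv_fraclap_FT x s0 s1 (addr_gt0 t0 r0) sf).2.
rewrite [X in (X <= _)%E](_ : _ = (`|cv (Ak t) f x|%:E + `|cv (Ck t) f x|%:E)%E)//.
rewrite EFinM -muleA; apply: le_trans (leeD hA hC) _.
by rewrite -mule2n -mule_natl.
Qed.
End fractional.

(** * Decay at infinity, and Poisson extensions of half-Laplacians *)

Section decay.
Context {R : realType}.
Local Notation mu := (@lebesgue_measure R).
Local Notation "\I f" := (Rintegral mu setT f) (at level 10).
Implicit Types (a s t x y z r xi : R) (f g w : R -> R).

(** Decay of order y^(-2), which test functions and their half-Laplacians share. *)
Definition dec w := measurable_fun setT w /\ exists2 K : R, 0 <= K & forall y, `|w y| <= K * rk 1 y.

Lemma rk1_le1 y : rk 1 y <= 1 :> R.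
Proof.
by rewrite /rk expr1n invf_le1 ?lerDr ?sqr_ge0// ltr_pwDr// sqr_ge0.
Qed.

Lemma bmeas_rk1 : bmeas (rk 1 : R -> R).
Proof.
split; first exact: measurable_rkT.
by exists 1 => y; rewrite ger0_norm ?rk1_le1// ltW// rk_gt0.
Qed.

Lemma dec_bmeas w : dec w -> bmeas w.
Proof.
move=> [mw [K K0 wK]]; split => //; exists K => y; apply: le_trans (wK y) _.
by rewrite ler_piMr// rk1_le1.
Qed.

(** [rk 1] is pi times P_1, so the semigroup law computes its Poisson integral exactly as (t + 1)
    [rk (t + 1)]. *)
Lemma cv_Pk_rk1 t x : 0 < t -> cv (Pk t) (rk 1) x <= 2 / (1 + `|x| + t).
Proof.
move=> t0; have -> : cv (Pk t) (rk 1) x = (t + 1) * rk (t + 1) x.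
  have p0 : (pi : R) != 0 by rewrite gt_eqF ?pi_gt0.
  transitivity (pi * Pk (t + 1) x); last by rewrite /Pk !mulrA divff// mul1r.
  rewrite -(cv_Pk_Pk x t0 ltr01) /cv -RintZ; last by apply: integ_PkM => //; exact: bmeas_Pk.
  apply: eq_Rintegral => y _; rewrite /Pk mulr1 mulrCA; congr (_ * _).
  by rewrite mulrA divff// mul1r.
have d0 : 0 < x ^+ 2 + (t + 1) ^+ 2 by apply: den_gt0; lra.
have e0 : 0 < 1 + `|x| + t by have := normr_ge0 x; lra.
rewrite /rk ler_pdivrMr// mulrAC ler_pdivlMr// -(real_normK (num_real x)).
by have := normr_ge0 x; move: `|x| => v v0; have := sqr_ge0 (v - (t + 1)); nra.
Qed.

Lemma cv_Pk_dec w : dec w -> exists2 K : R, 0 <= K & forall y t, 0 < t ->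
  `|cv (Pk t) w y| <= K / (1 + `|y| + t).
Proof.
move=> dw; have bw := dec_bmeas dw; have [mw [K K0 wK]] := dw.
exists (K * 2); first by rewrite mulr_ge0.
move=> y t t0.
have bK : bmeas (fun y => K * rk 1 y).
  split; first by apply: measurable_funM => //; exact: measurable_rkT.
  exists K => u; rewrite ger0_norm ?ler_piMr ?rk1_le1// mulr_ge0// ltW// rk_gt0//.
apply: (@le_trans _ _ (cv (Pk t) (fun y => K * rk 1 y) y)).
  apply: (@cv_le _ (Pk t) (Pk t) _ _ (pi^-1 * t) t) => //.
  - exact: measurable_PkT.
  - exact: measurable_PkT.
  - by move=> z; exact: norm_Pk_le.
  - by move=> z; rewrite ger0_norm// ltW// Pk_gt0.
have -> : cv (Pk t) (fun y => K * rk 1 y) y = K * cv (Pk t) (rk 1) y.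
  rewrite /cv -RintZ; last by apply: integ_PkM => //; exact: bmeas_rk1.
  by apply: eq_Rintegral => u _; rewrite mulrCA.
by rewrite -mulrA ler_wpM2l//; exact: cv_Pk_rk1.
Qed.

Lemma dec_bound w (M B : R) : measurable_fun setT w -> 0 <= B ->
  (forall y, `|w y| <= B) -> (forall y, M < `|y| -> y ^+ 2 * `|w y| <= B) -> dec w.
Proof.
move=> mw B0 wB wM; split=> //; exists (2 * B + B * M ^+ 2).
  by have := mulr_ge0 B0 (sqr_ge0 M); lra.
move=> y; rewrite /rk expr1n ler_pdivlMr; last by rewrite ltr_pwDr// sqr_ge0.
have [yM|yM] := leP `|y| M.
  have : y ^+ 2 <= M ^+ 2.
    by rewrite -(real_normK (num_real y)) ler_pXn2r// nnegrE// (le_trans _ yM).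
  have := wB y; have := normr_ge0 (w y); have := sqr_ge0 y.
  by move: `|w y| (y ^+ 2) (M ^+ 2) => u v m *; nra.
have := wM y yM; have := wB y; have := mulr_ge0 B0 (sqr_ge0 M); lra.
Qed.

Lemma smooth_cpt_dec f : smooth_cpt f -> dec f.
Proof.
move=> sf; have [mf [B fB]] := smooth_cpt_bmeas sf; have [M [M1 fM]] := smooth_cpt_supp sf.
have B0 : 0 <= B by apply: le_trans (fB 0).
by apply: (@dec_bound f M B mf B0 fB) => y yM; rewrite (fM y yM) normr0 mulr0.
Qed.

Lemma fraclap1_cont f : smooth_cpt f -> continuous (fraclap 1 f).
Proof. by move=> sf; apply: smooth_cont; exact: smooth_fraclap1. Qed.

(** The half-Laplacian is the limit of - [cv (Ck t) f] as t tends to 0. When |y| exceeds twice the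
    support radius, |y - z| >= |y| / 2 on the support, so |[Ck t]| <= 4 y^(-2) there, uniformly in
    t. *)
Lemma fraclap1_dec f : smooth_cpt f -> dec (fraclap 1 f).
Proof.
move=> sf; have bf := bmeas_fraclap ler01 (lexx 1) sf; have [mL [B LB]] := bf.
have fi := smooth_cpt_integ sf; have [M [M1 fM]] := smooth_cpt_supp sf.
pose I := \I (fun y => `|f y|); have I0 : 0 <= I by apply: Rintegral_ge0.
have B0 : 0 <= B by apply: le_trans (LB 0).
apply: (@dec_bound _ (2 * M) (B + 4 * I)) => //.
- by rewrite addr_ge0// mulr_ge0.
- by move=> y; rewrite (le_trans (LB y))// lerDl mulr_ge0.
move=> y yM; apply: (@le_trans _ _ (4 * I)); last by rewrite lerDr.
rewrite -ler_pdivlMl; last by rewrite exprn_even_gt0//= -normr_gt0; lra.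
have y20 : 0 < y ^+ 2 by rewrite exprn_even_gt0//= -normr_gt0; lra.
have lim := cv_Pk_lim bf (fraclap1_cont sf (x := y)).
apply: (@ler_cvg_to _ _ _ _ _ (cst ((y ^+ 2)^-1 * (4 * I))) _ _ (cvg_norm lim) (cvg_cst _)).
near=> t; have t0 : 0 < t by near: t; exact: nbhs_right_gt.
rewrite /cst -normrN -(cv_Ck_fraclap y t0 sf).
have iC := integ_CkM (smooth_cpt_bmeas sf) y t0.
apply: (@le_trans _ _ (\I (fun z => (y ^+ 2)^-1 * 4 * `|f z|))); last first.
  by rewrite RintZ ?mulrA//; exact: integ_norm.
apply: Rint_abs_le; [exact: integ_measurable iC|by apply: integZ; exact: integ_norm|] => z.
rewrite normrM; have [zM|zM] := ltP M `|z|; first by rewrite fM// normr0 !mulr0.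
rewrite ler_wpM2r//; apply: le_trans (norm_Ck_le _ t0) _.
have h : `|y| <= 2 * `|y - z|.
  by have := ler_normD (y - z) z; rewrite subrK; lra.
have h2 : y ^+ 2 <= 4 * (y - z) ^+ 2.
  rewrite -(real_normK (num_real y)) -(real_normK (num_real (y - z))).
  by move: h (normr_ge0 y) (normr_ge0 (y - z)) => *; nra.
have p1 : pi^-1 <= 1 :> R by rewrite invf_le1 ?pi_gt0//; have := pi_ge2 R; lra.
apply: (@le_trans _ _ (rk t (y - z))); first by rewrite ler_piMl// ltW// rk_gt0.
rewrite /rk ler_pdivlMl// ler_pdivrMr ?den_gt0//.
by have := sqr_ge0 t; lra.
Unshelve. all: by end_near. Qed.

Lemma cv_Ak_smooth f t x : 0 < t -> smooth_cpt f -> cv (Ak t) f x = cv (Pk t) (derive1 f) x.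
Proof.
move=> t0 sf; rewrite (cv_smooth_FT x t0 sf).1 (cv_Pk_smooth x t0 (smooth_cpt_derive sf)).
by congr (FT _ _ x); apply/funext => xi; rewrite (FC_derive xi sf, FS_derive xi sf).
Qed.

Lemma cv_fraclap1_FT f t x : 0 < t -> smooth_cpt f ->
  [/\ cv (Pk t) (fraclap 1 f) x =
       FT (fun xi => ek t xi * (gm 1 xi * FC f xi)) (fun xi => ek t xi * (gm 1 xi * FS f xi)) x,
   cv (Ak t) (fraclap 1 f) x = FT (fun xi => ek t xi * (2 * pi * xi * (gm 1 xi * FS f xi)))
                     (fun xi => ek t xi * (- (2 * pi * xi) * (gm 1 xi * FC f xi))) x &
  cv (Ck t) (fraclap 1 f) x = FT (fun xi => ek t xi * (- (2 * pi * `|xi|) * (gm 1 xi * FC f xi)))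
                     (fun xi => ek t xi * (- (2 * pi * `|xi|) * (gm 1 xi * FS f xi))) x].
Proof.
move=> t0 sf; have [i1 i2] := integ_gmF ler01 (lexx 1) sf.
have d1 := damped_integ i1; have d2 := damped_integ i2.
have Pw t' x' (h : 0 < t') : cv (Pk t') (fraclap 1 f) x' =
    FT (fun xi => ek t' xi * (gm 1 xi * FC f xi)) (fun xi => ek t' xi * (gm 1 xi * FS f xi)) x'.
  by rewrite fraclapE (cv_Pk_FT x' h i1 i2).
have bf := bmeas_fraclap ler01 (lexx 1) sf.
split; [exact: Pw|exact: (cv_Ak_FT bf d1 d2 Pw x t0)|exact: (cv_Ck_FT bf d1 d2 Pw x t0)].
Qed.

Lemma cv_Ak_fraclap1 f t x : 0 < t -> smooth_cpt f ->
  cv (Ak t) (fraclap 1 f) x = cv (Pk t) (fraclap 1 (derive1 f)) x.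
Proof.
move=> t0 sf; have [_ -> _] := cv_fraclap1_FT x t0 sf.
have [-> _ _] := cv_fraclap1_FT x t0 (smooth_cpt_derive sf).
by congr (FT _ _ x); apply/funext => xi; rewrite (FC_derive xi sf, FS_derive xi sf); ring.
Qed.

(** The generator applied twice is minus the second derivative: on the Fourier side |xi|^2 =
    xi^2. *)
Lemma cv_Ck_fraclap1 f t x : 0 < t -> smooth_cpt f ->
  cv (Ck t) (fraclap 1 f) x = cv (Pk t) (derive1 (derive1 f)) x.
Proof.
move=> t0 sf; have [_ _ ->] := cv_fraclap1_FT x t0 sf; have sf' := smooth_cpt_derive sf.
rewrite (cv_Pk_smooth x t0 (smooth_cpt_derive sf')).
have sq (xi : R) : `|xi| * `|xi| = xi * xi by rewrite -!expr2 real_normK ?num_real.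
congr (FT _ _ x); apply/funext => xi; rewrite gm1.
  rewrite (FC_derive xi sf') (FS_derive xi sf).
  transitivity (ek t xi * (- (2 * pi * (2 * pi * (`|xi| * `|xi|))) * FC f xi)); first by ring.
  by rewrite sq; ring.
rewrite (FS_derive xi sf') (FC_derive xi sf).
transitivity (ek t xi * (- (2 * pi * (2 * pi * (`|xi| * `|xi|))) * FS f xi)); first by ring.
by rewrite sq; ring.
Qed.
End decay.

(** * Half-plane extensions and the Hilbert transform *)

Section extensions.
Context {R : realType}.
Local Notation mu := (@lebesgue_measure R).
Local Notation "\I f" := (Rintegral mu setT f) (at level 10).
Implicit Types (s t x y z r K : R) (f g u w : R -> R) (U V : R -> R -> R).

(** The regularity asked of an extension and of its first derivatives so that [green_rect] can be
    applied: joint measurability, separate continuity and a uniform bound. *)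
Definition reg V := [/\ measurable_fun setT (fun z : R * R => V z.1 z.2),
  (forall y t, 0 < t -> {for t, continuous (V y)}),
  (forall y t, 0 < t -> {for y, continuous (V^~ t)}) &
  exists2 K : R, 0 <= K & forall y t, 0 < t -> `|V y t| <= K].

Lemma regD U V : reg U -> reg V -> reg (fun y t => U y t + V y t).
Proof.
move=> [mU tU yU [K K0 bU]] [mV tV yV [L L0 bV]]; split.
- exact: measurable_funD.
- by move=> y t t0; apply: cvgD; [exact: tU|exact: tV].
- by move=> y t t0; apply: cvgD; [exact: yU|exact: yV].
- exists (K + L); first by rewrite addr_ge0.
  by move=> y t t0; rewrite (le_trans (ler_normD _ _))// lerD ?bU ?bV.
Qed.

Lemma regM U V : reg U -> reg V -> reg (fun y t => U y t * V y t).
Proof.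
move=> [mU tU yU [K K0 bU]] [mV tV yV [L L0 bV]]; split.
- exact: measurable_funM.
- by move=> y t t0; apply: cvgM; [exact: tU|exact: tV].
- by move=> y t t0; apply: cvgM; [exact: yU|exact: yV].
- exists (K * L); first by rewrite mulr_ge0.
  by move=> y t t0; rewrite normrM ler_pM ?bU ?bV.
Qed.

Lemma regN V : reg V -> reg (fun y t => - V y t).
Proof.
move=> [mV tV yV [L L0 bV]]; split.
- exact: (measurableT_comp (@oppr_measurable R setT) mV).
- by move=> y t t0; apply: cvgN; exact: tV.
- by move=> y t t0; apply: cvgN; exact: yV.
- by exists L => // y t t0; rewrite normrN bV.
Qed.

Lemma reg_Pk w : bmeas w -> reg (fun y t => cv (Pk t) w y).
Proof.
move=> bw; have [mw [B wB]] := bw; split.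
- exact: mV2.
- by move=> y t t0; exact: (derive_cont (dVt bw y t0)).
- by move=> y t t0; exact: (derive_cont (dVx bw y t0)).
- exists B; first by apply: le_trans (wB 0).
  by move=> y t t0; exact: cv_Pk_le.
Qed.

(* U extends u to the half-plane t > 0, with partial derivatives Ut and Uy. *)
Definition ext U Ut Uy u := [/\ reg U, reg Ut & reg Uy] /\
  [/\ (forall y t, 0 < t -> is_derive t 1 (U y) (Ut y t)),
      (forall y t, 0 < t -> is_derive y 1 (U^~ t) (Uy y t)),
      (exists2 K : R, 0 <= K & forall y t, 0 < t -> `|U y t| <= K / (1 + `|y| + t)) &
      (forall y, U y t @[t --> 0^'+] --> u y)].

Lemma wt_gt0 y t : 0 < t -> 0 < 1 + `|y| + t.
Proof. by move=> t0; have := normr_ge0 y; lra. Qed.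

Lemma extD U Ut Uy u V Vt Vy v : ext U Ut Uy u -> ext V Vt Vy v ->
  ext (fun y t => U y t + V y t) (fun y t => Ut y t + Vt y t)
    (fun y t => Uy y t + Vy y t) (fun y => u y + v y).
Proof.
move=> [[rU rUt rUy] [dUt dUy [K K0 bU] lU]] [[rV rVt rVy] [dVt dVy [L L0 bV] lV]].
split; [split; exact: regD|split].
- move=> y t t0; have D1 := dUt y t t0; have D2 := dVt y t t0.
  exact: (@is_deriveD _ _ _ (U y) (V y)).
- move=> y t t0; have D1 := dUy y t t0; have D2 := dVy y t t0.
  exact: (@is_deriveD _ _ _ (U^~ t) (V^~ t)).
- exists (K + L); first by rewrite addr_ge0.
  move=> y t t0; rewrite mulrDl (le_trans (ler_normD _ _))// lerD ?bU ?bV//.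
- by move=> y; apply: cvgD; [exact: lU|exact: lV].
Qed.

Lemma extN V Vt Vy v : ext V Vt Vy v ->
  ext (fun y t => - V y t) (fun y t => - Vt y t) (fun y t => - Vy y t) (fun y => - v y).
Proof.
move=> [[rV rVt rVy] [dVt dVy [L L0 bV] lV]].
split; [split; exact: regN|split].
- move=> y t t0; have D2 := dVt y t t0; exact: (@is_deriveN _ _ _ (V y)).
- move=> y t t0; have D2 := dVy y t t0; exact: (@is_deriveN _ _ _ (V^~ t)).
- by exists L => // y t t0; rewrite normrN bV.
- by move=> y; apply: cvgN; exact: lV.
Qed.

Lemma extM U Ut Uy u V Vt Vy v : ext U Ut Uy u -> ext V Vt Vy v ->
  ext (fun y t => U y t * V y t) (fun y t => Ut y t * V y t + U y t * Vt y t)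
    (fun y t => Uy y t * V y t + U y t * Vy y t) (fun y => u y * v y).
Proof.
move=> [[rU rUt rUy] [dUt dUy [K K0 bU] lU]] [[rV rVt rVy] [dVt dVy _ lV]].
split; [split|split].
- exact: regM.
- by apply: regD; exact: regM.
- by apply: regD; exact: regM.
- move=> y t t0; have D1 := dUt y t t0; have D2 := dVt y t t0.
  by apply: is_derive_eq; rewrite /GRing.scale /=; ring.
- move=> y t t0; have D1 := dUy y t t0; have D2 := dVy y t t0.
  by apply: is_derive_eq; rewrite /GRing.scale /=; ring.
- have [_ _ _ [L L0 bV]] := rV; exists (K * L); first by rewrite mulr_ge0.
  by move=> y t t0; rewrite normrM mulrAC ler_pM ?bU ?bV.
- by move=> y; apply: cvgM; [exact: lU|exact: lV].
Qed.

Lemma is_derive_reflect (F : R -> R) (l x z : R) : is_derive (x - z) 1 F l ->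
  is_derive z 1 (fun z => F (x - z)) (- l).
Proof.
move=> D; have D1 : is_derive z (1 : R) (fun z : R => x - z) (- 1).
  by apply: is_derive_eq; rewrite /GRing.scale /=; ring.
have := @is_derive1_comp _ F (fun z => x - z) z _ _ D D1.
by move=> D2; apply: (is_derive_eq D2); rewrite mulrN1.
Qed.

Lemma reg_reflect V x : reg V -> reg (fun z t => V (x - z) t).
Proof.
move=> [mV tV yV [L L0 bV]]; split.
- have m : measurable_fun setT (fun z : R * R => (x - z.1, z.2)).
    by apply: measurable_fun_pair => //; apply: measurable_funB.
  exact: (measurableT_comp mV m).
- by move=> y t t0; exact: tV.
- move=> y t t0; apply: (@continuous_comp _ _ _ (fun z => x - z) (V^~ t)); last exact: yV.
  by apply: cvgB; [exact: cvg_cst|exact: cvg_id].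
- by exists L => // y t t0; exact: bV.
Qed.

Lemma wt_shift x z t : 0 < t -> 1 + `|z| + t <= (1 + `|x|) * (1 + `|x - z| + t).
Proof.
move=> t0; have h : `|z| <= `|x| + `|x - z|.
  by have := ler_normB x (x - z); rewrite opprB addrC subrK.
by have := normr_ge0 x; have := normr_ge0 (x - z); nra.
Qed.

(** The change of variable z -> x - z brings the point x to the origin. The decay constant acquires
    a factor 1 + |x|, harmless since x is fixed. *)
Lemma ext_reflect x U Ut Uy u : ext U Ut Uy u ->
  ext (fun z t => U (x - z) t) (fun z t => Ut (x - z) t) (fun z t => - Uy (x - z) t)
    (fun z => u (x - z)).
Proof.
move=> [[rU rUt rUy] [dUt dUy [K K0 bU] lU]]; split; [split|split].
- exact: reg_reflect.
- exact: reg_reflect.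
- exact: regN (reg_reflect x rUy).
- by move=> y t t0; exact: dUt.
- move=> y t t0; exact: (is_derive_reflect (dUy _ _ t0)).
- exists (K * (1 + `|x|)); first by rewrite mulr_ge0// addr_ge0.
  move=> y t t0; apply: (le_trans (bU _ _ t0)).
  rewrite ler_pdivrMr ?wt_gt0// mulrAC ler_pdivlMr ?wt_gt0// -mulrA ler_wpM2l//.
  exact: wt_shift.
- by move=> y; exact: lU.
Qed.

(** Properties of boundary values that make the symmetrised principal value absolutely convergent:
    the Lipschitz bound near the singularity and the decay at infinity. *)
Definition nice u := measurable_fun setT u /\ exists2 K : R, 0 <= K & forall y,
  `|u y| <= K / (1 + `|y|) /\ forall z, `|u y - u z| <= K * `|y - z|.

Lemma lip_deriv (F F' : R -> R) K : (forall x, is_derive x 1 F (F' x)) ->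
  (forall x, `|F' x| <= K) -> forall x y, `|F x - F y| <= K * `|x - y|.
Proof.
move=> dF bF; have H x y : x < y -> `|F x - F y| <= K * `|x - y|.
  move=> xy; have [|c _] := @MVT R F F' x y xy (fun x _ => dF x).
    by apply: continuous_subspaceT => z; exact: (derive_cont (dF z)).
  by move=> e; rewrite distrC e normrM (distrC x) ler_wpM2r.
move=> x y; have [xy|yx|->] := ltgtP x y; first exact: H.
  by rewrite distrC (distrC x) H.
by rewrite !subrr normr0 mulr0.
Qed.

Lemma ext_lip U Ut Uy u : ext U Ut Uy u -> exists2 K : R, 0 <= K &
  forall t x y, 0 < t -> `|U x t - U y t| <= K * `|x - y|.
Proof.
move=> [[_ _ [_ _ _ [K K0 bUy]]] [_ dUy _ _]]; exists K => // t x y t0.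
by apply: (@lip_deriv (U^~ t) (Uy^~ t)) => z; [exact: dUy|exact: bUy].
Qed.

Lemma ext_nice U Ut Uy u : ext U Ut Uy u -> nice u.
Proof.
move=> e; have [L L0 lip] := ext_lip e; have [[rU _ _] [_ _ [K K0 bU] lU]] := e.
have [mU _ _ _] := rU; split.
  apply: (@measurable_fun_cvg _ _ _ setT (fun n y => U y n.+1%:R^-1)).
    by move=> n; exact: (@measurable_sec2 _ _ _ _ _ _ (fun z : R * R => U z.1 z.2) (n.+1%:R^-1 : R) mU).
  move=> y _; have /cvg_at_rightP := lU y; apply; split => //.
  exact: (@cvg_harmonic R).
exists (K + L); first by rewrite addr_ge0.
move=> y; split => [|z].
  apply: (@le_trans _ _ (K / (1 + `|y|))); last first.
    by rewrite ler_wpM2r ?lerDl// invr_ge0 addr_ge0.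
  apply: (@ler_cvg_to _ _ _ _ _ (cst (K / (1 + `|y|))) _ _ (cvg_norm (lU y)) (cvg_cst _)).
  near=> t; have t0 : 0 < t by near: t; exact: nbhs_right_gt.
  rewrite /cst (le_trans (bU y t t0))// ler_wpM2l// lef_pV2 ?posrE ?wt_gt0//.
    by rewrite lerDl ltW.
apply: (@le_trans _ _ (L * `|y - z|)); last by rewrite ler_wpM2r// lerDr.
apply: (@ler_cvg_to _ _ _ _ _ (cst (L * `|y - z|)) _ _ (cvg_norm (cvgB (lU y) (lU z))) (cvg_cst _)).
near=> t; have t0 : 0 < t by near: t; exact: nbhs_right_gt.
exact: lip.
Unshelve. all: by end_near. Qed.

Lemma niceD u v : nice u -> nice v -> nice (fun y => u y + v y).
Proof.
move=> [mu_ [K K0 bu]] [mv [L L0 bv]]; split; first exact: measurable_funD.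
exists (K + L); first by rewrite addr_ge0.
move=> y; have [b1 l1] := bu y; have [b2 l2] := bv y; split => [|z].
  by rewrite mulrDl (le_trans (ler_normD _ _))// lerD.
rewrite mulrDl (_ : u y + v y - (u z + v z) = (u y - u z) + (v y - v z)); last by ring.
by rewrite (le_trans (ler_normD _ _))// lerD.
Qed.

Lemma niceN u : nice u -> nice (fun y => - u y).
Proof.
move=> [mu_ [K K0 bu]]; split; first exact: (measurableT_comp (@oppr_measurable R setT) mu_).
exists K => // y; have [b1 l1] := bu y; split => [|z]; first by rewrite normrN.
by rewrite -opprD normrN.
Qed.

(* Pairing z with -z makes the principal value absolutely convergent. *)
Definition hq u x z : R := (2 * pi)^-1 * ((u (x - z) - u (x + z)) / z).
Definition Hn u x := \I (hq u x).

(** The Lipschitz-type bound is used for |z| <= 1 and the decay for |z| > 1; together they give an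
    integrable majorant. *)
Lemma pair_bound K z (a b : R) : 0 <= K -> `|a| <= K / (1 + `|z|) -> `|b| <= K / (1 + `|z|) ->
  `|a - b| <= 2 * K * `|z| -> `|(a - b) / z| <= 4 * K * rk 1 z.
Proof.
move=> K0 ha hb hab; have [->|z0] := eqVneq z 0.
  by rewrite invr0 mulr0 normr0 mulr_ge0 ?mulr_ge0// ltW// rk_gt0.
have v0 : 0 < `|z| by rewrite normr_gt0.
have h : `|a - b| * (1 + `|z|) <= 2 * K.
  rewrite -ler_pdivlMr ?ltr_pwDl// (le_trans (ler_normB _ _))//.
  by rewrite (_ : 2 * K / _ = K / (1 + `|z|) + K / (1 + `|z|)) ?lerD// -mulrDl; congr (_ / _); ring.
rewrite normrM normfV /rk expr1n ler_pdivrMr// mulrAC ler_pdivlMr; last by rewrite ltr_pwDr// sqr_ge0.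
rewrite -(real_normK (num_real z)); move: hab h v0 (normr_ge0 (a - b)).
move: `|z| `|a - b| => v d hab h v0 d0.
by have [v1|v1] := leP v 1; nra.
Qed.

Lemma norm_Qk_le t z : 0 < t -> `|Qk t z| <= pi^-1 * `|z^-1|.
Proof.
move=> t0; rewrite /Qk; have [->|z0] := eqVneq z 0.
  by rewrite mulr0 mul0r normr0 mulr_ge0// ltW// ipi_gt0.
rewrite -mulrA normrM (gtr0_norm (@ipi_gt0 R)) ler_wpM2l ?(ltW (@ipi_gt0 R))//.
have [_ h] := andP (rk_sq_le z t0).
rewrite normrM (gtr0_norm (rk_gt0 z t0)) normfV -div1r ler_pdivlMr ?normr_gt0//.
rewrite mulrC mulrA -normrM -expr2 ger0_norm ?sqr_ge0//.
Qed.

Lemma hq_bound u : nice u -> exists2 K : R, 0 <= K &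
  forall x z, `|(u (x - z) - u (x + z)) / z| <= K * (1 + `|x|) * rk 1 z.
Proof.
move=> [mu_ [K K0 bu]]; exists (4 * K); first by rewrite mulr_ge0.
move=> x z; rewrite -mulrA; have x0 : 1 <= 1 + `|x| by rewrite lerDl.
have b y : `|x - y| = `|z| -> `|u y| <= K * (1 + `|x|) / (1 + `|z|).
  move=> e; have [h _] := bu y; rewrite (le_trans h)// ler_pdivrMr ?ltr_pwDl//.
  rewrite mulrAC ler_pdivlMr ?ltr_pwDl// -mulrA ler_wpM2l//.
  have : `|z| <= `|x| + `|y| by rewrite -e ler_normB.
  by have := normr_ge0 y; have := normr_ge0 x; nra.
rewrite [leRHS](_ : _ = 4 * (K * (1 + `|x|)) * rk 1 z); last by ring.
apply: pair_bound; first by rewrite mulr_ge0// addr_ge0.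
- by apply: b; rewrite opprB addrC subrK.
- by apply: b; rewrite opprD addNKr normrN.
- have [_ /(_ (x + z)) h] := bu (x - z); apply: (le_trans h).
  rewrite (_ : x - z - (x + z) = - (2 * z)); last by ring.
  rewrite normrN normrM ger0_norm// mulrCA mulrA ler_wpM2r//.
  by rewrite ler_pM2l// ler_peMr.
Qed.

Lemma measurable_hq u x : measurable_fun setT u -> measurable_fun setT (hq u x).
Proof.
move=> mu_; apply: measurable_funM => //; apply: measurable_funM; last exact: measurable_invr.
apply: measurable_funB; apply: (measurableT_comp mu_).
  exact: measurable_funB.
exact: measurable_funD.
Qed.

Lemma integ_hq u x : nice u -> integ (hq u x).
Proof.
move=> nu; have [mu_ _] := nu; have [K K0 hK] := hq_bound nu.
have p0 : 0 <= (2 * pi)^-1 :> R by rewrite invr_ge0 mulr_ge0// pi_ge0.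
apply: (integ_le (measurable_hq x mu_) (integZ ((2 * pi)^-1 * (K * (1 + `|x|))) (@integ_rk1 R).1)).
move=> z; rewrite /hq normrM ger0_norm// -mulrA ler_wpM2l//.
Qed.

Lemma HnD u v x : nice u -> nice v -> Hn (fun y => u y + v y) x = Hn u x + Hn v x.
Proof.
move=> nu nv; rewrite -RintD; [|exact: integ_hq|exact: integ_hq].
by apply: eq_Rintegral => z _; rewrite /hq; ring.
Qed.

Lemma HnN u x : nice u -> Hn (fun y => - u y) x = - Hn u x.
Proof.
move=> nu; rewrite -RintN; last exact: integ_hq.
by apply: eq_Rintegral => z _; rewrite /hq; ring.
Qed.

(** After z = x - y the truncated kernel is odd, so the integral may be averaged with its image
    under z -> - z. *)
Lemma hilbert_trunc u x e : nice u -> 0 < e ->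
  pi^-1 * Rintegral mu [set y | e < `|x - y|] (fun y => u y / (x - y)) =
  \I (fun z => \1_[set z | e < `|z|] z * hq u x z).
Proof.
move=> nu e0; have [mu_ [K K0 bu]] := nu.
pose k z : R := \1_[set z | e < `|z|] z / z.
have mS : measurable [set z : R | e < `|z|].
  rewrite (_ : [set z | _] = (fun z => `|z|) @^-1` `]e, +oo[%classic); last first.
    by apply/seteqP; split => z /=; rewrite in_itv/= andbT.
  by rewrite -[X in measurable X]setTI; apply: normr_measurable.
have mk : measurable_fun setT k.
  by apply: measurable_funM; [exact: measurable_indic|exact: measurable_invr].
pose c := K * (1 + `|x|) * (e^-1 + 1).
have kb z : `|k z * u (x - z)| <= c * rk 1 z.
  have rk0 := rk_gt0 z (@ltr01 R); have x0 := normr_ge0 x.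
  rewrite /k indicE; have [|_] := boolP (z \in [set z | e < `|z|]); last first.
    rewrite !mul0r normr0 mulr_ge0 ?(ltW rk0)// mulr_ge0 ?addr_ge0 ?invr_ge0 ?(ltW e0)//.
    by rewrite mulr_ge0// addr_ge0.
  rewrite inE /= mul1r => ez; have z0 : 0 < `|z| by apply: lt_trans ez.
  have [h _] := bu (x - z); rewrite normrM normfV ler_pdivrMl//; apply: (le_trans h).
  rewrite [leRHS](_ : _ = K * (`|z| * (1 + `|x|) * (e^-1 + 1) * rk 1 z)); last by rewrite /c; ring.
  rewrite ler_wpM2l// -[X in X <= _]mul1r ler_pdivrMr ?ltr_pwDl// /rk expr1n.
  have d0 : 0 < z ^+ 2 + 1 by rewrite ltr_pwDr// sqr_ge0.
  have h1 : `|z| <= `|x| + `|x - z|.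
    by have := ler_normB x (x - z); rewrite opprB addrC subrK.
  rewrite -(real_normK (num_real z)) in d0 *.
  have h2 : 1 <= e^-1 * `|z| by rewrite mulrC ler_pdivlMr// mul1r ltW.
  have [d d1] : exists d, d = (`|z| ^+ 2 + 1)^-1 by exists (`|z| ^+ 2 + 1)^-1.
  have d2 : d * (`|z| ^+ 2 + 1) = 1 by rewrite d1 mulVf// gt_eqF.
  have d3 : 0 < d by rewrite d1 invr_gt0.
  have a1 : 1 + `|z| <= (1 + `|x|) * (1 + `|x - z|).
    by have := normr_ge0 (x - z); nra.
  have a2 : `|z| ^+ 2 + 1 <= `|z| * (e^-1 + 1) * (1 + `|z|).
    by move: (e^-1) h2 => q h2; nra.
  rewrite -d1; apply: (@le_trans _ _ (d * (`|z| * (e^-1 + 1) * (1 + `|z|)))).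
    by rewrite -[X in X <= _]d2; apply: ler_wpM2l => //; exact: ltW.
  rewrite [leRHS](_ : _ = d * (`|z| * (e^-1 + 1) * ((1 + `|x|) * (1 + `|x - z|)))); last by ring.
  by apply: ler_wpM2l; [exact: ltW|apply: ler_wpM2l => //; apply: mulr_ge0 => //;
    rewrite addr_ge0// invr_ge0 ltW].
have mG : measurable_fun setT (fun z => k z * u (x - z)).
  by apply: measurable_funM => //; apply: (measurableT_comp mu_); exact: measurable_funB.
have i0 : integ (fun z => k z * u (x - z)).
  by apply: (integ_le mG (integZ c (@integ_rk1 R).1)).
have iG : integ (fun y => k (x - y) * u y).
  apply: (integ_le _ (integZ c (integ_rk_shift x ltr01).1)).
    by apply: measurable_funM => //; apply: (measurableT_comp mk); exact: measurable_funB.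
  by move=> y; have := kb (x - y); rewrite subKr.
have sE (y : R) : (- y \in [set z : R | e < `|z|]) = (y \in [set z : R | e < `|z|]).
  by apply/idP/idP => /set_mem/= h; apply/mem_set => /=; move: h; rewrite normrN.
have aux3 (q i a b d : R) : q * (i * d * a + i * - d * b) = i * (q * ((a - b) * d)) by ring.
have aux2 (m : R) : pi^-1 * m = (2 * pi)^-1 * (m + m).
  by have := pi_gt0 R; move: pi => q q0; field; rewrite gt_eqF.
have aux (a b d : R) : a * (b / d) = a / d * b by rewrite mulrA mulrAC.
rewrite Rintegral_indic (_ : \I _ = cv k u x); last first.
  apply: eq_Rintegral => y _; rewrite /k.
  rewrite (_ : \1_[set y | e < `|x - y|] y = \1_[set z | e < `|z|] (x - y))//.
rewrite (cv_shift iG).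
have i1 := integ_refl i0; have E := Rint_refl i0.
transitivity ((2 * pi)^-1 * (\I (fun z => k z * u (x - z)) + \I (fun z => k (- z) * u (x - - z)))).
  by rewrite E aux2.
rewrite -(RintD i0 i1) -(RintZ _ (integD i0 i1)); apply: eq_Rintegral => z _.
rewrite /k /hq !indicE opprK invrN.
by rewrite sE; exact: aux3.
Qed.

(** Dominated convergence in the truncation. It also shows that the limit defining [hilbert] exists,
    so that [lim] does not return a default value. *)
Lemma hilbertE u x : nice u -> hilbert u x = Hn u x.
Proof.
move=> nu; have [mu_ _] := nu; have ih := integ_hq x nu.
have [|||||_ H] := @Rint_dct_right R (fun e z => \1_[set z | e < `|z|] z * hq u x z) (hq u x)
    (fun z => `|hq u x z|) 1.
- move=> e _; apply: measurable_funM; last exact: measurable_hq.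
  apply: measurable_indic.
  rewrite (_ : [set z | _] = (fun z => `|z|) @^-1` `]e, +oo[%classic); last first.
    by apply/seteqP; split => z /=; rewrite in_itv/= andbT.
  by rewrite -[X in measurable X]setTI; apply: normr_measurable.
- by [].
- exact: integ_norm.
- by move=> e z _; rewrite normrM indicE; case: (_ \in _); rewrite ?normr1 ?mul1r// normr0 mul0r.
- move=> z; have [->|z0] := eqVneq z 0.
    by rewrite /hq invr0 !mulr0; under eq_fun do rewrite mulr0; exact: cvg_cst.
  apply: cvg_near_cst; near=> e.
  rewrite indicE mem_set ?mul1r//=; near: e; apply: nbhs_right_lt.
  by rewrite normr_gt0.
apply/cvg_lim; first exact: Rhausdorff.
apply: cvg_trans H; apply: near_eq_cvg; near=> e.
by rewrite hilbert_trunc//; near: e; exact: nbhs_right_gt.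
Unshelve. all: by end_near. Qed.

Lemma ext_Pk f : smooth_cpt f -> ext (fun y t => cv (Pk t) f y)
  (fun y t => - cv (Pk t) (fraclap 1 f) y) (fun y t => cv (Pk t) (derive1 f) y) f.
Proof.
move=> sf; have sf' := smooth_cpt_derive sf; have bf := smooth_cpt_bmeas sf.
split; [split|split].
- exact: reg_Pk.
- apply: regN; apply: reg_Pk; exact: bmeas_fraclap.
- exact: reg_Pk (smooth_cpt_bmeas sf').
- by move=> y t t0; rewrite -(cv_Ck_fraclap y t0 sf); exact: dVt.
- by move=> y t t0; rewrite -(cv_Ak_smooth y t0 sf); exact: dVx.
- exact: cv_Pk_dec (smooth_cpt_dec sf).
- by move=> y; apply: cv_Pk_lim => //; exact: smooth_cont (smooth_cpt_smooth sf) _.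
Qed.

Lemma ext_PkL f : smooth_cpt f -> ext (fun y t => cv (Pk t) (fraclap 1 f) y)
  (fun y t => cv (Pk t) (derive1 (derive1 f)) y) (fun y t => cv (Pk t) (fraclap 1 (derive1 f)) y)
  (fraclap 1 f).
Proof.
move=> sf; have sf' := smooth_cpt_derive sf; have bf := bmeas_fraclap ler01 (lexx 1) sf.
split; [split|split].
- exact: reg_Pk.
- exact: reg_Pk (smooth_cpt_bmeas (smooth_cpt_derive sf')).
- by apply: reg_Pk; exact: bmeas_fraclap.
- by move=> y t t0; rewrite -(cv_Ck_fraclap1 y t0 sf); exact: dVt.
- by move=> y t t0; have D := dVx bf y t0; rewrite (cv_Ak_fraclap1 y t0 sf) in D; exact: D.
- exact: cv_Pk_dec (fraclap1_dec sf).
- by move=> y; apply: cv_Pk_lim => //; exact: fraclap1_cont.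
Qed.
End extensions.

(** * Green's formula on the half-plane *)

Section green_half_plane.
Context {R : realType}.
Local Notation mu := (@lebesgue_measure R).
Local Notation "\I f" := (Rintegral mu setT f) (at level 10).
Implicit Types (s t x y z r K N M : R) (f g w : R -> R).

Lemma rk_le_t t z : 0 < t -> rk t z <= (t ^+ 2)^-1.
Proof.
move=> t0; rewrite /rk lef_pV2 ?posrE ?exprn_gt0 ?den_gt0//.
by rewrite lerDr sqr_ge0.
Qed.

Lemma tz_rk_le t z : 0 < t -> t * `|z| * rk t z <= 1.
Proof.
move=> t0; have := rk_tz_le z t0; rewrite !normrM (gtr0_norm t0) (gtr0_norm (rk_gt0 z t0)).
rewrite ger0_norm//; apply: le_trans; rewrite -!mulrA ler_peMl// ?ler1n//.
by rewrite mulr_ge0 ?(ltW t0)// mulr_ge0// ltW// rk_gt0.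
Qed.

Lemma Pk_Qk_le t z : 0 < t -> `|Pk t z| <= pi^-1 / t /\ `|Qk t z| <= pi^-1 / t.
Proof.
move=> t0; have p0 := @ipi_gt0 R; have r0 := rk_gt0 z t0.
split; rewrite /Pk /Qk -mulrA normrM (gtr0_norm p0) ler_wpM2l ?(ltW p0)// normrM (gtr0_norm r0).
  rewrite (gtr0_norm t0) -div1r ler_pdivlMr// mulrAC -ler_pdivlMl -?expr2 ?exprn_gt0//.
  by rewrite mulr1; exact: rk_le_t.
by rewrite -div1r ler_pdivlMr// mulrC mulrA; exact: tz_rk_le.
Qed.

Lemma Pk_le_z t z : 0 < t -> z != 0 -> `|Pk t z| <= pi^-1 / `|z|.
Proof.
move=> t0 z0; have p0 := @ipi_gt0 R; have r0 := rk_gt0 z t0.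
rewrite /Pk -mulrA normrM (gtr0_norm p0) ler_wpM2l ?(ltW p0)// normrM (gtr0_norm r0).
rewrite (gtr0_norm t0) -div1r ler_pdivlMr ?normr_gt0// mulrAC.
exact: tz_rk_le.
Qed.

Lemma Qk_lim z : z != 0 -> Qk t z @[t --> 0^'+] --> pi^-1 / z.
Proof.
move=> z0; rewrite (_ : pi^-1 / z = pi^-1 * z * (z ^+ 2)^-1); last by move: pi^-1 => c; field.
apply: cvgM; first exact: cvg_cst.
apply: cvg_at_right_filter; rewrite /rk.
have c2 : z ^+ 2 + t ^+ 2 @[t --> (0 : R)] --> z ^+ 2 + 0 ^+ 2.
  by apply: cvgD; [exact: cvg_cst|exact: exprn_continuous].
by rewrite expr0n/= addr0 in c2; apply: cvgV => //; rewrite expf_neq0.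
Qed.

Lemma Rint_itv_le (a b M : R) f : a <= b -> measurable_fun setT f ->
  (forall x, a <= x <= b -> `|f x| <= M) -> `|Rintegral mu `[a, b]%classic f| <= M * (b - a).
Proof.
move=> ab mf fM; rewrite Rintegral_indic.
have -> : M * (b - a) = \I (fun x => M * \1_(`[a, b]%classic) x).
  rewrite RintZ; last exact: integ_indic_itv.
  have h : mu `[a, b]%classic = (b - a)%:E.
    rewrite lebesgue_measure_itv/= lte_fin; case: ltP => [_|ba]; first by rewrite -EFinD.
    by congr (_%:E); lra.
  by congr (_ * _); rewrite /Rintegral (_ : integral _ _ _ = (b - a)%:E)// integral_indic// setIT.
apply: Rint_abs_le; [|by apply: integZ; exact: integ_indic_itv|] => [|x].
  by apply: measurable_funM => //; apply: measurable_indic.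
rewrite indicE mem_setE in_itv/= normrM.
have [h|_] := boolP (a <= x <= b); last by rewrite normr0 mul0r mulr0.
by rewrite normr1 mul1r mulr1 fM.
Qed.

Lemma Rint_norm_le (A : set R) (F : R -> R) (G : R -> \bar R) : measurable A ->
  mu.-integrable A (EFin \o F) -> measurable_fun A G ->
  (forall x, A x -> (`|F x|%:E <= G x)%E) ->
  (`|Rintegral mu A F|%:E <= \int[mu]_(x in A) G x)%E.
Proof.
move=> mA iF mG FG.
have h1 : `|Rintegral mu A F| <= Rintegral mu A (fun x => `|F x|).
  exact: le_normr_Rintegral.
have iN : mu.-integrable A (EFin \o (fun x => `|F x|)) by exact: integrable_norm.
apply: (@le_trans _ _ (Rintegral mu A (fun x => `|F x|))%:E); first by rewrite lee_fin.
rewrite (Rint_in_EFin mA iN); apply: ge0_le_integral => //.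
by case/integrableP: iN.
Qed.

Variables (X Xt Xz Y Yt Yz : R -> R -> R) (X0 Y0 : R -> R).
Hypotheses (eX : ext X Xt Xz X0) (eY : ext Y Yt Yz Y0).
Hypothesis CR : forall z t, 0 < t -> Yt z t = Xz z t.

(** The field with components q and p pairs (X, Y) with (P_t, Q_t). Since d_z P = d_t Q and d_t P =
    - d_z Q, hypothesis [CR] reduces its divergence to P_t (X_t + Y_z). The signs differ from those
    in [green] because z is the reflected variable x - y. *)
Let p z t := Pk t z * X z t - Qk t z * Y z t.
Let q z t := Pk t z * Y z t + Qk t z * X z t.
Let pt z t := (Ck t z * X z t + Pk t z * Xt z t) - (Ak t z * Y z t + Qk t z * Yt z t).
Let qz z t := (Ak t z * Y z t + Pk t z * Yz z t) + (- Ck t z * X z t + Qk t z * Xz z t).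
Let J : \bar R := (\int[mu]_z \int[mu]_(t in `]0%R, +oo[) (Pk t z * `|Xt z t + Yz z t|)%:E)%E.

Let mPk2 : measurable_fun setT (fun z : R * R => Pk z.2 z.1).
Proof. by apply: measurable_Pkc => //. Qed.
Let mQk2 : measurable_fun setT (fun z : R * R => Qk z.2 z.1).
Proof. by apply: measurable_Qkc => //. Qed.
Let mAk2 : measurable_fun setT (fun z : R * R => Ak z.2 z.1).
Proof. by apply: measurable_Akc => //. Qed.
Let mCk2 : measurable_fun setT (fun z : R * R => Ck z.2 z.1).
Proof. by apply: measurable_Ckc => //. Qed.

Let mp : measurable_fun setT (fun z : R * R => p z.1 z.2).
Proof.
have [[[mX _ _ _] _ _] _] := eX; have [[[mY _ _ _] _ _] _] := eY.
by apply: measurable_funB; exact: measurable_funM.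
Qed.

Let mq : measurable_fun setT (fun z : R * R => q z.1 z.2).
Proof.
have [[[mX _ _ _] _ _] _] := eX; have [[[mY _ _ _] _ _] _] := eY.
by apply: measurable_funD; exact: measurable_funM.
Qed.

Let mpt : measurable_fun setT (fun z : R * R => pt z.1 z.2).
Proof.
have [[[mX _ _ _] [mXt _ _ _] [mXz _ _ _]] _] := eX.
have [[[mY _ _ _] [mYt _ _ _] [mYz _ _ _]] _] := eY.
by apply: measurable_funB; apply: measurable_funD; exact: measurable_funM.
Qed.

Let mqz : measurable_fun setT (fun z : R * R => qz z.1 z.2).
Proof.
have [[[mX _ _ _] [mXt _ _ _] [mXz _ _ _]] _] := eX.
have [[[mY _ _ _] [mYt _ _ _] [mYz _ _ _]] _] := eY.
apply: measurable_funD; apply: measurable_funD; apply: measurable_funM => //.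
exact: (measurableT_comp (@oppr_measurable R setT) mCk2).
Qed.

Let dp z t : 0 < t -> is_derive t 1 (p z) (pt z t).
Proof.
move=> t0; have [_ [dX _ _ _]] := eX; have [_ [dY _ _ _]] := eY.
have D1 := dX z t t0; have D2 := dY z t t0.
have D3 := is_derive_Pkt z t0; have D4 := is_derive_Qkt z t0.
by apply: is_derive_eq; rewrite /GRing.scale /= /pt; ring.
Qed.

Let dq z t : 0 < t -> is_derive z 1 (q^~ t) (qz z t).
Proof.
move=> t0; have [_ [_ dX _ _]] := eX; have [_ [_ dY _ _]] := eY.
have D1 := dX z t t0; have D2 := dY z t t0.
have D3 := is_derive_Pkz z t0; have D4 := is_derive_Qkz z t0.
by apply: is_derive_eq; rewrite /GRing.scale /= /qz; ring.
Qed.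

Let cpt z t : 0 < t -> {for t, continuous (pt z)}.
Proof.
move=> t0; have [[[_ tX _ _] [_ tXt _ _] _] _] := eX; have [[[_ tY _ _] [_ tYt _ _] _] _] := eY.
have cP := derive_cont (is_derive_Pkt z t0); have cQ := derive_cont (is_derive_Qkt z t0).
have cA := derive_cont (is_derive_Akt z t0); have cC := derive_cont (is_derive_Ckt z t0).
apply: cvgB; apply: cvgD; apply: cvgM => //;
  [exact: tX|exact: tXt|exact: tY|exact: tYt].
Qed.

Let cqz z t : 0 < t -> {for z, continuous (qz^~ t)}.
Proof.
move=> t0; have [[[_ _ zX _] _ [_ _ zXz _]] _] := eX; have [[[_ _ zY _] _ [_ _ zYz _]] _] := eY.
have cP := derive_cont (is_derive_Pkz z t0); have cQ := derive_cont (is_derive_Qkz z t0).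
have cA := derive_cont (is_derive_Akz z t0); have cC := derive_cont (is_derive_Ckz z t0).
apply: cvgD; apply: cvgD; apply: cvgM => //;
  [exact: zY|exact: zYz|exact: (cvgN cC)|exact: zX|exact: zXz].
Qed.

Let kern_bound (t0 : R) : 0 < t0 -> exists2 W : R, 0 <= W & forall z t, t0 <= t ->
  [/\ `|Pk t z| <= W, `|Qk t z| <= W, `|Ak t z| <= W & `|Ck t z| <= W].
Proof.
move=> t00; have p0 := @ipi_gt0 R; exists (pi^-1 / t0 + pi^-1 / t0 ^+ 2).
  by rewrite addr_ge0// mulr_ge0 ?(ltW p0)// invr_ge0 ltW// exprn_gt0.
move=> z t tt; have t_gt0 : 0 < t by exact: lt_le_trans tt.
have [h1 h2] := Pk_Qk_le z t_gt0.
have e1 : pi^-1 / t <= pi^-1 / t0 :> R by rewrite ler_wpM2l ?(ltW p0)// lef_pV2.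
have e2 : pi^-1 * rk t z <= pi^-1 / t0 ^+ 2.
  rewrite ler_wpM2l ?(ltW p0)// (le_trans (rk_le_t _ t_gt0))// lef_pV2 ?posrE ?exprn_gt0//.
  by rewrite ler_pXn2r// nnegrE ltW.
have n1 : 0 <= pi^-1 / t0 :> R by rewrite mulr_ge0 ?(ltW p0)// invr_ge0 ltW.
have n2 : 0 <= pi^-1 / t0 ^+ 2 :> R by rewrite mulr_ge0 ?(ltW p0)// invr_ge0 ltW// exprn_gt0.
have := norm_Ak_le z t_gt0; have := norm_Ck_le z t_gt0.
by move=> h3 h4; split; lra.
Qed.

Let four_bound (W M a1 a2 a3 a4 b1 b2 b3 b4 : R) :
  `|a1| <= W -> `|a2| <= W -> `|a3| <= W -> `|a4| <= W ->
  `|b1| <= M -> `|b2| <= M -> `|b3| <= M -> `|b4| <= M ->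
  `|(a1 * b1 + a2 * b2) + (a3 * b3 + a4 * b4)| <= 4 * (W * M).
Proof.
move=> h1 h2 h3 h4 k1 k2 k3 k4.
have e a b : `|a| <= W -> `|b| <= M -> `|a * b| <= W * M.
  by move=> ha hb; rewrite normrM ler_pM.
have := e _ _ h1 k1; have := e _ _ h2 k2; have := e _ _ h3 k3; have := e _ _ h4 k4.
move=> f4 f3 f2 f1; apply: (le_trans (ler_normD _ _)).
have := ler_normD (a1 * b1) (a2 * b2); have := ler_normD (a3 * b3) (a4 * b4); lra.
Qed.

Let six_bound (a b c d u v : R) (M := `|a| + `|b| + `|c| + `|d| + `|u| + `|v|) :
  [/\ a <= M, b <= M, c <= M & [/\ d <= M, u <= M & v <= M]].
Proof.
have := ler_norm a; have := ler_norm b; have := ler_norm c; have := ler_norm d.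
have := ler_norm u; have := ler_norm v; have := normr_ge0 a; have := normr_ge0 b.
have := normr_ge0 c; have := normr_ge0 d; have := normr_ge0 u; have := normr_ge0 v.
by rewrite /M => *; split; [lra|lra|lra|split; lra].
Qed.

Let green_step (N t0 t1 : R) : 0 <= N -> 0 < t0 -> t0 <= t1 ->
  (`|Rintegral mu `[- N, N]%classic (fun z => p z t1 - p z t0) +
     Rintegral mu `[t0, t1]%classic (fun t => q N t - q (- N) t)|%:E <= J)%E.
Proof.
move=> N0 t00 t01.
have [[[mX tX zX [K1 _ bX]] [mXt tXt _ [K2 _ bXt]] [_ _ zXz [K3 _ bXz]]] _] := eX.
have [[[mY tY zY [K4 _ bY]] [_ tYt _ [K5 _ bYt]] [mYz _ zYz [K6 _ bYz]]] _] := eY.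
have [W W0 bW] := kern_bound t00.
pose M := `|K1| + `|K2| + `|K3| + `|K4| + `|K5| + `|K6|.
have KM : [/\ K1 <= M, K2 <= M, K3 <= M & [/\ K4 <= M, K5 <= M & K6 <= M]].
  exact: six_bound.
have [KM1 KM2 KM3 [KM4 KM5 KM6]] := KM.
have pos t : t0 <= t <= t1 -> 0 < t by move=> /andP[h _]; exact: lt_le_trans h.
have bpt z t : t0 <= t <= t1 -> `|pt z t| <= 4 * (W * M).
  move=> tt; have tp := pos t tt; have [h1 h2 h3 h4] := bW z t (andP tt).1.
  rewrite (_ : pt z t = (Ck t z * X z t + Pk t z * Xt z t) + ((- Ak t z) * Y z t + (- Qk t z) * Yt z t)).
    2: by rewrite /pt; ring.
  apply: four_bound => //.
  - by rewrite normrN.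
  - by rewrite normrN.
  - exact: le_trans (bX _ _ tp) KM1.
  - exact: le_trans (bXt _ _ tp) KM2.
  - exact: le_trans (bY _ _ tp) KM4.
  - exact: le_trans (bYt _ _ tp) KM5.
have bqz z t : t0 <= t <= t1 -> `|qz z t| <= 4 * (W * M).
  move=> tt; have tp := pos t tt; have [h1 h2 h3 h4] := bW z t (andP tt).1.
  apply: four_bound => //.
  - by rewrite normrN.
  - exact: le_trans (bY _ _ tp) KM4.
  - exact: le_trans (bYz _ _ tp) KM6.
  - exact: le_trans (bX _ _ tp) KM1.
  - exact: le_trans (bXz _ _ tp) KM3.
have dp' y t : t0 <= t <= t1 -> is_derive t 1 (p y) (pt y t) by move=> /pos; exact: dp.
have dq' y t : t0 <= t <= t1 -> is_derive y 1 (q^~ t) (qz y t) by move=> /pos; exact: dq.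
have cp' y t : t0 <= t <= t1 -> {for t, continuous (pt y)} by move=> /pos; exact: cpt.
have cq' y t : t0 <= t <= t1 -> {for y, continuous (qz^~ t)} by move=> /pos; exact: cqz.
have [i1 i2 E] := green_rect N0 t01 dp' cp' dq' cq' mpt mqz bpt bqz.
set A := `[(- N), N]%classic in i1 i2 E *; set B := `[t0, t1]%classic in i1 i2 E *.
rewrite -E.
have mA : measurable A by exact: measurable_itv.
have mB : measurable B by exact: measurable_itv.
have Bt t : B t -> 0 < t by rewrite /B/= in_itv/=; exact: pos.
have sB : B `<=` `]0%R, +oo[%classic by move=> t /Bt; rewrite /= in_itv/= andbT.
clearbody A B.
pose g z t : R := Pk t z * `|Xt z t + Yz z t|.
have mg : measurable_fun setT (fun z : R * R => g z.1 z.2).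
  by apply: measurable_funM => //; apply: measurableT_comp => //; exact: measurable_funD.
have g0 z t : 0 < t -> 0 <= g z t by move=> tp; rewrite mulr_ge0// ltW// Pk_gt0.
have mB' : measurable (`]0%R, +oo[%classic : set R) by exact: measurable_itv.
have mgB (D : set R) : measurable D -> (D `<=` `]0%R, +oo[%classic) ->
    measurable_fun setT (fun z => \int[mu]_(t in D) (g z t)%:E)%E.
  move=> mD sD; apply: measurable_fun_integral_in => // z t /sD.
  by rewrite /= in_itv/= andbT; exact: g0.
apply: (@le_trans _ _ (\int[mu]_(z in A) \int[mu]_(t in B) (g z t)%:E)%E).
  apply: Rint_norm_le => //; first by apply: measurable_funTS; exact: mgB.
  move=> z Az; apply: Rint_norm_le => //; first exact: i1.
    apply/measurable_EFinP; apply: measurable_funTS; exact: (measurable_sec1 z mg).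
  move=> t /Bt tp; rewrite lee_fin.
  rewrite (_ : pt z t + qz z t = Pk t z * (Xt z t + Yz z t)); last first.
    by rewrite /pt /qz (CR z tp); ring.
  by rewrite normrM (gtr0_norm (Pk_gt0 z tp)).
apply: (@le_trans _ _ (\int[mu]_(z in A) \int[mu]_(t in `]0%R, +oo[) (g z t)%:E)%E).
  apply: ge0_le_integral => //.
  - by move=> z _; apply: integral_ge0 => t /Bt tp; rewrite lee_fin g0.
  - by apply: measurable_funTS; exact: mgB.
  - by apply: measurable_funTS; exact: mgB.
  - move=> z _; apply: ge0_subset_integral => //.
      apply/measurable_EFinP; apply: measurable_funTS; exact: (measurable_sec1 z mg).
    by move=> t; rewrite /= in_itv/= andbT lee_fin; exact: g0.
apply: ge0_subset_integral => //; first exact: mgB.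
by move=> z _; apply: integral_ge0 => t; rewrite /= in_itv/= andbT lee_fin; exact: g0.
Qed.

Let dec_KB : exists2 K : R, 0 <= K & forall z t, 0 < t ->
  `|X z t| <= K / (1 + `|z| + t) /\ `|Y z t| <= K / (1 + `|z| + t).
Proof.
have [_ [_ _ [K K0 bX] _]] := eX; have [_ [_ _ [L L0 bY] _]] := eY.
exists (K + L); first by rewrite addr_ge0.
move=> z t t0; have w0 := wt_gt0 z t0; split.
  by apply: (le_trans (bX z t t0)); rewrite ler_wpM2r ?lerDl// invr_ge0 ltW.
by apply: (le_trans (bY z t t0)); rewrite ler_wpM2r ?lerDr// invr_ge0 ltW.
Qed.

Let two_bound (W M a1 a2 b1 b2 : R) : `|a1| <= W -> `|a2| <= W ->
  `|b1| <= M -> `|b2| <= M -> `|a1 * b1 + a2 * b2| <= 2 * (W * M).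
Proof.
move=> h1 h2 k1 k2; have e a b : `|a| <= W -> `|b| <= M -> `|a * b| <= W * M.
  by move=> ha hb; rewrite normrM ler_pM.
have := e _ _ h1 k1; have := e _ _ h2 k2; have := ler_normD (a1 * b1) (a2 * b2); lra.
Qed.

Let pq_bound : exists2 K : R, 0 <= K & forall z t, 0 < t ->
  [/\ `|p z t| <= K / t ^+ 2, z != 0 -> `|q z t| <= K / z ^+ 2 &
   `|p z t| <= K * (1 + t) * rk t z].
Proof.
have [K K0 bK] := dec_KB; have p0 := @ipi_gt0 R.
exists (2 * (pi^-1 * K)); first by rewrite mulr_ge0// mulr_ge0// ltW.
move=> z t t0; have [b1 b2] := bK z t t0; have [k1 k2] := Pk_Qk_le z t0.
have w0 := wt_gt0 z t0; have z0 := normr_ge0 z.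
split.
- rewrite (_ : 2 * _ / _ = 2 * (pi^-1 / t * (K / t))); last first.
    by have := lt0r_neq0 t0; move: pi^-1 => c tn0; field.
  have h : K / (1 + `|z| + t) <= K / t by rewrite ler_wpM2l// lef_pV2 ?posrE//; lra.
  rewrite /p -mulNr; apply: two_bound; rewrite ?normrN//.
    exact: le_trans b1 h.
  exact: le_trans b2 h.
- move=> zn0; rewrite -(real_normK (num_real z)).
  have zp : 0 < `|z| by rewrite normr_gt0.
  rewrite (_ : 2 * _ / _ = 2 * (pi^-1 / `|z| * (K / `|z|))); last first.
    by have := lt0r_neq0 zp; move: pi^-1 => c tn0; field.
  have h : K / (1 + `|z| + t) <= K / `|z| by rewrite ler_wpM2l// lef_pV2 ?posrE//; lra.
  rewrite /q; apply: two_bound.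
  + exact: Pk_le_z.
  + by rewrite -normfV; exact: norm_Qk_le.
  + exact: le_trans b2 h.
  + exact: le_trans b1 h.
- have r0 := rk_gt0 z t0.
  have e1 : `|Pk t z| <= pi^-1 * ((1 + t) * (1 + `|z|)) * rk t z.
    rewrite /Pk normrM (gtr0_norm r0) ler_wpM2r ?(ltW r0)// normrM (gtr0_norm p0) (gtr0_norm t0).
    by rewrite ler_wpM2l ?(ltW p0)//; nra.
  have e2 : `|Qk t z| <= pi^-1 * ((1 + t) * (1 + `|z|)) * rk t z.
    rewrite /Qk normrM (gtr0_norm r0) ler_wpM2r ?(ltW r0)// normrM (gtr0_norm p0).
    by rewrite ler_wpM2l ?(ltW p0)//; nra.
  have h : K / (1 + `|z| + t) <= K / (1 + `|z|).
    by rewrite ler_wpM2l// lef_pV2 ?posrE//; lra.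
  rewrite (_ : 2 * _ * _ * _ = 2 * (pi^-1 * ((1 + t) * (1 + `|z|)) * rk t z * (K / (1 + `|z|)))); last first.
    have : 1 + `|z| != 0 by rewrite gt_eqF// ltr_pwDl.
    by move: pi^-1 (rk t z) => c r n0; field.
  rewrite /p -mulNr; apply: two_bound; rewrite ?normrN//.
    exact: le_trans b1 h.
  exact: le_trans b2 h.
Qed.

Let integ_p t : 0 < t -> integ (p^~ t).
Proof.
move=> t0; have [K K0 bK] := pq_bound.
apply: (integ_le _ (integZ (K * (1 + t)) (integ_rk t0).1)).
  exact: (@measurable_sec2 _ _ _ _ _ _ (fun z : R * R => p z.1 z.2) t mp).
by move=> z; have [] := bK z t t0.
Qed.

Let tri (a b c d j k : R) : `|a - b + c| <= j -> `|a| <= 2 * k -> `|c| <= d ->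
  d <= 2 * k -> 0 <= k -> `|b| <= j + 6 * k.
Proof.
have e : - (a - b + c) + (a + c) = b by ring.
have := ler_normD (- (a - b + c)) (a + c); rewrite e normrN.
by have := ler_normD a c; lra.
Qed.

(** The rectangle [-m, m] x [t, m] grows. Its upper edge has length 2 m and its vertical edges have
    length at most m, while p and q are O(m^(-2)) there, so only the lower edge survives. *)
Let green_level t : 0 < t -> (`|\I (p^~ t)|%:E <= J)%E.
Proof.
move=> t0; have [K K0 bK] := pq_bound.
have [->|Jfin] := eqVneq J +oo%E; first by rewrite leey.
have J0 : (0 <= J)%E.
  apply: integral_ge0 => z _; apply: integral_ge0 => s; rewrite /= in_itv/= andbT => s0.
  by rewrite lee_fin mulr_ge0// ltW// Pk_gt0.
have [j Ej] : exists j, J = j%:E.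
  by exists (fine J); rewrite fineK// ge0_fin_numE// ltey.
rewrite Ej lee_fin.
pose An n : set R := `[- n.+1%:R, n.+1%:R]%classic.
have lim : \I (fun z => \1_(An n) z * p z t) @[n --> \oo] --> \I (p^~ t).
  have [||||_ H] := @Rint_dct R (fun n z => \1_(An n) z * p z t) (p^~ t) (fun z => `|p z t|).
  - move=> n; apply: measurable_funM; last exact: integ_measurable (integ_p t0).
    by apply: measurable_indic; exact: measurable_itv.
  - by apply: integ_norm; exact: integ_p.
  - by move=> n z; rewrite normrM indicE; case: (_ \in _); rewrite ?normr1 ?mul1r// normr0 mul0r.
  - move=> z; apply: cvg_near_cst; near=> n.
    rewrite indicE mem_set ?mul1r// /An/= in_itv/= -ler_norml.
    apply: (@le_trans _ _ n%:R); last by rewrite ler_nat.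
    by near: n; exact: nbhs_infty_ger.
  exact: H.
have bnd : \forall n \near \oo, `|\I (fun z => \1_(An n) z * p z t)| <= j + 6 * K / n.+1%:R.
  near=> n; have nt : t <= n.+1%:R.
    apply: (@le_trans _ _ n%:R); last by rewrite ler_nat.
    by near: n; exact: nbhs_infty_ger.
  have n0 : 0 < n.+1%:R :> R by rewrite ltr0n.
  have mpn s : measurable_fun setT (p^~ s).
    exact: (@measurable_sec2 _ _ _ _ _ _ (fun z : R * R => p z.1 z.2) s mp).
  have mqn s : measurable_fun setT (q s).
    exact: (@measurable_sec1 _ _ _ _ _ _ (fun z : R * R => q z.1 z.2) s mq).
  have H := green_step (ltW n0) t0 nt; rewrite Ej lee_fin in H.
  set m : R := n.+1%:R in nt n0 H *.
  have A1 : `|Rintegral mu `[- m, m]%classic (p^~ m)| <= K / m ^+ 2 * (m - - m).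
    apply: Rint_itv_le => //; first by lra.
    by move=> z _; have [] := bK z m n0.
  have A2 : `|Rintegral mu `[t, m]%classic (fun s => q m s - q (- m) s)| <= 2 * (K / m ^+ 2) * (m - t).
    apply: Rint_itv_le => //; first by apply: measurable_funB.
    move=> s /andP[ts _]; have s0 := lt_le_trans t0 ts.
    have [_ h1 _] := bK m s s0; have [_ h2 _] := bK (- m) s s0.
    have {}h1 := h1 (lt0r_neq0 n0); rewrite sqrrN oppr_eq0 in h2.
    have {}h2 := h2 (lt0r_neq0 n0).
    rewrite mulr_natl mulr2n; apply: (le_trans (ler_normB _ _)); exact: lerD.
  have E : Rintegral mu `[- m, m]%classic (fun z => p z m - p z t) =
      Rintegral mu `[- m, m]%classic (p^~ m) - \I (fun z => \1_(An n) z * p z t).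
    rewrite (Rintegral_indic _ (fun z => p z m - p z t)) (Rintegral_indic _ (p^~ m)).
    have iind s : 0 < s -> integ (fun z => \1_(An n) z * p z s).
      move=> s0; apply: (integ_le _ (integ_norm (integ_p s0))).
        by apply: measurable_funM => //; apply: measurable_indic; exact: measurable_itv.
      by move=> z; rewrite normrM indicE; case: (_ \in _); rewrite ?normr1 ?mul1r// normr0 mul0r.
    rewrite -(RintB (iind _ n0) (iind _ t0)); apply: eq_Rintegral => z _; exact: mulrBr.
  rewrite E in H.
  have K1 : K / m ^+ 2 * (m - - m) = 2 * (K / m) by have := lt0r_neq0 n0; move=> ?; field.
  have K2 : 2 * (K / m ^+ 2) * (m - t) <= 2 * (K / m).
    have -> : 2 * (K / m) = 2 * (K / m ^+ 2) * m by have := lt0r_neq0 n0; move=> ?; field.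
    rewrite ler_wpM2l//; last by lra.
    by rewrite mulr_ge0// mulr_ge0// invr_ge0 ltW// exprn_gt0.
  have Km : 0 <= K / m by rewrite mulr_ge0// invr_ge0 ltW.
  have -> : 6 * K / m = 6 * (K / m) by rewrite mulrA.
  rewrite K1 in A1; move: H A1 A2 K2.
  set a := Rintegral _ _ _; set b := \I _; set c := Rintegral _ _ _ => H A1 A2 K2.
  exact: (tri H A1 A2 K2 Km).
have lim2 : j + 6 * K / n.+1%:R @[n --> \oo] --> j + 6 * K * 0.
  apply: cvgD; first exact: cvg_cst.
  by apply: cvgM; [exact: cvg_cst|exact: (@cvg_harmonic R)].
rewrite mulr0 addr0 in lim2.
exact: (ler_cvg_to (cvg_norm lim) lim2 bnd).
Unshelve. all: by end_near. Qed.

Let half (m : R) : 2^-1 * (m + m) = m. Proof. by field. Qed.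

Let integ_PX t : 0 < t -> integ (fun z => Pk t z * X z t).
Proof.
move=> t0; have [[[mX _ _ [K K0 bX]] _ _] _] := eX.
have mXt : measurable_fun setT (X^~ t).
  exact: (@measurable_sec2 _ _ _ _ _ _ (fun z : R * R => X z.1 z.2) t mX).
have i1 := integ_Pk t0; apply: (integ_le _ (integZ K i1)).
  by apply: measurable_funM => //; exact: integ_measurable i1.
by move=> z; rewrite normrM (gtr0_norm (Pk_gt0 z t0)) mulrC ler_wpM2r ?bX// ltW// Pk_gt0.
Qed.

Let integ_QY t : 0 < t -> integ (fun z => Qk t z * Y z t).
Proof.
move=> t0; have [K K0 bK] := dec_KB; have [[[mY _ _ _] _ _] _] := eY.
have p0 := @ipi_gt0 R.
apply: (integ_le _ (integZ (pi^-1 * K * (1 + t)) (integ_rk t0).1)).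
  apply: measurable_funM.
    exact: (@measurable_sec2 _ _ _ _ _ _ (fun z : R * R => Qk z.2 z.1) t mQk2).
  exact: (@measurable_sec2 _ _ _ _ _ _ (fun z : R * R => Y z.1 z.2) t mY).
move=> z; have [_ h] := bK z t t0; rewrite normrM.
have r0 := rk_gt0 z t0; have z0 := normr_ge0 z.
rewrite (_ : _ * rk t z = (pi^-1 * ((1 + t) * (1 + `|z|)) * rk t z) * (K / (1 + `|z|))); last first.
  have : 1 + `|z| != 0 by rewrite gt_eqF// ltr_pwDl.
  by move: pi^-1 (rk t z) => c r n0; field.
apply: ler_pM => //.
  rewrite /Qk normrM (gtr0_norm r0) ler_wpM2r ?(ltW r0)// normrM (gtr0_norm p0).
  by rewrite ler_wpM2l ?(ltW p0)//; nra.
by apply: (le_trans h); rewrite ler_wpM2l// lef_pV2 ?posrE//; lra.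
Qed.

(** X(., t) itself moves with t, so [cv_Pk_lim] does not apply to it. The Lipschitz bound, uniform
    in t, compares X(z, t) with X(0, t) through a fixed bounded continuous w that vanishes at 0, and
    [cv_Pk_lim] is applied to w. *)
Let lim_Pk : \I (fun z => Pk t z * X z t) @[t --> 0^'+] --> X0 0.
Proof.
have [L L0 lip] := ext_lip eX; have [[[mX _ _ [K K0 bX]] _ _] [_ _ _ lX]] := eX.
pose w z := 2 * (L + 2 * K) * `|z| / (1 + `|z|).
have w0 z : 0 <= w z by rewrite /w !mulr_ge0 ?addr_ge0 ?mulr_ge0 ?invr_ge0 ?addr_ge0.
have Xw z t : 0 < t -> `|X z t - X 0 t| <= w z.
  move=> t0; have h1 := lip t z 0 t0; rewrite subr0 in h1.
  have h2 : `|X z t - X 0 t| <= 2 * K.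
    by have := bX z t t0; have := bX 0 t t0; have := ler_normB (X z t) (X 0 t); lra.
  rewrite /w ler_pdivlMr ?ltr_pwDl//; move: h1 h2 (normr_ge0 z) (normr_ge0 (X z t - X 0 t)).
  move: `|_ - _| `|z| => d v h1 h2 v0 d0.
  by have [v1|v1] := leP v 1; nra.
have mw : measurable_fun setT w.
  apply: measurable_funM; first exact: measurable_funM.
  by apply: measurable_funV; exact: measurable_funD.
have bw : bmeas w.
  split=> //; exists (2 * (L + 2 * K)) => z; rewrite ger0_norm// /w ler_pdivrMr ?ltr_pwDl//.
  by rewrite ler_wpM2l ?lerDr// mulr_ge0// addr_ge0// mulr_ge0.
have cw : {for 0, continuous w}.
  have cn : {for (0 : R), continuous (fun z : R => `|z|)} by exact: norm_continuous.
  apply: cvgM; first by apply: cvgM; [exact: cvg_cst|exact: cn].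
  by apply: cvgV; [rewrite normr0 addr0 oner_neq0|apply: cvgD; [exact: cvg_cst|exact: cn]].
have H := cv_Pk_lim bw cw.
have w00 : w 0 = 0 by rewrite /w normr0 mulr0 mul0r.
rewrite w00 in H.
have P1 t : 0 < t -> integ (Pk t) /\ \I (Pk t) = 1.
  move=> t0; have [i1 E1] := integ_Pk_shift 0 t0.
  have e : (fun y => Pk t (0 - y)) = Pk t by apply/funext => y; rewrite sub0r PkN.
  by rewrite e in i1 E1.
have key t : 0 < t -> `|\I (fun z => Pk t z * X z t) - X 0 t| <= cv (Pk t) w 0.
  move=> t0; have [i1 E1] := P1 t t0.
  have i2 := integ_PX t0.
  have -> : X 0 t = \I (fun z => X 0 t * Pk t z) by rewrite RintZ// E1 mulr1.
  rewrite -(RintB i2 (integZ _ i1)).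
  have ec : cv (Pk t) w 0 = \I (fun z => Pk t z * w z).
    by apply: eq_Rintegral => z _; rewrite sub0r PkN.
  have i3 : integ (fun z => Pk t z * w z).
    have := integ_PkM 0 t0 bw; congr (_.-integrable _ _); apply/funext => z /=.
    by rewrite sub0r PkN.
  rewrite ec; apply: Rint_abs_le => //.
    by apply: (integ_measurable (integB i2 (integZ _ i1))).
  move=> z; rewrite [X 0 t * _]mulrC -mulrBr normrM (gtr0_norm (Pk_gt0 z t0)).
  by rewrite ler_wpM2l ?Xw// ltW// Pk_gt0.
have c1 : \I (fun z => Pk t z * X z t) - X 0 t @[t --> 0^'+] --> (0 : R).
  apply: norm_cvg0; apply: (@squeeze_cvgr _ _ _ _ (cst 0) (fun t => cv (Pk t) w 0)) => //.
    near=> t; have t0 : 0 < t by near: t; exact: nbhs_right_gt.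
    by rewrite normr_ge0 key.
  exact: cvg_cst.
have C : \I (fun z => Pk t z * X z t) - X 0 t + X 0 t @[t --> 0^'+] --> 0 + X0 0.
  by apply: cvgD; [exact: c1|exact: lX].
rewrite add0r in C; apply: cvg_trans C; apply: near_eq_cvg.
by near=> t; rewrite /= subrK.
Unshelve. all: by end_near. Qed.

(** Q_t is odd, so the integral is symmetrised. Then |Q_t(z)| <= 1 / (pi |z|) and [pair_bound] give
    a majorant independent of t, and Q_t(z) tends to 1 / (pi z). *)
Let lim_Qk : \I (fun z => Qk t z * Y z t) @[t --> 0^'+] -->
  \I (fun z => (2 * pi)^-1 * ((Y0 z - Y0 (- z)) / z)).
Proof.
have [L L0 lip] := ext_lip eY; have [K K0 bK] := dec_KB; have [[[mY _ _ _] _ _] [_ _ _ lY]] := eY.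
have p0 := @ipi_gt0 R.
have mYt t : measurable_fun setT (Y^~ t).
  exact: (@measurable_sec2 _ _ _ _ _ _ (fun z : R * R => Y z.1 z.2) t mY).
have mQ t : measurable_fun setT (Qk t : R -> R).
  exact: (@measurable_sec2 _ _ _ _ _ _ (fun z : R * R => Qk z.2 z.1) t mQk2).
pose F t z := 2^-1 * (Qk t z * (Y z t - Y (- z) t)).
have E t : 0 < t -> \I (fun z => Qk t z * Y z t) = \I (F t).
  move=> t0; have i1 := integ_refl (integ_QY t0); have e := Rint_refl (integ_QY t0).
  have -> : \I (F t) = \I (fun z => 2^-1 * (Qk t z * Y z t + Qk t (- z) * Y (- z) t)).
    by apply: eq_Rintegral => z _; rewrite /F /Qk /rk sqrrN; ring.
  by rewrite (RintZ _ (integD (integ_QY t0) i1)) (RintD (integ_QY t0) i1) e half.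
have bF z t : 0 < t -> `|F t z| <= 2^-1 * (pi^-1 * (4 * (K + L) * rk 1 z)).
  move=> t0; rewrite /F normrM ger0_norm// ler_wpM2l// normrM.
  have [z0|z0] := eqVneq z 0.
    rewrite z0 /Qk mulr0 mul0r normr0 mul0r mulr_ge0 ?(ltW p0)// mulr_ge0 ?(ltW (rk_gt0 _ _))//.
    by rewrite mulr_ge0// addr_ge0.
  apply: (@le_trans _ _ (pi^-1 * `|(Y z t - Y (- z) t) / z|)).
    rewrite [leRHS](_ : _ = pi^-1 * `|z^-1| * `|Y z t - Y (- z) t|); last by rewrite normrM; ring.
    by rewrite ler_wpM2r//; exact: norm_Qk_le.
  rewrite ler_wpM2l ?(ltW p0)//; apply: pair_bound; first by rewrite addr_ge0.
  - have [_ h] := bK z t t0; apply: (le_trans h); apply: ler_pM => //; rewrite ?invr_ge0 ?(ltW (wt_gt0 _ _))//.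
      by rewrite lerDl.
    by rewrite lef_pV2 ?posrE ?wt_gt0// ?ltr_pwDl// lerDl ltW.
  - have [_ h] := bK (- z) t t0; rewrite normrN in h.
    apply: (le_trans h); apply: ler_pM => //; rewrite ?invr_ge0 ?(ltW (wt_gt0 _ _))//.
      by rewrite lerDl.
    by rewrite lef_pV2 ?posrE ?wt_gt0// ?ltr_pwDl// lerDl ltW.
  - apply: (le_trans (lip t z (- z) t0)); rewrite (_ : z - - z = 2 * z); last by ring.
    by rewrite normrM ger0_norm// mulrCA mulrA ler_wpM2r// ler_pM2l// lerDr.
have [|||||_ H] := @Rint_dct_right R F (fun z => (2 * pi)^-1 * ((Y0 z - Y0 (- z)) / z))
    (fun z => 2^-1 * (pi^-1 * (4 * (K + L) * rk 1 z))) 1.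
- move=> t _; apply: measurable_funM => //; apply: measurable_funM; first exact: mQ.
  apply: measurable_funB; first exact: mYt.
  exact: (measurableT_comp (mYt t)).
- by [].
- by apply: integZ; apply: integZ; apply: integZ; exact: (@integ_rk1 R).1.
- by move=> t z /andP[t0 _]; exact: bF.
- move=> z; have [z0|z0] := eqVneq z 0.
    have e0 : F^~ 0 = fun=> 0 by apply/funext => t; rewrite /F /Qk mulr0 !mul0r mulr0.
    by rewrite z0 e0 invr0 !mulr0; exact: cvg_cst.
  have ez : (2 * pi)^-1 * ((Y0 z - Y0 (- z)) / z) = 2^-1 * (pi^-1 / z * (Y0 z - Y0 (- z))).
    by have := pi_gt0 R; move: pi (Y0 z - _) => c d c0; have cn := lt0r_neq0 c0; field; rewrite ?cn ?z0.
  rewrite ez /F; apply: cvgM; first exact: cvg_cst.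
  by apply: cvgM; [exact: Qk_lim|apply: cvgB; exact: lY].
apply: cvg_trans H; apply: near_eq_cvg; near=> t; rewrite E//; near: t.
Unshelve. all: by end_near. Qed.

(** The bound of [green_level] does not depend on the height, so the lower edge may be sent to the
    boundary. *)
Lemma green_origin :
  (`|X0 0 - \I (fun z => (2 * pi)^-1 * ((Y0 z - Y0 (- z)) / z))|%:E <=
   \int[mu]_z \int[mu]_(t in `]0%R, +oo[) (Pk t z * `|Xt z t + Yz z t|)%:E)%E.
Proof.
have lim : `|\I (fun z => Pk t z * X z t) - \I (fun z => Qk t z * Y z t)| @[t --> 0^'+] -->
    `|X0 0 - \I (fun z => (2 * pi)^-1 * ((Y0 z - Y0 (- z)) / z))|.
  by apply: cvg_norm; apply: cvgB; [exact: lim_Pk|exact: lim_Qk].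
rewrite -/J; have [->|Jfin] := eqVneq J +oo%E; first by rewrite leey.
have J0 : (0 <= J)%E.
  apply: integral_ge0 => z _; apply: integral_ge0 => s; rewrite /= in_itv/= andbT => s0.
  by rewrite lee_fin mulr_ge0// ltW// Pk_gt0.
have [j Ej] : exists j, J = j%:E.
  by exists (fine J); rewrite fineK// ge0_fin_numE// ltey.
rewrite Ej lee_fin; apply: (ler_cvg_to lim (cvg_cst j)).
near=> t; have t0 : 0 < t by near: t; exact: nbhs_right_gt.
have := green_level t0; rewrite Ej lee_fin; apply: le_trans.
by rewrite (RintB (integ_PX t0) (integ_QY t0)).
Unshelve. all: by end_near. Qed.

End green_half_plane.

Section green_apply.
Context {R : realType}.
Local Notation mu := (@lebesgue_measure R).

(* Green's identity on the half-plane against (P_t, Q_t): if X + iY were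
   conjugate up to the sign in CR, then X0 = H Y0, and the defect X_t - Y_y
   measures the error. *)
Lemma green (X Xt Xy Y Yt Yy : R -> R -> R) (X0 Y0 : R -> R) (x : R) :
  ext X Xt Xy X0 -> ext Y Yt Yy Y0 ->
  (forall y t, 0 < t -> Yt y t = - Xy y t) ->
  (`|X0 x - Hn Y0 x|%:E <=
   \int[mu]_z \int[mu]_(t in `]0%R, +oo[)
     (Pk t z * `|Xt (x - z) t - Yy (x - z) t|)%:E)%E.
Proof.
move=> eX eY CR; have eX' := ext_reflect x eX; have eY' := ext_reflect x eY.
have := green_origin eX' eY' (fun z t t0 => CR (x - z) t t0).
rewrite subr0 (_ : Rintegral _ _ _ = Hn Y0 x)//.
by apply: eq_Rintegral => z _; rewrite /hq opprK.
Qed.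
End green_apply.

(** * The commutators *)

Section commutators.
Context {R : realType}.
Local Notation mu := (@lebesgue_measure R).
Local Notation "\I f" := (Rintegral mu setT f) (at level 10).
Implicit Types (a f g u w : R -> R) (s t x y z r K : R).

(** Serves to see that x a(x) is again a test function, in the proof that Q_t convolved with a
    decays. *)
Lemma smooth_id : smooth (fun x : R => x).
Proof.
pose P (h : R -> R) := exists c d : R, h = fun x => c * x + d.
apply: (@smooth_ind R P); last first.
  by exists 1, 0; apply/funext => x; rewrite mul1r addr0.
move=> h [c [d ->]].
have D (x : R) : is_derive x 1 (fun x : R => c * x + d) c.
  by apply: is_derive_eq; rewrite /GRing.scale /=; ring.
split; first by move=> x; case: (D x).
by rewrite (is_derive_derive1 D); exists 0, c; apply/funext => x; rewrite mul0r add0r.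
Qed.

Lemma integ_QkM a t x : 0 < t -> integ a -> integ (fun y => Qk t (x - y) * a y).
Proof.
move=> t0 ia; apply: (integ_le _ (integZ (pi^-1 / t) (integ_norm ia))).
  apply: measurable_funM; last exact: integ_measurable ia.
  by apply: measurable_Qkc => //; exact: measurable_funB.
by move=> y; rewrite normrM ler_wpM2r//; exact: (Pk_Qk_le _ t0).2.
Qed.

Lemma smooth_cpt_nice f : smooth_cpt f -> nice f.
Proof. by move=> sf; exact: ext_nice (ext_Pk sf). Qed.

Lemma cv_Qk_half a t x : 0 < t -> smooth_cpt a ->
  cv (Qk t) a x = \I (fun z => 2^-1 * (Qk t z * (a (x - z) - a (x + z)))).
Proof.
move=> t0 sa; have ia := smooth_cpt_integ sa; have i0 := integ_QkM x t0 ia.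
rewrite (cv_shift i0).
have i1 : integ (fun z => Qk t z * a (x - z)).
  have := integ_affine (- x) ltr01 (integ_refl i0); congr (_.-integrable _ _).
  apply/funext => z /=; have e1 : x - - (1 * z - x) = z by ring.
  have e2 : - (1 * z - x) = x - z by ring.
  by rewrite e1 e2.
have i2 := integ_refl i1; have E := Rint_refl i1.
transitivity (2^-1 * (\I (fun z => Qk t z * a (x - z)) + \I (fun z => Qk t (- z) * a (x - - z)))).
  have half (m : R) : 2^-1 * (m + m) = m by field.
  by rewrite E half.
rewrite -(RintD i1 i2) -(RintZ _ (integD i1 i2)); apply: eq_Rintegral => z _.
by rewrite /Qk /rk sqrrN opprK; ring.
Qed.

(** Q_t is not integrable uniformly in t. In the symmetrised form the part |z| <= 1 is controlled by
    the Lipschitz constant of a and the part |z| > 1 by its L^1 norm. *)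
Lemma cv_Qk_bound a : smooth_cpt a -> exists2 B : R, 0 <= B &
  forall t x, 0 < t -> `|cv (Qk t) a x| <= B.
Proof.
move=> sa; have ia := smooth_cpt_integ sa; have [ma [K K0 bK]] := smooth_cpt_nice sa.
pose I := \I (fun y => `|a y|); have I0 : 0 <= I by apply: Rintegral_ge0.
have p0 := @ipi_gt0 R.
have p1 : pi^-1 <= 1 :> R by rewrite invf_le1 ?pi_gt0//; have := pi_ge2 R; lra.
pose D := \I (fun z => K * \1_(`[- 1, 1]%classic) z).
exists (D + (I + I)).
  rewrite addr_ge0 ?addr_ge0//; apply: Rintegral_ge0 => z _.
  by rewrite mulr_ge0// indicE; case: (_ \in _).
move=> t x t0; rewrite (cv_Qk_half x t0 sa).
have iD : integ (fun z => K * \1_(`[- 1, 1]%classic) z) by apply: integZ; exact: integ_indic_itv.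
have iN := integ_norm ia.
have j1 : integ (fun z => `|a (x - z)|).
  have := integ_refl (integ_affine x ltr01 iN); congr (_.-integrable _ _).
  by apply/funext => z /=; rewrite mul1r addrC.
have j2 : integ (fun z => `|a (x + z)|).
  have := integ_affine x ltr01 iN; congr (_.-integrable _ _).
  by apply/funext => z /=; rewrite mul1r addrC.
have E2 : \I (fun z => `|a (x + z)|) = I.
  have h := Rint_affine x ltr01 iN; rewrite invr1 mul1r in h; rewrite /I -h.
  by apply: eq_Rintegral => z _; rewrite mul1r addrC.
have E1 : \I (fun z => `|a (x - z)|) = I.
  rewrite -E2 -(Rint_refl j2); exact: eq_Rintegral.
rewrite -{1}E1 -E2 -(RintD j1 j2) -(RintD iD (integD j1 j2)).
apply: Rint_abs_le; [|exact: integD iD (integD j1 j2)|].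
  apply: measurable_funM => //; apply: measurable_funM; first exact: measurable_Qkc.
  apply: measurable_funB; apply: (measurableT_comp ma).
    exact: measurable_funB.
  exact: measurable_funD.
move=> z; rewrite normrM ger0_norm// normrM indicE mem_setE in_itv/= -ler_norml.
have q0 := norm_Qk_le z t0.
have d1 := ler_normB (a (x - z)) (a (x + z)).
have d2 : `|a (x - z) - a (x + z)| <= 2 * K * `|z|.
  have [_ /(_ (x + z))] := bK (x - z).
  by rewrite (_ : x - z - (x + z) = - (2 * z)); [rewrite normrN normrM ger0_norm// mulrCA mulrA|ring].
have n1 := normr_ge0 (a (x - z)); have n2 := normr_ge0 (a (x + z)).
have n3 := normr_ge0 (a (x - z) - a (x + z)); have n4 := normr_ge0 (Qk t z).
have [z1|z1] := leP `|z| 1.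
  have h : `|Qk t z| * `|a (x - z) - a (x + z)| <= 2 * K.
    have [->|z0] := eqVneq z 0; first by rewrite /Qk mulr0 mul0r normr0 mul0r mulr_ge0.
    apply: (@le_trans _ _ (`|z^-1| * (2 * K * `|z|))).
      apply: ler_pM => //; apply: (le_trans q0); rewrite ler_piMl//.
    by rewrite normfV mulrCA mulVf ?mulr1// normr_eq0.
  rewrite mulr1; lra.
have h : `|Qk t z| * `|a (x - z) - a (x + z)| <= 1 * (`|a (x - z)| + `|a (x + z)|).
  apply: ler_pM => //; apply: (le_trans q0); rewrite mulr_ile1 ?(ltW p0)//.
  by rewrite normfV invf_le1 ?ltW// (lt_trans ltr01).
by rewrite mulr0; lra.
Qed.

(** The weight t is absorbed by t |Q_t| <= 1 / pi. The weight y is commuted through the convolution: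
    this leaves the kernel (y - z) Q_t(y - z), bounded by 1 / pi, and Q_t convolved with z a(z), to
    which the uniform bound applies. *)
Lemma cv_Qk_decay a : smooth_cpt a -> exists2 K : R, 0 <= K &
  forall y t, 0 < t -> `|cv (Qk t) a y| <= K / (1 + `|y| + t).
Proof.
move=> sa; have ia := smooth_cpt_integ sa; have sxa := smooth_cptM sa smooth_id.
have [B B0 bB] := cv_Qk_bound sa; have [B' B'0 bB'] := cv_Qk_bound sxa.
pose I := \I (fun y => `|a y|); have I0 : 0 <= I by apply: Rintegral_ge0.
have p0 := @ipi_gt0 R.
have p1 : pi^-1 <= 1 :> R by rewrite invf_le1 ?pi_gt0//; have := pi_ge2 R; lra.
exists (B + (I + B') + I); first by rewrite !addr_ge0.
move=> y t t0; rewrite ler_pdivlMr ?wt_gt0//.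
have iQ := integ_QkM y t0 ia; have iQ' := integ_QkM y t0 (smooth_cpt_integ sxa).
have h1 : `|cv (Qk t) a y| * t <= I.
  rewrite -ler_pdivlMr//; apply: (@le_trans _ _ (\I (fun z => t^-1 * `|a z|))); last first.
    by rewrite (RintZ _ (integ_norm ia)) mulrC.
  apply: Rint_abs_le; [exact: integ_measurable iQ|by apply: integZ; exact: integ_norm|] => z.
  rewrite normrM ler_wpM2r//; apply: (le_trans (Pk_Qk_le _ t0).2).
  by rewrite ler_piMl// invr_ge0 ltW.
have h2 : `|cv (Qk t) a y| * `|y| <= I + B'.
  rewrite -normrM mulrC.
  have -> : y * cv (Qk t) a y = \I (fun z => (y - z) * Qk t (y - z) * a z) +
      cv (Qk t) (fun z => a z * z) y.
    have iE : integ (fun z => (y - z) * Qk t (y - z) * a z).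
      have := integB (integZ y iQ) iQ'; congr (_.-integrable _ _).
      by apply/funext => z /=; congr (_%:E); ring.
    rewrite -(RintZ _ iQ) -(RintD iE iQ'); apply: eq_Rintegral => z _; ring.
  apply: (le_trans (ler_normD _ _)); apply: lerD; last exact: bB'.
  apply: Rint_abs_le; [|exact: integ_norm|].
    apply: measurable_funM; last exact: integ_measurable ia.
    apply: measurable_funM; first exact: measurable_funB.
    by apply: measurable_Qkc => //; exact: measurable_funB.
  move=> z; rewrite normrM ler_piMl//.
  rewrite (_ : _ * _ = pi^-1 * ((y - z) ^+ 2 * rk t (y - z))); last by rewrite /Qk; ring.
  have /andP[r0 r1] := rk_sq_le (y - z) t0.
  rewrite ger0_norm; last exact: mulr_ge0 (ltW p0) r0.
  exact: mulr_ile1 (ltW p0) r0 p1 r1.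
have := bB t y t0; rewrite mulrDr mulrDr mulr1; lra.
Qed.

(** The conjugate Poisson integral is the harmonic extension of H a. It provides an extension for a
    boundary value without compact support, which is what applying H a second time requires. *)
Lemma ext_Qk a : smooth_cpt a -> ext (fun y t => cv (Qk t) a y)
  (fun y t => cv (Pk t) (derive1 a) y) (fun y t => cv (Pk t) (fraclap 1 a) y) (Hn a).
Proof.
move=> sa; have ia := smooth_cpt_integ sa; have sa' := smooth_cpt_derive sa.
have ba := smooth_cpt_bmeas sa; have [K K0 bK] := cv_Qk_decay sa.
have dy y t : 0 < t -> is_derive y 1 (fun y => cv (Qk t) a y) (cv (Pk t) (fraclap 1 a) y).
  move=> t0; rewrite -[cv (Pk t) _ y]opprK -(cv_Ck_fraclap y t0 sa) -(cvN (integ_CkM ba y t0)).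
  apply: (@is_derive_cv _ (Qk t) (fun z => - Ck t z) a pi^-1 t y t0) => //.
  - by move=> z; exact: is_derive_Qkz.
  - by move=> z; rewrite normrN; exact: norm_Ck_le.
  - by move=> x; exact: integ_QkM.
have dt y t : 0 < t -> is_derive t 1 (fun t => cv (Qk t) a y) (cv (Pk t) (derive1 a) y).
  move=> t0; rewrite -(cv_Ak_smooth y t0 sa).
  apply: (@is_derive_cvt _ (fun t => Qk t) (fun t => Ak t) a (4 * pi^-1) t y t0) => //.
  - by move=> s z; exact: is_derive_Qkt.
  - move=> s z ts; have s0 : 0 < s by lra.
    apply: (le_trans (norm_Ak_le _ s0)); rewrite [leRHS](_ : _ = pi^-1 * (4 * rk t z)).
      by apply: ler_wpM2l; [exact: ltW (@ipi_gt0 R)|exact: rk_t_le].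
    by rewrite mulrCA mulrA.
  - by move=> s s0; exact: integ_QkM.
split; [split|split; [exact: dt|exact: dy| |]].
- split.
  + by apply: measurable_cv2; [exact: measurable_Qkc|case: ba].
  + by move=> y t t0; exact: derive_cont (dt y t t0).
  + by move=> y t t0; exact: derive_cont (dy y t t0).
  + exists K => // y t t0; apply: (le_trans (bK y t t0)); rewrite ler_piMr// invf_le1 ?wt_gt0//.
    by have := normr_ge0 y; lra.
- exact: reg_Pk (smooth_cpt_bmeas sa').
- apply: reg_Pk; exact: bmeas_fraclap.
- by exists K.
- move=> x; have na := smooth_cpt_nice sa; have [ma _] := na; have [L L0 bL] := hq_bound na.
  have [|||||_ H] := @Rint_dct_right R (fun t z => 2^-1 * (Qk t z * (a (x - z) - a (x + z)))) (hq a x)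
    (fun z => L * (1 + `|x|) * rk 1 z) 1.
  + move=> t _; apply: measurable_funM => //; apply: measurable_funM; first exact: measurable_Qkc.
    apply: measurable_funB; apply: (measurableT_comp ma).
      exact: measurable_funB.
    exact: measurable_funD.
  + by [].
  + by apply: integZ; exact: (@integ_rk1 R).1.
  + move=> t z /andP[t0 _]; have p0 := @ipi_gt0 R.
    have p1 : pi^-1 <= 1 :> R by rewrite invf_le1 ?pi_gt0//; have := pi_ge2 R; lra.
    apply: le_trans (bL x z); rewrite normrM ger0_norm// normrM [leRHS]normrM.
    have q : `|Qk t z| <= `|z^-1| by apply: (le_trans (norm_Qk_le z t0)); rewrite ler_piMl.
    apply: (@le_trans _ _ (`|Qk t z| * `|a (x - z) - a (x + z)|)).
      by apply: ler_piMl; [rewrite mulr_ge0|lra].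
    by rewrite mulrC ler_wpM2l.
  + move=> z; have [->|z0] := eqVneq z 0.
      rewrite (_ : (fun t => _) = fun=> 0); last first.
        by apply/funext => t; rewrite /Qk mulr0 !mul0r mulr0.
      by rewrite /hq invr0 !mulr0; exact: cvg_cst.
    rewrite (_ : hq a x z = 2^-1 * (pi^-1 / z * (a (x - z) - a (x + z)))).
      by apply: cvgM; [exact: cvg_cst|apply: cvgM; [exact: Qk_lim|exact: cvg_cst]].
    have := pi_gt0 R; rewrite /hq; move: pi (a _ - a _) => c d c0.
    by have cn := lt0r_neq0 c0; field; rewrite ?cn ?z0.
  apply: cvg_trans H; apply: near_eq_cvg; near=> t.
  by rewrite (cv_Qk_half x _ sa).
Unshelve. all: by end_near. Qed.

(** With vanishing defect the inequality of [green] becomes an identity. The rules of calculation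
    for H below come from this, with no Fourier representation of H. *)
Lemma green_conj (X Xt Xy Y Yt Yy : R -> R -> R) (X0 Y0 : R -> R) x :
  ext X Xt Xy X0 -> ext Y Yt Yy Y0 ->
  (forall y t, 0 < t -> Yt y t = - Xy y t) -> (forall y t, 0 < t -> Xt y t = Yy y t) ->
  X0 x = Hn Y0 x.
Proof.
move=> eX eY CR S0; have := green x eX eY CR.
rewrite integral0_eq; last first.
  move=> z _; apply: integral0_eq => t; rewrite /= in_itv/= andbT => t0.
  by rewrite (S0 _ _ t0) subrr normr0 mulr0.
by rewrite lee_fin normr_le0 subr_eq0 => /eqP.
Qed.

Lemma Hn_fraclap1 f x : smooth_cpt f -> Hn (fraclap 1 f) x = - derive1 f x.
Proof.
move=> sf; have sf' := smooth_cpt_derive sf; have e := ext_PkL sf.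
rewrite (green_conj x (ext_Pk sf') (extN e)) ?HnN ?opprK//.
exact: ext_nice e.
Qed.

Lemma Hn_Hn f x : smooth_cpt f -> Hn (Hn f) x = - f x.
Proof.
move=> sf; have e := ext_Qk sf.
rewrite (green_conj x (ext_Pk sf) (extN e)) ?HnN ?opprK//.
exact: ext_nice e.
Qed.

(** Since H (-Delta)^(1/2) f = - f', the second half of the commutator is local. *)
Lemma commHE phi f x : smooth_cpt phi -> smooth_cpt f ->
  commH phi (fraclap 1 f) x = Hn (fun y => phi y * fraclap 1 f y) x + phi x * derive1 f x.
Proof.
move=> sp sf; have n1 := smooth_cpt_nice (smooth_cptM sp (smooth_fraclap1 sf)).
rewrite /commH (hilbertE x n1) (hilbertE x (ext_nice (ext_PkL sf))) (Hn_fraclap1 x sf).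
by rewrite mulrN opprK.
Qed.

Lemma measurable_Hn u : measurable_fun setT u -> measurable_fun setT (Hn u).
Proof.
move=> mu_; apply: (@measurable_Rint_param R _ _ (fun z : R * R => hq u z.1 z.2)).
apply: measurable_funM => //; apply: measurable_funM.
  apply: measurable_funB; apply: (measurableT_comp mu_).
    exact: measurable_funB.
  exact: measurable_funD.
exact: (measurableT_comp (@measurable_invr R)).
Qed.

(** Integrating in x first, translation invariance removes z, and then P_t has mass 1. Inside the
    proof |P_t| replaces P_t to keep integrands nonnegative for t <= 0 too. *)
Lemma poisson_average (G : R -> R -> R) :
  measurable_fun setT (fun z : R * R => G z.1 z.2) -> (forall x t, 0 <= G x t) ->
  (\int[mu]_x \int[mu]_z \int[mu]_(t in `]0%R, +oo[) (Pk t z * G (x - z) t)%:E =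
   \int[mu]_x \int[mu]_(t in `]0%R, +oo[) (G x t)%:E)%E.
Proof.
move=> mG G0; pose B : set R := `]0%R, +oo[%classic.
have mB : measurable B by exact: measurable_itv.
have mPk2 : measurable_fun setT (fun z : R * R => `|Pk z.1 z.2|).
  by apply: measurableT_comp => //; exact: measurable_Pkc.
pose H x z t : \bar R := (`|Pk t z| * G (x - z) t)%:E.
have H0 x z t : (0 <= H x z t)%E by rewrite lee_fin mulr_ge0.
have mH : measurable_fun setT (fun w : (R * R) * R => H w.1.1 w.2 w.1.2).
  apply: measurable_EF; apply: measurable_funM.
    apply: measurableT_comp => //; apply: measurable_Pkc => //.
    exact: (measurableT_comp measurable_snd measurable_fst).
  have m1 : measurable_fun setT (fun w : (R * R) * R => (w.1.1 - w.2, w.1.2)).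
    apply: measurable_fun_pair.
      by apply: measurable_funB => //; exact: (measurableT_comp measurable_fst measurable_fst).
    exact: (measurableT_comp measurable_snd measurable_fst).
  exact: (measurableT_comp mG m1).
have mHx x : measurable_fun setT (fun w : R * R => H x w.1 w.2).
  have m1 : measurable_fun setT (fun w : R * R => ((x, w.2), w.1)).
    by apply: measurable_fun_pair => //; apply: measurable_fun_pair.
  exact: (measurableT_comp mH m1).
have mHt t : measurable_fun setT (fun w : R * R => H w.1 w.2 t).
  have m1 : measurable_fun setT (fun w : R * R => ((w.1, t), w.2)).
    by apply: measurable_fun_pair => //; apply: measurable_fun_pair.
  exact: (measurableT_comp mH m1).
have mGE : measurable_fun setT (fun z : R * R => (G z.1 z.2)%:E) by exact: measurable_EF.
have GE0 x t : (0 <= (G x t)%:E)%E by rewrite lee_fin.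
transitivity (\int[mu]_x \int[mu]_(t in B) \int[mu]_z H x z t)%E.
  apply: eq_integral => x _.
  rewrite -(@tonelli_in _ setT B (fun z t => H x z t) measurableT mB (mHx x) (H0 x)).
  apply: eq_integral => z _; apply: eq_integral => t; rewrite inE /B/= in_itv/= andbT => t0.
  by rewrite /H (gtr0_norm (Pk_gt0 z t0)).
rewrite (@tonelli_in _ setT B (fun x t => \int[mu]_z H x z t)%E measurableT mB); last 2 first.
- by apply: (@measurable_ei1 _ _ _ (fun (w : R * R) z => H w.1 z w.2)).
- by move=> x t; apply: integral_ge0.
rewrite (@tonelli_in _ setT B (fun x t => (G x t)%:E) measurableT mB mGE GE0).
apply: eq_integral => t; rewrite inE /B/= in_itv/= andbT => t0.
rewrite (@tonelli_in _ setT setT (fun x z => H x z t) measurableT measurableT (mHt t)); last first.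
  by move=> x z; exact: H0.
have mGt : measurable_fun setT (fun x => (G x t)%:E).
  exact: (@measurable_sec2 _ _ _ _ _ _ (fun z : R * R => (G z.1 z.2)%:E) t mGE).
have e z : (\int[mu]_x H x z t = (\int[mu]_x (G x t)%:E) * `|Pk t z|%:E)%E.
  rewrite -(@ge0_integral_shift R (fun x => (G x t)%:E) (- z)) //.
  rewrite muleC -(@eiZ R (`|Pk t z|%:E) (fun x => (G (x - z) t)%:E))//.
  by apply: (measurableT_comp mGt); exact: measurable_funB.
under eq_integral do rewrite e.
rewrite (@eiZ R (\int[mu]_x (G x t)%:E) (fun z => `|Pk t z|%:E))//.
- have i1 := integ_Pk t0; rewrite -(Rint_EFin (integ_norm i1)).
  rewrite (_ : Rintegral _ _ _ = 1) ?mule1//.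
  have [_ E1] := integ_Pk_shift 0 t0; rewrite -E1; apply: eq_Rintegral => z _.
  by rewrite sub0r PkN (gtr0_norm (Pk_gt0 z t0)).
- exact: (@measurable_EF _ _ _ (fun z => `|Pk t z|) (measurable_sec1 t mPk2)).
- exact: integral_ge0.
Qed.

Lemma measurable_half d (T : measurableType d) (F : T -> R -> \bar R) :
  measurable_fun setT (fun z : T * R => F z.1 z.2) -> (forall p t, (0 <= F p t)%E) ->
  measurable_fun setT (fun p => \int[mu]_(t in `]0%R, +oo[) F p t)%E.
Proof.
move=> mF F0; rewrite (_ : (fun p => _) =
    (fun p => \int[mu]_t ((\1_(`]0%R, +oo[%classic) t)%:E * F p t))%E); last first.
  by apply/funext => p; rewrite integral_in_indic.
apply: measurable_ei1; last by move=> p t; apply: mule_ge0 => //; rewrite lee_fin.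
by apply: emeasurable_funM => //; apply: measurable_EF; exact: measurable_indicc.
Qed.

Lemma measurable_TTNN s g : bmeas g ->
  measurable_fun setT (fun z : R * R => TT s (NN g z.1) z.2).
Proof.
move=> bg; apply: (@measurable_TT _ _ _ s (fun z : R * R => NN g z.1) snd) => //.
- have mp : measurable_fun setT (fun z : (R * R) * R => (z.1.1, z.2)).
    apply: measurable_fun_pair => //; exact: (measurableT_comp measurable_fst measurable_fst).
  exact: (measurableT_comp (measurable_NN bg) mp).
- by move=> z t; exact: NN_ge0.
Qed.

Lemma TTNN_ge0 s g x t : (0 <= TT s (NN g x) t)%E.
Proof. by apply: TT_ge0 => r; exact: NN_ge0. Qed.

Lemma half_plane_le (G W : R -> R -> \bar R) (k : \bar R) :
  measurable_fun setT (fun z : R * R => G z.1 z.2) ->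
  measurable_fun setT (fun z : R * R => W z.1 z.2) ->
  (forall x t, (0 <= G x t)%E) -> (forall x t, (0 <= W x t)%E) -> (0 <= k)%E ->
  (forall x t, 0 < t -> (G x t <= k * W x t)%E) ->
  (\int[mu]_x \int[mu]_(t in `]0%R, +oo[) G x t <=
   k * \int[mu]_x \int[mu]_(t in `]0%R, +oo[) W x t)%E.
Proof.
move=> mG mW G0 W0 k0 GW.
have mB : measurable (`]0%R, +oo[%classic : set R) by exact: measurable_itv.
have mIW := measurable_half mW W0.
rewrite -eiZ//; last by move=> x; exact: integral_ge0.
apply: lei.
- exact: measurable_half.
- exact: measurable_funeM.
- by move=> x; exact: integral_ge0.
move=> x; have mWx := measurable_sec1 x mW; have mGx := measurable_sec1 x mG.
rewrite -ge0_integralZl//; last exact: measurable_funTS.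
apply: ge0_le_integral => //.
- exact: measurable_funTS.
- by apply: measurable_funTS; exact: measurable_funeM.
- by move=> t; rewrite /= in_itv/= andbT; exact: GW.
Qed.

Lemma prod_le2 (x y k l : R) (S T : \bar R) : 0 <= x -> 0 <= y ->
  (x%:E <= k%:E * S -> y%:E <= l%:E * T ->
   (2 * (x * y))%:E <= (2 * (k * l))%:E * (S * T))%E.
Proof.
move=> x0 y0 h1 h2.
rewrite (EFinM 2 (x * y)) (EFinM 2 (k * l)) (EFinM x y) (EFinM k l) -muleA.
by apply: lee_wpmul2l; [rewrite lee_fin|rewrite muleACA; apply: lee_pmul; rewrite ?lee_fin].
Qed.

(** [green] at every x, integrated in x: [poisson_average] removes the kernel and [gamma_NN] turns
    both gradients into superpositions. The constant collects the 2 of the hypothesis and the two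
    constants of [gamma_NN]. *)
Lemma L1_bound (s1 s2 : R) (phi f : R -> R) (X Xt Xy Y Yt Yy : R -> R -> R) (X0 Y0 : R -> R) :
  0 < s1 -> s1 < 1 -> 0 < s2 -> s2 < 1 -> smooth_cpt phi -> smooth_cpt f ->
  ext X Xt Xy X0 -> ext Y Yt Yy Y0 ->
  (forall y t, 0 < t -> Yt y t = - Xy y t) ->
  (forall y t, 0 < t -> `|Xt y t - Yy y t| <= 2 * (NN phi y t * NN f y t)) ->
  (L1norm (fun x => X0 x - Hn Y0 x)%R <=
   (2 * (2 * (cg s1)^-1 * (2 * (cg s2)^-1)))%:E * BB s1 s2 (fraclap s1 phi) (fraclap s2 f))%E.
Proof.
move=> s10 s11 s20 s21 sp sf eX eY CR bS.
have c1 := cg_gt0 s10 s11; have c2 := cg_gt0 s20 s21.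
pose B : set R := `]0%R, +oo[%classic.
have mB : measurable B by exact: measurable_itv.
have Bt t : B t -> 0 < t by rewrite /B/= in_itv/= andbT.
have bp := smooth_cpt_bmeas sp; have bf := smooth_cpt_bmeas sf.
pose G y t := 2 * (NN phi y t * NN f y t).
have G0 y t : 0 <= G y t by rewrite mulr_ge0// mulr_ge0// NN_ge0.
have mG : measurable_fun setT (fun z : R * R => G z.1 z.2).
  by apply: measurable_funM => //; apply: measurable_funM; exact: measurable_NN.
have [mX0 _] := ext_nice eX; have [mY0 _] := ext_nice eY.
apply: (@le_trans _ _ (\int[mu]_x \int[mu]_z \int[mu]_(t in B) (Pk t z * G (x - z) t)%:E)%E).
  rewrite [leRHS](_ : _ = \int[mu]_x \int[mu]_z \int[mu]_(t in B)
      (`|Pk t z| * G (x - z) t)%:E)%E; last first.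
    apply: eq_integral => x _; apply: eq_integral => z _; apply: eq_integral => t.
    by rewrite inE => /Bt t0; rewrite (gtr0_norm (Pk_gt0 z t0)).
  have H0 x z t : (0 <= (`|Pk t z| * G (x - z) t)%:E)%E by rewrite lee_fin mulr_ge0.
  apply: lei.
  - apply: measurable_EF; apply: measurableT_comp => //; apply: measurable_funB => //.
    exact: measurable_Hn.
  - apply: measurable_ei1; last by move=> x z; apply: integral_ge0.
    apply: (@measurable_half _ _ (fun (w : R * R) t => (`|Pk t w.2| * G (w.1 - w.2) t)%:E)).
      apply: measurable_EF; apply: measurable_funM.
        apply: measurableT_comp => //; apply: measurable_Pkc => //.
        exact: (measurableT_comp measurable_snd measurable_fst).
      have m1 : measurable_fun setT (fun w : (R * R) * R => (w.1.1 - w.1.2, w.2)).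
        apply: measurable_fun_pair => //; apply: measurable_funB.
          exact: (measurableT_comp measurable_fst measurable_fst).
        exact: (measurableT_comp measurable_snd measurable_fst).
      exact: (measurableT_comp mG m1).
    by move=> w t; exact: H0.
  - by move=> x; rewrite lee_fin.
  - move=> x; apply: (le_trans (green x eX eY CR)).
    have mS : measurable_fun setT (fun z : R * R => `|Xt z.1 z.2 - Yy z.1 z.2|).
      have [[_ [mXt _ _ _] _] _] := eX; have [[_ _ [mYy _ _ _]] _] := eY.
      by apply: measurableT_comp => //; exact: measurable_funB.
    have mPS (S : R -> R -> R) : measurable_fun setT (fun z : R * R => S z.1 z.2) ->
        measurable_fun setT (fun w : R * R => (`|Pk w.2 w.1| * S (x - w.1) w.2)%:E).
      move=> mS'; apply: measurable_EF; apply: measurable_funM.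
        by apply: measurableT_comp => //; exact: measurable_Pkc.
      have m1 : measurable_fun setT (fun w : R * R => (x - w.1, w.2)).
        by apply: measurable_fun_pair => //; apply: measurable_funB.
      exact: (measurableT_comp mS' m1).
    rewrite [leLHS](_ : _ = \int[mu]_z \int[mu]_(t in B)
        (`|Pk t z| * `|Xt (x - z) t - Yy (x - z) t|)%:E)%E; last first.
      apply: eq_integral => z _; apply: eq_integral => t.
      by rewrite inE => /Bt t0; rewrite (gtr0_norm (Pk_gt0 z t0)).
    have m1 := mPS (fun y t => `|Xt y t - Yy y t|) mS; have m2 := mPS G mG.
    apply: lei.
    + apply: (@measurable_half _ _ (fun z t => (`|Pk t z| * `|Xt (x - z) t - Yy (x - z) t|)%:E)) => //.
    + by apply: (@measurable_half _ _ (fun z t => (`|Pk t z| * G (x - z) t)%:E)).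
    + by move=> z; apply: integral_ge0 => t _; rewrite lee_fin mulr_ge0.
    + move=> z; apply: ge0_le_integral => //.
      * by apply: measurable_funTS; exact: (measurable_sec1 z m1).
      * by apply: measurable_funTS; exact: (measurable_sec1 z m2).
      * by move=> t /Bt t0; rewrite lee_fin ler_wpM2l// bS.
rewrite (poisson_average mG G0).
set k := (2 * _)%R; have k0 : 0 <= k.
  have i1 : 0 <= 2 * (cg s1)^-1 by apply: mulr_ge0 => //; rewrite invr_ge0; exact: ltW.
  have i2 : 0 <= 2 * (cg s2)^-1 by apply: mulr_ge0 => //; rewrite invr_ge0; exact: ltW.
  by apply: (mulr_ge0 _ (mulr_ge0 i1 i2)).
have mT1 := measurable_TTNN s1 (bmeas_fraclap (ltW s10) (ltW s11) sp).
have mT2 := measurable_TTNN s2 (bmeas_fraclap (ltW s20) (ltW s21) sf).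
have mTT := emeasurable_funM mT1 mT2.
apply: (half_plane_le (measurable_EF mG) mTT).
- by move=> x t; rewrite lee_fin.
- by move=> x t; apply: mule_ge0; exact: TTNN_ge0.
- by rewrite lee_fin.
move=> x t t0; have g1 := gamma_NN x s10 s11 t0 sp; have g2 := gamma_NN x s20 s21 t0 sf.
exact: (prod_le2 (NN_ge0 _ _ _) (NN_ge0 _ _ _) g1 g2).
Qed.

Section pair.
Variables (P P1 P2 PL PL1 F F1 F2 FL FL1 : R -> R -> R) (p p1 pl f f1 fl : R -> R).
Hypotheses (eP : ext P (fun y t => - PL y t) P1 p) (eP1 : ext P1 (fun y t => - PL1 y t) P2 p1).
Hypotheses (ePL : ext PL P2 PL1 pl).
Hypotheses (eF : ext F (fun y t => - FL y t) F1 f) (eF1 : ext F1 (fun y t => - FL1 y t) F2 f1).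
Hypotheses (eFL : ext FL F2 FL1 fl).
Local Notation gradM y t := ((`|P1 y t| + `|PL y t|) * (`|F1 y t| + `|FL y t|)).

Let quad (a b c d : R) :
  `|2 * (a * d - c * b)| <= 2 * ((`|a| + `|b|) * (`|c| + `|d|)) /\
  `|2 * (b * d + a * c)| <= 2 * ((`|a| + `|b|) * (`|c| + `|d|)).
Proof.
have e : (`|a| + `|b|) * (`|c| + `|d|) =
  `|a * c| + `|a * d| + `|c * b| + `|b * d| by rewrite !normrM; ring.
have h1 := normr_ge0 (a * c); have h2 := normr_ge0 (a * d); have h3 := normr_ge0 (c * b).
have h4 := normr_ge0 (b * d); have h5 := ler_normB (a * d) (c * b).
have h6 := ler_normD (b * d) (a * c).
by rewrite normrM [X in _ /\ X <= _]normrM ger0_norm// e; split; rewrite ler_pM2l//; lra.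
Qed.

(** Second-order terms and terms in an undifferentiated extension cancel; what remains of the defect
    is, up to sign, twice the determinant of the two gradients. *)
Lemma difference_pair : exists X Xt Xy Y Yt Yy, [/\
  ext X Xt Xy (fun x => p x * f1 x - f x * p1 x),
  ext Y Yt Yy (fun x => - (p x * fl x) + f x * pl x),
  (forall y t, 0 < t -> Yt y t = - Xy y t) &
  (forall y t, 0 < t -> `|Xt y t - Yy y t| <= 2 * gradM y t)].
Proof.
have eX := extD (extM eP eF1) (extN (extM eF eP1)).
have eY := extD (extN (extM eP eFL)) (extM eF ePL).
do 6 eexists; split; [exact: eX|exact: eY| |] => y t t0 /=; first by ring.
have [h _] := quad (P1 y t) (PL y t) (F1 y t) (FL y t).
by apply: le_trans h; rewrite le_eqVlt; apply/orP; left; apply/eqP; congr (`|_|); ring.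
Qed.

(** Here the defect reduces to twice the inner product of the two gradients, half the Laplacian-type
    terms cancelling by harmonicity. *)
Lemma sum_pair : exists X Xt Xy Y Yt Yy, [/\
  ext X Xt Xy (fun x => - (pl x * f x) - p x * fl x),
  ext Y Yt Yy (fun x => - (p1 x * f x + p x * f1 x)),
  (forall y t, 0 < t -> Yt y t = - Xy y t) &
  (forall y t, 0 < t -> `|Xt y t - Yy y t| <= 2 * gradM y t)].
Proof.
have eX := extD (extN (extM ePL eF)) (extN (extM eP eFL)).
have eY := extN (extD (extM eP1 eF) (extM eP eF1)).
do 6 eexists; split; [exact: eX|exact: eY| |] => y t t0 /=; first by ring.
have [_ h] := quad (P1 y t) (PL y t) (F1 y t) (FL y t).
by apply: le_trans h; rewrite le_eqVlt; apply/orP; left; apply/eqP; congr (`|_|); ring.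
Qed.
End pair.

Section bounds.
Variables (s1 s2 : R) (phi f : R -> R).
Hypotheses (s10 : 0 < s1) (s11 : s1 < 1) (s20 : 0 < s2) (s21 : s2 < 1).
Hypotheses (sp : smooth_cpt phi) (sf : smooth_cpt f).
Let K := (2 * (2 * (cg s1)^-1 * (2 * (cg s2)^-1)))%:E.
Let sp' : smooth_cpt (derive1 phi). Proof. exact: smooth_cpt_derive. Qed.
Let sf' : smooth_cpt (derive1 f). Proof. exact: smooth_cpt_derive. Qed.

Let NNE g y t : smooth_cpt g -> 0 < t ->
  NN g y t = `|cv (Pk t) (derive1 g) y| + `|cv (Pk t) (fraclap 1 g) y|.
Proof.
move=> sg t0; rewrite /NN (cv_Ak_smooth y t0 sg) (cv_Ck_fraclap y t0 sg).
by congr (_ + _); exact: normrN.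
Qed.

Lemma commutator_difference :
  (L1norm (fun x => (commH phi (fraclap 1 f) x - commH f (fraclap 1 phi) x)%R) <=
   K * BB s1 s2 (fraclap s1 phi) (fraclap s2 f))%E.
Proof.
have [X [Xt [Xy [Y [Yt [Yy [eX eY CR bS]]]]]]] := difference_pair (ext_Pk sp) (ext_Pk sp')
  (ext_PkL sp) (ext_Pk sf) (ext_Pk sf') (ext_PkL sf).
have := L1_bound s10 s11 s20 s21 sp sf eX eY CR.
rewrite (_ : (fun x => _ - Hn _ x) = fun x => commH phi (fraclap 1 f) x - commH f (fraclap 1 phi) x).
  by apply=> y t t0; rewrite (NNE y sp t0) (NNE y sf t0); exact: bS.
have aux (b c u v : R) : b - c - (- u + v) = u + b - (v + c) by ring.
apply/funext => x; rewrite (commHE x sp sf) (commHE x sf sp).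
have n1 := smooth_cpt_nice (smooth_cptM sp (smooth_fraclap1 sf)).
have n2 := smooth_cpt_nice (smooth_cptM sf (smooth_fraclap1 sp)).
rewrite (HnD x (niceN n1) n2) (HnN x n1).
exact: aux.
Qed.

Lemma commutator_sum :
  (L1norm (hilbert (fun x => (commH phi (fraclap 1 f) x + commH f (fraclap 1 phi) x)%R)) <=
   K * BB s1 s2 (fraclap s1 phi) (fraclap s2 f))%E.
Proof.
have [X [Xt [Xy [Y [Yt [Yy [eX eY CR bS]]]]]]] := sum_pair (ext_Pk sp) (ext_Pk sp')
  (ext_PkL sp) (ext_Pk sf) (ext_Pk sf') (ext_PkL sf).
have aux1 (b c d g u v : R) : u + b * c + (v + d * g) = u + v + (g * d + b * c) by ring.
have aux2 (b c u v w : R) : - (w * b) - c * v - - u = - (c * v + b * w) + u by ring.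
(* By [commHE] the sum of the commutators is H a + e, where e is the derivative of phi f; a second
   application of H gives - a + H e because H H a = - a. *)
pose a x := phi x * fraclap 1 f x + f x * fraclap 1 phi x.
pose e x := derive1 phi x * f x + phi x * derive1 f x.
have sa1 := smooth_cptM sp (smooth_fraclap1 sf); have sa2 := smooth_cptM sf (smooth_fraclap1 sp).
have sa : smooth_cpt a := smooth_cptD sa1 sa2.
have se : smooth_cpt e.
  exact: smooth_cptD (smooth_cptM sp' (smooth_cpt_smooth sf)) (smooth_cptM sp (smooth_cpt_smooth sf')).
have nHa : nice (Hn a) := ext_nice (ext_Qk sa).
have ne := smooth_cpt_nice se.
have := L1_bound s10 s11 s20 s21 sp sf eX eY CR.
rewrite (_ : (fun x => _ - Hn _ x) = hilbert (fun x => commH phi (fraclap 1 f) x + commH f (fraclap 1 phi) x)).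
  by apply=> y t t0; rewrite (NNE y sp t0) (NNE y sf t0); exact: bS.
rewrite (_ : (fun x => commH _ _ x + _) = fun x => Hn a x + e x); last first.
  apply/funext => x; rewrite (commHE x sp sf) (commHE x sf sp).
  rewrite (HnD x (smooth_cpt_nice sa1) (smooth_cpt_nice sa2)) /e.
  exact: aux1.
apply/funext => x; rewrite (hilbertE x (niceD nHa ne)) (HnD x nHa ne) (Hn_Hn x sa).
rewrite (HnN x ne) /a; exact: aux2.
Qed.
End bounds.

End commutators.

(** * Countable decompositions *)

Section decomposition.
Context {R : realType}.
Local Notation mu := (@lebesgue_measure R).
Local Notation "\I f" := (Rintegral mu setT f) (at level 10).
Implicit Types (g h : R -> R) (s t x y z r c d : R) (E F : set R).

Definition cut (D : set R) g y : R := \1_D y * g y.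

Lemma cv_scale (k g : R -> R) c x : integ (fun y => k (x - y) * g y) ->
  cv k (fun y => c * g y) x = c * cv k g x.
Proof. by move=> i; rewrite /cv -(RintZ c i); apply: eq_Rintegral => y _; rewrite mulrCA. Qed.

Lemma NN_scale c g x t : 0 < t -> bmeas g -> 0 <= c ->
  NN (fun y => c * g y) x t = c * NN g x t.
Proof.
move=> t0 bg c0; rewrite /NN (cv_scale c (integ_AkM bg x t0)) (cv_scale c (integ_CkM bg x t0)).
by rewrite (normrM c) (normrM c) (ger0_norm c0) mulrDr.
Qed.

Lemma measurable_pwNN s g x t : bmeas g ->
  measurable_fun setT (fun r => (pw s r * NN g x (t + r))%:E).
Proof.
move=> bg; apply: measurable_EF; apply: measurable_funM; first exact: measurable_pw.
apply: (measurableT_comp (measurable_sec1 x (measurable_NN bg))).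
exact: measurable_funD.
Qed.

Lemma pwNN_ge0 s g x t r : (0 <= (pw s r * NN g x (t + r))%:E)%E.
Proof. by rewrite lee_fin; apply: mulr_ge0; [exact: pw_ge0|exact: NN_ge0]. Qed.

Lemma TT_scale s c g x t : 0 < t -> bmeas g -> 0 <= c ->
  TT s (NN (fun y => c * g y) x) t = (c%:E * TT s (NN g x) t)%E.
Proof.
move=> t0 bg c0; rewrite /TT -(eiZ (measurable_pwNN s x t bg) (pwNN_ge0 s g x t)); last by rewrite lee_fin.
apply: eq_integral => r _; rewrite -EFinM; congr (_%:E).
have [r0|r0] := leP r 0; first by rewrite (pw0 _ r0) mul0r mul0r mulr0.
by rewrite (NN_scale x (addr_gt0 t0 r0) bg c0) mulrCA.
Qed.

Lemma bmeas_scale c g : bmeas g -> bmeas (fun y => c * g y).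
Proof.
move=> [mg [B gB]]; split; first exact: measurable_funM.
by exists (`|c| * B) => y; rewrite normrM ler_wpM2l.
Qed.

Lemma BB_scale s1 s2 c d g h : bmeas g -> bmeas h -> 0 <= c -> 0 <= d ->
  (BB s1 s2 (fun y => c * g y)%R (fun y => d * h y)%R <= (c * d)%:E * BB s1 s2 g h)%E.
Proof.
move=> bg bh c0 d0; have cd : (0 <= (c * d)%:E :> \bar R)%E by rewrite lee_fin mulr_ge0.
have M s k : bmeas k -> measurable_fun setT (fun z : R * R => TT s (NN k z.1) z.2).
  exact: measurable_TTNN.
have m1 := emeasurable_funM (M s1 _ (bmeas_scale c bg)) (M s2 _ (bmeas_scale d bh)).
have m2 := emeasurable_funM (M s1 _ bg) (M s2 _ bh).
apply: (half_plane_le m1 m2) => //.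
- by move=> x t; apply: mule_ge0; exact: TTNN_ge0.
- by move=> x t; apply: mule_ge0; exact: TTNN_ge0.
- move=> x t t0; rewrite (TT_scale s1 x t0 bg c0) (TT_scale s2 x t0 bh d0).
  by rewrite muleACA -EFinM.
Qed.

Lemma BB_sym s1 s2 g h : BB s1 s2 g h = BB s2 s1 h g.
Proof. by apply: eq_integral => x _; apply: eq_integral => t _; exact: muleC. Qed.

(** Homogeneity in each argument. A height equal to 0 forces the function to vanish, and the
    convention 0^-1 = 0 keeps its normalisation harmless. *)
Lemma scaled_bound s1 s2 kp : 0 < s1 -> 0 < s2 -> s1 + s2 = 1 -> 0 < kp -> kp <= 1 / 4 ->
  exists2 C : R, 0 < C & forall E F g h (l m e f : R), measurable E -> measurable F ->
    bmeas g -> bmeas h -> 0 <= l -> 0 <= m ->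
    (forall y, `|g y| <= l * \1_E y) -> (forall y, `|h y| <= m * \1_F y) ->
    0 < e -> e <= f -> (mu E <= e%:E)%E -> (mu F <= f%:E)%E ->
    (BB s1 s2 g h <= (C * (l * m) * (e * (f / e) `^ kp))%:E)%E.
Proof.
move=> s10 s20 s12 kp0 kp1; have [C [C0 HC]] := restricted_bound s10 s20 s12 kp0 kp1.
exists C => // E F g h l m e f mE mF bg bh l0 m0 gl hm e0 ef muE muF.
have scale (k : R -> R) (w : R) (D : set R) : 0 <= w -> (forall y, `|k y| <= w * \1_D y) ->
    (forall y, `|w^-1 * k y| <= \1_D y) /\ k = (fun y => w * (w^-1 * k y)).
  move=> w0 kw; have [w00|wn0] := eqVneq w 0.
    have k0 y : k y = 0.
      by apply/eqP; rewrite -normr_le0 (le_trans (kw y))// w00 mul0r.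
    split=> [y|]; first by rewrite k0 mulr0 normr0 indicE.
    by apply/funext => y; rewrite w00 mul0r k0.
  have wp : 0 < w by rewrite lt_neqAle eq_sym wn0.
  split=> [y|]; last by apply/funext => y; rewrite mulrA divff// mul1r.
  by rewrite normrM normfV (ger0_norm w0) ler_pdivrMl.
have [g1 ge] := scale g l E l0 gl; have [h1 he] := scale h m F m0 hm.
have bg' := bmeas_scale l^-1 bg; have bh' := bmeas_scale m^-1 bh.
rewrite ge he; apply: (le_trans (BB_scale s1 s2 bg' bh' l0 m0)).
rewrite (_ : C * (l * m) * _ = l * m * (C * e * (f / e) `^ kp)); last by ring.
rewrite [X in (_ <= X)%E]EFinM; apply: lee_wpmul2l; first by rewrite lee_fin mulr_ge0.
exact: (HC E F _ _ e f mE mF bg' bh' g1 h1 e0 ef muE muF).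
Qed.

Section series.
Variables (E : nat -> set R).
Hypotheses (mE : forall i, measurable (E i)) (tE : trivIset setT E).
Let U := \bigcup_i E i.

Let indic_sum y : (forall n, \sum_(0 <= i < n) \1_(E i) y <= 1 :> R) /\
  \sum_(0 <= i < n) \1_(E i) y @[n --> \oo] --> (\1_U y : R).
Proof.
have [[j _ Ej]|nU] := pselect (U y); last first.
  have e n : \sum_(0 <= i < n) \1_(E i) y = 0 :> R.
    rewrite big1// => i _; rewrite indicE memNset//.
    by move=> Ei; apply: nU; exists i.
  split=> [n|]; first by rewrite e.
  by under eq_fun do rewrite e; rewrite indicE memNset//; exact: cvg_cst.
have e n : \sum_(0 <= i < n) \1_(E i) y = (j < n)%N%:R :> R.
  elim: n => [|n IH]; first by rewrite big_geq.
  rewrite big_nat_recr//= IH indicE.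
  have [<-|jn] := eqVneq j n; first by rewrite ltnn ltnSn mem_set// add0r.
  rewrite memNset ?addr0; first by rewrite [in RHS]ltnS [in RHS]leq_eqVlt (negbTE jn).
  by move=> En; move/eqP: jn; apply; apply: tE => //; exists y.
split=> [n|]; first by rewrite e lern1 leq_b1.
apply: cvg_near_cst; near=> n; rewrite e indicE mem_set; last by exists j.
by congr (nat_of_bool _)%:R; near: n; exact: nbhs_infty_gt.
Unshelve. all: by end_near. Qed.

(** Partial sums of disjoint indicators are at most 1, so |f| dominates them and the finite triangle
    inequality passes to the limit. *)
Lemma Rint_series (f : R -> R) : integ f ->
  (`|\I (fun y => \1_U y * f y)|%:E <= \sum_(0 <= i <oo) `|\I (fun y => \1_(E i) y * f y)|%:E)%E.
Proof.
move=> fi; have mf := integ_measurable fi.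
have ii i : integ (fun y => \1_(E i) y * f y).
  apply: (integ_le _ (integ_norm fi)).
    by apply: measurable_funM => //; exact: measurable_indic.
  by move=> y; rewrite normrM indicE; case: (_ \in _); rewrite ?normr1 ?mul1r// normr0 mul0r.
pose S n y : R := (\sum_(0 <= i < n) \1_(E i) y) * f y.
have SI n : integ (S n) /\ \I (S n) = \sum_(0 <= i < n) \I (fun y => \1_(E i) y * f y).
  elim: n => [|n [IH1 IH2]].
    rewrite (_ : S 0 = fun=> 0); last by apply/funext => y; rewrite /S big_geq// mul0r.
    rewrite Rint0 big_geq//; split => //.
    by have := integZ 0 fi; congr (_.-integrable _ _); apply/funext => y /=; rewrite mul0r.
  rewrite (_ : S n.+1 = fun y => S n y + \1_(E n) y * f y); last first.
    by apply/funext => y; rewrite /S big_nat_recr//= mulrDl.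
  by rewrite (RintD IH1 (ii n)) IH2 big_nat_recr//=; split => //; exact: integD.
have [||||_ H] := @Rint_dct R S (fun y => \1_U y * f y) (fun y => `|f y|).
- by move=> n; exact: integ_measurable (SI n).1.
- exact: integ_norm.
- move=> n y; rewrite /S normrM ler_piMl// ger0_norm; first exact: (indic_sum y).1.
  by apply: sumr_ge0 => i _; rewrite indicE.
- by move=> y; apply: cvgM; [exact: (indic_sum y).2|exact: cvg_cst].
set M : \bar R := (\sum_(0 <= i <oo) _)%E.
have M0 : (0 <= M)%E by apply: nneseries_ge0.
have [->|Mfin] := eqVneq M +oo%E; first by rewrite leey.
have [m Em] : exists m, M = m%:E.
  by exists (fine M); rewrite fineK// ge0_fin_numE// ltey.
rewrite Em lee_fin; apply: (ler_cvg_to (cvg_norm H) (cvg_cst m)).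
near=> n; rewrite (SI n).2 (le_trans (ler_norm_sum _ _ _))//.
rewrite -lee_fin -Em -sumEFin; apply: nneseries_lim_ge => i _.
by rewrite lee_fin.
Unshelve. all: by end_near. Qed.

Variable g : R -> R.
Hypothesis bg : bmeas g.

Let mU : measurable U. Proof. exact: bigcup_measurable. Qed.

Lemma bmeas_indicM D : measurable D -> bmeas (cut D g).
Proof.
move=> mD; have [mg [B gB]] := bg; split.
  by apply: measurable_funM => //; exact: measurable_indic.
exists B => y; rewrite normrM indicE; case: (_ \in _); rewrite ?normr1 ?mul1r//.
by rewrite normr0 mul0r (le_trans _ (gB y)).
Qed.

Let bE i := bmeas_indicM (mE i).
Let bU := bmeas_indicM mU.

Lemma NN_series x t : 0 < t ->
  ((NN (cut U g) x t)%:E <=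
   \sum_(0 <= i <oo) (NN (cut (E i) g) x t)%:E)%E.
Proof.
move=> t0; have key (k : R -> R) : integ (fun y => k (x - y) * g y) ->
    (`|cv k (cut U g) x|%:E <=
     \sum_(0 <= i <oo) `|cv k (cut (E i) g) x|%:E)%E.
  move=> ik; have e D : cv k (cut D g) x = \I (fun y => \1_D y * (k (x - y) * g y)).
    by apply: eq_Rintegral => y _; rewrite mulrCA.
  by rewrite e; under eq_eseriesr do rewrite e; exact: Rint_series.
have h1 := key _ (integ_AkM bg x t0); have h2 := key _ (integ_CkM bg x t0).
apply: (@le_trans _ _ (`|cv (Ak t) (cut U g) x|%:E +
   `|cv (Ck t) (cut U g) x|%:E)%E); first exact: lexx.
apply: le_trans (leeD h1 h2) _; rewrite -nneseriesD; last 2 first.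
- by move=> i _; rewrite lee_fin.
- by move=> i _; rewrite lee_fin.
exact: lexx.
Qed.

Lemma TT_series s x t : 0 < t ->
  (TT s (NN (cut U g) x) t <=
   \sum_(0 <= i <oo) TT s (NN (cut (E i) g) x) t)%E.
Proof.
move=> t0; rewrite /TT -integral_nneseries//; last 2 first.
- by move=> i; exact: (measurable_pwNN s x t (bE i)).
- by move=> i r _; exact: pwNN_ge0.
have m2 : measurable_fun setT (fun r =>
    \sum_(0 <= i <oo) (pw s r * NN (cut (E i) g) x (t + r))%:E)%E.
  apply: ge0_emeasurable_sum => [i r _ _|i _]; first exact: pwNN_ge0.
  exact: (measurable_pwNN s x t (bE i)).
apply: (lei (measurable_pwNN s x t bU) m2); first by move=> r; exact: pwNN_ge0.
move=> r; have [r0|r0] := leP r 0.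
  by rewrite (pw0 _ r0) mul0r; apply: nneseries_ge0 => i _ _; rewrite mul0r.
rewrite EFinM; under eq_eseriesr do rewrite EFinM.
rewrite nneseriesZl; last by move=> i _; rewrite lee_fin; exact: NN_ge0.
apply: lee_wpmul2l; first by rewrite lee_fin; exact: pw_ge0.
by apply: NN_series; rewrite addr_gt0.
Qed.

(** For v = +oo the right-hand side is infinite as soon as one u i is nonzero. *)
Lemma series_mul_le (u : nat -> \bar R) (v : \bar R) : (forall i, (0 <= u i)%E) -> (0 <= v)%E ->
  ((\sum_(0 <= i <oo) u i) * v <= \sum_(0 <= i <oo) (u i * v))%E.
Proof.
move=> u0; case: v => [v| |//] v0.
  by rewrite muleC -nneseriesZl//; apply: lee_nneseries => i *; rewrite ?mule_ge0// muleC.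
have [e|ne] := eqVneq (\sum_(0 <= i <oo) u i)%E 0%E.
  by rewrite e mul0e; apply: nneseries_ge0 => i _ _; rewrite mule_ge0.
have [i ui] : exists i, u i != 0%E.
  apply: contrapT => H; move/eqP: ne; apply; rewrite eseries0// => i _ _.
  by apply/eqP/negPn/negP => ui; apply: H; exists i.
rewrite (@nneseries_pinfty _ (fun i => u i * +oo)%E xpredT i)//.
- by rewrite leey.
- by move=> n _; rewrite mule_ge0.
- by rewrite gt0_muley// lt_neqAle eq_sym ui u0.
Qed.

(** The absolute values in [NN] make the form only countably subadditive, which suffices; series and
    integrals of nonnegative terms are exchanged freely. *)
Lemma BB_series s1 s2 h : bmeas h ->
  (BB s1 s2 (cut U g) h <=
   \sum_(0 <= i <oo) BB s1 s2 (cut (E i) g) h)%E.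
Proof.
move=> bh; have mh := measurable_TTNN s2 bh; have mU' := measurable_TTNN s1 bU.
have mi i := emeasurable_funM (measurable_TTNN s1 (bE i)) mh.
have i0 i x t : (0 <= TT s1 (NN (cut (E i) g) x) t * TT s2 (NN h x) t)%E.
  by apply: mule_ge0; exact: TTNN_ge0.
have mB : measurable (`]0%R, +oo[%classic : set R) by exact: measurable_itv.
have mW : measurable_fun setT (fun z : R * R => \sum_(0 <= i <oo)
    (TT s1 (NN (cut (E i) g) z.1) z.2 * TT s2 (NN h z.1) z.2))%E.
  by apply: ge0_emeasurable_sum => [i z _ _|i _]; [exact: i0|exact: mi].
have := @half_plane_le R (fun x t => TT s1 (NN (cut U g) x) t * TT s2 (NN h x) t)%E
  (fun x t => \sum_(0 <= i <oo) (TT s1 (NN (cut (E i) g) x) t * TT s2 (NN h x) t))%E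
  1%E (emeasurable_funM mU' mh) mW.
rewrite mul1e => H; apply: le_trans (H _ _ _ _) _ => //.
- by move=> x t; apply: mule_ge0; exact: TTNN_ge0.
- by move=> x t; apply: nneseries_ge0 => i _ _; exact: i0.
- move=> x t t0; rewrite mul1e; apply: le_trans (_ : _ <= (\sum_(0 <= i <oo)
     TT s1 (NN (cut (E i) g) x) t) * TT s2 (NN h x) t)%E _.
    by apply: lee_wpmul2r; [exact: TTNN_ge0|exact: TT_series].
  by apply: series_mul_le => [i|]; exact: TTNN_ge0.
rewrite le_eqVlt; apply/orP; left; apply/eqP.
rewrite -integral_nneseries//; last 2 first.
- by move=> i; apply: measurable_half; [exact: mi|exact: i0].
- by move=> i x _; apply: integral_ge0 => t _; exact: i0.
apply: eq_integral => x _; rewrite integral_nneseries//.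
by move=> i; apply: measurable_funTS; exact: (measurable_sec1 x (mi i)).
Qed.
End series.
End decomposition.

(** * Dyadic rearrangement and Lorentz norms *)

Section rearrangement.
Context {R : realType}.
Local Notation mu := (@lebesgue_measure R).
Implicit Types (g : R -> R) (s t x y L p q lam : R) (k j : int).

Definition Gr g t : R := fine (rearr g t).
(** The dyadic number 2^k for an integer k of either sign, as a real power so that it combines with
    the exponents 1/p and kappa. *)
Definition two k : R := 2 `^ k%:~R.

Lemma two_gt0 k : 0 < two k. Proof. exact: powR_gt0. Qed.

Lemma two_le k j : (k <= j)%R -> two k <= two j.
Proof. by move=> kj; apply: ler_powR; rewrite ?ler1n// ler_int. Qed.

Lemma twoS k : two (k + 1) = 2 * two k.
Proof. by rewrite /two intrD powRD ?pnatr_eq0 ?implybT// powRr1// mulrC. Qed.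

Lemma measurable_level g lam : bmeas g -> measurable [set x | lam < `|g x|].
Proof.
move=> [mg _]; rewrite (_ : [set x | _] = (fun x => `|g x|) @^-1` `]lam, +oo[%classic); last first.
  by apply/seteqP; split => z /=; rewrite in_itv/= andbT.
have mn : measurable_fun setT (fun x => `|g x|) by exact: measurableT_comp.
by rewrite -[X in measurable X]setTI; apply: mn => //; exact: measurable_itv.
Qed.

Variable g : R -> R.
Hypothesis bg : bmeas g.

Let ml lam : measurable [set x | lam < `|g x|]. Proof. exact: measurable_level. Qed.

Lemma distrib_anti (a b : R) : a <= b -> (distrib g b <= distrib g a)%E.
Proof.
move=> ab; apply: le_measure; [by rewrite inE; exact: ml|by rewrite inE; exact: ml|].
by move=> x /=; exact: le_lt_trans ab.
Qed.

Lemma rearrE t : 0 <= t -> rearr g t = (Gr g t)%:E /\ 0 <= Gr g t.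
Proof.
move=> t0; have [mg [B gB]] := bg; have B0 : 0 <= B by apply: le_trans (gB 0).
have h0 : (0 <= rearr g t)%E by apply: le_ereal_inf_tmp => _ [lam [l0 _] <-]; rewrite lee_fin.
have h1 : (rearr g t <= B%:E)%E.
  apply: ereal_inf_lbound; exists B => //; split => //.
  rewrite /distrib (_ : [set x | _] = set0) ?measure0 ?lee_fin//.
  by apply/seteqP; split => // x /=; rewrite ltNge gB.
have f : rearr g t \is a fin_num by rewrite ge0_fin_numE// (le_lt_trans h1)// ltry.
by rewrite /Gr fineK//; split => //; rewrite -lee_fin fineK.
Qed.

Lemma Gr_le t lam : 0 <= t -> 0 <= lam -> (distrib g lam <= t%:E)%E -> Gr g t <= lam.
Proof.
move=> t0 l0 h; have [e _] := rearrE t0; rewrite -lee_fin -e.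
by apply: ereal_inf_lbound; exists lam.
Qed.

(** The infimum defining the rearrangement is attained: the set where |g| exceeds [Gr g t] is the
    increasing union of those where it exceeds [Gr g t] + 1/(n+1). *)
Lemma distrib_Gr t : 0 <= t -> (distrib g (Gr g t) <= t%:E)%E.
Proof.
move=> t0; have [e G0] := rearrE t0.
pose F n := [set x | Gr g t + n.+1%:R^-1 < `|g x|].
have Fb n : (mu (F n) <= t%:E)%E.
  have : (rearr g t < (Gr g t + n.+1%:R^-1)%:E)%E by rewrite e lte_fin ltrDl invr_gt0.
  move=> /ereal_inf_lt [_ [lam [l0 hl] <-]]; rewrite lte_fin => hlt.
  by apply: le_trans hl; apply: distrib_anti; exact: ltW.
have FU : [set x | Gr g t < `|g x|] = \bigcup_n F n.
  apply/seteqP; split => [x /= h|x [n _] /=]; last first.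
    by apply: le_lt_trans; rewrite lerDl invr_ge0.
  have d0 : 0 < `|g x| - Gr g t by rewrite subr_gt0.
  exists (Num.truncn (`|g x| - Gr g t)^-1) => //; rewrite /F /=.
  rewrite addrC -ltrBrDr; apply: (@lt_le_trans _ _ ((`|g x| - Gr g t)^-1)^-1); last by rewrite invrK.
  by rewrite ltf_pV2 ?posrE ?invr_gt0// truncnS_gt.
rewrite /distrib FU.
have cv : mu \o F @ \oo --> mu (\bigcup_n F n).
  apply: nondecreasing_cvg_mu => [n| |m n mn]; first exact: ml.
    by apply: bigcup_measurable => n _; exact: ml.
  apply/subsetPset => x /=; apply: le_lt_trans.
  by rewrite lerD2l lef_pV2 ?posrE// ler_nat.
by apply: (cvge_le _ cv); near=> n; exact: Fb.
Unshelve. all: by end_near. Qed.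

Lemma Gr_anti s t : 0 <= s -> s <= t -> Gr g t <= Gr g s.
Proof.
move=> s0 st; have [_ G0] := rearrE s0; apply: Gr_le => //; first exact: le_trans st.
by apply: (le_trans (distrib_Gr s0)); rewrite lee_fin.
Qed.

(** Truncating the argument at 0 makes the function monotone on the whole line. *)
Lemma measurable_Gr : measurable_fun setT (fun t => Gr g (Num.max 0 t)).
Proof.
apply: nonincreasing_measurable => // s t st; apply: Gr_anti; first by rewrite le_max lexx.
by rewrite ge_max le_max lexx/= le_max st orbT.
Qed.

(** The Lorentz norm sampled at dyadic points: its L^q norm with respect to dt/t becomes an l^q norm
    of this sequence. *)
Definition coef p k : R := two k `^ p^-1 * Gr g (two k).

Lemma coef_ge0 p k : 0 <= coef p k.
Proof. by rewrite mulr_ge0 ?powR_ge0//; have [] := rearrE (ltW (two_gt0 k)). Qed.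

Lemma lorentz_ge0 p (q : \bar R) : (0 <= lorentz p q g)%E.
Proof.
case: q => [q| |] //=; first exact: poweR_ge0.
apply: (@le_trans _ _ ((1 `^ p^-1)%:E * rearr g 1)%E).
  by have [-> G0] := rearrE (@ler01 R); rewrite -EFinM lee_fin mulr_ge0// powR_ge0.
by apply: ereal_sup_ubound; exists 1; rewrite //= in_itv/= andbT.
Qed.

(** On ]2^(k-1), 2^k] the integrand is at least (2^((k-1)/p) g*(2^k))^q / 2^k, because g* decreases.
    Out of the constant 4, one factor 2 pays for the shift from k - 1 to k, since 2^(1/p) <= 2, and
    the other for the ratio 1/2 of the length of the interval to 2^k, since q >= 1. *)
Lemma lorentz_coef p q L : 1 < p -> 1 <= q -> lorentz p q%:E g = L%:E ->
  forall s : seq int, uniq s -> \sum_(k <- s) coef p k `^ q <= (4 * L) `^ q.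
Proof.
move=> p1 q1 eL s us; have p0 : 0 < p by lra. have q0 : 0 < q by lra.
pose D : set R := `]0%R, +oo[%classic.
pose F t : R := (t `^ p^-1 * Gr g (Num.max 0 t)) `^ q * t^-1.
have mF : measurable_fun setT F.
  apply: measurable_funM; last exact: measurable_invr.
  apply: measurable_fun_powR; apply: measurable_funM; last exact: measurable_Gr.
  exact: measurable_fun_powR.
have DE t : D t = (0 < t) :> Prop by rewrite /D/= in_itv/= andbT.
have F0 t : D t -> 0 <= F t by rewrite DE => t0; rewrite mulr_ge0 ?powR_ge0// invr_ge0 ltW.
have mD : measurable D by exact: measurable_itv.
have Ft t : 0 < t -> (poweR ((t `^ p^-1)%:E * rearr g t) q * (t^-1)%:E = (F t)%:E)%E.
  move=> t0; have [-> _] := rearrE (ltW t0).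
  by rewrite /F max_r ?ltW.
have eI : (\int[mu]_(t in D) (F t)%:E = (L `^ q)%:E)%E.
  have e : lorentz p q%:E g = poweR (\int[mu]_(t in D) (F t)%:E) q^-1.
    rewrite /lorentz; congr poweR; apply: eq_integral => t; rewrite inE/= in_itv/= andbT.
    exact: Ft.
  have I0 : (0 <= \int[mu]_(t in D) (F t)%:E)%E.
    by apply: integral_ge0 => t /F0; rewrite lee_fin.
  move: e; rewrite eL; case: (integral _ _ _) I0 => [r| |//] r0.
    rewrite poweR_EFin => -[->]; rewrite -powRrM mulVf ?gt_eqF// powRr1//.
  by rewrite poweRyr// invr_eq0 gt_eqF.
pose J k : set R := `]two (k - 1), two k]%classic.
have JD k t : J k t -> two (k - 1) < t <= two k by rewrite /J/= in_itv.
have J0 k t : J k t -> 0 < t by move=> /JD /andP[h _]; rewrite (lt_trans _ h) ?two_gt0.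
have mJ k : measurable (J k) by exact: measurable_itv.
have tJ : trivIset [set` s] J.
  have lt k j t : J k t -> J j t -> (k <= j)%R.
    move=> /JD /andP[h _] /JD /andP[_ h']; rewrite leNgt; apply/negP => jk.
    have : two j <= two (k - 1) by apply: two_le; lia.
    by rewrite leNgt (lt_le_trans h h').
  move=> k j _ _ [t [Jk Jj]]; apply/eqP; rewrite eq_le.
  by rewrite (lt _ _ _ Jk Jj) (lt _ _ _ Jj Jk).
have lower k : ((4 `^ q)^-1%:E * (coef p k `^ q)%:E <= \int[mu]_(t in J k) (F t)%:E)%E.
  pose b := two (k - 1) `^ p^-1 * Gr g (two k).
  have [_ G0] := rearrE (ltW (two_gt0 k)).
  have b0 : 0 <= b by rewrite mulr_ge0// powR_ge0.
  have tk : two k = 2 * two (k - 1) by rewrite -twoS subrK.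
  have muJ : mu (J k) = (two (k - 1))%:E.
    rewrite /J lebesgue_measure_itv/= lte_fin tk ltr_pMl ?two_gt0 ?ltr1n// -EFinD.
    by congr (_%:E); ring.
  have Fb t : J k t -> b `^ q * (two k)^-1 <= F t.
    move=> Jt; have t0 := J0 _ _ Jt; have /andP[t1 t2] := JD _ _ Jt.
    have Gt0 : 0 <= Gr g t by have [] := rearrE (ltW t0).
    have i0 : 0 <= (two k)^-1 by rewrite invr_ge0; exact: ltW (two_gt0 k).
    rewrite /F (max_r (ltW t0)); apply: (ler_pM (powR_ge0 _ _) i0).
      apply: ge0_ler_powR; rewrite ?nnegrE ?(ltW q0)// ?mulr_ge0 ?powR_ge0//.
      apply: ler_pM => //; first exact: powR_ge0.
        apply: ge0_ler_powR; rewrite ?nnegrE ?invr_ge0 ?(ltW (two_gt0 _)) ?(ltW t0)//; first exact: ltW.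
        exact: ltW.
      by apply: Gr_anti => //; exact: ltW.
    by rewrite lef_pV2 ?posrE ?two_gt0.
  apply: (@le_trans _ _ (\int[mu]_(t in J k) (cst (b `^ q * (two k)^-1)%:E t))%E).
    rewrite (_ : integral _ _ _ = (b `^ q * (two k)^-1 * two (k - 1))%:E); last first.
      transitivity ((b `^ q * (two k)^-1)%:E * mu (J k))%E; first by apply: integral_cst; exact: mJ.
      by rewrite muJ.
    rewrite -EFinM lee_fin tk invfM -!mulrA mulVf ?gt_eqF ?two_gt0// mulr1.
    rewrite ler_pdivrMl ?powR_gt0//.
    have h : coef p k `^ q <= 2 `^ q * b `^ q.
      rewrite -powRM//; apply: ge0_ler_powR; rewrite ?nnegrE ?coef_ge0 ?mulr_ge0 ?powR_ge0//; first exact: ltW.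
      rewrite /coef /b tk powRM ?(ltW (two_gt0 _))// -!mulrA ler_wpM2r ?mulr_ge0 ?powR_ge0//.
        by rewrite -tk.
      apply: (@le_trans _ _ (2 `^ 1)); last by rewrite powRr1.
      by apply: ler_powR; rewrite ?ler1n// invf_le1//; exact: ltW.
    apply: (le_trans h); have -> : 4 = 2 * 2 :> R by ring.
    rewrite powRM// -!mulrA ler_wpM2l ?powR_ge0// mulrCA ler_peMr ?powR_ge0//.
    rewrite ler_pdivlMr// mul1r; apply: (@le_trans _ _ (2 `^ 1)); first by rewrite powRr1.
    by apply: ler_powR; rewrite ?ler1n.
  apply: ge0_le_integral => //.
  - exact: mJ.
  - by move=> t _; rewrite lee_fin mulr_ge0 ?powR_ge0// invr_ge0 ltW// two_gt0.
  - by apply/measurable_EFinP; apply: measurable_funTS.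
have sub : \big[setU/set0]_(k <- s) J k `<=` D.
  rewrite -bigcup_seq => t [k _ Jt]; rewrite DE; exact: J0 Jt.
have H : (\sum_(k <- s) \int[mu]_(t in J k) (F t)%:E <= (L `^ q)%:E)%E.
  rewrite -eI -ge0_integral_bigsetU//.
  - apply: ge0_subset_integral => //; first by apply: bigsetU_measurable => k _; exact: mJ.
      by apply/measurable_EFinP; exact: measurable_funTS.
  - by apply/measurable_EFinP; exact: measurable_funTS.
  - by move=> t /sub /F0; rewrite lee_fin.
have L0 : 0 <= L by have := lorentz_ge0 p q%:E; rewrite eL lee_fin.
rewrite powRM// -ler_pdivrMl ?powR_gt0// mulr_sumr -lee_fin -sumEFin.
by apply: le_trans H; apply: lee_sum => k _; rewrite EFinM; exact: lower.
Qed.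

Lemma lorentz_coef_sup p L : lorentz p +oo g = L%:E -> forall k, coef p k <= L.
Proof.
move=> /= eL k; rewrite -lee_fin -eL; apply: ereal_sup_ubound.
exists (two k); first by rewrite /= in_itv/= andbT two_gt0.
by have [-> _] := rearrE (ltW (two_gt0 k)); rewrite -EFinM.
Qed.
End rearrangement.

(** * Discrete Schur test *)

Section sums.
Context {R : realType}.
Implicit Types (th M : R) (k j : int).

(** The enumeration 0, -1, 1, -2, ... of the integers; countable sums are indexed by [nat]. *)
Definition zn (n : nat) : int := if odd n then Negz n./2 else Posz n./2.

Lemma zn_inj : injective zn.
Proof.
move=> m n; rewrite /zn; case om: (odd m); case on: (odd n) => // -[e];
  by rewrite -(odd_double_half m) -(odd_double_half n) om on e.
Qed.

Lemma zn_surj k : exists n, zn n = k.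
Proof.
case: k => n.
  by exists n.*2; rewrite /zn odd_double doubleK.
by exists n.*2.+1; rewrite /zn /= odd_double /= uphalf_double.
Qed.

Lemma geometric_le th (s : seq nat) : 0 < th -> th < 1 -> uniq s ->
  \sum_(k <- s) th ^+ k <= (1 - th)^-1.
Proof.
move=> t0 t1 us; have d0 : 0 < 1 - th by rewrite subr_gt0.
have p0 (k : nat) : 0 <= th ^+ k by rewrite exprn_ge0// ltW.
pose N := (\max_(k <- s) k).+1.
have sN (k : nat) : k \in s -> (k < N)%N by move=> ks; rewrite ltnS; exact: leq_bigmax_seq.
have ps : perm_eq s [seq k <- iota 0 N | k \in s].
  apply: uniq_perm => // [|k]; first by rewrite filter_uniq// iota_uniq.
  by rewrite mem_filter mem_iota add0n; case: (boolP (k \in s)) => // /sN ->.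
rewrite (perm_big _ ps) big_filter big_mkcond /=.
apply: (@le_trans _ _ (\sum_(k <- iota 0 N) th ^+ k)).
  by apply: ler_sum => k _; case: ifP.
have e : (1 - th) * \sum_(k <- iota 0 N) th ^+ k = 1 - th ^+ N.
  have -> : \sum_(k <- iota 0 N) th ^+ k = \sum_(k < N) th ^+ k.
    by rewrite -(subn0 N) -/(index_iota 0 N) big_mkord subn0.
  by rewrite -[1 in RHS](expr1n _ N) subrXX; congr (_ * _); apply: eq_bigr => k _; rewrite expr1n mul1r.
by rewrite -[leRHS]mul1r ler_pdivlMr// mulrC e gerBl.
Qed.

(** On each side of k the distance to k is injective in j, so each half is bounded by a one-sided
    geometric series. *)
Lemma geometric_int_le th k (s : seq int) : 0 < th -> th < 1 -> uniq s ->
  \sum_(j <- s) th ^+ absz (k - j) <= 2 * (1 - th)^-1.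
Proof.
move=> t0 t1 us; rewrite (bigID (fun j => (j <= k)%R)) /=.
rewrite mulr_natl mulr2n; apply: lerD.
  rewrite -big_filter -(big_map (fun j => absz (k - j)) xpredT (fun n => th ^+ n)).
  apply: geometric_le => //; rewrite map_inj_in_uniq ?filter_uniq// => i j.
  by rewrite !mem_filter => /andP[hi _] /andP[hj _]; lia.
rewrite -big_filter -(big_map (fun j => absz (k - j)) xpredT (fun n => th ^+ n)).
apply: geometric_le => //; rewrite map_inj_in_uniq ?filter_uniq// => i j.
by rewrite !mem_filter => /andP[hi _] /andP[hj _]; lia.
Qed.

(* The l^q norm of a is at most M. *)
Definition cbound (q : \bar R) (a : int -> R) M := match q with
  | q%:E => forall s : seq int, uniq s -> \sum_(k <- s) a k `^ q <= M `^ q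
  | +oo%E => forall k, a k <= M
  | -oo%E => False
  end.

Lemma cbound_le q a M : (1 <= q)%E -> 0 <= M -> (forall k, 0 <= a k) -> cbound q a M ->
  forall k, a k <= M.
Proof.
case: q => [q| |//] //= q1 M0 a0 H k; have := H [:: k] isT; rewrite big_seq1.
rewrite lee_fin in q1; apply: contraTT; rewrite -!ltNge; apply: gt0_ltr_powR; rewrite ?nnegrE//.
by rewrite (lt_le_trans _ q1).
Qed.

(** Young's inequality, normalised by M and M', separates the two indices into summable majorants.
    When one exponent is infinite, its sequence is replaced by its supremum and a single majorant is
    enough. *)
Lemma young_seq (q q' : \bar R) (a b : int -> R) M M' : conj_exp q q' -> 0 < M -> 0 < M' ->
  (forall k, 0 <= a k) -> (forall k, 0 <= b k) -> cbound q a M -> cbound q' b M' ->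
  exists A B : int -> R, [/\ forall k, 0 <= A k, forall k, 0 <= B k,
    forall k j, a k * b j <= A k + B j,
    forall s, uniq s -> \sum_(k <- s) A k <= M * M' &
    forall s, uniq s -> \sum_(k <- s) B k <= M * M'].
Proof.
move=> cq M0 M'0 a0 b0; have MM0 : 0 < M * M' by rewrite mulr_gt0.
case: q q' cq => [q| |] [q'| |] //=.
- move=> [q1 [q'1 qq]] ha hb.
  have q0 : 0 < q by lra. have q'0 : 0 < q' by lra.
  have inv (r N : R) (c : int -> R) s : 1 <= r -> 0 < N ->
      (forall k, 0 <= c k) -> (forall s, uniq s -> \sum_(k <- s) c k `^ r <= N `^ r) ->
      uniq s -> \sum_(k <- s) (M * M' * ((c k / N) `^ r / r)) <= M * M'.
    move=> r1 N0 c0 hc us; have r0 : 0 < r by lra.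
    rewrite -mulr_sumr ler_piMr ?(ltW MM0)//.
    have -> : \sum_(k <- s) (c k / N) `^ r / r = (\sum_(k <- s) c k `^ r) * ((N^-1) `^ r / r).
      rewrite mulr_suml; apply: eq_bigr => k _; rewrite powRM ?mulrA// invr_ge0 ltW//.
    apply: (@le_trans _ _ (N `^ r * ((N^-1) `^ r / r))).
      by rewrite ler_wpM2r ?hc// mulr_ge0 ?powR_ge0// invr_ge0 ltW.
    have e1 : N `^ r * (N^-1) `^ r = 1.
      by rewrite -powRM ?invr_ge0 ?(ltW N0)// divff ?gt_eqF// powR1.
    by rewrite mulrA e1 mul1r invf_le1.
  exists (fun k => M * M' * ((a k / M) `^ q / q)), (fun j => M * M' * ((b j / M') `^ q' / q')).
  split.
  + by move=> k; rewrite mulr_ge0 ?(ltW MM0)// mulr_ge0 ?powR_ge0// invr_ge0 ltW.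
  + by move=> k; rewrite mulr_ge0 ?(ltW MM0)// mulr_ge0 ?powR_ge0// invr_ge0 ltW.
  + move=> k j; rewrite -mulrDr.
    have -> : a k * b j = M * M' * ((a k / M) * (b j / M')).
      by field; rewrite !gt_eqF.
    rewrite ler_wpM2l ?(ltW MM0)//; apply: conjugate_powR => //.
      by rewrite mulr_ge0// invr_ge0 ltW.
    by rewrite mulr_ge0// invr_ge0 ltW.
  + by move=> s; exact: inv.
  + by move=> s; exact: inv.
- move=> q1 ha hb; exists (fun k => M' * a k), (fun=> 0); split => //.
  + by move=> k; rewrite mulr_ge0// ltW.
  + by move=> k j; rewrite addr0 mulrC ler_wpM2r.
  + move=> s us; rewrite -mulr_sumr mulrC ler_wpM2r ?(ltW M'0)//.
    have := ha s us; rewrite q1 powRr1 ?(ltW M0)//.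
    by under eq_bigr do rewrite powRr1//.
  + by move=> s us; rewrite big1// ltW.
- move=> q1 ha hb; exists (fun=> 0), (fun k => M * b k); split => //.
  + by move=> k; rewrite mulr_ge0// ltW.
  + by move=> k j; rewrite add0r ler_wpM2r.
  + by move=> s us; rewrite big1// ltW.
  + move=> s us; rewrite -mulr_sumr ler_wpM2l ?(ltW M0)//.
    have := hb s us; rewrite q1 powRr1 ?(ltW M'0)//.
    by under eq_bigr do rewrite powRr1//.
Qed.

(** Once the indices are separated, the kernel th^|k - j| is summed over the index that its majorant
    does not contain. *)
Lemma schur_sum th (q q' : \bar R) (a b : int -> R) M M' (s r : seq int) :
  0 < th -> th < 1 -> conj_exp q q' -> 0 < M -> 0 < M' ->
  (forall k, 0 <= a k) -> (forall k, 0 <= b k) -> cbound q a M -> cbound q' b M' ->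
  uniq s -> uniq r ->
  \sum_(k <- s) \sum_(j <- r) th ^+ absz (k - j) * (a k * b j) <= 4 * (1 - th)^-1 * (M * M').
Proof.
move=> t0 t1 cq M0 M'0 a0 b0 ca cb us ur.
have [A [B [A0 B0 AB sA sB]]] := young_seq cq M0 M'0 a0 b0 ca cb.
have w0 k j : 0 <= th ^+ absz (k - j) by rewrite exprn_ge0// ltW.
have d0 : 0 <= 2 * (1 - th)^-1 by rewrite mulr_ge0// invr_ge0 subr_ge0 ltW.
apply: (@le_trans _ _ (\sum_(k <- s) \sum_(j <- r) th ^+ absz (k - j) * A k +
   \sum_(k <- s) \sum_(j <- r) th ^+ absz (k - j) * B j)).
  rewrite -big_split /=; apply: ler_sum => k _; rewrite -big_split /=; apply: ler_sum => j _.
  by rewrite -mulrDr ler_wpM2l.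
rewrite (_ : 4 * _ * _ = 2 * (1 - th)^-1 * (M * M') + 2 * (1 - th)^-1 * (M * M')); last first.
  by move: (1 - th)^-1 => d; ring.
apply: lerD.
  apply: (@le_trans _ _ (\sum_(k <- s) 2 * (1 - th)^-1 * A k)).
    by apply: ler_sum => k _; rewrite -mulr_suml ler_wpM2r// geometric_int_le.
  by rewrite -mulr_sumr ler_wpM2l// sA.
rewrite exchange_big /=; apply: (@le_trans _ _ (\sum_(j <- r) 2 * (1 - th)^-1 * B j)).
  apply: ler_sum => j _; rewrite -mulr_suml ler_wpM2r//.
  by under eq_bigr do rewrite -abszN opprB; exact: geometric_int_le.
by rewrite -mulr_sumr ler_wpM2l// sB.
Qed.

Lemma two_shift k (n : nat) : two (k + n%:Z) = two k * 2 `^ n%:R :> R.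
Proof. by rewrite /two intrD powRD// pnatr_eq0 implybT. Qed.

(** With j = k + n, and up to the common factor 2^(k+1) l m, the left-hand side is 2^(n kp) and the
    right-hand side 2^(n (1/p' - dl)). *)
Lemma pair_exponent (p p' kp dl l m : R) k j : 1 < p -> 1 < p' -> p^-1 + p'^-1 = 1 ->
  kp + dl <= p'^-1 -> 0 <= l -> 0 <= m -> (k <= j)%R ->
  l * m * (two (k + 1) * (two (j + 1) / two (k + 1)) `^ kp) <=
  2 * (2 `^ (- dl)) ^+ absz (k - j) * ((two k `^ p^-1 * l) * (two j `^ p'^-1 * m)).
Proof.
move=> p1 p'1 pp kd l0 m0 kj; have [n jn] : exists n : nat, j = k + n%:Z.
  by exists (absz (j - k)); lia.
have an : absz (k - j) = n by lia.
have T0 : 0 < (two k : R) by exact: two_gt0.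
rewrite an jn !twoS two_shift.
set T := two k in T0 *; set X := 2 `^ n%:R.
have X0 : 0 < X by exact: powR_gt0.
have -> : 2 * (T * X) / (2 * T) = X by field; rewrite gt_eqF.
rewrite (powRM _ (ltW T0) (ltW X0)).
have eT : T `^ p^-1 * T `^ p'^-1 = T.
  by rewrite -powRD ?pp ?powRr1 ?ltW// gt_eqF// implybT.
have aux (t t' w x : R) : 2 * w * ((t * l) * (t' * x * m)) = (t * t') * (l * m * 2 * (w * x)) by ring.
rewrite aux eT [leLHS](_ : _ = T * (l * m * 2 * X `^ kp)); last by ring.
rewrite !ler_wpM2l ?mulr_ge0 ?(ltW T0)//.
rewrite -powR_mulrn ?powR_ge0// /X -!powRrM -powRD ?pnatr_eq0 ?implybT//.
apply: ler_powR; rewrite ?ler1n//.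
have n0 : 0 <= n%:R :> R by []. have := ler_wpM2l n0 kd; lra.
Qed.
End sums.

(** * The bilinear form on Lorentz spaces *)

Section lorentz_bound.
Context {R : realType}.
Local Notation mu := (@lebesgue_measure R).
Implicit Types (g h : R -> R) (k j : int).

Lemma cv_ae (k0 g h : R -> R) (N : set R) x : measurable_fun setT k0 ->
  measurable_fun setT g -> measurable_fun setT h -> measurable N -> mu N = 0%E ->
  (forall y, ~ N y -> g y = h y) -> cv k0 g x = cv k0 h x.
Proof.
move=> mk mg mh mN N0 gh; rewrite /cv /Rintegral; congr fine.
have m1 (w : R -> R) : measurable_fun setT w -> measurable_fun setT (fun y : R => (k0 (x - y) * w y)%:E).
  move=> mw; apply: measurable_EF; apply: measurable_funM => //.
  by apply: (measurableT_comp mk); exact: measurable_funB.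
apply: ae_eq_integral => //; [exact: m1|exact: m1|].
exists N; split => //= y /= ny; apply: contrapT => Ny; apply: ny => _.
by rewrite (gh y Ny).
Qed.

Lemma NN_ae g h (N : set R) : measurable_fun setT g -> measurable_fun setT h ->
  measurable N -> mu N = 0%E -> (forall y, ~ N y -> g y = h y) -> NN g = NN h.
Proof.
move=> mg mh mN N0 gh; apply/funext => x; apply/funext => t; rewrite /NN.
rewrite (@cv_ae (Ak t) g h N x)//; last exact: measurable_AkT.
by rewrite (@cv_ae (Ck t) g h N x)//; exact: measurable_CkT.
Qed.

Lemma null_of_small (N : set R) : (forall n : nat, (mu N <= (n.+1%:R^-1)%:E)%E) -> mu N = 0%E.
Proof.
move=> H; have N0 : (0 <= mu N)%E by exact: measure_ge0.
have [r er] : exists r, mu N = r%:E.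
  exists (fine (mu N)); rewrite fineK// ge0_fin_numE//.
  by apply: le_lt_trans (H 0%N) _; rewrite ltry.
rewrite er; congr (_%:E); apply/eqP; rewrite eq_le -!lee_fin -er N0 andbT er lee_fin.
rewrite leNgt; apply/negP => r0; have := H (Num.truncn r^-1); rewrite er lee_fin.
apply/negP; rewrite -ltNge -[X in _ < X]invrK ltf_pV2 ?posrE ?invr_gt0//.
exact: truncnS_gt.
Qed.

(** The set where |g| lies between two consecutive dyadic values of g*. It has measure at most
    2^(k+1), g is at most g*(2^k) on it, and it is empty where g* does not drop. *)
Definition shell g k : set R := [set y | Gr g (two (k + 1)) < `|g y| <= Gr g (two k)].

Section shells.
Variable g : R -> R.
Hypothesis bg : bmeas g.

Lemma measurable_shell k : measurable (shell g k).
Proof.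
rewrite (_ : shell g k = [set y | Gr g (two (k + 1)) < `|g y|] `\` [set y | Gr g (two k) < `|g y|]).
  by apply: measurableD; exact: measurable_level.
apply/seteqP; split => y /=.
  by move=> /andP[h1 h2]; split => //; apply/negP; rewrite -leNgt.
by move=> [h1 /negP]; rewrite -leNgt => h2; rewrite /shell/= h1.
Qed.

Lemma mu_shell k : (mu (shell g k) <= (two (k + 1))%:E)%E.
Proof.
apply: le_trans (distrib_Gr bg (ltW (two_gt0 (k + 1)))); apply: le_measure.
- by rewrite inE; exact: measurable_shell.
- by rewrite inE; exact: measurable_level.
- by move=> y /= /andP[].
Qed.

Lemma cut_shell_le k y : `|cut (shell g k) g y| <= Gr g (two k) * \1_(shell g k) y.
Proof.
rewrite /cut indicE; case: (boolP (y \in shell g k)) => [|_].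
  by rewrite inE => /andP[_ h]; rewrite mul1r mulr1.
by rewrite mul0r normr0 mulr0.
Qed.

Lemma trivIset_shell : trivIset setT (fun n => shell g (zn n)).
Proof.
have lt k j y : shell g k y -> shell g j y -> (k <= j)%R.
  move=> /= /andP[_ h] /andP[h' _]; rewrite leNgt; apply/negP => jk.
  have : Gr g (two k) <= Gr g (two (j + 1)).
    by apply: Gr_anti => //; [exact: ltW (two_gt0 _)|apply: two_le; lia].
  by rewrite leNgt (lt_le_trans h' h).
move=> m n _ _ [y [hm hn]]; apply: zn_inj; apply/eqP; rewrite eq_le.
by rewrite (lt _ _ _ hm hn) (lt _ _ _ hn hm).
Qed.

Definition cutall := cut (\bigcup_n shell g (zn n)) g.

(** Bounded coefficients force g*(2^n) to tend to 0, so that small nonzero values of g are reached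
    by some shell. *)
Lemma coef_bound_lt p M (e : R) : 1 < p -> 0 <= M -> (forall k, coef g p k <= M) -> 0 < e ->
  exists n : nat, Gr g (two n%:Z) < e.
Proof.
move=> p1 M0 cM e0; have p0 : 0 < p by lra.
pose n := Num.truncn ((M / e) `^ p); exists n.
have h1 : (M / e) `^ p < 2 ^+ n.
  by apply: (lt_le_trans (truncnS_gt _)); rewrite -natrX ler_nat ltn_expl.
have tn : two n%:Z = 2 ^+ n :> R by rewrite /two powR_mulrn.
have h2 : M / e < two n%:Z `^ p^-1.
  have e1 : M / e = ((M / e) `^ p) `^ p^-1.
    by rewrite -powRrM mulfV ?gt_eqF// powRr1// mulr_ge0// invr_ge0 ltW.
  by rewrite tn e1; apply: gt0_ltr_powR; rewrite ?invr_gt0 ?nnegrE ?powR_ge0 ?exprn_ge0.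
have t0 : 0 < two n%:Z `^ p^-1 by rewrite powR_gt0// two_gt0.
have := cM n%:Z; rewrite /coef mulrC -ler_pdivlMr// => h3.
apply: (le_lt_trans h3); rewrite ltr_pdivrMr// mulrC -ltr_pdivrMr//.
Qed.

(** Let g y be nonzero with y in no shell. If |g y| <= g*(2^(-m)) for some m, the first index at
    which the rearrangement falls below |g y| would place y in the preceding shell. Hence |g y|
    exceeds every g*(2^(-m)), and by [distrib_Gr] such points form a null set. *)
Lemma cutall_ae p M : 1 < p -> 0 <= M -> (forall k, coef g p k <= M) -> NN g = NN cutall.
Proof.
move=> p1 M0 cM; have [mg _] := bg.
pose U := \bigcup_n shell g (zn n).
have mU : measurable U by apply: bigcup_measurable => n _; exact: measurable_shell.
have [mc _] := bmeas_indicM bg mU.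
pose N := [set y | 0 < `|g y|] `\` U.
have mN : measurable N by apply: measurableD => //; exact: measurable_level.
apply: (@NN_ae g cutall N) => //; last first.
  move=> y Ny; rewrite /cutall /cut indicE; case: (boolP (y \in U)) => [_|]; first by rewrite mul1r.
  rewrite notin_setE => nU; rewrite mul0r; apply/eqP; rewrite -normr_le0 leNgt; apply/negP => g0.
  exact: Ny.
apply: null_of_small => n.
have key (m : nat) : N `<=` [set y | Gr g (two (- m%:Z)) < `|g y|].
  move=> y [/= g0 nU]; rewrite ltNge; apply/negP => gle.
  have [n0 hn0] := coef_bound_lt p1 M0 cM g0.
  have ex : exists i : nat, Gr g (two (- m%:Z + i%:Z)) < `|g y|.
    exists (m + n0)%N; rewrite (_ : _ + _ = n0%:Z)//; lia.
  have [i hi mi] := ex_minnP ex.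
  case: i hi mi => [|i] hi mi; first by move: hi; rewrite addr0 ltNge gle.
  apply: nU; have [l hl] := zn_surj (- m%:Z + i%:Z); exists l => //; rewrite hl /shell /=.
  apply/andP; split; first by rewrite (_ : _ + 1 = - m%:Z + i.+1%:Z)//; lia.
  by rewrite leNgt; apply/negP => /mi; rewrite ltnn.
have two_n : two (- (n.+1)%:Z) <= n.+1%:R^-1 :> R.
  rewrite /two intrN powRN powR_mulrn// lef_pV2 ?posrE ?exprn_gt0//.
  by rewrite -natrX ler_nat ltnW// ltn_expl.
apply: (@le_trans _ _ (two (- (n.+1)%:Z))%:E); last by rewrite lee_fin.
apply: le_trans (distrib_Gr bg (ltW (two_gt0 (- (n.+1)%:Z)))); apply: le_measure.
- by rewrite inE.
- by rewrite inE; exact: measurable_level.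
- exact: key.
Qed.

Lemma bmeas_cut_shell k : bmeas (cut (shell g k) g).
Proof. by apply: bmeas_indicM => //; exact: measurable_shell. Qed.

Lemma bmeas_cutall : bmeas cutall.
Proof. by apply: bmeas_indicM => //; apply: bigcup_measurable => n _; exact: measurable_shell. Qed.

End shells.

Lemma BB_congr s1 s2 g g' h h' : NN g = NN g' -> NN h = NN h' -> BB s1 s2 g h = BB s1 s2 g' h'.
Proof. by rewrite /BB => -> ->. Qed.

Lemma nneseries_le (u : nat -> \bar R) (M : \bar R) : (forall i, (0 <= u i)%E) ->
  (forall n, \sum_(0 <= i < n) u i <= M)%E -> (\sum_(0 <= i <oo) u i <= M)%E.
Proof.
by move=> u0 uM; apply: lime_le; [exact: is_cvg_nneseries|near=> n; exact: uM].
Unshelve. all: by end_near. Qed.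

Lemma BB_ge0 s1 s2 g h : (0 <= BB s1 s2 g h)%E.
Proof.
apply: integral_ge0 => x _; apply: integral_ge0 => t _.
by apply: mule_ge0; exact: TTNN_ge0.
Qed.

Lemma BB_shells s1 s2 g h : bmeas g -> bmeas h ->
  (BB s1 s2 (cutall g) (cutall h) <= \sum_(0 <= i <oo) \sum_(0 <= j <oo)
    BB s1 s2 (cut (shell g (zn i)) g) (cut (shell h (zn j)) h))%E.
Proof.
move=> bg bh.
apply: le_trans (BB_series (fun n => measurable_shell bg (zn n)) (trivIset_shell bg) bg s1 s2 (bmeas_cutall bh)) _.
apply: lee_nneseries => [i _ _|i _]; first exact: BB_ge0.
rewrite BB_sym.
apply: le_trans (BB_series (fun n => measurable_shell bh (zn n)) (trivIset_shell bh) bh s2 s1 (bmeas_cut_shell bg (zn i))) _.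
by apply: lee_nneseries => [j _ _|j _]; [exact: BB_ge0|rewrite BB_sym].
Qed.

(** The shell with the smaller index plays the part of the smaller set; the opposite case follows by
    exchanging the two arguments of the form. *)
Lemma shell_pair s1 s2 p p' : 0 < s1 -> 0 < s2 -> s1 + s2 = 1 ->
  1 < p -> 1 < p' -> p^-1 + p'^-1 = 1 ->
  exists th K : R, [/\ 0 < th, th < 1, 0 < K & forall g h k j, bmeas g -> bmeas h ->
    (BB s1 s2 (cut (shell g k) g) (cut (shell h j) h) <=
     (K * (th ^+ absz (k - j) * (coef g p k * coef h p' j)))%:E)%E].
Proof.
move=> s10 s20 s12 p1 p'1 pp.
(* The bound 1/4 is the restriction on kappa in [scaled_bound]; 1/p and 1/p' are the exponents
   available in [pair_exponent] for the two orders. Half of m becomes kappa and the other half the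
   rate of decay. *)
pose m : R := Num.min 4^-1 (Num.min p^-1 p'^-1).
have m0 : 0 < m by rewrite /m !lt_min !invr_gt0; apply/and3P; split; lra.
have m1 : m <= 4^-1 by rewrite /m ge_min lexx.
have m2 : m <= p^-1 by rewrite /m ge_min ge_min lexx orbT.
have m3 : m <= p'^-1 by rewrite /m ge_min ge_min lexx !orbT.
pose d := m / 2; have d0 : 0 < d by rewrite /d; lra.
have dd : d + d = m by rewrite -splitr.
have d1 : d <= 1 / 4 by rewrite /d; lra.
have [C1 C10 H1] := scaled_bound s10 s20 s12 d0 d1.
have s21 : s2 + s1 = 1 by rewrite addrC.
have [C2 C20 H2] := scaled_bound s20 s10 s21 d0 d1.
exists (2 `^ (- d)), (2 * (C1 + C2)); split.
- exact: powR_gt0.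
- have : 1 `^ d < 2 `^ d :> R by apply: gt0_ltr_powR; rewrite ?nnegrE ?ltr1n.
  by rewrite powR1 powRN invf_lt1 ?powR_gt0.
- by rewrite mulr_gt0// addr_gt0.
move=> g h k j bg bh.
have [_ g0] := rearrE bg (ltW (two_gt0 k)); have [_ h0] := rearrE bh (ltW (two_gt0 j)).
have c0 : 0 <= (2 `^ (- d)) ^+ absz (k - j) * (coef g p k * coef h p' j) :> R.
  by rewrite mulr_ge0 ?exprn_ge0 ?powR_ge0// mulr_ge0//; exact: coef_ge0.
have absorb (x y c : R) : 0 <= y -> 0 <= c -> x * (2 * c) <= 2 * (x + y) * c.
  move=> y0 c1; rewrite (_ : 2 * _ * c = x * (2 * c) + 2 * (y * c)); last by ring.
  by rewrite lerDl !mulr_ge0.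
have [kj|jk] := leP k j.
  have tt : two (k + 1) <= two (j + 1) :> R by apply: two_le; rewrite lerD2r.
  have hb := H1 _ _ _ _ _ _ _ _ (measurable_shell bg k)
    (measurable_shell bh j) (bmeas_cut_shell bg k) (bmeas_cut_shell bh j) g0 h0
    (cut_shell_le g k) (cut_shell_le h j) (two_gt0 _) tt (mu_shell bg k) (mu_shell bh j).
  apply: (le_trans hb).
  have := @pair_exponent R p p' d d _ _ k j p1 p'1 pp _ g0 h0 kj.
  rewrite dd => /(_ m3) hx; rewrite lee_fin -mulrA.
  apply: (@le_trans _ _ (C1 * (2 * ((2 `^ (- d)) ^+ absz (k - j) * (coef g p k * coef h p' j))))).
    by rewrite ler_pM2l//; apply: (le_trans hx); rewrite -mulrA.
  exact: absorb (ltW C20) c0.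
rewrite BB_sym.
have tt : two (j + 1) <= two (k + 1) :> R by apply: two_le; rewrite lerD2r ltW.
have hb := H2 _ _ _ _ _ _ _ _ (measurable_shell bh j)
  (measurable_shell bg k) (bmeas_cut_shell bh j) (bmeas_cut_shell bg k) h0 g0
  (cut_shell_le h j) (cut_shell_le g k) (two_gt0 _) tt (mu_shell bh j) (mu_shell bg k).
apply: (le_trans hb).
have pp' : p'^-1 + p^-1 = 1 by rewrite addrC.
have := @pair_exponent R p' p d d _ _ j k p'1 p1 pp' _ h0 g0 (ltW jk).
rewrite dd => /(_ m2) hx; rewrite lee_fin -mulrA.
rewrite -abszN opprB in hx.
apply: (@le_trans _ _ (C2 * (2 * ((2 `^ (- d)) ^+ absz (k - j) * (coef g p k * coef h p' j))))).
  rewrite ler_pM2l//; apply: (le_trans hx).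
  by rewrite -mulrA [X in _ * (_ * X) <= _]mulrC.
by rewrite (addrC C1); exact: absorb (ltW C10) c0.
Qed.

Lemma lorentz_cbound p q g L : 1 < p -> (1 <= q)%E -> bmeas g -> lorentz p q g = L%:E ->
  0 <= L -> cbound q (coef g p) (4 * L).
Proof.
move=> p1; case: q => [q| |] //= q1 bg eL L0.
  by move=> s us; exact: (lorentz_coef bg p1 _ eL us).
by move=> k; apply: (le_trans (lorentz_coef_sup bg eL k)); lra.
Qed.

Lemma conj_exp_ge1 q q' : @conj_exp R q q' -> (1 <= q)%E /\ (1 <= q')%E.
Proof.
case: q q' => [q| |] [q'| |] //=; rewrite ?lee_fin ?leey.
- by move=> [? []].
- by move=> ->.
- by move=> ->.
Qed.

(** All coefficients vanish, so g is 0 almost everywhere and the form vanishes by scaling. The case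
    is kept apart because [young_seq] divides by the norms, and because a zero norm times an
    infinite one is 0, so that the form must really be 0 there. *)
Lemma BB_lorentz0 s1 s2 p q g h : 1 < p -> (1 <= q)%E -> bmeas g -> bmeas h ->
  lorentz p q g = 0%E -> BB s1 s2 g h = 0%E.
Proof.
move=> p1 q1 bg bh L0.
have cM k : coef g p k <= 0.
  apply: (cbound_le q1 (lexx 0) (coef_ge0 bg p)).
  by rewrite -[X in cbound _ _ X](mulr0 4); exact: lorentz_cbound L0 _.
have G0 k : Gr g (two k) = 0.
  have [_ G0] := rearrE bg (ltW (two_gt0 k)).
  apply/eqP; rewrite eq_le G0 andbT; have := cM k.
  by rewrite /coef pmulr_rle0// powR_gt0// two_gt0.
rewrite (BB_congr s1 s2 (cutall_ae bg p1 (lexx 0) cM) (erefl (NN h))).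
have -> : cutall g = (fun y => 0 * cutall g y).
  apply/funext => y; rewrite mul0r /cutall /cut indicE.
  case: (boolP (y \in _)) => [|_]; last by rewrite mul0r.
  rewrite inE => -[n _ /andP[_]]; rewrite G0 normr_le0 => /eqP ->; exact: mulr0.
have -> : h = (fun y => 1 * h y) by apply/funext => y; rewrite mul1r.
apply/eqP; rewrite eq_le BB_ge0 andbT.
apply: (le_trans (BB_scale s1 s2 (bmeas_cutall bg) bh (lexx 0) ler01)).
by rewrite mul0r mul0e.
Qed.

Lemma BB_lorentz s1 s2 p p' q q' : 0 < s1 -> 0 < s2 -> s1 + s2 = 1 ->
  1 < p -> 1 < p' -> p^-1 + p'^-1 = 1 -> conj_exp q q' ->
  exists2 C : R, 0 < C & forall g h, bmeas g -> bmeas h ->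
    (BB s1 s2 g h <= C%:E * (lorentz p q g * lorentz p' q' h))%E.
Proof.
move=> s10 s20 s12 p1 p'1 pp cq; have [q1 q'1] := conj_exp_ge1 cq.
have [th [K [t0 t1 K0 H]]] := shell_pair s10 s20 s12 p1 p'1 pp.
have d0 : 0 < (1 - th)^-1 by rewrite invr_gt0 subr_gt0.
(* 4 (1 - th)^-1 is the constant of [schur_sum], and 16 comes from the factor 4 of [lorentz_cbound]
   in each of the two norms. *)
have C0 : 0 < K * (4 * (1 - th)^-1 * 16) by rewrite !mulr_gt0.
exists (K * (4 * (1 - th)^-1 * 16)) => // g h bg bh.
have := lorentz_ge0 bg p q; have := lorentz_ge0 bh p' q'.
case eL : (lorentz p q g) => [L| |] //; case eL' : (lorentz p' q' h) => [L'| |] // + +; last 3 first.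
- move=> _; rewrite lee_fin le_eqVlt => /orP[/eqP L0|L0]; last by rewrite gt0_muley// gt0_muley ?lte_fin// leey.
  by rewrite (BB_lorentz0 s1 s2 p1 q1 bg bh) ?eL -?L0// mul0e mule0.
- rewrite lee_fin le_eqVlt => /orP[/eqP L0|L0] _; last by rewrite gt0_mulye// gt0_muley ?lte_fin// leey.
  by rewrite BB_sym (BB_lorentz0 s2 s1 p'1 q'1 bh bg) ?eL' -?L0// !mule0.
- by move=> _ _; rewrite mulyy gt0_muley ?lte_fin// leey.
rewrite !lee_fin => L'0; rewrite le_eqVlt => /orP[/eqP L0|L0].
  by rewrite (BB_lorentz0 s1 s2 p1 q1 bg bh) ?eL -?L0// mul0e mule0.
move: L'0; rewrite le_eqVlt => /orP[/eqP L'0|L'0].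
  by rewrite BB_sym (BB_lorentz0 s2 s1 p'1 q'1 bh bg) ?eL' -?L'0// !mule0.
have cg := lorentz_cbound p1 q1 bg eL (ltW L0).
have ch := lorentz_cbound p'1 q'1 bh eL' (ltW L'0).
have M0 : 0 < 4 * L by rewrite mulr_gt0.
have M'0 : 0 < 4 * L' by rewrite mulr_gt0.
have cg' := cbound_le q1 (ltW M0) (coef_ge0 bg p) cg.
have ch' := cbound_le q'1 (ltW M'0) (coef_ge0 bh p') ch.
rewrite (BB_congr s1 s2 (cutall_ae bg p1 (ltW M0) cg') (cutall_ae bh p'1 (ltW M'0) ch')).
(* The double series is tested on finite blocks, where the real-valued discrete Schur test applies
   with a bound independent of the block. *)
apply: (le_trans (BB_shells s1 s2 bg bh)).
apply: nneseries_le => [i|n]; first by apply: nneseries_ge0 => j _ _; exact: BB_ge0.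
rewrite -nneseries_sum_nat; last by move=> *; exact: BB_ge0.
apply: nneseries_le => [i|m]; first by apply: sume_ge0 => j _; exact: BB_ge0.
set a := coef g p; set b := coef h p'.
apply: (@le_trans _ _ (\sum_(0 <= i < m) \sum_(0 <= j < n)
    (K * (th ^+ absz (zn j - zn i) * (a (zn j) * b (zn i))))%:E)%E).
  by apply: lee_sum => i _; apply: lee_sum => j _; exact: H.
under eq_bigr do rewrite sumEFin; rewrite sumEFin -!EFinM lee_fin.
under eq_bigr do rewrite -mulr_sumr; rewrite -mulr_sumr -!mulrA ler_pM2l//.
have us l : uniq [seq zn i | i <- index_iota 0 l].
  by rewrite map_inj_uniq ?iota_uniq//; exact: zn_inj.
have := schur_sum t0 t1 cq M0 M'0 (coef_ge0 bg p) (coef_ge0 bh p') cg ch (us n) (us m).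
rewrite exchange_big big_map; under eq_bigr do rewrite big_map.
by move=> /le_trans; apply; rewrite le_eqVlt; apply/orP; left; apply/eqP; move: (1 - th)^-1 => e; ring.
Qed.
End lorentz_bound.

(** * The two commutator estimates *)

Theorem theorem2p7 (R : realType) (s1 s2 p p' : R) (q q' : \bar R) :
  0 < s1 < 1 -> 0 < s2 < 1 -> s1 + s2 = 1 ->
  1 < p -> 1 < p' -> p^-1 + p'^-1 = 1 ->
  conj_exp q q' ->
  exists C : R, 0 < C /\
    forall phi f : R -> R, smooth_cpt phi -> smooth_cpt f ->
      (L1norm (fun x => (commH phi (fraclap 1 f) x - commH f (fraclap 1 phi) x)%R)
        <= C%:E * (lorentz p q (fraclap s1 phi) * lorentz p' q' (fraclap s2 f)))%E /\
      (L1norm (hilbert (fun x => (commH phi (fraclap 1 f) x + commH f (fraclap 1 phi) x)%R))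
        <= C%:E * (lorentz p q (fraclap s1 phi) * lorentz p' q' (fraclap s2 f)))%E.
Proof.
move=> /andP[s10 s11] /andP[s20 s21] s12 p1 p'1 pp cq.
have [C C0 HC] := BB_lorentz s10 s20 s12 p1 p'1 pp cq.
pose A : R := 2 * (2 * (cg s1)^-1 * (2 * (cg s2)^-1)).
have A0 : 0 < A by rewrite !mulr_gt0// invr_gt0; exact: cg_gt0.
exists (A * C); split => [|phi f sp sf]; first exact: mulr_gt0.
have H : (A%:E * BB s1 s2 (fraclap s1 phi) (fraclap s2 f) <=
    (A * C)%:E * (lorentz p q (fraclap s1 phi) * lorentz p' q' (fraclap s2 f)))%E.
  rewrite [X in (_ <= X * _)%E]EFinM -muleA; apply: lee_wpmul2l; first by rewrite lee_fin ltW.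
  by apply: HC; apply: bmeas_fraclap => //; exact: ltW.
by split; [apply: le_trans (commutator_difference s10 s11 s20 s21 sp sf) H
          |apply: le_trans (commutator_sum s10 s11 s20 s21 sp sf) H].
Qed.
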